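(* Let $b\geq 2$ be an integer. The function $G_b(s)=\sum_{n=1}^\infty S_b(n)n^{-s}$ (defined by this series for $\Re(s)>2$) has a meromorphic continuation to $\mathbb{C}$. The poles of $G_b(s)$ consist of: (i) a double pole at $s=2$ with Laurent expansion \[ G_b(s) = \frac{b-1}{2\log b}(s-2)^{-2} + \biggl(\frac{b-1}{2\log b}\bigl(\log(2\pi)-1\bigr)-\frac{b+1}{4}\biggr)(s-2)^{-1} + O(1); \] (ii) a simple pole at $s=1$ with residue $\operatorname{Res}(G_b(s),s=1) = \frac{b+1}{12}$; (iii) simple poles at $s=2 + 2\pi i m/\log b$ with $m\in\mathbb{Z}$, $m\neq 0$, with residue \[ \operatorname{Res}\Bigl( G_b(s) , s= 2 + \tfrac{2\pi i m}{\log b} \Bigr) = - \frac{b-1}{2\pi i m}\Bigl(1+\tfrac{2\pi i m}{\log b}\Bigr)^{-1} \zeta\Bigl(\tfrac{2\pi i m}{\log b}\Bigr); \] (iv) simple poles at the points $s=2-k + 2\pi i m/\log b$ with $k\geq 2$ an even integer and $m\in\mathbb{Z}$, with residue \[ \operatorname{Res}\Bigl( G_b(s) , s= 2 - k + \tfrac{2\pi i m}{\log b} \Bigr) = \frac{b-1}{\log b}\, \zeta\Bigl(\tfrac{2\pi i m}{\log b}\Bigr) \frac{B_k}{k(k-2)!} \prod_{j=1}^{k-2}\Bigl(\tfrac{2\pi i m}{\log b} - j\Bigr). \]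
   Context: For an integer $b\geq 2$ and a positive integer $n$ with base-$b$ expansion $n=\sum_{i\geq 0}\delta_{b,i}(n)b^i$, $\delta_{b,i}(n)\in\{0,1,\dots,b-1\}$, let $d_b(n)=\sum_{i\geq 0}\delta_{b,i}(n)$ be the base-$b$ digit sum, and let $S_b(n)=\sum_{m=1}^{n-1}d_b(m)$ (note the sum runs to $n-1$; $S_b(1)=0$). $\zeta$ is the Riemann zeta function. The Bernoulli numbers $B_k$ are defined by $\frac{x}{e^x-1}=\sum_{k=0}^\infty \frac{B_k}{k!}x^k$. An empty product equals $1$. *)

(* Defs.v *)
From Stdlib Require Import Reals List Arith ZArith ClassicalEpsilon.
From Coquelicot Require Import Coquelicot.

Open Scope C_scope.

Definition digit (b i n : nat) : nat := Nat.modulo (Nat.div n (Nat.pow b i)) b.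

(* For b >= 2 we have n < b ^ n, so all digits of index i > n vanish. *)
Definition digit_sum (b n : nat) : nat :=
  list_sum (map (fun i => digit b i n) (seq 0 (S n))).

(* [seq 1 (n - 1)] lists 1, ..., n - 1. *)
Definition cumul_digit_sum (b n : nat) : nat :=
  list_sum (map (digit_sum b) (seq 1 (n - 1))).

Definition Cexp (z : C) : C :=
  ((exp (Re z) * cos (Im z))%R, (exp (Re z) * sin (Im z))%R).

(* n ^ s for n >= 1, with the real logarithm of n. *)
Definition Cpow_nat (n : nat) (s : C) : C := Cexp (s * RtoC (ln (INR n))).

(* The series over n >= 1 of a(n) n^(-s) converges to l; [is_series] starts at
   index 0, hence the shift. *)
Definition is_dirichlet_series (a : nat -> C) (s l : C) : Prop :=
  is_series (fun n : nat => a (S n) * Cpow_nat (S n) (- s)) l.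

Definition holomorphic_at (f : C -> C) (a : C) : Prop :=
  locally a (fun s : C => ex_derive f s).

(* c j is the coefficient of (s - a)^(-j) in the Laurent expansion of f at a,
   all coefficients with j > n being zero. *)
Definition is_principal_part (f : C -> C) (a : C) (n : nat) (c : nat -> C) : Prop :=
  exists h : C -> C,
    holomorphic_at h a /\
    locally' a (fun s : C =>
      f s = sum_n_m (fun j : nat => c j / (s - a) ^ j) 1 n + h s).

Definition pole_of_order (f : C -> C) (a : C) (n : nat) : Prop :=
  (1 <= n)%nat /\
  exists c : nat -> C, is_principal_part f a n c /\ c n <> 0.

Definition is_pole (f : C -> C) (a : C) : Prop :=
  exists n : nat, pole_of_order f a n.

Definition is_residue (f : C -> C) (a r : C) : Prop :=
  exists (n : nat) (c : nat -> C),
    (1 <= n)%nat /\ is_principal_part f a n c /\ c 1%nat = r.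

(* The value of f at a pole is irrelevant; poles are isolated because the
   principal part formula makes f holomorphic on a punctured neighbourhood. *)
Definition meromorphic (f : C -> C) : Prop :=
  forall a : C, holomorphic_at f a \/ is_pole f a.

Definition is_riemann_zeta (z : C -> C) : Prop :=
  (forall s : C, s <> 1 -> holomorphic_at z s) /\
  (forall s : C, (1 < Re s)%R -> is_dirichlet_series (fun _ => 1) s (z s)).

(* The analytic continuation is unique on C \ {1}; the value at 1 is
   unspecified. *)
Definition zeta : C -> C :=
  epsilon (inhabits (fun _ : C => RtoC 0)) is_riemann_zeta.

Definition is_bernoulli (B : nat -> R) : Prop :=
  exists r : R, (0 < r)%R /\
    forall x : R, (0 < Rabs x < r)%R ->
      is_pseries (fun k : nat => B k / INR (fact k))%R x (x / (exp x - 1))%R.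

(* The generating function determines the sequence uniquely. *)
Definition bernoulli : nat -> R :=
  epsilon (inhabits (fun _ : nat => 0%R)) is_bernoulli.

Definition vshift (b : nat) (m : Z) : C :=
  RtoC 2 * RtoC PI * Ci * RtoC (IZR m) / RtoC (ln (INR b)).

Definition Cprod1 (f : nat -> C) (n : nat) : C :=
  fold_right (fun j p => f j * p) (RtoC 1) (seq 1 n).

(* Main.v *)
Require Import Defs.
From Stdlib Require Import Reals List Arith ZArith Lra Lia Psatz ClassicalEpsilon FunctionalExtensionality.
From Coquelicot Require Import Coquelicot.
Open Scope R_scope.

(** Summation by parts with the second differences S(n+1) - 2 S(n) + S(n-1) = d(n) - d(n-1) and the even part
    of the binomial series turn the digit series into a recursion for H(s) = (s-1)(s-2) G(s):
      H(s) = Z(s-2) - sum_j q_j(s) H(s+2+2j),   q_j(s) = 2 (2-s)(1-s)...(1-s-2j) / (2j+4)!,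
    where Z(w) = sum_l (d(l) - d(l-1)) l^(-w) = zeta(w) (b^w - b) / (b^w - 1), because d(l) - d(l-1) equals 1 unless
    b divides l, and drops by b - 1 under l -> b l.  Reading the recursion from right to left continues H to the
    plane; its poles are those of Z(s-2) at 2 + 2 pi i m / log b together with their translates by -2, -4, ....
    The residues obey a convolution recursion, solved by (1-k) B_k / k! because
    (2 cosh x - 2)(y - x y') = x^2 for y = x / (e^x - 1).

    The same kind of recursion shows that (s-1) zeta(s) is entire, with the values needed at -1, 0 and 1; its
    derivative at 0 comes from Wallis' product.  The points 2 - k + 2 pi i m / log b really are poles because B_k <> 0
    for even k (Riccati equation of (x/2) coth (x/2)) and zeta(it) <> 0 for t <> 0, which follows from zeta(1+it) <> 0
    and the functional equation, proved from the Fourier series of x - x^2. *)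

(** * Complex and path calculus *)

(** The factor [(s - 1)(s - 2)] is forced by the recursion. Twice the second binomial coefficient of
    exponent [2 - s] equals it, and in every later coefficient the last two factors of the falling
    factorial form the same expression at the shifted argument. So [H] absorbs them, all [q_j] are
    polynomials in [s], no division occurs, and the poles of [H] stay simple.

    Extra poles of [G] arise only when the factor is undone. All [q_j] vanish at 1 and at 2. At 1
    this leaves the number [H 1 = Z (-1)]. At 2 the sum contributes nothing to the principal part,
    the simple pole of [Z] at 0 becomes double, and two Taylor coefficients of [w Z(w)] at 0 are
    required; this is the reason why the derivative of [(s - 1) zeta(s)] at 0 and with it
    [ln (2 PI)] enter.

    Keeping only the even binomial terms makes the translates move by two, so that
    [2 - k + 2 pi i m / log b] is regular for odd [k > 1].

    The function theory rests on power series in discs. Two continuations are compared only on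
    convex sets, where a segment suffices; for zeta these are half-planes with 1 on their
    boundary. *)

Definition ccont (f : C -> C) (z : C) : Prop :=
  forall eps, 0 < eps -> exists d, 0 < d /\
    forall w, Cmod (w - z) < d -> Cmod (f w - f z) < eps.

(** The bound includes [w = z], so there is no punctured case, and the explicit modulus can be
    chained with the estimates that follow. *)
Definition cder (f : C -> C) (z l : C) : Prop :=
  forall eps, 0 < eps -> exists d, 0 < d /\
    forall w, Cmod (w - z) < d -> Cmod (f w - f z - l * (w - z)) <= eps * Cmod (w - z).

Definition rcont (g : R -> C) (t : R) : Prop :=
  forall eps, 0 < eps -> exists d, 0 < d /\
    forall u, Rabs (u - t) < d -> Cmod (g u - g t) < eps.

Definition rder (g : R -> C) (t : R) (v : C) : Prop :=
  forall eps, 0 < eps -> exists d, 0 < d /\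
    forall u, Rabs (u - t) < d -> Cmod (g u - g t - RtoC (u - t) * v) <= eps * Rabs (u - t).

Lemma Cmod_minus_sym (x y : C) : Cmod (x - y) = Cmod (y - x).
Proof. replace (x - y)%C with (- (y - x))%C by ring. apply Cmod_opp. Qed.

Lemma Cmod_triangle_minus (x y : C) : Cmod (x - y) <= Cmod x + Cmod y.
Proof. replace (x - y)%C with (x + - y)%C by ring. rewrite <- (Cmod_opp y). apply Cmod_triangle. Qed.

Lemma Cmod_triangle_rev (x y : C) : Cmod x - Cmod y <= Cmod (x - y).
Proof.
  replace x with ((x - y) + y)%C at 1 by ring.
  generalize (Cmod_triangle (x - y) y); lra.
Qed.

Lemma im_le_Cmod (c : C) : Rabs (Im c) <= Cmod c.
Proof. apply Rle_trans with (2 := Rmax_Cmod c). apply Rmax_r. Qed.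

Lemma Cmod_le_re_im (c : C) : Cmod c <= Rabs (Re c) + Rabs (Im c).
Proof.
  unfold Cmod, Re, Im. destruct c as [x y]; simpl fst; simpl snd.
  apply Rsqr_incr_0_var; [| generalize (Rabs_pos x) (Rabs_pos y); lra].
  rewrite Rsqr_sqrt by nra. unfold Rsqr.
  generalize (Rabs_pos x) (Rabs_pos y) (pow2_abs x) (pow2_abs y); nra.
Qed.

Lemma norm_C_R (x : C) : @norm R_AbsRing C_R_NormedModule x = Cmod x.
Proof.
  unfold norm; simpl; unfold prod_norm, Cmod; simpl.
  f_equal. unfold norm; simpl; unfold abs; simpl.
  rewrite !Rmult_1_r, <- !Rabs_mult.
  rewrite !Rabs_pos_eq by nra. reflexivity.
Qed.

Lemma locally_Cmod (a : C) (P : C -> Prop) :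
  locally (T := C_UniformSpace) a P <->
  exists d, 0 < d /\ forall w, Cmod (w - a) < d -> P w.
Proof.
  split.
  - intros [d Hd]. exists d. split; [apply cond_pos|].
    intros w Hw. apply Hd. apply C_NormedModule_mixin_compat1. exact Hw.
  - intros [d [Hd H]].
    (* Balls of the uniform structure are products of intervals; shrinking by [sqrt 2] puts such a
       square inside the disc. *)
    assert (Hd' : 0 < d / sqrt 2) by (apply Rdiv_lt_0_compat; [assumption | apply Rlt_sqrt2_0]).
    exists (mkposreal _ Hd'). intros w Hw. apply H.
    generalize (C_NormedModule_mixin_compat2 a w _ Hw). simpl.
    replace (sqrt 2 * (d / sqrt 2)) with d. { intros; assumption. }
    field. generalize Rlt_sqrt2_0; lra.
Qed.

Lemma locally'_Cmod (a : C) (P : C -> Prop) :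
  locally' (T := C_UniformSpace) a P <->
  exists d, 0 < d /\ forall w, Cmod (w - a) < d -> w <> a -> P w.
Proof.
  unfold locally', within. apply locally_Cmod.
Qed.

Lemma cder_is_derive (f : C -> C) (z l : C) :
  cder f z l <-> is_derive (K := C_AbsRing) (V := C_NormedModule) f z l.
Proof.
  split.
  - intros H. split. { apply is_linear_scal_l. }
    intros x Hx.
    assert (x = z) as ->.
    { apply (is_filter_lim_locally_unique (K := C_AbsRing) (V := AbsRing_NormedModule C_AbsRing)) in Hx. symmetry; exact Hx. }
    intros eps. destruct (H eps (cond_pos eps)) as [d [Hd Hd2]].
    exists (mkposreal d Hd). intros w Hw.
    generalize (Hd2 w Hw).
    replace (f w - f z - l * (w - z))%C with (f w - f z - (w - z) * l)%C by ring.
    intros HH; exact HH.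
  - intros [_ H] eps Heps.
    assert (Hz : is_filter_lim (locally (T := AbsRing_UniformSpace C_AbsRing) z) z) by (intros P HP; exact HP).
    destruct (H z Hz (mkposreal eps Heps)) as [d Hd].
    exists d. split; [apply cond_pos|].
    intros w Hw. generalize (Hd w Hw).
    replace (f w - f z - l * (w - z))%C with (f w - f z - (w - z) * l)%C by ring.
    intros HH; exact HH.
Qed.

(** The same derivative in the normed module that [C] carries as an absolute ring, which is the
    setting of the product rule and of the inner function in the chain rule. *)
Lemma cder_is_derive_absring (f : C -> C) (z l : C) :
  cder f z l <-> is_derive (K := C_AbsRing) (V := AbsRing_NormedModule C_AbsRing) f z l.
Proof.
  split.
  - intros H. split. { apply is_linear_scal_l. }
    intros x Hx.
    assert (x = z) as ->.
    { apply (is_filter_lim_locally_unique (K := C_AbsRing) (V := AbsRing_NormedModule C_AbsRing)) in Hx. symmetry; exact Hx. }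
    intros eps. destruct (H eps (cond_pos eps)) as [d [Hd Hd2]].
    exists (mkposreal d Hd). intros w Hw.
    generalize (Hd2 w Hw).
    replace (f w - f z - l * (w - z))%C with (f w - f z - (w - z) * l)%C by ring.
    intros HH; exact HH.
  - intros [_ H] eps Heps.
    assert (Hz : is_filter_lim (locally (T := AbsRing_UniformSpace C_AbsRing) z) z) by (intros P HP; exact HP).
    destruct (H z Hz (mkposreal eps Heps)) as [d Hd].
    exists d. split; [apply cond_pos|].
    intros w Hw. generalize (Hd w Hw).
    replace (f w - f z - l * (w - z))%C with (f w - f z - (w - z) * l)%C by ring.
    intros HH; exact HH.
Qed.

Lemma rder_is_derive (g : R -> C) (t : R) (v : C) :
  rder g t v <-> is_derive (K := R_AbsRing) (V := C_R_NormedModule) g t v.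
Proof.
  split.
  - intros H. split. { apply is_linear_scal_l. }
    intros x Hx.
    assert (x = t) as ->.
    { apply (is_filter_lim_locally_unique (V := R_NormedModule)) in Hx. symmetry; exact Hx. }
    intros eps. destruct (H eps (cond_pos eps)) as [d [Hd Hd2]].
    exists (mkposreal d Hd). intros w Hw. rewrite norm_C_R.
    generalize (Hd2 w Hw).
    intros HH. eapply Rle_trans; [|exact HH]. right. f_equal.
    unfold minus, plus, opp, scal; simpl. unfold prod_plus, prod_opp, prod_scal; simpl.
    unfold scal, mult; simpl. unfold mult, plus, opp; simpl.
    apply injective_projections; simpl; ring.
  - intros [_ H] eps Heps.
    assert (Hz : is_filter_lim (locally (T := AbsRing_UniformSpace R_AbsRing) t) t) by (intros P HP; exact HP).
    destruct (H t Hz (mkposreal eps Heps)) as [d Hd].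
    exists d. split; [apply cond_pos|].
    intros w Hw. generalize (Hd w Hw). rewrite norm_C_R.
    intros HH. eapply Rle_trans; [|exact HH]. right. f_equal.
    unfold minus, plus, opp, scal; simpl. unfold prod_plus, prod_opp, prod_scal; simpl.
    unfold scal, mult; simpl. unfold mult, plus, opp; simpl.
    apply injective_projections; simpl; ring.
Qed.

Lemma rcont_continuous (g : R -> C) (t : R) :
  rcont g t -> continuous (T := R_UniformSpace) (U := C_R_NormedModule) g t.
Proof.
  intros H. apply filterlim_locally. intros eps.
  destruct (H eps (cond_pos eps)) as [d [Hd Hd2]].
  exists (mkposreal d Hd). intros u Hu.
  apply C_NormedModule_mixin_compat1. apply Hd2. exact Hu.
Qed.

Lemma continuous_rcont (g : R -> C) (t : R) :
  continuous (fun u => Re (g u)) t -> continuous (fun u => Im (g u)) t -> rcont g t.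
Proof.
  intros H1 H2 eps Heps.
  apply continuity_pt_filterlim in H1. apply continuity_pt_filterlim in H2.
  destruct (H1 (eps/2) ltac:(lra)) as [d1 [Hd1 K1]].
  destruct (H2 (eps/2) ltac:(lra)) as [d2 [Hd2 K2]].
  exists (Rmin d1 d2). split. { apply Rmin_case; assumption. }
  intros u Hu. apply Rle_lt_trans with (1 := Cmod_le_re_im _).
  assert (A1 : Rabs (Re (g u) - Re (g t)) < eps/2).
  { destruct (Req_dec u t) as [->|Hne].
    - rewrite Rminus_diag, Rabs_R0. lra.
    - apply K1. split. { split; [exact I| auto]. }
      apply Rlt_le_trans with (1 := Hu). apply Rmin_l. }
  assert (A2 : Rabs (Im (g u) - Im (g t)) < eps/2).
  { destruct (Req_dec u t) as [->|Hne].
    - rewrite Rminus_diag, Rabs_R0. lra.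
    - apply K2. split. { split; [exact I| auto]. }
      apply Rlt_le_trans with (1 := Hu). apply Rmin_r. }
  change (Re (g u - g t)) with (Re (g u) - Re (g t)).
  change (Im (g u - g t)) with (Im (g u) - Im (g t)). lra.
Qed.

Lemma is_derive_rder (g : R -> C) (t : R) (v : C) :
  is_derive (fun u => Re (g u)) t (Re v) -> is_derive (fun u => Im (g u)) t (Im v) -> rder g t v.
Proof.
  intros H1 H2 eps Heps.
  destruct H1 as [_ H1]. destruct H2 as [_ H2].
  assert (Hz : is_filter_lim (locally (T := AbsRing_UniformSpace R_AbsRing) t) t) by (intros P HP; exact HP).
  assert (He : 0 < eps/2) by lra.
  destruct (H1 t Hz (mkposreal _ He)) as [d1 K1].
  destruct (H2 t Hz (mkposreal _ He)) as [d2 K2].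
  exists (Rmin d1 d2). split. { apply Rmin_case; apply cond_pos. }
  intros u Hu. apply Rle_trans with (1 := Cmod_le_re_im _).
  assert (A1 := K1 u (Rlt_le_trans _ _ _ Hu (Rmin_l _ _))).
  assert (A2 := K2 u (Rlt_le_trans _ _ _ Hu (Rmin_r _ _))).
  unfold norm, minus, plus, opp, scal in A1, A2; simpl in A1, A2.
  unfold abs, mult in A1, A2; simpl in A1, A2. fold (Rminus u t) in A1, A2.
  replace (Re (g u - g t - RtoC (u - t) * v)) with (Re (g u) + - Re (g t) + - ((u - t) * Re v)) by (unfold Re, Im; simpl; ring).
  replace (Im (g u - g t - RtoC (u - t) * v)) with (Im (g u) + - Im (g t) + - ((u - t) * Im v)) by (unfold Re, Im; simpl; ring).
  unfold Rminus in *. lra.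
Qed.

Lemma cder_cont (f : C -> C) (z l : C) : cder f z l -> ccont f z.
Proof.
  intros H eps Heps.
  destruct (H 1 Rlt_0_1) as [d [Hd K]].
  assert (Hl := Cmod_ge_0 l).
  exists (Rmin d (eps / (2 + Cmod l))). split.
  { apply Rmin_case; [assumption|]. apply Rdiv_lt_0_compat; lra. }
  intros w Hw.
  assert (H1 := Rlt_le_trans _ _ _ Hw (Rmin_l _ _)).
  assert (H2 := Rlt_le_trans _ _ _ Hw (Rmin_r _ _)).
  specialize (K w H1).
  replace (f w - f z)%C with ((f w - f z - l * (w - z)) + l * (w - z))%C by ring.
  apply Rle_lt_trans with (1 := Cmod_triangle _ _).
  rewrite Cmod_mult. assert (H3 := Cmod_ge_0 (w - z)).
  apply Rle_lt_trans with ((1 + Cmod l) * Cmod (w - z)); [nra|].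
  apply Rle_lt_trans with ((1 + Cmod l) * (eps / (2 + Cmod l))).
  { apply Rmult_le_compat_l; lra. }
  apply Rlt_le_trans with ((2 + Cmod l) * (eps / (2 + Cmod l))).
  - apply Rmult_lt_compat_r; [apply Rdiv_lt_0_compat; lra|lra].
  - right. field. lra.
Qed.

Lemma cder_ext_loc (f g : C -> C) (z l : C) :
  (exists d, 0 < d /\ forall w, Cmod (w - z) < d -> f w = g w) -> cder f z l -> cder g z l.
Proof.
  intros [d0 [Hd0 E]] H eps Heps.
  destruct (H eps Heps) as [d [Hd K]].
  exists (Rmin d d0). split; [apply Rmin_case; assumption|].
  intros w Hw. rewrite <- !E.
  - apply K. apply Rlt_le_trans with (1 := Hw), Rmin_l.
  - replace (z - z)%C with (RtoC 0) by ring. rewrite Cmod_0; assumption.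
  - apply Rlt_le_trans with (1 := Hw), Rmin_r.
Qed.

Lemma cder_ext (f g : C -> C) (z l : C) : (forall w, f w = g w) -> cder f z l -> cder g z l.
Proof. intros H. apply cder_ext_loc. exists 1. split; [lra|]. intros; apply H. Qed.

Lemma cder_unique (f : C -> C) (z l l' : C) : cder f z l -> cder f z l' -> l = l'.
Proof.
  intros H H'. apply cder_is_derive in H. apply cder_is_derive in H'.
  rewrite <- (is_C_derive_unique f z l H). apply is_C_derive_unique. exact H'.
Qed.

Lemma cder_const (c z : C) : cder (fun _ => c) z 0.
Proof. apply cder_is_derive. apply (is_derive_const (K := C_AbsRing) (V := C_NormedModule)). Qed.

Lemma cder_id (z : C) : cder (fun w => w) z 1.
Proof.
  intros eps Heps. exists 1. split; [lra|]. intros w _.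
  replace (w - z - 1 * (w - z))%C with (RtoC 0) by ring. rewrite Cmod_0.
  generalize (Cmod_ge_0 (w - z)); nra.
Qed.

Lemma cder_plus (f g : C -> C) (z a b : C) :
  cder f z a -> cder g z b -> cder (fun w => f w + g w)%C z (a + b).
Proof.
  rewrite !cder_is_derive. intros.
  apply (is_derive_plus (K := C_AbsRing) (V := C_NormedModule)); assumption.
Qed.

Lemma cder_opp (f : C -> C) (z a : C) : cder f z a -> cder (fun w => - f w)%C z (- a).
Proof.
  rewrite !cder_is_derive. intros.
  apply (is_derive_opp (K := C_AbsRing) (V := C_NormedModule)); assumption.
Qed.

Lemma cder_minus (f g : C -> C) (z a b : C) :
  cder f z a -> cder g z b -> cder (fun w => f w - g w)%C z (a - b).
Proof. intros; apply cder_plus; [assumption | apply cder_opp; assumption]. Qed.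

Lemma cder_mult (f g : C -> C) (z a b : C) :
  cder f z a -> cder g z b -> cder (fun w => f w * g w)%C z (a * g z + f z * b).
Proof.
  rewrite !cder_is_derive_absring. intros.
  apply (is_derive_mult (K := C_AbsRing)); try assumption.
  intros; apply Cmult_comm.
Qed.

Lemma cder_comp (f g : C -> C) (z a b : C) :
  cder f (g z) a -> cder g z b -> cder (fun w => f (g w)) z (b * a).
Proof.
  rewrite (cder_is_derive_absring g), !cder_is_derive. intros.
  apply (is_derive_comp (K := C_AbsRing) (V := C_NormedModule)); assumption.
Qed.

Lemma cder_inv_id (z : C) : z <> 0 -> cder (fun w => / w)%C z (- / (z * z)).
Proof.
  intros Hz eps Heps.
  assert (Hm : 0 < Cmod z) by (apply Cmod_gt_0; assumption).
  set (m := Cmod z) in *.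
  (* The remainder is [(w - z)^2 / (w z^2)]; the first bound keeps [Cmod w] above [m / 2], the
     second then absorbs [m / 2 * m * m]. *)
  exists (Rmin (m / 2) (eps * m ^ 3 / 2)). split.
  { apply Rmin_case; [lra|]. assert (0 < m ^ 3) by (apply pow_lt; assumption). nra. }
  intros w Hw.
  assert (H1 := Rlt_le_trans _ _ _ Hw (Rmin_l _ _)).
  assert (H2 := Rlt_le_trans _ _ _ Hw (Rmin_r _ _)).
  assert (Hwm : m / 2 < Cmod w).
  { generalize (Cmod_triangle_rev z w). rewrite Cmod_minus_sym. fold m. lra. }
  assert (Hw0 : w <> 0) by (apply Cmod_gt_0; lra).
  replace (/ w - / z - - / (z * z) * (w - z))%C with ((w - z) * (w - z) * / (w * z * z))%C
    by (field; split; assumption).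
  rewrite !Cmod_mult, Cmod_inv, !Cmod_mult by (repeat apply Cmult_neq_0; assumption).
  fold m. set (x := Cmod (w - z)) in *. assert (Hx : 0 <= x) by apply Cmod_ge_0.
  rewrite Rmult_assoc, (Rmult_comm eps). apply Rmult_le_compat_l; [assumption|].
  assert (Hp : 0 < Cmod w * m * m) by (repeat apply Rmult_lt_0_compat; lra).
  apply Rmult_le_reg_r with (Cmod w * m * m); [assumption|].
  rewrite Rmult_assoc, Rinv_l, Rmult_1_r by lra.
  apply Rle_trans with (1 := Rlt_le _ _ H2).
  replace (eps * m ^ 3 / 2) with (eps * (m / 2 * m * m)) by field.
  apply Rmult_le_compat_l; [lra|]. apply Rmult_le_compat_r; [lra|]. apply Rmult_le_compat_r; lra.
Qed.

Lemma cder_inv (f : C -> C) (z a : C) :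
  f z <> 0 -> cder f z a -> cder (fun w => / f w)%C z (a * - / (f z * f z)).
Proof. intros Hz H. apply (cder_comp Cinv f); [apply cder_inv_id; assumption | assumption]. Qed.

Lemma cder_eq (f : C -> C) (z l l' : C) : cder f z l -> l = l' -> cder f z l'.
Proof. intros H <-; exact H. Qed.

Lemma rder_comp (f : C -> C) (g : R -> C) (t : R) (l v : C) :
  cder f (g t) l -> rder g t v -> rder (fun u => f (g u)) t (l * v).
Proof.
  intros Hf Hg eps Heps.
  assert (Hl := Cmod_ge_0 l). assert (Hv := Cmod_ge_0 v).
  destruct (Hf (eps / (2 * (1 + Cmod v)))) as [d1 [Hd1 K1]].
  { apply Rdiv_lt_0_compat; lra. }
  destruct (Hg (Rmin 1 (eps / (2 * (1 + Cmod l))))) as [d2 [Hd2 K2]].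
  { apply Rmin_case; [lra|]. apply Rdiv_lt_0_compat; lra. }
  exists (Rmin d2 (d1 / (1 + Cmod v))). split.
  { apply Rmin_case; [assumption|]. apply Rdiv_lt_0_compat; lra. }
  intros u Hu.
  assert (H1 := Rlt_le_trans _ _ _ Hu (Rmin_l _ _)).
  assert (H2 := Rlt_le_trans _ _ _ Hu (Rmin_r _ _)).
  specialize (K2 u H1). set (x := Rabs (u - t)) in *.
  assert (Hx : 0 <= x) by apply Rabs_pos.
  assert (Hgu : Cmod (g u - g t) <= (1 + Cmod v) * x).
  { replace (g u - g t)%C with ((g u - g t - RtoC (u - t) * v) + RtoC (u - t) * v)%C by ring.
    apply Rle_trans with (1 := Cmod_triangle _ _). rewrite Cmod_mult, Cmod_R. fold x.
    assert (Rmin 1 (eps / (2 * (1 + Cmod l))) * x <= 1 * x) by (apply Rmult_le_compat_r; [assumption|apply Rmin_l]).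
    lra. }
  assert (Hgd : Cmod (g u - g t) < d1).
  { apply Rle_lt_trans with (1 := Hgu).
    apply Rlt_le_trans with ((1 + Cmod v) * (d1 / (1 + Cmod v))).
    - apply Rmult_lt_compat_l; lra.
    - right; field; lra. }
  specialize (K1 (g u) Hgd).
  replace (f (g u) - f (g t) - RtoC (u - t) * (l * v))%C
    with ((f (g u) - f (g t) - l * (g u - g t)) + l * (g u - g t - RtoC (u - t) * v))%C by ring.
  apply Rle_trans with (1 := Cmod_triangle _ _). rewrite Cmod_mult.
  assert (A : Cmod (f (g u) - f (g t) - l * (g u - g t)) <= eps / 2 * x).
  { apply Rle_trans with (1 := K1).
    apply Rle_trans with (eps / (2 * (1 + Cmod v)) * ((1 + Cmod v) * x)).
    - apply Rmult_le_compat_l; [|assumption]. apply Rlt_le, Rdiv_lt_0_compat; lra.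
    - right; field; lra. }
  assert (B : Cmod l * Cmod (g u - g t - RtoC (u - t) * v) <= eps / 2 * x).
  { apply Rle_trans with ((1 + Cmod l) * (eps / (2 * (1 + Cmod l)) * x)).
    - apply Rmult_le_compat; [assumption | apply Cmod_ge_0 | lra |].
      apply Rle_trans with (1 := K2). apply Rmult_le_compat_r; [assumption | apply Rmin_r].
    - right; field; lra. }
  lra.
Qed.

Lemma rcont_comp (f : C -> C) (g : R -> C) (t : R) :
  ccont f (g t) -> rcont g t -> rcont (fun u => f (g u)) t.
Proof.
  intros Hf Hg eps Heps. destruct (Hf eps Heps) as [d [Hd K]].
  destruct (Hg d Hd) as [d' [Hd' K']]. exists d'. split; [assumption|].
  intros u Hu. apply K, K', Hu.
Qed.

Lemma rcont_plus (f g : R -> C) (t : R) : rcont f t -> rcont g t -> rcont (fun u => f u + g u)%C t.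
Proof.
  intros Hf Hg eps Heps.
  destruct (Hf (eps/2) ltac:(lra)) as [d1 [Hd1 K1]].
  destruct (Hg (eps/2) ltac:(lra)) as [d2 [Hd2 K2]].
  exists (Rmin d1 d2). split. { apply Rmin_case; assumption. }
  intros u Hu.
  replace (f u + g u - (f t + g t))%C with ((f u - f t) + (g u - g t))%C by ring.
  apply Rle_lt_trans with (1 := Cmod_triangle _ _).
  assert (A1 := K1 u (Rlt_le_trans _ _ _ Hu (Rmin_l _ _))).
  assert (A2 := K2 u (Rlt_le_trans _ _ _ Hu (Rmin_r _ _))). lra.
Qed.

Lemma rcont_const (c : C) (t : R) : rcont (fun _ => c) t.
Proof.
  intros eps Heps. exists 1. split; [lra|]. intros.
  replace (c - c)%C with (RtoC 0) by ring. rewrite Cmod_0; assumption.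
Qed.

Lemma rcont_mult (f g : R -> C) (t : R) : rcont f t -> rcont g t -> rcont (fun u => f u * g u)%C t.
Proof.
  intros Hf Hg eps Heps.
  assert (P1 := Cmod_ge_0 (f t)). assert (P2 := Cmod_ge_0 (g t)).
  set (e := Rmin 1 (eps / (2 * (1 + Cmod (f t) + Cmod (g t))))).
  assert (He : 0 < e). { apply Rmin_case; [lra|]. apply Rdiv_lt_0_compat; lra. }
  assert (He1 : e <= 1) by apply Rmin_l.
  assert (He2 : e * (1 + Cmod (f t) + Cmod (g t)) <= eps / 2).
  { apply Rle_trans with (eps / (2 * (1 + Cmod (f t) + Cmod (g t))) * (1 + Cmod (f t) + Cmod (g t))).
    - apply Rmult_le_compat_r; [lra|apply Rmin_r].
    - right; field; lra. }
  destruct (Hf e He) as [d1 [Hd1 K1]].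
  destruct (Hg e He) as [d2 [Hd2 K2]].
  exists (Rmin d1 d2). split. { apply Rmin_case; assumption. }
  intros u Hu.
  assert (A1 := K1 u (Rlt_le_trans _ _ _ Hu (Rmin_l _ _))).
  assert (A2 := K2 u (Rlt_le_trans _ _ _ Hu (Rmin_r _ _))).
  replace (f u * g u - f t * g t)%C
    with ((f u - f t) * (g u - g t) + (f u - f t) * g t + f t * (g u - g t))%C by ring.
  eapply Rle_lt_trans; [apply Cmod_triangle|].
  eapply Rle_lt_trans; [apply Rplus_le_compat_r, Cmod_triangle|].
  rewrite !Cmod_mult.
  set (x := Cmod (f u - f t)) in *. set (y := Cmod (g u - g t)) in *.
  assert (0 <= x) by apply Cmod_ge_0. assert (0 <= y) by apply Cmod_ge_0.
  nra.
Qed.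

Lemma rder_cont (g : R -> C) (t : R) (v : C) : rder g t v -> rcont g t.
Proof.
  intros H eps Heps.
  destruct (H 1 Rlt_0_1) as [d [Hd K]].
  assert (Hl := Cmod_ge_0 v).
  exists (Rmin d (eps / (2 + Cmod v))). split.
  { apply Rmin_case; [assumption|]. apply Rdiv_lt_0_compat; lra. }
  intros w Hw.
  assert (H1 := Rlt_le_trans _ _ _ Hw (Rmin_l _ _)).
  assert (H2 := Rlt_le_trans _ _ _ Hw (Rmin_r _ _)).
  specialize (K w H1).
  replace (g w - g t)%C with ((g w - g t - RtoC (w - t) * v) + RtoC (w - t) * v)%C by ring.
  apply Rle_lt_trans with (1 := Cmod_triangle _ _).
  rewrite Cmod_mult, Cmod_R. assert (H3 := Rabs_pos (w - t)).
  apply Rle_lt_trans with ((1 + Cmod v) * Rabs (w - t)); [nra|].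
  apply Rle_lt_trans with ((1 + Cmod v) * (eps / (2 + Cmod v))).
  { apply Rmult_le_compat_l; lra. }
  apply Rlt_le_trans with ((2 + Cmod v) * (eps / (2 + Cmod v))).
  - apply Rmult_lt_compat_r; [apply Rdiv_lt_0_compat; lra|lra].
  - right. field. lra.
Qed.

Lemma rder_mult (f g : R -> C) (t : R) (a b : C) :
  rder f t a -> rder g t b -> rder (fun u => f u * g u)%C t (a * g t + f t * b).
Proof.
  intros Hf Hg eps Heps. assert (Hc := rder_cont _ _ _ Hg).
  assert (PA := Cmod_ge_0 a). assert (PG := Cmod_ge_0 (g t)). assert (PF := Cmod_ge_0 (f t)).
  set (K := Cmod (g t) + 1 + Cmod a + Cmod (f t)).
  set (e := Rmin 1 (eps / K)).
  assert (He : 0 < e). { apply Rmin_case; [lra|]. apply Rdiv_lt_0_compat; unfold K; lra. }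
  assert (He1 : e <= 1) by apply Rmin_l.
  assert (He2 : e * K <= eps).
  { apply Rle_trans with (eps / K * K).
    - apply Rmult_le_compat_r; [unfold K; lra|apply Rmin_r].
    - right; field; unfold K; lra. }
  destruct (Hf e He) as [d1 [Hd1 K1]]. destruct (Hg e He) as [d2 [Hd2 K2]]. destruct (Hc e He) as [d3 [Hd3 K3]].
  exists (Rmin d1 (Rmin d2 d3)). split. { repeat apply Rmin_case; assumption. }
  intros u Hu.
  assert (A1 := K1 u (Rlt_le_trans _ _ _ Hu (Rmin_l _ _))).
  assert (Hu' := Rlt_le_trans _ _ _ Hu (Rmin_r _ _)).
  assert (A2 := K2 u (Rlt_le_trans _ _ _ Hu' (Rmin_l _ _))).
  assert (A3 := K3 u (Rlt_le_trans _ _ _ Hu' (Rmin_r _ _))).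
  replace (f u * g u - f t * g t - RtoC (u - t) * (a * g t + f t * b))%C
    with ((f u - f t - RtoC (u - t) * a) * g u + RtoC (u - t) * a * (g u - g t) + f t * (g u - g t - RtoC (u - t) * b))%C by ring.
  eapply Rle_trans; [apply Cmod_triangle|].
  eapply Rle_trans; [apply Rplus_le_compat_r, Cmod_triangle|].
  rewrite !Cmod_mult, Cmod_R. set (x := Rabs (u - t)) in *. assert (Px : 0 <= x) by apply Rabs_pos.
  assert (G1 : Cmod (g u) <= Cmod (g t) + 1) by (generalize (Cmod_triangle_rev (g u) (g t)); lra).
  assert (B1 : Cmod (f u - f t - RtoC (u - t) * a) * Cmod (g u) <= e * x * (Cmod (g t) + 1)).
  { apply Rmult_le_compat; try apply Cmod_ge_0; assumption. }
  assert (B2 : x * Cmod a * Cmod (g u - g t) <= x * Cmod a * e).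
  { apply Rmult_le_compat_l; [apply Rmult_le_pos; assumption | lra]. }
  assert (B3 : Cmod (f t) * Cmod (g u - g t - RtoC (u - t) * b) <= Cmod (f t) * (e * x)).
  { apply Rmult_le_compat_l; assumption. }
  apply Rle_trans with (e * K * x); [unfold K; lra|]. apply Rmult_le_compat_r; assumption.
Qed.

(** * Integrals of complex-valued functions of a real variable *)

Definition CInt (f : R -> C) (a b : R) : C := RInt (V := C_R_CompleteNormedModule) f a b.

Definition rcont_on (f : R -> C) (a b : R) : Prop :=
  forall t, Rmin a b <= t <= Rmax a b -> rcont f t.

Lemma rcont_on_le (f : R -> C) (a b : R) :
  a <= b -> (forall t, a <= t <= b -> rcont f t) -> rcont_on f a b.
Proof. intros Hab H t. rewrite Rmin_left, Rmax_right by assumption. apply H. Qed.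

Lemma rcont_on_sym (f : R -> C) (a b : R) : rcont_on f a b -> rcont_on f b a.
Proof. intros H t Ht. apply H. rewrite Rmin_comm, Rmax_comm. exact Ht. Qed.

Lemma ex_CInt (f : R -> C) (a b : R) :
  rcont_on f a b -> ex_RInt (V := C_R_CompleteNormedModule) f a b.
Proof.
  intros H. apply (ex_RInt_continuous (V := C_R_CompleteNormedModule)).
  intros t Ht. apply rcont_continuous, H, Ht.
Qed.

Lemma is_CInt (f : R -> C) (a b : R) :
  rcont_on f a b -> is_RInt (V := C_R_CompleteNormedModule) f a b (CInt f a b).
Proof. intros; apply (RInt_correct (V := C_R_CompleteNormedModule)), ex_CInt; assumption. Qed.

Lemma CInt_ext (f g : R -> C) (a b : R) :
  (forall t, Rmin a b < t < Rmax a b -> f t = g t) -> CInt f a b = CInt g a b.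
Proof. apply (RInt_ext (V := C_R_CompleteNormedModule)). Qed.

Lemma CInt_ext_all (f g : R -> C) (a b : R) : (forall t, f t = g t) -> CInt f a b = CInt g a b.
Proof. intros H; apply CInt_ext; intros; apply H. Qed.

Lemma CInt_plus (f g : R -> C) (a b : R) :
  rcont_on f a b -> rcont_on g a b ->
  (CInt (fun t => f t + g t)%C a b = CInt f a b + CInt g a b)%C.
Proof.
  intros Hf Hg.
  apply (RInt_plus (V := C_R_CompleteNormedModule) f g); apply ex_CInt; assumption.
Qed.

Lemma CInt_scal (c : C) (f : R -> C) (a b : R) :
  rcont_on f a b -> (CInt (fun t => c * f t)%C a b = c * CInt f a b)%C.
Proof.
  intros Hf. apply (is_RInt_unique (V := C_R_CompleteNormedModule)).
  assert (H := is_CInt f a b Hf).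
  set (I := CInt f a b) in *.
  assert (H1 := is_RInt_fct_extend_fst (U := R_NormedModule) (V := R_NormedModule) f a b I H).
  assert (H2 := is_RInt_fct_extend_snd (U := R_NormedModule) (V := R_NormedModule) f a b I H).
  apply (is_RInt_fct_extend_pair (U := R_NormedModule) (V := R_NormedModule)
    (fun t => (c * f t)%C) a b (fst c * fst I - snd c * snd I) (fst c * snd I + snd c * fst I)); simpl.
  - apply (is_RInt_minus (V := R_NormedModule) (fun t => fst c * fst (f t)) (fun t => snd c * snd (f t)));
    apply (is_RInt_scal (V := R_NormedModule)); assumption.
  - apply (is_RInt_plus (V := R_NormedModule) (fun t => fst c * snd (f t)) (fun t => snd c * fst (f t)));
    apply (is_RInt_scal (V := R_NormedModule)); assumption.
Qed.

Lemma rcont_scal (c : C) (f : R -> C) t : rcont f t -> rcont (fun u => c * f u)%C t.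
Proof. intros H. apply (rcont_mult (fun _ => c)); [apply rcont_const | assumption]. Qed.

Lemma rcont_minus (f g : R -> C) t : rcont f t -> rcont g t -> rcont (fun u => f u - g u)%C t.
Proof.
  intros Hf Hg. apply rcont_plus; [assumption|]. intros eps Heps.
  destruct (Hg eps Heps) as [d [Hd K]]. exists d. split; [assumption|]. intros u Hu.
  replace (- g u - - g t)%C with (- (g u - g t))%C by ring. rewrite Cmod_opp. apply K, Hu.
Qed.

Lemma CInt_minus (f g : R -> C) (a b : R) :
  rcont_on f a b -> rcont_on g a b ->
  (CInt (fun t => f t - g t)%C a b = CInt f a b - CInt g a b)%C.
Proof.
  intros Hf Hg.
  rewrite (CInt_ext_all _ (fun t => f t + (- (1)) * g t)%C) by (intros; ring).
  rewrite CInt_plus, CInt_scal; try assumption; [ring|].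
  intros t Ht. apply rcont_scal, Hg, Ht.
Qed.

Lemma CInt_Chasles (f : R -> C) (a b c : R) :
  rcont_on f a b -> rcont_on f b c -> (CInt f a c = CInt f a b + CInt f b c)%C.
Proof.
  intros H1 H2. symmetry.
  apply (RInt_Chasles (V := C_R_CompleteNormedModule)); apply ex_CInt; assumption.
Qed.

Lemma CInt_point (f : R -> C) (a : R) : CInt f a a = 0.
Proof. apply (RInt_point (V := C_R_CompleteNormedModule)). Qed.

Lemma CInt_swap (f : R -> C) (a b : R) : rcont_on f a b -> (CInt f b a = - CInt f a b)%C.
Proof.
  intros H. assert (H' := CInt_Chasles f a b a H (rcont_on_sym _ _ _ H)).
  rewrite CInt_point in H'.
  replace (CInt f b a) with ((CInt f a b + CInt f b a) - CInt f a b)%C by ring.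
  rewrite <- H'. ring.
Qed.

Lemma CInt_const (c : C) (a b : R) : CInt (fun _ => c) a b = (RtoC (b - a) * c)%C.
Proof.
  unfold CInt. rewrite (RInt_const (V := C_R_CompleteNormedModule)).
  unfold scal; simpl. unfold prod_scal, scal; simpl. unfold mult; simpl.
  apply injective_projections; simpl; ring.
Qed.

Lemma CInt_bound (f : R -> C) (a b M : R) :
  rcont_on f a b -> (forall t, Rmin a b <= t <= Rmax a b -> Cmod (f t) <= M) ->
  Cmod (CInt f a b) <= Rabs (b - a) * M.
Proof.
  intros Hf H. rewrite <- norm_C_R.
  apply (norm_RInt_le_const_abs (V := C_R_CompleteNormedModule) f a b); try assumption.
  - intros x Hx. rewrite norm_C_R. apply H, Hx.
  - apply is_CInt; assumption.
Qed.

Lemma CInt_bound_fct (f : R -> C) (g : R -> R) (a b Ig : R) :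
  a <= b -> rcont_on f a b -> (forall t, a <= t <= b -> Cmod (f t) <= g t) ->
  is_RInt g a b Ig -> Cmod (CInt f a b) <= Ig.
Proof.
  intros Hab Hf H HI. rewrite <- norm_C_R.
  apply (norm_RInt_le (V := C_R_CompleteNormedModule) f g a b); try assumption.
  - intros x Hx. rewrite norm_C_R. apply H, Hx.
  - apply is_CInt; assumption.
Qed.

Lemma CInt_derive (g dg : R -> C) (a b : R) :
  (forall t, Rmin a b <= t <= Rmax a b -> rder g t (dg t)) -> rcont_on dg a b ->
  CInt dg a b = (g b - g a)%C.
Proof.
  intros H1 H2. apply (is_RInt_unique (V := C_R_CompleteNormedModule)).
  apply (is_RInt_derive (V := C_R_CompleteNormedModule) g dg).
  - intros x Hx. apply rder_is_derive, H1, Hx.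
  - intros x Hx. apply rcont_continuous, H2, Hx.
Qed.

(** * The exponential *)

Lemma exp_le (x y : R) : x <= y -> exp x <= exp y.
Proof. intros [H| ->]; [left; apply exp_increasing, H | right; reflexivity]. Qed.

Lemma Cexp_0 : Cexp 0 = 1.
Proof.
  unfold Cexp; simpl. rewrite exp_0, cos_0, sin_0.
  apply injective_projections; simpl; ring.
Qed.

Lemma Cexp_add (z w : C) : Cexp (z + w) = (Cexp z * Cexp w)%C.
Proof.
  unfold Cexp, Re, Im; destruct z as [a b]; destruct w as [c d]; simpl.
  rewrite exp_plus, cos_plus, sin_plus. apply injective_projections; simpl; ring.
Qed.

Lemma Cexp_opp_mult (z : C) : (Cexp z * Cexp (- z) = 1)%C.
Proof. rewrite <- Cexp_add. replace (z + - z)%C with (RtoC 0) by ring. apply Cexp_0. Qed.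

Lemma Cexp_neq_0 (z : C) : Cexp z <> 0.
Proof.
  intros H. generalize (Cexp_opp_mult z). rewrite H, Cmult_0_l.
  intros E. apply (RtoC_inj 0 1) in E. lra.
Qed.

Lemma Cexp_opp (z : C) : Cexp (- z) = (/ Cexp z)%C.
Proof.
  assert (H := Cexp_neq_0 z). rewrite <- (Cmult_1_r (/ Cexp z)), <- (Cexp_opp_mult z).
  field. exact H.
Qed.

Lemma Cexp_RtoC (x : R) : Cexp (RtoC x) = RtoC (exp x).
Proof.
  unfold Cexp; simpl. rewrite cos_0, sin_0. apply injective_projections; simpl; ring.
Qed.

Lemma Cmod_Cexp (z : C) : Cmod (Cexp z) = exp (Re z).
Proof.
  unfold Cexp, Cmod; simpl.
  replace (_ + _) with (exp (Re z) * exp (Re z) * (Rsqr (sin (Im z)) + Rsqr (cos (Im z))))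
    by (unfold Rsqr; ring).
  rewrite sin2_cos2, Rmult_1_r. apply sqrt_square. left; apply exp_pos.
Qed.

Lemma rder_Cexp_lin (h : C) (t : R) : rder (fun u => Cexp (RtoC u * h)) t (h * Cexp (RtoC t * h)).
Proof.
  destruct h as [a b].
  apply is_derive_rder; unfold Cexp, Re, Im; simpl.
  - apply (is_derive_ext (fun u : R => exp (u * a) * cos (u * b))).
    { intros u. f_equal; f_equal; ring. }
    auto_derive; [exact I|].
    replace (t * a - 0 * b) with (t * a) by ring. replace (t * b + 0 * a) with (t * b) by ring. ring.
  - apply (is_derive_ext (fun u : R => exp (u * a) * sin (u * b))).
    { intros u. f_equal; f_equal; ring. }
    auto_derive; [exact I|].
    replace (t * a - 0 * b) with (t * a) by ring. replace (t * b + 0 * a) with (t * b) by ring. ring.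
Qed.

Lemma rcont_Cexp_lin (h : C) (t : R) : rcont (fun u => Cexp (RtoC u * h)) t.
Proof. eapply rder_cont, rder_Cexp_lin. Qed.

Lemma Cmod_Cexp_segment (h : C) (t : R) : 0 <= t <= 1 -> Cmod (Cexp (RtoC t * h)) <= exp (Cmod h).
Proof.
  intros Ht. rewrite Cmod_Cexp. apply exp_le.
  replace (Re (RtoC t * h)) with (t * Re h) by (unfold Re; destruct h; simpl; ring).
  generalize (re_le_Cmod h) (Rle_abs (Re h)) (Rabs_pos (Re h)) (Cmod_ge_0 h). nra.
Qed.

(** The difference is the integral of [h * Cexp (t h)] over the unit interval. One more integration
    of the same kind gives the second-order bound, and with it the complex derivative. *)
Lemma Cexp_minus_1_bound (h : C) : Cmod (Cexp h - 1) <= Cmod h * exp (Cmod h).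
Proof.
  assert (E : (Cexp h - 1 = CInt (fun t => h * Cexp (RtoC t * h)) 0 1)%C).
  { rewrite (CInt_derive (fun t => Cexp (RtoC t * h))).
    - rewrite Cmult_1_l, Cmult_0_l, Cexp_0. reflexivity.
    - intros; apply rder_Cexp_lin.
    - intros t _. apply rcont_scal, rcont_Cexp_lin. }
  rewrite E.
  replace (Cmod h * exp (Cmod h)) with (Rabs (1 - 0) * (Cmod h * exp (Cmod h)))
    by (rewrite Rminus_0_r, Rabs_R1; ring).
  apply CInt_bound.
  - intros t _. apply rcont_scal, rcont_Cexp_lin.
  - intros t. rewrite Rmin_left, Rmax_right by lra. intros Ht. rewrite Cmod_mult.
    apply Rmult_le_compat_l; [apply Cmod_ge_0|]. apply Cmod_Cexp_segment; assumption.
Qed.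

Lemma Cexp_taylor_bound (h : C) : Cmod (Cexp h - 1 - h) <= Cmod h ^ 2 * exp (Cmod h).
Proof.
  assert (Hc : rcont_on (fun t => h * (Cexp (RtoC t * h) - 1))%C 0 1).
  { intros t _. apply rcont_scal, rcont_minus; [apply rcont_Cexp_lin|apply rcont_const]. }
  assert (E : (Cexp h - 1 - h = CInt (fun t => h * (Cexp (RtoC t * h) - 1)) 0 1)%C).
  { rewrite (CInt_ext_all _ (fun t => h * Cexp (RtoC t * h) - h)%C) by (intros; ring).
    rewrite (CInt_minus _ (fun _ => h)), CInt_const.
    - rewrite (CInt_derive (fun t => Cexp (RtoC t * h))).
      + rewrite Cmult_1_l, Cmult_0_l, Cexp_0. replace (1 - 0) with 1 by ring. ring.
      + intros; apply rder_Cexp_lin.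
      + intros t _. apply rcont_scal, rcont_Cexp_lin.
    - intros t _. apply rcont_scal, rcont_Cexp_lin.
    - intros t _. apply rcont_const. }
  rewrite E.
  replace (Cmod h ^ 2 * exp (Cmod h)) with (Rabs (1 - 0) * (Cmod h * (Cmod h * exp (Cmod h))))
    by (rewrite Rminus_0_r, Rabs_R1; ring).
  apply CInt_bound; [exact Hc|].
  intros t. rewrite Rmin_left, Rmax_right by lra. intros Ht. rewrite Cmod_mult.
  apply Rmult_le_compat_l; [apply Cmod_ge_0|].
  apply Rle_trans with (1 := Cexp_minus_1_bound _).
  assert (Cmod (RtoC t * h) <= Cmod h).
  { rewrite Cmod_mult, Cmod_R, Rabs_pos_eq by lra. generalize (Cmod_ge_0 h); nra. }
  apply Rmult_le_compat; [apply Cmod_ge_0 | left; apply exp_pos | assumption | apply exp_le; assumption].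
Qed.

Lemma cder_Cexp (z : C) : cder Cexp z (Cexp z).
Proof.
  intros eps Heps.
  assert (Hp : 0 < Cmod (Cexp z)) by (apply Cmod_gt_0, Cexp_neq_0).
  exists (Rmin 1 (eps / (Cmod (Cexp z) * exp 1))).
  assert (He : 0 < exp 1) by apply exp_pos.
  split. { apply Rmin_case; [lra|]. apply Rdiv_lt_0_compat; nra. }
  intros w Hw.
  assert (H1 := Rlt_le_trans _ _ _ Hw (Rmin_l _ _)).
  assert (H2 := Rlt_le_trans _ _ _ Hw (Rmin_r _ _)).
  set (h := (w - z)%C) in *.
  replace w with (z + h)%C by (unfold h; ring). rewrite Cexp_add.
  replace (Cexp z * Cexp h - Cexp z - Cexp z * h)%C with (Cexp z * (Cexp h - 1 - h))%C by ring.
  rewrite Cmod_mult. assert (H3 := Cmod_ge_0 h).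
  apply Rle_trans with (Cmod (Cexp z) * (Cmod h ^ 2 * exp 1)).
  { apply Rmult_le_compat_l; [lra|]. apply Rle_trans with (1 := Cexp_taylor_bound h).
    apply Rmult_le_compat_l; [nra|]. apply exp_le; lra. }
  replace (Cmod (Cexp z) * (Cmod h ^ 2 * exp 1)) with ((Cmod (Cexp z) * exp 1) * Cmod h * Cmod h) by ring.
  apply Rmult_le_compat_r; [assumption|].
  apply Rle_trans with ((Cmod (Cexp z) * exp 1) * (eps / (Cmod (Cexp z) * exp 1))).
  - apply Rmult_le_compat_l; nra.
  - right; field; lra.
Qed.

(** Builds the derivative as an existential term. Its value is adjusted afterwards with [cder_eq],
    and the non-vanishing of denominators is left to the caller. *)
Ltac cder_auto :=
  lazymatch goal with
  | |- cder (fun w => Cplus (@?f w) (@?g w)) _ _ => eapply (cder_plus f g); cder_auto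
  | |- cder (fun w => Cminus (@?f w) (@?g w)) _ _ => eapply (cder_minus f g); cder_auto
  | |- cder (fun w => Copp (@?f w)) _ _ => eapply (cder_opp f); cder_auto
  | |- cder (fun w => w) _ _ => eapply cder_id
  | |- cder (fun _ => ?c) _ _ => eapply (cder_const c)
  | |- cder (fun w => Cmult (@?f w) (@?g w)) _ _ => eapply (cder_mult f g); cder_auto
  | |- cder (fun w => Cdiv (@?f w) (@?g w)) _ _ =>
      eapply (cder_mult f (fun w => Cinv (g w))); cder_auto
  | |- cder (fun w => Cinv (@?f w)) _ _ => eapply (cder_inv f); [ | cder_auto]
  | |- cder (fun w => Cexp (@?f w)) _ _ => eapply (cder_comp Cexp f); [apply cder_Cexp | cder_auto]
  | |- _ => try eassumption
  end.

(** * Complex series *)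

(** Indices run below [n], so [csum u (S n)] is the inclusive [sum_n u n]; having the empty sum
    makes splitting a series at an index uniform. *)
Fixpoint csum (u : nat -> C) (n : nat) : C :=
  match n with O => RtoC 0 | S k => (csum u k + u k)%C end.

Fixpoint rsum (u : nat -> R) (n : nat) : R :=
  match n with O => 0 | S k => rsum u k + u k end.

Definition cseries (u : nat -> C) (l : C) : Prop :=
  forall eps, 0 < eps -> exists N, forall n, (N <= n)%nat -> Cmod (csum u n - l) < eps.

(** A total function, so that continuations can be defined before convergence is known; its value
    means something only together with a convergence proof. *)
Definition CSer (u : nat -> C) : C := epsilon (inhabits (RtoC 0)) (cseries u).

Lemma csum_sum_n (u : nat -> C) (n : nat) : csum u (S n) = sum_n (G := C_AbelianMonoid) u n.
Proof.
  induction n as [|n IH].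
  - rewrite sum_O. simpl. ring.
  - rewrite sum_Sn, <- IH. reflexivity.
Qed.

Lemma rsum_sum_n (u : nat -> R) (n : nat) : rsum u (S n) = sum_n u n.
Proof.
  induction n as [|n IH].
  - rewrite sum_O. simpl. ring.
  - rewrite sum_Sn, <- IH. reflexivity.
Qed.

Lemma cseries_is_series (u : nat -> C) (l : C) :
  cseries u l <-> is_series (K := C_AbsRing) (V := C_NormedModule) u l.
Proof.
  split.
  - intros H P HP. apply locally_Cmod in HP. destruct HP as [d [Hd HP]].
    destruct (H d Hd) as [N HN]. exists N. intros n Hn. apply HP.
    rewrite <- csum_sum_n. apply HN. lia.
  - intros H eps Heps.
    assert (L : locally (T := C_UniformSpace) l (fun w => Cmod (w - l) < eps)).
    { apply locally_Cmod. exists eps. split; [assumption|]. tauto. }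
    destruct (H _ L) as [N HN]. exists (S N). intros n Hn. destruct n as [|n]; [lia|].
    rewrite csum_sum_n. apply HN. lia.
Qed.

Lemma cseries_unique (u : nat -> C) (l l' : C) : cseries u l -> cseries u l' -> l = l'.
Proof.
  intros H H'. destruct (Ceq_dec l l') as [E|E]; [exact E|exfalso].
  assert (P : 0 < Cmod (l - l')). { apply Cmod_gt_0. intros F. apply E. replace l with ((l - l') + l')%C by ring. rewrite F; ring. }
  destruct (H (Cmod (l - l') / 2) ltac:(lra)) as [N HN].
  destruct (H' (Cmod (l - l') / 2) ltac:(lra)) as [N' HN'].
  specialize (HN (max N N') ltac:(lia)). specialize (HN' (max N N') ltac:(lia)).
  set (s := csum u (max N N')) in *.
  assert (Cmod (l - l') <= Cmod (s - l') + Cmod (s - l)).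
  { replace (l - l')%C with ((s - l') - (s - l))%C by ring. apply Cmod_triangle_minus. }
  lra.
Qed.

Lemma CSer_correct (u : nat -> C) (l : C) : cseries u l -> cseries u (CSer u).
Proof. intros H. unfold CSer. apply epsilon_spec. exists l; exact H. Qed.

Lemma CSer_unique (u : nat -> C) (l : C) : cseries u l -> CSer u = l.
Proof. intros H. apply (cseries_unique u); [eapply CSer_correct, H | exact H]. Qed.

Lemma csum_ext (u v : nat -> C) (n : nat) : (forall k, (k < n)%nat -> u k = v k) -> csum u n = csum v n.
Proof.
  induction n as [|n IH]; intros H; [reflexivity|]. simpl. rewrite IH, H; auto.
Qed.

Lemma cseries_ext (u v : nat -> C) (l : C) : (forall n, u n = v n) -> cseries u l -> cseries v l.
Proof.
  intros H K eps Heps. destruct (K eps Heps) as [N HN]. exists N. intros n Hn.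
  rewrite (csum_ext v u) by (intros; symmetry; apply H). apply HN, Hn.
Qed.

Lemma csum_scal (c : C) (u : nat -> C) (n : nat) : csum (fun k => c * u k)%C n = (c * csum u n)%C.
Proof. induction n as [|n IH]; simpl; [ring|]. rewrite IH; ring. Qed.

Lemma cseries_plus (u v : nat -> C) (l m : C) :
  cseries u l -> cseries v m -> cseries (fun n => u n + v n)%C (l + m).
Proof. rewrite !cseries_is_series. intros H1 H2. exact (is_series_plus _ _ _ _ H1 H2). Qed.

Lemma cseries_scal (c : C) (u : nat -> C) (l : C) : cseries u l -> cseries (fun n => c * u n)%C (c * l).
Proof. rewrite !cseries_is_series. intros H. exact (is_series_scal c _ _ H). Qed.

Lemma cseries_minus (u v : nat -> C) (l m : C) :
  cseries u l -> cseries v m -> cseries (fun n => u n - v n)%C (l - m).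
Proof. rewrite !cseries_is_series. intros H1 H2. exact (is_series_minus _ _ _ _ H1 H2). Qed.

Lemma cseries_shift (u : nat -> C) (l : C) : cseries (fun n => u (S n)) l <-> cseries u (u O + l).
Proof.
  assert (E : forall n, csum u (S n) = (u O + csum (fun k => u (S k)) n)%C).
  { induction n as [|n IH]; [simpl; ring|]. change (csum u (S (S n))) with (csum u (S n) + u (S n))%C.
    rewrite IH. simpl. ring. }
  split; intros H eps Heps; destruct (H eps Heps) as [N HN].
  - exists (S N). intros n Hn. destruct n as [|n]; [lia|]. rewrite E.
    replace (u O + csum (fun k => u (S k)) n - (u O + l))%C with (csum (fun k => u (S k)) n - l)%C by ring.
    apply HN; lia.
  - exists N. intros n Hn. specialize (HN (S n) ltac:(lia)). rewrite E in HN.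
    replace (u O + csum (fun k => u (S k)) n - (u O + l))%C with (csum (fun k => u (S k)) n - l)%C in HN by ring.
    exact HN.
Qed.

Lemma cseries_single (u : nat -> C) : (forall n, u (S n) = 0) -> cseries u (u O).
Proof.
  intros H eps Heps. exists 1%nat. intros n Hn. destruct n as [|n]; [lia|]. clear Hn.
  assert (E : csum u (S n) = u O).
  { induction n as [|n IH]; [simpl; ring|].
    change (csum u (S n) + u (S n) = u O)%C. rewrite IH, H. ring. }
  rewrite E. replace (u O - u O)%C with (RtoC 0) by ring. rewrite Cmod_0; assumption.
Qed.

Lemma csum_bound (u : nat -> C) (M : nat -> R) (n : nat) :
  (forall k, Cmod (u k) <= M k) -> Cmod (csum u n) <= rsum M n.
Proof.
  intros H. induction n as [|n IH]; simpl; [rewrite Cmod_0; lra|].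
  apply Rle_trans with (1 := Cmod_triangle _ _). generalize (H n); lra.
Qed.

Lemma rsum_le_Series (M : nat -> R) (n : nat) :
  (forall k, 0 <= M k) -> ex_series M -> rsum M n <= Series M.
Proof.
  intros Hp HM. destruct n as [|n].
  - simpl. rewrite <- (Rmult_0_l (Series M)), <- Series_scal_l.
    apply Series_le; [|assumption]. intros k. generalize (Hp k); lra.
  - rewrite rsum_sum_n.
    assert (H := Series_correct _ HM). apply is_lim_seq_incr_compare.
    + exact H.
    + intros k. rewrite sum_Sn. unfold plus; simpl. generalize (Hp (S k)); lra.
Qed.

Lemma cseries_bound (u : nat -> C) (M : nat -> R) (l : C) :
  (forall k, Cmod (u k) <= M k) -> ex_series M -> cseries u l -> Cmod l <= Series M.
Proof.
  intros Hu HM H. apply Rnot_lt_le. intros C0.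
  destruct (H (Cmod l - Series M) ltac:(lra)) as [N HN]. specialize (HN N (le_n _)).
  assert (A := csum_bound u M N Hu).
  assert (B := rsum_le_Series M N (fun k => Rle_trans _ _ _ (Cmod_ge_0 _) (Hu k)) HM).
  assert (D := Cmod_triangle_rev l (csum u N)). rewrite Cmod_minus_sym in D. lra.
Qed.

Lemma cseries_abs (u : nat -> C) (M : nat -> R) :
  (forall k, Cmod (u k) <= M k) -> ex_series M -> cseries u (CSer u).
Proof.
  intros Hu HM.
  destruct (ex_series_le (K := C_AbsRing) (V := C_CompleteNormedModule) u M) as [l Hl]; [|assumption|].
  - intros n. apply Hu.
  - apply cseries_is_series in Hl. eapply CSer_correct; exact Hl.
Qed.

Lemma cseries_shift_n (u : nat -> C) (l : C) (N : nat) :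
  cseries (fun n => u (N + n)%nat) l <-> cseries u (csum u N + l).
Proof.
  revert u l. induction N as [|N IH]; intros u l.
  - simpl. rewrite Cplus_0_l. tauto.
  - assert (E : forall n, csum u (S n) = (u O + csum (fun k => u (S k)) n)%C).
    { induction n as [|n IHn]; [simpl; ring|]. change (csum u (S (S n))) with (csum u (S n) + u (S n))%C.
      rewrite IHn. simpl. ring. }
    rewrite E, <- Cplus_assoc, <- cseries_shift. apply (IH (fun k => u (S k))).
Qed.

Lemma ex_series_shift_n (M : nat -> R) (N : nat) : ex_series M -> ex_series (fun n => M (N + n)%nat).
Proof. apply ex_series_incr_n. Qed.

Lemma cseries_tail (u : nat -> C) (M : nat -> R) (l : C) (N : nat) :
  (forall k, Cmod (u k) <= M k) -> ex_series M -> cseries u l ->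
  Cmod (l - csum u N) <= Series (fun n => M (N + n)%nat).
Proof.
  intros Hu HM H. apply (cseries_bound (fun n => u (N + n)%nat)).
  - intros; apply Hu.
  - apply ex_series_shift_n, HM.
  - apply cseries_shift_n. replace (csum u N + (l - csum u N))%C with l by ring. exact H.
Qed.

Lemma Series_tail_small (M : nat -> R) : ex_series M ->
  forall eps, 0 < eps -> exists N0, forall N, (N0 <= N)%nat -> Rabs (Series (fun n => M (N + n)%nat)) < eps.
Proof.
  intros HM eps Heps.
  assert (H := Series_correct _ HM).
  assert (L : locally (Series M) (fun x => Rabs (x - Series M) < eps)).
  { exists (mkposreal eps Heps). intros y Hy. exact Hy. }
  destruct (H _ L) as [N HN]. exists (S N). intros n Hn. destruct n as [|n]; [lia|].
  specialize (HN n ltac:(lia)).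
  rewrite (Series_incr_n M (S n)) in HN by (try lia; assumption).
  simpl pred in HN. rewrite <- sum_n_Reals in HN.
  assert (E : forall x y, Rabs (x - (x + y)) < eps -> Rabs y < eps).
  { intros x y. replace (x - (x + y)) with (- y) by ring. rewrite Rabs_Ropp. tauto. }
  exact (E _ _ HN).
Qed.

(* Product majorants are all that is needed for the interchange. *)
Lemma cseries_swap (u : nat -> nat -> C) (a b : nat -> R) (r c : nat -> C) (l : C) :
  (forall n j, Cmod (u n j) <= a n * b j) -> ex_series a -> ex_series b ->
  (forall n, 0 <= a n) -> (forall j, 0 <= b j) ->
  (forall n, cseries (fun j => u n j) (r n)) ->
  (forall j, cseries (fun n => u n j) (c j)) ->
  cseries c l -> cseries r l.
Proof.
  intros Hu Ha Hb Pa Pb Hr Hc Hl eps Heps.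
  assert (PB : 0 <= Series b).
  { apply Rle_trans with (rsum b 0); [simpl; lra|]. apply rsum_le_Series; assumption. }
  destruct (Series_tail_small a Ha (eps / (1 + Series b))) as [N0 HN0].
  { apply Rdiv_lt_0_compat; lra. }
  exists N0. intros N HN.
  (* The sum of the first [N] rows, taken column by column. *)
  assert (F : cseries (fun j => csum (fun n => u n j) N) (csum r N)).
  { clear HN. induction N as [|N IH]; simpl.
    - intros e He. exists O. intros n _. replace (csum (fun _ => RtoC 0) n) with (RtoC 0).
      + replace (RtoC 0 - RtoC 0)%C with (RtoC 0) by ring. rewrite Cmod_0; assumption.
      + clear. induction n as [|n IH]; simpl; [reflexivity|]. rewrite <- IH. ring.
    - apply cseries_plus; [exact IH | apply Hr]. }
  assert (D := cseries_minus _ _ _ _ Hl F).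
  rewrite Cmod_minus_sym.
  set (T := Series (fun n => a (N + n)%nat)).
  assert (HT := HN0 N HN). fold T in HT.
  assert (PT : 0 <= T).
  { apply Rle_trans with (rsum (fun n => a (N + n)%nat) 0); [simpl; lra|].
    apply rsum_le_Series; [intros; apply Pa | apply ex_series_shift_n, Ha]. }
  rewrite Rabs_pos_eq in HT by assumption.
  (* Column [j] without its first [N] terms is at most [T * b j], where [T] is the tail of [a];
     summing over [j] leaves a multiple of [T]. *)
  apply Rle_lt_trans with (Series (fun j => T * b j)).
  - apply (cseries_bound (fun j => c j - csum (fun n => u n j) N)%C); [| |exact D].
    + intros j. apply Rle_trans with (Series (fun n => (a (N + n)%nat) * b j)).
      * apply (cseries_tail (fun n => u n j) (fun n => a n * b j)); [intros; apply Hu| |apply Hc].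
        apply (ex_series_scal_r (b j)), Ha.
      * rewrite Series_scal_r. apply Rle_refl.
    + apply (ex_series_scal_l T b Hb).
  - rewrite Series_scal_l.
    apply Rle_lt_trans with (eps / (1 + Series b) * Series b).
    + apply Rmult_le_compat_r; lra.
    + apply Rlt_le_trans with (eps / (1 + Series b) * (1 + Series b)).
      * apply Rmult_lt_compat_l; [apply Rdiv_lt_0_compat; lra|lra].
      * right; field; lra.
Qed.

(** * Goursat's lemma and primitives *)

Lemma Cmod_le_coord (z w : C) :
  Rabs (fst z) <= Rabs (fst w) -> Rabs (snd z) <= Rabs (snd w) -> Cmod z <= Cmod w.
Proof.
  intros H1 H2. unfold Cmod. apply sqrt_le_1_alt.
  rewrite <- (pow2_abs (fst z)), <- (pow2_abs (snd z)), <- (pow2_abs (fst w)), <- (pow2_abs (snd w)).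
  apply Rplus_le_compat; apply pow_incr; split; try assumption; apply Rabs_pos.
Qed.

Lemma rder_hor (x y : R) : rder (fun u => (u, y) : C) x 1.
Proof.
  apply is_derive_rder; unfold Re, Im; simpl.
  - apply (is_derive_id (K := R_AbsRing)).
  - apply (is_derive_const (K := R_AbsRing) (V := R_NormedModule)).
Qed.

Lemma rder_ver (x y : R) : rder (fun u => (x, u) : C) y Ci.
Proof.
  apply is_derive_rder; unfold Re, Im; simpl.
  - apply (is_derive_const (K := R_AbsRing) (V := R_NormedModule)).
  - apply (is_derive_id (K := R_AbsRing)).
Qed.

Lemma rcont_hor (f : C -> C) (x y : R) : ccont f (x, y) -> rcont (fun u => f (u, y)) x.
Proof. intros H. apply (rcont_comp f (fun u => (u, y))); [exact H|]. eapply rder_cont, rder_hor. Qed.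

Lemma rcont_ver (f : C -> C) (x y : R) : ccont f (x, y) -> rcont (fun u => f (x, u)) y.
Proof. intros H. apply (rcont_comp f (fun u => (x, u))); [exact H|]. eapply rder_cont, rder_ver. Qed.

(** The contour integral along the boundary, counterclockwise; [Ci] is [dz / dy] on the vertical
    sides. *)
Definition rect (f : C -> C) (x1 x2 y1 y2 : R) : C :=
  (CInt (fun x => f (x, y1)) x1 x2 - CInt (fun x => f (x, y2)) x1 x2
   + Ci * (CInt (fun y => f (x2, y)) y1 y2 - CInt (fun y => f (x1, y)) y1 y2))%C.

Definition in_rect (x1 x2 y1 y2 : R) (z : C) : Prop :=
  x1 <= fst z <= x2 /\ y1 <= snd z <= y2.

Definition cont_rect (f : C -> C) (x1 x2 y1 y2 : R) : Prop :=
  forall z, in_rect x1 x2 y1 y2 z -> ccont f z.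

Lemma cont_rect_hor f x1 x2 y1 y2 y a b :
  cont_rect f x1 x2 y1 y2 -> y1 <= y <= y2 -> x1 <= a -> a <= b -> b <= x2 ->
  rcont_on (fun x => f (x, y)) a b.
Proof.
  intros H Hy Ha Hab Hb t. rewrite Rmin_left, Rmax_right by assumption. intros Ht.
  apply rcont_hor, H. split; simpl; lra.
Qed.

Lemma cont_rect_ver f x1 x2 y1 y2 x a b :
  cont_rect f x1 x2 y1 y2 -> x1 <= x <= x2 -> y1 <= a -> a <= b -> b <= y2 ->
  rcont_on (fun y => f (x, y)) a b.
Proof.
  intros H Hy Ha Hab Hb t. rewrite Rmin_left, Rmax_right by assumption. intros Ht.
  apply rcont_ver, H. split; simpl; lra.
Qed.

Lemma rect_split_x f x1 u x2 y1 y2 :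
  cont_rect f x1 x2 y1 y2 -> x1 <= u <= x2 -> y1 <= y2 ->
  rect f x1 x2 y1 y2 = (rect f x1 u y1 y2 + rect f u x2 y1 y2)%C.
Proof.
  intros H Hu Hy. unfold rect.
  rewrite (CInt_Chasles (fun x => f (x, y1)) x1 u x2), (CInt_Chasles (fun x => f (x, y2)) x1 u x2);
    try (apply (cont_rect_hor f x1 x2 y1 y2); [assumption | lra..]).
  ring.
Qed.

Lemma rect_split_y f x1 x2 y1 u y2 :
  cont_rect f x1 x2 y1 y2 -> y1 <= u <= y2 -> x1 <= x2 ->
  rect f x1 x2 y1 y2 = (rect f x1 x2 y1 u + rect f x1 x2 u y2)%C.
Proof.
  intros H Hu Hy. unfold rect.
  rewrite (CInt_Chasles (fun x => f (x1, x)) y1 u y2), (CInt_Chasles (fun x => f (x2, x)) y1 u y2);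
    try (apply (cont_rect_ver f x1 x2 y1 y2); [assumption | lra..]).
  ring.
Qed.

Lemma rect_bound f x1 x2 y1 y2 M :
  cont_rect f x1 x2 y1 y2 -> x1 <= x2 -> y1 <= y2 ->
  (forall z, in_rect x1 x2 y1 y2 z -> Cmod (f z) <= M) ->
  Cmod (rect f x1 x2 y1 y2) <= 2 * M * ((x2 - x1) + (y2 - y1)).
Proof.
  intros H Hx Hy HM.
  assert (A : forall y, y1 <= y <= y2 -> Cmod (CInt (fun x => f (x, y)) x1 x2) <= (x2 - x1) * M).
  { intros y Hyy. rewrite <- (Rabs_pos_eq (x2 - x1)) by lra. apply CInt_bound.
    - apply (cont_rect_hor f x1 x2 y1 y2); [assumption|lra..].
    - rewrite Rmin_left, Rmax_right by assumption. intros t Ht. apply HM. split; simpl; lra. }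
  assert (B : forall x, x1 <= x <= x2 -> Cmod (CInt (fun y => f (x, y)) y1 y2) <= (y2 - y1) * M).
  { intros x Hxx. rewrite <- (Rabs_pos_eq (y2 - y1)) by lra. apply CInt_bound.
    - apply (cont_rect_ver f x1 x2 y1 y2); [assumption|lra..].
    - rewrite Rmin_left, Rmax_right by assumption. intros t Ht. apply HM. split; simpl; lra. }
  unfold rect. apply Rle_trans with (1 := Cmod_triangle _ _).
  rewrite Cmod_mult, Cmod_Ci, Rmult_1_l.
  eapply Rle_trans; [apply Rplus_le_compat; apply Cmod_triangle_minus|].
  generalize (A y1 ltac:(lra)) (A y2 ltac:(lra)) (B x1 ltac:(lra)) (B x2 ltac:(lra)). lra.
Qed.

Lemma rect_minus f g x1 x2 y1 y2 :
  cont_rect f x1 x2 y1 y2 -> cont_rect g x1 x2 y1 y2 -> x1 <= x2 -> y1 <= y2 ->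
  rect (fun z => f z - g z)%C x1 x2 y1 y2 = (rect f x1 x2 y1 y2 - rect g x1 x2 y1 y2)%C.
Proof.
  intros Hf Hg Hx Hy. unfold rect.
  rewrite 2!(CInt_minus (fun x => f (x, _)) (fun x => g (x, _)));
    try (apply (cont_rect_hor _ x1 x2 y1 y2); [assumption|lra..]).
  rewrite 2!(CInt_minus (fun x => f (_, x)) (fun x => g (_, x)));
    try (apply (cont_rect_ver _ x1 x2 y1 y2); [assumption|lra..]).
  ring.
Qed.

Lemma rect_primitive F f x1 x2 y1 y2 :
  (forall z, cder F z (f z)) -> (forall z, ccont f z) -> rect f x1 x2 y1 y2 = 0.
Proof.
  intros HF Hf.
  assert (A : forall y, CInt (fun x => f (x, y)) x1 x2 = (F (x2, y) - F (x1, y))%C).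
  { intros y. apply (CInt_derive (fun x => F (x, y))).
    - intros t _. replace (f (t, y)) with (f (t, y) * 1)%C by ring.
      apply (rder_comp F (fun x => (x, y))); [apply HF | apply rder_hor].
    - intros t _. apply rcont_hor, Hf. }
  assert (B : forall x, (Ci * CInt (fun y => f (x, y)) y1 y2 = F (x, y2) - F (x, y1))%C).
  { intros x. rewrite <- CInt_scal.
    - apply (CInt_derive (fun y => F (x, y))).
      + intros t _. rewrite Cmult_comm.
        apply (rder_comp F (fun y => (x, y))); [apply HF | apply rder_ver].
      + intros t _. apply rcont_scal, rcont_ver, Hf.
    - intros t _. apply rcont_ver, Hf. }
  unfold rect. rewrite !A.
  match goal with |- (_ + Ci * (?a - ?b))%C = _ => replace (Ci * (a - b))%C with (Ci * a - Ci * b)%C by ring end.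
  rewrite !B. ring.
Qed.

Lemma rect_affine (p q c : C) x1 x2 y1 y2 : rect (fun z => p + q * (z - c))%C x1 x2 y1 y2 = 0.
Proof.
  apply (rect_primitive (fun z => p * z + (q * / 2) * ((z - c) * (z - c)))%C).
  - intros z. eapply cder_eq; [cder_auto|].
    field; intros E; apply (RtoC_inj 2 0) in E; lra.
  - intros z. eapply cder_cont. cder_auto.
Qed.

(** * Bisection of rectangles *)

Lemma nested_intervals (a b : nat -> R) :
  (forall n, a n <= a (S n)) -> (forall n, b (S n) <= b n) -> (forall n, a n <= b n) ->
  exists c, forall n, a n <= c <= b n.
Proof.
  intros Ha Hb Hab.
  assert (Ma : forall n k, a n <= a (n + k)%nat).
  { induction k as [|k IH]; [rewrite Nat.add_0_r; lra|]. rewrite Nat.add_succ_r.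
    apply Rle_trans with (1 := IH), Ha. }
  assert (Mb : forall n k, b (n + k)%nat <= b n).
  { induction k as [|k IH]; [rewrite Nat.add_0_r; lra|]. rewrite Nat.add_succ_r.
    apply Rle_trans with (2 := IH), Hb. }
  assert (M : forall n m, a n <= b m).
  { intros n m. apply Rle_trans with (a (n + m)%nat); [apply Ma|].
    apply Rle_trans with (b (n + m)%nat); [apply Hab|]. rewrite Nat.add_comm. apply Mb. }
  destruct (completeness (fun x => exists n, x = a n)) as [c [Hc1 Hc2]].
  - exists (b O). intros x [n ->]. apply M.
  - exists (a O). exists O. reflexivity.
  - exists c. intros n. split.
    + apply Hc1. exists n; reflexivity.
    + apply Hc2. intros x [m ->]. apply M.
Qed.

Lemma pow_half_small (w d : R) : 0 <= w -> 0 < d -> exists n, w * (/ 2) ^ n < d.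
Proof.
  intros Hw Hd. destruct (pow_lt_1_zero (/ 2)) with (y := d / (w + 1)) as [N HN].
  - rewrite Rabs_pos_eq; lra.
  - apply Rdiv_lt_0_compat; lra.
  - exists N. specialize (HN N (le_n _)).
    assert (P : 0 < (/ 2) ^ N) by (apply pow_lt; lra).
    rewrite Rabs_pos_eq in HN by lra.
    apply Rle_lt_trans with ((w + 1) * (/ 2) ^ N); [nra|].
    apply Rlt_le_trans with ((w + 1) * (d / (w + 1))); [apply Rmult_lt_compat_l; lra|].
    right; field; lra.
Qed.

Record box := mkbox { bx1 : R; bx2 : R; by1 : R; by2 : R }.

(** Halving the sides divides the threshold by four, so at least one quarter inherits the
    inequality; at the limit point it contradicts differentiability. *)
Definition big_box (f : C -> C) (k : R) (q : box) : Prop :=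
  bx1 q <= bx2 q /\ by1 q <= by2 q /\ cont_rect f (bx1 q) (bx2 q) (by1 q) (by2 q) /\
  k * ((bx2 q - bx1 q) + (by2 q - by1 q)) ^ 2 < Cmod (rect f (bx1 q) (bx2 q) (by1 q) (by2 q)).

Lemma big_box_step f k q : big_box f k q ->
  exists q', big_box f k q' /\ bx1 q <= bx1 q' /\ bx2 q' <= bx2 q /\ by1 q <= by1 q' /\ by2 q' <= by2 q /\
    bx2 q' - bx1 q' = (bx2 q - bx1 q) / 2 /\ by2 q' - by1 q' = (by2 q - by1 q) / 2.
Proof.
  destruct q as [x1 x2 y1 y2]. unfold big_box; simpl. intros (Hx & Hy & Hc & HB).
  set (mx := (x1 + x2) / 2). set (my := (y1 + y2) / 2).
  assert (Hmx : x1 <= mx <= x2) by (unfold mx; lra). assert (Hmy : y1 <= my <= y2) by (unfold my; lra).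
  assert (Sub : forall a b c d, x1 <= a -> b <= x2 -> y1 <= c -> d <= y2 -> cont_rect f a b c d).
  { intros a b c d ? ? ? ? z [? ?]. apply Hc. split; lra. }
  assert (E : rect f x1 x2 y1 y2 = (rect f x1 mx y1 my + rect f x1 mx my y2 + (rect f mx x2 y1 my + rect f mx x2 my y2))%C).
  { rewrite (rect_split_x f x1 mx x2), (rect_split_y f x1 mx y1 my y2), (rect_split_y f mx x2 y1 my y2);
      try assumption; try lra; try reflexivity; apply Sub; lra. }
  set (w := (x2 - x1) + (y2 - y1)) in *.
  assert (T : Cmod (rect f x1 x2 y1 y2) <= Cmod (rect f x1 mx y1 my) + Cmod (rect f x1 mx my y2)
     + (Cmod (rect f mx x2 y1 my) + Cmod (rect f mx x2 my y2))).
  { rewrite E. eapply Rle_trans; [apply Cmod_triangle|]. apply Rplus_le_compat; apply Cmod_triangle. }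
  assert (G : forall a b c d, x1 <= a -> a <= b -> b <= x2 -> y1 <= c -> c <= d -> d <= y2 ->
     b - a = (x2 - x1) / 2 -> d - c = (y2 - y1) / 2 ->
     k * (w / 2) ^ 2 < Cmod (rect f a b c d) ->
     exists q', (bx1 q' <= bx2 q' /\ by1 q' <= by2 q' /\ cont_rect f (bx1 q') (bx2 q') (by1 q') (by2 q') /\
       k * (bx2 q' - bx1 q' + (by2 q' - by1 q')) ^ 2 < Cmod (rect f (bx1 q') (bx2 q') (by1 q') (by2 q'))) /\
       x1 <= bx1 q' /\ bx2 q' <= x2 /\ y1 <= by1 q' /\ by2 q' <= y2 /\
       bx2 q' - bx1 q' = (x2 - x1) / 2 /\ by2 q' - by1 q' = (y2 - y1) / 2).
  { intros a b c d ? ? ? ? ? ? E1 E2 HH. exists (mkbox a b c d); simpl. repeat split; try lra.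
    - apply Sub; lra.
    - rewrite E1, E2. replace ((x2 - x1) / 2 + (y2 - y1) / 2) with (w / 2) by (unfold w; field). exact HH. }
  destruct (Rlt_dec (k * (w / 2) ^ 2) (Cmod (rect f x1 mx y1 my))) as [A1|A1].
  { apply (G x1 mx y1 my); unfold mx, my in *; try lra. }
  destruct (Rlt_dec (k * (w / 2) ^ 2) (Cmod (rect f x1 mx my y2))) as [A2|A2].
  { apply (G x1 mx my y2); unfold mx, my in *; try lra. }
  destruct (Rlt_dec (k * (w / 2) ^ 2) (Cmod (rect f mx x2 y1 my))) as [A3|A3].
  { apply (G mx x2 y1 my); unfold mx, my in *; try lra. }
  destruct (Rlt_dec (k * (w / 2) ^ 2) (Cmod (rect f mx x2 my y2))) as [A4|A4].
  { apply (G mx x2 my y2); unfold mx, my in *; try lra. }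
  exfalso. replace (k * w ^ 2) with (4 * (k * (w / 2) ^ 2)) in HB by field. lra.
Qed.

Lemma goursat f x1 x2 y1 y2 :
  x1 <= x2 -> y1 <= y2 ->
  (forall z, in_rect x1 x2 y1 y2 z -> exists l, cder f z l) -> rect f x1 x2 y1 y2 = 0.
Proof.
  intros Hx Hy H.
  destruct (Ceq_dec (rect f x1 x2 y1 y2) 0) as [E|NE]; [exact E|exfalso].
  assert (HA : 0 < Cmod (rect f x1 x2 y1 y2)) by (apply Cmod_gt_0; exact NE).
  set (A := Cmod (rect f x1 x2 y1 y2)) in *.
  set (W := (x2 - x1) + (y2 - y1)).
  assert (HW : 0 <= W) by (unfold W; lra).
  (* Small enough for the initial rectangle to satisfy [big_box]; the [+ 1] covers the degenerate
     case [W = 0]. *)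
  set (k := A / (2 * (W ^ 2 + 1))).
  assert (Hk : 0 < k) by (apply Rdiv_lt_0_compat; nra).
  assert (B0 : big_box f k (mkbox x1 x2 y1 y2)).
  { unfold big_box; simpl. repeat split; try assumption.
    - intros z Hz. destruct (H z Hz) as [l Hl]. eapply cder_cont, Hl.
    - fold A. change (k * W ^ 2 < A). unfold k.
      replace (A / (2 * (W ^ 2 + 1)) * W ^ 2) with (A * (W ^ 2 / (2 * (W ^ 2 + 1)))) by (field; nra).
      rewrite <- (Rmult_1_r A) at 2. apply Rmult_lt_compat_l; [assumption|].
      apply Rmult_lt_reg_r with (2 * (W ^ 2 + 1)); [nra|].
      unfold Rdiv. rewrite Rmult_assoc, Rinv_l; nra. }
  (* Dependent choice turns the bisection step into a nested sequence. *)
  set (step := fun p : {q | big_box f k q} =>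
     let s := constructive_indefinite_description _ (big_box_step f k (proj1_sig p) (proj2_sig p)) in
     exist (big_box f k) (proj1_sig s) (proj1 (proj2_sig s))).
  set (Q := fun n => nat_rect (fun _ => {q | big_box f k q}) (exist _ _ B0) (fun _ p => step p) n).
  set (q := fun n => proj1_sig (Q n)).
  assert (Hq : forall n, big_box f k (q n)) by (intros n; exact (proj2_sig (Q n))).
  assert (Hs : forall n, bx1 (q n) <= bx1 (q (S n)) /\ bx2 (q (S n)) <= bx2 (q n) /\ by1 (q n) <= by1 (q (S n))
     /\ by2 (q (S n)) <= by2 (q n) /\ bx2 (q (S n)) - bx1 (q (S n)) = (bx2 (q n) - bx1 (q n)) / 2
     /\ by2 (q (S n)) - by1 (q (S n)) = (by2 (q n) - by1 (q n)) / 2).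
  { intros n. unfold q. simpl.
    exact (proj2 (proj2_sig (constructive_indefinite_description _ (big_box_step f k (proj1_sig (Q n)) (proj2_sig (Q n)))))). }
  destruct (nested_intervals (fun n => bx1 (q n)) (fun n => bx2 (q n))) as [cx Hcx].
  { intros; apply Hs. } { intros; apply Hs. } { intros; apply Hq. }
  destruct (nested_intervals (fun n => by1 (q n)) (fun n => by2 (q n))) as [cy Hcy].
  { intros; apply Hs. } { intros; apply Hs. } { intros; apply Hq. }
  assert (Hdim : forall n, (bx2 (q n) - bx1 (q n)) + (by2 (q n) - by1 (q n)) = W * (/ 2) ^ n).
  { induction n as [|n IH]; [unfold q, W; simpl; ring|].
    destruct (Hs n) as (_ & _ & _ & _ & E1 & E2). rewrite E1, E2. simpl. lra. }
  destruct (H (cx, cy)) as [l Hl].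
  { specialize (Hcx O); specialize (Hcy O). unfold q in *; simpl in *. split; simpl; lra. }
  destruct (Hl (k / 4) ltac:(lra)) as [d [Hd Hd2]].
  destruct (pow_half_small W d HW Hd) as [n Hn]. rewrite <- Hdim in Hn.
  destruct (Hq n) as (Hx' & Hy' & Hc' & HB').
  specialize (Hcx n). specialize (Hcy n). simpl in Hcx, Hcy.
  set (X1 := bx1 (q n)) in *. set (X2 := bx2 (q n)) in *. set (Y1 := by1 (q n)) in *. set (Y2 := by2 (q n)) in *.
  set (w := (X2 - X1) + (Y2 - Y1)) in *.
  assert (Ca : cont_rect (fun z => f (cx, cy) + l * (z - (cx, cy)))%C X1 X2 Y1 Y2).
  { intros z _. eapply cder_cont. cder_auto. }
  assert (Cf : cont_rect (fun z => f z - (f (cx, cy) + l * (z - (cx, cy))))%C X1 X2 Y1 Y2).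
  { intros z Hz eps Heps.
    destruct (Hc' z Hz (eps / 2) ltac:(lra)) as [d1 [Hd1 K1]].
    destruct (Ca z Hz (eps / 2) ltac:(lra)) as [d2 [Hd2' K2]].
    exists (Rmin d1 d2). split; [apply Rmin_case; assumption|]. intros u Hu.
    specialize (K1 u (Rlt_le_trans _ _ _ Hu (Rmin_l _ _))). specialize (K2 u (Rlt_le_trans _ _ _ Hu (Rmin_r _ _))).
    match goal with |- Cmod (?a - ?b - (?c - ?e)) < _ => replace (a - b - (c - e))%C with ((a - c) - (b - e))%C by ring end.
    eapply Rle_lt_trans; [apply Cmod_triangle_minus|]. lra. }
  (* Affine functions integrate to zero, so only the remainder counts. It is at most [k / 4 * w] on
     a boundary of length [2 * w], which yields half of what [big_box] asserts. *)
  assert (BB := rect_bound _ X1 X2 Y1 Y2 (k / 4 * w) Cf Hx' Hy').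
  assert (Hb : Cmod (rect f X1 X2 Y1 Y2) <= 2 * (k / 4 * w) * w).
  { rewrite (rect_minus f (fun z => f (cx, cy) + l * (z - (cx, cy)))%C) in BB by assumption.
    rewrite rect_affine in BB. unfold Cminus in BB. rewrite Copp_0, Cplus_0_r in BB. apply BB.
    intros z [Hz1 Hz2].
    assert (Hzc : Cmod (z - (cx, cy)) <= w).
    { apply Rle_trans with (1 := Cmod_le_re_im _). unfold Re, Im; simpl. unfold w.
      apply Rplus_le_compat; apply Rabs_le; lra. }
    match goal with |- Cmod ?u <= _ => replace u with (f z - f (cx, cy) - l * (z - (cx, cy)))%C by ring end.
    apply Rle_trans with (1 := Hd2 z ltac:(lra)). apply Rmult_le_compat_l; lra. }
  assert (HB2 : k * w ^ 2 < Cmod (rect f X1 X2 Y1 Y2)) by exact HB'.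
  assert (0 <= k * w ^ 2) by (apply Rmult_le_pos; [lra | apply pow2_ge_0]).
  replace (2 * (k / 4 * w) * w) with (k * w ^ 2 / 2) in Hb by field. lra.
Qed.

Lemma rect_degenerate_x f x y1 y2 : rect f x x y1 y2 = 0.
Proof. unfold rect. rewrite !CInt_point. ring. Qed.

Lemma rect_degenerate_y f x1 x2 y : rect f x1 x2 y y = 0.
Proof. unfold rect. rewrite !CInt_point. ring. Qed.

(** The exceptional point is enclosed in a rectangle of sides at most [2 * e], where continuity
    alone makes the integral small. The difference quotient behind Cauchy's formula is such a
    function. *)
Lemma goursat_punctured f z0 x1 x2 y1 y2 :
  x1 <= x2 -> y1 <= y2 -> cont_rect f x1 x2 y1 y2 ->
  (forall z, in_rect x1 x2 y1 y2 z -> z <> z0 -> exists l, cder f z l) -> rect f x1 x2 y1 y2 = 0.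
Proof.
  intros Hx Hy Hc H.
  destruct (Ceq_dec (rect f x1 x2 y1 y2) 0) as [E|NE]; [exact E|exfalso].
  assert (HA : 0 < Cmod (rect f x1 x2 y1 y2)) by (apply Cmod_gt_0; exact NE).
  destruct (excluded_middle_informative (in_rect x1 x2 y1 y2 z0)) as [Hz0|Hz0].
  2: { apply NE. apply goursat; try assumption. intros z Hz. apply H; [assumption|]. intros ->. contradiction. }
  destruct (Hc z0 Hz0 1 Rlt_0_1) as [d [Hd Hd2]].
  set (M := Cmod (f z0) + 1). assert (HM : 0 < M) by (unfold M; generalize (Cmod_ge_0 (f z0)); lra).
  set (A := Cmod (rect f x1 x2 y1 y2)) in *.
  (* With sides at most [2 * e] the integral is at most [2 * M * (4 * e)], hence at most [A / 2]. *)
  set (e := Rmin (d / 4) (A / (16 * M))).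
  assert (He : 0 < e). { apply Rmin_case; [lra|]. apply Rdiv_lt_0_compat; lra. }
  assert (He1 : e <= d / 4) by apply Rmin_l.
  assert (He2 : e * (16 * M) <= A).
  { apply Rle_trans with (A / (16 * M) * (16 * M)); [apply Rmult_le_compat_r; [lra|apply Rmin_r]|].
    right; field; lra. }
  destruct z0 as [p q]. destruct Hz0 as [Hp Hq]; simpl in Hp, Hq.
  (* The small rectangle is clipped, as the point may lie on or near the boundary. *)
  set (u := Rmax x1 (p - e)). set (v := Rmin x2 (p + e)). set (s := Rmax y1 (q - e)). set (t := Rmin y2 (q + e)).
  assert (Hu : x1 <= u <= p /\ p - e <= u). { unfold u. split; [split; [apply Rmax_l | apply Rmax_lub; lra] | apply Rmax_r]. }
  assert (Hv : p <= v <= x2 /\ v <= p + e). { unfold v. split; [split; [apply Rmin_glb; lra | apply Rmin_l] | apply Rmin_r]. }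
  assert (Hs : y1 <= s <= q /\ q - e <= s). { unfold s. split; [split; [apply Rmax_l | apply Rmax_lub; lra] | apply Rmax_r]. }
  assert (Ht : q <= t <= y2 /\ t <= q + e). { unfold t. split; [split; [apply Rmin_glb; lra | apply Rmin_l] | apply Rmin_r]. }
  assert (Sub : forall a b c d, x1 <= a -> b <= x2 -> y1 <= c -> d <= y2 -> cont_rect f a b c d).
  { intros a b c d' ? ? ? ? z [? ?]. apply Hc. split; lra. }
  assert (Z : forall a b c d, x1 <= a -> a <= b -> b <= x2 -> y1 <= c -> c <= d -> d <= y2 ->
     ~ in_rect a b c d (p, q) -> rect f a b c d = 0).
  { intros a b c d' ? ? ? ? ? ? Hn. apply goursat; try assumption. intros z Hz. apply H.
    - destruct Hz; split; lra.
    - intros ->. contradiction. }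
  assert (R1 : rect f x1 u y1 y2 = 0).
  { destruct (Req_dec u x1) as [->|Hne]; [apply rect_degenerate_x|]. apply Z; try lra.
    intros [K _]; simpl in K. revert Hne K. unfold u, Rmax. destruct Rle_dec; intros Hne K; (lra || (apply Hne; reflexivity)). }
  assert (R2 : rect f v x2 y1 y2 = 0).
  { destruct (Req_dec v x2) as [->|Hne]; [apply rect_degenerate_x|]. apply Z; try lra.
    intros [K _]; simpl in K. revert Hne K. unfold v, Rmin. destruct Rle_dec; intros Hne K; (lra || (apply Hne; reflexivity)). }
  assert (R3 : rect f u v y1 s = 0).
  { destruct (Req_dec s y1) as [->|Hne]; [apply rect_degenerate_y|]. apply Z; try lra.
    intros [_ K]; simpl in K. revert Hne K. unfold s, Rmax. destruct Rle_dec; intros Hne K; (lra || (apply Hne; reflexivity)). }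
  assert (R4 : rect f u v t y2 = 0).
  { destruct (Req_dec t y2) as [->|Hne]; [apply rect_degenerate_y|]. apply Z; try lra.
    intros [_ K]; simpl in K. revert Hne K. unfold t, Rmin. destruct Rle_dec; intros Hne K; (lra || (apply Hne; reflexivity)). }
  assert (E : rect f x1 x2 y1 y2 = rect f u v s t).
  { rewrite (rect_split_x f x1 u x2) by (try assumption; lra). rewrite R1, Cplus_0_l.
    rewrite (rect_split_x f u v x2) by (try (apply Sub); lra). rewrite R2, Cplus_0_r.
    rewrite (rect_split_y f u v y1 s y2) by (try (apply Sub); lra). rewrite R3, Cplus_0_l.
    rewrite (rect_split_y f u v s t y2) by (try (apply Sub); lra). rewrite R4, Cplus_0_r. reflexivity. }
  assert (B : A <= 2 * M * ((v - u) + (t - s))).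
  { unfold A. rewrite E. apply rect_bound; try lra. { apply Sub; lra. }
    intros z [Hz1 Hz2].
    assert (Hzd : Cmod (z - (p, q)) < d).
    { apply Rle_lt_trans with (1 := Cmod_le_re_im _). unfold Re, Im; simpl.
      apply Rle_lt_trans with (e + e); [|lra]. apply Rplus_le_compat; apply Rabs_le; lra. }
    specialize (Hd2 z Hzd). generalize (Cmod_triangle_rev (f z) (f (p, q))). unfold M; lra. }
  nra.
Qed.

Lemma rect_swap_x f x1 x2 y1 y2 :
  rcont_on (fun x => f (x, y1)) x1 x2 -> rcont_on (fun x => f (x, y2)) x1 x2 ->
  rect f x2 x1 y1 y2 = (- rect f x1 x2 y1 y2)%C.
Proof. intros H1 H2. unfold rect. rewrite (CInt_swap _ _ _ H1), (CInt_swap _ _ _ H2). ring. Qed.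

Lemma rect_swap_y f x1 x2 y1 y2 :
  rcont_on (fun y => f (x1, y)) y1 y2 -> rcont_on (fun y => f (x2, y)) y1 y2 ->
  rect f x1 x2 y2 y1 = (- rect f x1 x2 y1 y2)%C.
Proof. intros H1 H2. unfold rect. rewrite (CInt_swap _ _ _ H1), (CInt_swap _ _ _ H2). ring. Qed.

(** A primitive compares points in arbitrary relative position, so rectangles of all four
    orientations occur. *)
Lemma goursat_oriented f z0 x1 x2 y1 y2 :
  let r := in_rect (Rmin x1 x2) (Rmax x1 x2) (Rmin y1 y2) (Rmax y1 y2) in
  (forall z, r z -> ccont f z) ->
  (forall z, r z -> z <> z0 -> exists l, cder f z l) -> rect f x1 x2 y1 y2 = 0.
Proof.
  intros r Hc H. unfold r in *. clear r.
  assert (HH : forall y, Rmin y1 y2 <= y <= Rmax y1 y2 -> rcont_on (fun x => f (x, y)) x1 x2).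
  { intros y Hy t Ht. apply rcont_hor, Hc. split; assumption. }
  assert (HV : forall x, Rmin x1 x2 <= x <= Rmax x1 x2 -> rcont_on (fun y => f (x, y)) y1 y2).
  { intros x Hx t Ht. apply rcont_ver, Hc. split; assumption. }
  assert (X1 := conj (Rmin_l x1 x2) (Rmax_l x1 x2)). assert (X2 := conj (Rmin_r x1 x2) (Rmax_r x1 x2)).
  assert (Y1 := conj (Rmin_l y1 y2) (Rmax_l y1 y2)). assert (Y2 := conj (Rmin_r y1 y2) (Rmax_r y1 y2)).
  assert (ON : forall z : C, (- z)%C = 0 -> z = 0).
  { intros z E. replace z with (- - z)%C by ring. rewrite E. ring. }
  assert (G := goursat_punctured f z0 _ _ _ _ (Rminmax x1 x2) (Rminmax y1 y2) Hc H).
  destruct (Rle_dec x1 x2) as [Hx|Hx]; destruct (Rle_dec y1 y2) as [Hy|Hy].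
  - rewrite (Rmin_left x1), (Rmax_right x1), (Rmin_left y1), (Rmax_right y1) in G by lra. exact G.
  - rewrite (Rmin_left x1), (Rmax_right x1), (Rmin_right y1), (Rmax_left y1) in G by lra.
    rewrite rect_swap_y in G by (apply HV; lra).
    apply ON, G.
  - rewrite (Rmin_right x1), (Rmax_left x1), (Rmin_left y1), (Rmax_right y1) in G by lra.
    rewrite rect_swap_x in G by (apply HH; lra).
    apply ON, G.
  - rewrite (Rmin_right x1), (Rmax_left x1), (Rmin_right y1), (Rmax_left y1) in G by lra.
    rewrite rect_swap_y in G by (apply HV; lra).
    rewrite rect_swap_x in G by (apply HH; lra).
    apply ON, ON, G.
Qed.

(** The primitive integrates from the centre, horizontally and then vertically, along a path that
    stays in the disc. Its increment splits into two short integrals near [z] once Goursat's lemma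
    has moved the horizontal one. *)
Lemma primitive_disc (f : C -> C) (a z0 : C) (r : R) :
  (forall z, Cmod (z - a) < r -> ccont f z) ->
  (forall z, Cmod (z - a) < r -> z <> z0 -> exists l, cder f z l) ->
  exists F, forall z, Cmod (z - a) < r -> cder F z (f z).
Proof.
  destruct a as [ax ay]. intros Hc H.
  exists (fun z => CInt (fun x => f (x, ay)) ax (fst z) + Ci * CInt (fun y => f (fst z, y)) ay (snd z))%C.
  intros [zx zy] Hz eps Heps.
  destruct (Hc (zx, zy) Hz (eps / 2) ltac:(lra)) as [d [Hd Hd2]].
  set (m := r - Cmod ((zx, zy) - (ax, ay))). assert (Hm : 0 < m) by (unfold m; lra).
  exists (Rmin (d / 2) (m / 2)). split; [apply Rmin_case; lra|].
  intros [wx wy] Hw.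
  assert (Hw1 := Rlt_le_trans _ _ _ Hw (Rmin_l _ _)). assert (Hw2 := Rlt_le_trans _ _ _ Hw (Rmin_r _ _)).
  set (h := Cmod ((wx, wy) - (zx, zy))) in *.
  assert (Hhx : Rabs (wx - zx) <= h) by (generalize (re_le_Cmod ((wx, wy) - (zx, zy))); unfold Re; simpl; auto).
  assert (Hhy : Rabs (wy - zy) <= h) by (generalize (im_le_Cmod ((wx, wy) - (zx, zy))); unfold Im; simpl; auto).
  (* Every point that occurs is dominated, coordinate by coordinate, by a sum of two vectors of
     total length below [r]. *)
  assert (In : forall x y, Rabs (x - ax) <= Rabs (zx - ax) + Rabs (wx - zx) -> Rabs (y - ay) <= Rabs (zy - ay) + Rabs (wy - zy)
     -> Cmod ((x, y) - (ax, ay)) < r).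
  { intros x y Hx Hy.
    set (x' := Rabs (zx - ax)) in *. set (y' := Rabs (zy - ay)) in *.
    apply Rle_lt_trans with (Cmod ((x', y') + (Rabs (wx - zx), Rabs (wy - zy)))).
    - apply Cmod_le_coord; simpl; (eapply Rle_trans; [|apply Rle_abs]); assumption.
    - apply Rle_lt_trans with (1 := Cmod_triangle _ _).
      assert (Cmod (x', y') <= Cmod ((zx, zy) - (ax, ay))).
      { apply Cmod_le_coord; simpl; unfold x', y'; rewrite Rabs_Rabsolu; apply Rle_refl. }
      assert (Cmod (Rabs (wx - zx), Rabs (wy - zy)) <= h).
      { apply Cmod_le_coord; simpl; rewrite Rabs_Rabsolu; apply Rle_refl. }
      unfold m in *. lra. }
  assert (Bet : forall c e t, Rmin c e <= t <= Rmax c e -> forall b, Rabs (t - b) <= Rabs (c - b) + Rabs (e - c)).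
  { intros c e t Ht b. unfold Rmin, Rmax in Ht. destruct (Rle_dec c e); unfold Rabs; repeat destruct Rcase_abs; lra. }
  assert (Bet2 : forall c e t, Rmin c e <= t <= Rmax c e -> Rabs (t - c) <= Rabs (e - c)).
  { intros c e t Ht. unfold Rmin, Rmax in Ht. destruct (Rle_dec c e); unfold Rabs; repeat destruct Rcase_abs; lra. }
  assert (P1 := Rabs_pos (wx - zx)). assert (P2 := Rabs_pos (wy - zy)).
  assert (P3 := Rabs_pos (zx - ax)). assert (P4 := Rabs_pos (zy - ay)).
  assert (TX : Rabs (wx - ax) <= Rabs (zx - ax) + Rabs (wx - zx)) by (apply Bet; unfold Rmin, Rmax; destruct Rle_dec; lra).
  assert (TY : Rabs (wy - ay) <= Rabs (zy - ay) + Rabs (wy - zy)) by (apply Bet; unfold Rmin, Rmax; destruct Rle_dec; lra).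
  assert (ZZ : forall x : R, Rabs (x - x) = 0) by (intros; rewrite Rminus_diag; apply Rabs_R0).
  assert (C1 : rcont_on (fun x => f (x, ay)) ax zx).
  { intros t Ht. apply rcont_hor, Hc, In; [|rewrite ZZ; lra]. generalize (Bet2 _ _ _ Ht); lra. }
  assert (C2 : rcont_on (fun x => f (x, ay)) zx wx).
  { intros t Ht. apply rcont_hor, Hc, In; [|rewrite ZZ; lra]. apply Bet; assumption. }
  assert (C3 : rcont_on (fun y => f (wx, y)) ay zy).
  { intros t Ht. apply rcont_ver, Hc, In; [exact TX|]. generalize (Bet2 _ _ _ Ht); lra. }
  assert (C4 : rcont_on (fun y => f (wx, y)) zy wy).
  { intros t Ht. apply rcont_ver, Hc, In; [exact TX|]. apply Bet; assumption. }
  assert (C5 : rcont_on (fun x => f (x, zy)) zx wx).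
  { intros t Ht. apply rcont_hor, Hc, In; [apply Bet; assumption|lra]. }
  (* This moves the horizontal increment from height [ay] to height [zy], next to the point of
     differentiation. *)
  assert (GR : rect f zx wx ay zy = 0).
  { assert (K : forall z, in_rect (Rmin zx wx) (Rmax zx wx) (Rmin ay zy) (Rmax ay zy) z -> Cmod (z - (ax, ay)) < r).
    { intros [x y] [Hx Hy]; simpl in Hx, Hy. apply In; [apply Bet; assumption|]. generalize (Bet2 _ _ _ Hy); lra. }
    apply (goursat_oriented f z0); intros; [apply Hc, K | apply H; [apply K|]]; assumption. }
  simpl fst; simpl snd.
  rewrite (CInt_Chasles _ ax zx wx C1 C2), (CInt_Chasles _ ay zy wy C3 C4).
  unfold rect in GR.
  set (I1 := CInt (fun x => f (x, ay)) zx wx) in *.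
  set (I2 := CInt (fun y => f (wx, y)) ay zy) in *.
  set (I3 := CInt (fun y => f (zx, y)) ay zy) in *.
  assert (D1 : (CInt (fun x => f (x, zy) - f (zx, zy)) zx wx = CInt (fun x => f (x, zy)) zx wx - RtoC (wx - zx) * f (zx, zy))%C).
  { rewrite (CInt_minus _ (fun _ => f (zx, zy))), CInt_const; [reflexivity | exact C5 | intros t _; apply rcont_const]. }
  assert (D2 : (CInt (fun y => f (wx, y) - f (zx, zy)) zy wy = CInt (fun y => f (wx, y)) zy wy - RtoC (wy - zy) * f (zx, zy))%C).
  { rewrite (CInt_minus _ (fun _ => f (zx, zy))), CInt_const; [reflexivity | exact C4 | intros t _; apply rcont_const]. }
  set (J1 := CInt (fun x => f (x, zy)) zx wx) in *. set (J2 := CInt (fun y => f (wx, y)) zy wy) in *.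
  set (L := CInt (fun x => f (x, ay)) ax zx).
  assert (EQ : (L + I1 + Ci * (I2 + J2) - (L + Ci * I3) - f (zx, zy) * ((wx, wy) - (zx, zy)) =
     CInt (fun x => f (x, zy) - f (zx, zy)) zx wx + Ci * CInt (fun y => f (wx, y) - f (zx, zy)) zy wy)%C).
  { rewrite D1, D2.
    replace ((wx, wy) - (zx, zy))%C with (RtoC (wx - zx) + Ci * RtoC (wy - zy))%C
      by (apply injective_projections; simpl; ring).
    assert (EI : (I1 = J1 - Ci * (I2 - I3))%C).
    { replace I1 with ((I1 - J1 + Ci * (I2 - I3)) + (J1 - Ci * (I2 - I3)))%C by ring. rewrite GR. ring. }
    rewrite EI. ring. }
  rewrite EQ. eapply Rle_trans; [apply Cmod_triangle|]. rewrite Cmod_mult, Cmod_Ci, Rmult_1_l.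
  replace (eps * h) with (h * (eps / 2) + h * (eps / 2)) by field.
  assert (Near : forall x y, Rabs (x - zx) <= Rabs (wx - zx) -> Rabs (y - zy) <= Rabs (wy - zy) ->
     Cmod (f (x, y) - f (zx, zy)) <= eps / 2).
  { intros x y Hx Hy. left. apply Hd2. apply Rle_lt_trans with h; [|lra].
    apply Cmod_le_coord; simpl; fold (Rminus x zx) (Rminus y zy) (Rminus wx zx) (Rminus wy zy); assumption. }
  apply Rplus_le_compat.
  - apply Rle_trans with (Rabs (wx - zx) * (eps / 2)); [|apply Rmult_le_compat_r; lra].
    apply CInt_bound.
    + intros t Ht. apply rcont_minus; [apply C5, Ht | apply rcont_const].
    + intros t Ht. apply Near; [apply Bet2, Ht|]. rewrite ZZ; assumption.
  - apply Rle_trans with (Rabs (wy - zy) * (eps / 2)); [|apply Rmult_le_compat_r; lra].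
    apply CInt_bound.
    + intros t Ht. apply rcont_minus; [apply C4, Ht | apply rcont_const].
    + intros t Ht. apply Near; [lra | apply Bet2, Ht].
Qed.

(** * Cauchy's formula and Taylor series *)

Definition holo_on (U : C -> Prop) (f : C -> C) : Prop := forall z, U z -> exists l, cder f z l.

Definition cdisc (a : C) (r : R) (z : C) : Prop := Cmod (z - a) < r.

Lemma RtoC_neq_0 (x : R) : x <> 0 -> RtoC x <> 0.
Proof. intros H E. apply H. apply RtoC_inj. exact E. Qed.

Lemma Cexp_mult_nat (n : nat) (z : C) : Cexp (RtoC (INR n) * z) = (Cexp z ^ n)%C.
Proof.
  induction n as [|n IH].
  - simpl. rewrite Cmult_0_l. apply Cexp_0.
  - rewrite S_INR, RtoC_plus, Cmult_plus_distr_r, Cexp_add, IH, Cmult_1_l. simpl. ring.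
Qed.

Lemma csum_geom (q : C) (n : nat) : (csum (fun k => q ^ k) n * (1 - q) = 1 - q ^ n)%C.
Proof.
  induction n as [|n IH]; [simpl; ring|]. simpl.
  replace ((csum (fun k => q ^ k) n + q ^ n) * (1 - q))%C
    with (csum (fun k => q ^ k) n * (1 - q) + q ^ n * (1 - q))%C by ring.
  rewrite IH. ring.
Qed.

Lemma rcont_pow (f : R -> C) (n : nat) t : rcont f t -> rcont (fun u => f u ^ n)%C t.
Proof.
  intros H. induction n as [|n IH]; simpl; [apply rcont_const|]. apply rcont_mult; assumption.
Qed.

Lemma CInt_csum (u : nat -> R -> C) (n : nat) (a b : R) :
  (forall k, rcont_on (u k) a b) ->
  CInt (fun t => csum (fun k => u k t) n) a b = csum (fun k => CInt (u k) a b) n.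
Proof.
  intros H. induction n as [|n IH]; simpl.
  - rewrite CInt_const. ring.
  - rewrite CInt_plus, IH; [reflexivity | | apply H].
    clear IH. induction n as [|n IH]; simpl; intros t Ht; [apply rcont_const|].
    apply rcont_plus; [apply IH, Ht | apply H, Ht].
Qed.

(** The remainder of the geometric series is [q ^ n / (1 - q)], uniformly small since
    [Cmod q <= r < 1]. It is applied to the boundary values of a function and to the constant 1. *)
Lemma cseries_CInt_geom (h q : R -> C) (b M r : R) :
  0 <= b -> 0 <= r < 1 -> (forall t, rcont h t) -> (forall t, rcont q t) ->
  (forall t, 0 <= t <= b -> Cmod (h t) <= M) -> (forall t, Cmod (q t) <= r) ->
  cseries (fun n => CInt (fun t => h t * q t ^ n)%C 0 b) (CInt (fun t => h t * / (1 - q t))%C 0 b).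
Proof.
  intros Hb Hr Hh Hq HM Hqr eps Heps.
  assert (PM : 0 <= M) by (apply Rle_trans with (2 := HM 0 (conj (Rle_refl 0) Hb)); apply Cmod_ge_0).
  assert (D : forall t, 1 - r <= Cmod (1 - q t)).
  { intros t. generalize (Cmod_triangle_rev 1 (q t)) (Hqr t). rewrite Cmod_1. lra. }
  assert (N0 : forall t, (1 - q t <> 0)%C) by (intros t; apply Cmod_gt_0; generalize (D t); lra).
  assert (Ci1 : forall t, rcont (fun u => / (1 - q u))%C t).
  { intros t. apply (rcont_comp Cinv (fun u => 1 - q u)%C).
    - eapply cder_cont, cder_inv_id, N0.
    - apply rcont_minus; [apply rcont_const | apply Hq]. }
  set (K := b * (M * / (1 - r))).
  assert (PK : 0 <= K). { unfold K. assert (0 < / (1 - r)) by (apply Rinv_0_lt_compat; lra). repeat apply Rmult_le_pos; lra. }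
  destruct (pow_lt_1_zero r) with (y := eps / (K + 1)) as [N HN].
  { rewrite Rabs_pos_eq; lra. } { apply Rdiv_lt_0_compat; lra. }
  exists N. intros n Hn. specialize (HN n Hn).
  rewrite <- CInt_csum by (intros k t _; apply rcont_mult; [apply Hh | apply rcont_pow, Hq]).
  rewrite <- CInt_minus.
  2: { intros t _. clear - Hh Hq. induction n as [|n IH]; simpl; [apply rcont_const|].
       apply rcont_plus; [apply IH|]. apply rcont_mult; [apply Hh | apply rcont_pow, Hq]. }
  2: { intros t _. apply rcont_mult; [apply Hh | apply Ci1]. }
  rewrite (CInt_ext_all _ (fun t => - (1) * (h t * q t ^ n * / (1 - q t)))%C).
  2: { intros t. rewrite csum_scal.
       match goal with |- (_ * ?s - _ = _)%C =>
         assert (E : (s * (1 - q t) = 1 - q t ^ n)%C) by exact (csum_geom (q t) n);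
         replace s with (s * (1 - q t) * / (1 - q t))%C by (field; apply N0) end.
       rewrite E. field. apply N0. }
  assert (Cc : forall t, rcont (fun t => h t * q t ^ n * / (1 - q t))%C t).
  { intros t. apply rcont_mult; [apply rcont_mult; [apply Hh | apply rcont_pow, Hq] | apply Ci1]. }
  rewrite CInt_scal by (intros t _; apply Cc). rewrite Cmod_mult, Cmod_opp, Cmod_1, Rmult_1_l.
  assert (Pr : 0 <= r ^ n) by (apply pow_le; lra).
  apply Rle_lt_trans with (Rabs (b - 0) * (M * r ^ n * / (1 - r))).
  - apply CInt_bound; [intros t _; apply Cc|]. intros t. rewrite Rmin_left, Rmax_right by assumption. intros Ht.
    rewrite !Cmod_mult, Cmod_inv, Cmod_pow by apply N0.
    apply Rmult_le_compat.
    + apply Rmult_le_pos; [apply Cmod_ge_0 | apply pow_le, Cmod_ge_0].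
    + left; apply Rinv_0_lt_compat. generalize (D t); lra.
    + apply Rmult_le_compat; [apply Cmod_ge_0 | apply pow_le, Cmod_ge_0 | apply HM, Ht |].
      apply pow_incr. split; [apply Cmod_ge_0 | apply Hqr].
    + apply Rinv_le_contravar; [lra|apply D].
  - rewrite Rminus_0_r, Rabs_pos_eq by assumption.
    replace (b * (M * r ^ n * / (1 - r))) with (K * r ^ n) by (unfold K; ring).
    rewrite Rabs_pos_eq in HN by assumption.
    apply Rle_lt_trans with ((K + 1) * r ^ n); [nra|].
    apply Rlt_le_trans with ((K + 1) * (eps / (K + 1))); [apply Rmult_lt_compat_l; lra|].
    right; field; lra.
Qed.

Lemma CInt_Cexp_period (n : nat) : (0 < n)%nat -> CInt (fun t => Cexp (RtoC t * - Ci) ^ n)%C 0 (2 * PI) = 0.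
Proof.
  intros Hn. set (h := (- Ci * RtoC (INR n))%C).
  assert (Hh : h <> 0).
  { unfold h. apply Cmult_neq_0.
    - intros E. apply (f_equal Cmod) in E. rewrite Cmod_opp, Cmod_Ci, Cmod_0 in E. lra.
    - apply RtoC_neq_0, not_0_INR. lia. }
  assert (E0 : CInt (fun t => h * Cexp (RtoC t * h))%C 0 (2 * PI) = 0).
  { rewrite (CInt_derive (fun t => Cexp (RtoC t * h))).
    - rewrite Cmult_0_l, Cexp_0.
      replace (Cexp (RtoC (2 * PI) * h)) with (RtoC 1); [ring|].
      unfold Cexp, h, Re, Im. simpl.
      replace (2 * PI * (- (0) * INR n - - (1) * 0) - 0 * (- (0) * 0 + - (1) * INR n)) with 0 by ring.
      replace (2 * PI * (- (0) * 0 + - (1) * INR n) + 0 * (- (0) * INR n - - (1) * 0)) with (- (0 + 2 * INR n * PI)) by ring.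
      rewrite cos_neg, sin_neg, cos_period, sin_period, cos_0, sin_0, exp_0.
      apply injective_projections; simpl; ring.
    - intros; apply rder_Cexp_lin.
    - intros t _. apply rcont_scal, rcont_Cexp_lin. }
  rewrite CInt_scal in E0 by (intros t _; apply rcont_Cexp_lin).
  rewrite (CInt_ext_all _ (fun t => Cexp (RtoC t * h))).
  - replace (CInt (fun t => Cexp (RtoC t * h)) 0 (2 * PI)) with (/ h * (h * CInt (fun t => Cexp (RtoC t * h)) 0 (2 * PI)))%C
      by (field; exact Hh).
    rewrite E0. ring.
  - intros t. rewrite <- Cexp_mult_nat. f_equal. unfold h. ring.
Qed.

(** On the circle [1 / (1 - q t)] is the normalized Cauchy kernel, so its geometric expansion
    becomes the Taylor series. The coefficients are integrals over the circle and inherit their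
    bound from there. *)
Lemma taylor (f : C -> C) (a : C) (r rho M : R) :
  0 < rho < r -> holo_on (cdisc a r) f -> 
  (forall t, 0 <= t <= 2 * PI -> Cmod (f (a + RtoC rho * Cexp (RtoC t * Ci))%C) <= M) ->
  exists c : nat -> C, (forall n, Cmod (c n) <= M / rho ^ n) /\
    forall z, Cmod (z - a) < rho -> cseries (fun n => c n * (z - a) ^ n)%C (f z).
Proof.
  intros Hrho Hf HM.
  set (e := fun t => Cexp (RtoC t * - Ci)).
  set (e' := fun t => Cexp (RtoC t * Ci)).
  set (g := fun t => (a + RtoC rho * e' t)%C).
  assert (Me : forall t, Cmod (e t) = 1).
  { intros t. unfold e. rewrite Cmod_Cexp. unfold Re; simpl.
    replace (t * - 0 - 0 * - (1)) with 0 by ring. apply exp_0. }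
  assert (Me' : forall t, Cmod (e' t) = 1).
  { intros t. unfold e'. rewrite Cmod_Cexp. unfold Re; simpl.
    replace (t * 0 - 0 * 1) with 0 by ring. apply exp_0. }
  assert (ee : forall t, (e t * e' t = 1)%C).
  { intros t. unfold e, e'. rewrite <- Cexp_add. replace (RtoC t * - Ci + RtoC t * Ci)%C with (RtoC 0) by ring. apply Cexp_0. }
  assert (Ce : forall t, rcont e t) by (intros; apply rcont_Cexp_lin).
  assert (Mg : forall t, Cmod (g t - a) = rho).
  { intros t. unfold g. replace (a + RtoC rho * e' t - a)%C with (RtoC rho * e' t)%C by ring.
    rewrite Cmod_mult, Cmod_R, Me', Rabs_pos_eq by lra. ring. }
  assert (Hgf : forall t, cdisc a r (g t)) by (intros t; unfold cdisc; rewrite Mg; lra).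
  assert (Dg : forall t, rder g t (RtoC rho * (Ci * e' t))%C).
  { intros t. unfold g, e'.
    apply (rder_comp (fun w => a + RtoC rho * w)%C (fun t => Cexp (RtoC t * Ci))); [|apply rder_Cexp_lin].
    eapply cder_eq; [cder_auto|ring]. }
  assert (Cg : forall t, rcont g t) by (intros t; eapply rder_cont, Dg).
  assert (Cf : forall z, cdisc a r z -> ccont f z) by (intros z Hz; destruct (Hf z Hz) as [l Hl]; eapply cder_cont, Hl).
  assert (Cfg : forall t, rcont (fun u => f (g u)) t) by (intros t; apply rcont_comp; [apply Cf, Hgf | apply Cg]).
  assert (Hpi := PI_RGT_0).
  exists (fun n => / RtoC (2 * PI) * (/ RtoC rho ^ n * CInt (fun t => f (g t) * e t ^ n) 0 (2 * PI)))%C.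
  assert (Pr : RtoC rho <> 0) by (apply RtoC_neq_0; lra).
  assert (P2 : RtoC (2 * PI) <> 0) by (apply RtoC_neq_0; lra).
  split.
  - intros n. rewrite !Cmod_mult, !Cmod_inv, Cmod_pow, !Cmod_R by (try apply Cpow_nz; assumption).
    rewrite (Rabs_pos_eq rho), (Rabs_pos_eq (2 * PI)) by lra.
    assert (B : Cmod (CInt (fun t => f (g t) * e t ^ n)%C 0 (2 * PI)) <= 2 * PI * M).
    { rewrite <- (Rabs_pos_eq (2 * PI)) at 2 by lra. rewrite <- (Rminus_0_r (2 * PI)) at 2. apply CInt_bound.
      - intros t _. apply rcont_mult; [apply Cfg | apply rcont_pow, Ce].
      - intros t. rewrite Rmin_left, Rmax_right by lra. intros Ht.
        rewrite Cmod_mult, Cmod_pow, Me, pow1, Rmult_1_r. apply HM, Ht. }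
    assert (Pp : 0 < rho ^ n) by (apply pow_lt; lra).
    apply Rle_trans with (/ (2 * PI) * (/ rho ^ n * (2 * PI * M))).
    + apply Rmult_le_compat_l; [left; apply Rinv_0_lt_compat; lra|].
      apply Rmult_le_compat_l; [left; apply Rinv_0_lt_compat; lra|]. exact B.
    + right. field. split; lra.
  - intros z Hz. set (x := (z - a)%C) in *.
    set (q := fun t => (x * / RtoC rho * e t)%C).
    assert (Cq : forall t, rcont q t) by (intros t; apply rcont_scal, Ce).
    assert (Mq : forall t, Cmod (q t) = Cmod x / rho).
    { intros t. unfold q. rewrite !Cmod_mult, Cmod_inv, Me, Cmod_R, Rabs_pos_eq by (try assumption; lra). field; lra. }
    assert (Hr1 : 0 <= Cmod x / rho < 1).
    { split; [apply Rdiv_le_0_compat; [apply Cmod_ge_0|lra]|].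
      apply Rmult_lt_reg_r with rho; [lra|]. unfold Rdiv. rewrite Rmult_assoc, Rinv_l; lra. }
    assert (N0 : forall t, (1 - q t <> 0)%C).
    { intros t. apply Cmod_gt_0. generalize (Cmod_triangle_rev 1 (q t)). rewrite Cmod_1, Mq. lra. }
    assert (Ci1 : forall t, rcont (fun u => / (1 - q u))%C t).
    { intros t. apply (rcont_comp Cinv (fun u => 1 - q u)%C).
      - eapply cder_cont, cder_inv_id, N0.
      - apply rcont_minus; [apply rcont_const | apply Cq]. }
    assert (S1 := cseries_CInt_geom (fun t => f (g t)) q (2 * PI) M (Cmod x / rho) ltac:(lra) Hr1 Cfg Cq
       HM (fun t => Req_le _ _ (Mq t))).
    assert (S2 := cseries_CInt_geom (fun t => RtoC 1) q (2 * PI) 1 (Cmod x / rho) ltac:(lra) Hr1 (fun t => rcont_const _ t) Cq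
       (fun t _ => Req_le _ _ Cmod_1) (fun t => Req_le _ _ (Mq t))).
    (* The winding integral: over a full period every power of [q] but the zeroth integrates to
       zero. *)
    assert (V : CInt (fun t => 1 * / (1 - q t))%C 0 (2 * PI) = RtoC (2 * PI)).
    { apply (cseries_unique _ _ _ S2).
      assert (T : forall n, CInt (fun t => 1 * q t ^ n)%C 0 (2 * PI) = match n with O => RtoC (2 * PI) | S _ => RtoC 0 end).
      { intros [|n].
        - rewrite (CInt_ext_all _ (fun _ => RtoC 1)) by (intros; simpl; ring). rewrite CInt_const, Rminus_0_r. ring.
        - rewrite (CInt_ext_all _ (fun t => (x * / RtoC rho) ^ S n * e t ^ S n)%C)
            by (intros; unfold q; rewrite Cpow_mult_l; ring).
          rewrite CInt_scal by (intros t _; apply rcont_pow, Ce). unfold e. rewrite CInt_Cexp_period by lia. ring. }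
      eapply cseries_ext; [intros n; symmetry; apply T|].
      apply (cseries_single (fun n => match n with O => RtoC (2 * PI) | S _ => RtoC 0 end)). reflexivity. }
    (* Integrate the difference quotient, which has a primitive, along the circle. *)
    assert (Hdz : cdisc a r z) by (unfold cdisc; fold x; lra).
    destruct (Hf z Hdz) as [l Hl].
    set (k := fun w => if Ceq_dec w z then l else ((f w - f z) / (w - z))%C).
    assert (kne : forall w, w <> z -> k w = ((f w - f z) / (w - z))%C).
    { intros w Hw. unfold k. destruct (Ceq_dec w z); [contradiction|reflexivity]. }
    assert (kd : forall w, cdisc a r w -> w <> z -> exists m, cder k w m).
    { intros w Hw Hwz. destruct (Hf w Hw) as [m Hm].
      assert (Hwz' : (w - z <> 0)%C) by (apply Cminus_eq_contra; assumption).
      eexists. apply (cder_ext_loc (fun u => (f u - f z) / (u - z))%C).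
      - exists (Cmod (w - z)). split; [apply Cmod_gt_0; assumption|]. intros u Hu. symmetry. apply kne. intros ->.
        rewrite Cmod_minus_sym in Hu. lra.
      - cder_auto; eassumption. }
    assert (kc : forall w, cdisc a r w -> ccont k w).
    { intros w Hw. destruct (Ceq_dec w z) as [->|Hwz].
      - intros eps Heps. destruct (Hl (eps / 2) ltac:(lra)) as [d [Hd K]]. exists d. split; [assumption|]. intros u Hu.
        unfold k at 2. destruct (Ceq_dec z z) as [_|n]; [|contradiction].
        destruct (Ceq_dec u z) as [->|Hu']; unfold k.
        + destruct (Ceq_dec z z) as [_|n]; [|contradiction]. replace (l - l)%C with (RtoC 0) by ring. rewrite Cmod_0; lra.
        + destruct (Ceq_dec u z) as [->|_]; [contradiction|].
          assert (Hwz' : (u - z <> 0)%C) by (apply Cminus_eq_contra; assumption).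
          replace ((f u - f z) / (u - z) - l)%C with ((f u - f z - l * (u - z)) / (u - z))%C by (field; assumption).
          rewrite Cmod_div by assumption. assert (P := proj1 (Cmod_gt_0 _) Hwz').
          specialize (K u Hu). apply Rle_lt_trans with (eps / 2); [|lra].
          apply Rmult_le_reg_r with (Cmod (u - z)); [assumption|]. unfold Rdiv at 1. rewrite Rmult_assoc, Rinv_l; lra.
      - destruct (kd w Hw Hwz) as [m Hm]. eapply cder_cont, Hm. }
    destruct (primitive_disc k a z r kc kd) as [F HF].
    assert (Z : CInt (fun t => k (g t) * (RtoC rho * (Ci * e' t)))%C 0 (2 * PI) = 0).
    { rewrite (CInt_derive (fun t => F (g t))).
      - replace (g (2 * PI)) with (g 0); [ring|]. unfold g, e', Cexp, Re, Im. simpl.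
        replace (0 * 0 - 0 * 1) with 0 by ring. replace (0 * 1 + 0 * 0) with 0 by ring.
        replace (2 * PI * 0 - 0 * 1) with 0 by ring. replace (2 * PI * 1 + 0 * 0) with (2 * PI) by ring.
        rewrite cos_2PI, sin_2PI, cos_0, sin_0. reflexivity.
      - intros t _. apply rder_comp; [apply HF, Hgf | apply Dg].
      - intros t _. apply rcont_mult; [apply rcont_comp; [apply kc, Hgf | apply Cg]|].
        apply rcont_scal, rcont_scal, rcont_Cexp_lin. }
    (* Since [g t - z] factors as [rho e'(t) (1 - q t)], the line element cancels and
       [Ci / (1 - q t)] is left. *)
    rewrite (CInt_ext_all _ (fun t => Ci * (f (g t) * / (1 - q t) - f z * (1 * / (1 - q t))))%C) in Z.
    2: { intros t.
         assert (Hgz : (g t - z <> 0)%C).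
         { apply Cmod_gt_0. replace (g t - z)%C with ((g t - a) - x)%C by (unfold x; ring).
           generalize (Cmod_triangle_rev (g t - a) x). rewrite Mg. lra. }
         assert (E : (RtoC rho * e' t * (1 - q t) = g t - z)%C).
         { unfold q, g, x. replace (RtoC rho * e' t * (1 - (z - a) * / RtoC rho * e t))%C
             with (RtoC rho * e' t - (z - a) * (RtoC rho * / RtoC rho) * (e t * e' t))%C by ring.
           rewrite ee, Cinv_r by assumption. ring. }
         rewrite kne by (intros E'; apply Hgz; rewrite E'; ring).
         rewrite <- E. rewrite <- E in Hgz. field.
         repeat split; [apply N0 | intros E'; apply Hgz; rewrite E'; ring | assumption]. }
    assert (Cz : forall t, rcont (fun t => f (g t) * / (1 - q t))%C t) by (intros t; apply rcont_mult; [apply Cfg|apply Ci1]).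
    assert (Cz1 : forall t, rcont (fun t => 1 * / (1 - q t))%C t) by (intros t; apply rcont_scal, Ci1).
    rewrite CInt_scal in Z by (intros t _; apply rcont_minus; [apply Cz | apply rcont_scal, Cz1]).
    rewrite (CInt_minus (fun t => f (g t) * / (1 - q t))%C (fun t => f z * (1 * / (1 - q t)))%C) in Z;
      [|intros t _; apply Cz | intros t _; apply rcont_scal, Cz1].
    rewrite (CInt_scal (f z) (fun t => 1 * / (1 - q t))%C), V in Z by (intros t _; apply Cz1).
    assert (E : CInt (fun t => f (g t) * / (1 - q t))%C 0 (2 * PI) = (f z * RtoC (2 * PI))%C).
    { set (I := CInt (fun t => f (g t) * / (1 - q t))%C 0 (2 * PI)) in *.
      replace I with (- Ci * (Ci * (I - f z * RtoC (2 * PI))) + f z * RtoC (2 * PI))%C.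
      - rewrite Z. ring.
      - apply injective_projections; simpl; ring. }
    cbv beta in S1. rewrite E in S1. apply (cseries_scal (/ RtoC (2 * PI))) in S1.
    replace (/ RtoC (2 * PI) * (f z * RtoC (2 * PI)))%C with (f z) in S1 by (field; assumption).
    eapply cseries_ext; [|exact S1]. intros n. cbv beta.
    rewrite (CInt_ext_all _ (fun t => (x * / RtoC rho) ^ n * (f (g t) * e t ^ n))%C)
      by (intros; unfold q; rewrite Cpow_mult_l; ring).
    rewrite CInt_scal by (intros t _; apply rcont_mult; [apply Cfg | apply rcont_pow, Ce]).
    rewrite Cpow_mult_l, Cpow_inv by assumption. ring.
Qed.

Lemma ex_series_Rscal (c : R) (a : nat -> R) : ex_series a -> ex_series (fun n => c * a n).
Proof. exact (ex_series_scal_l c a). Qed.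

Lemma disc_center a r : 0 < r -> cdisc a r a.
Proof. intros H. unfold cdisc. replace (a - a)%C with (RtoC 0) by ring. rewrite Cmod_0; exact H. Qed.

Lemma disc_sub a r b r' z : Cmod (b - a) + r' <= r -> cdisc b r' z -> cdisc a r z.
Proof.
  unfold cdisc. intros H Hz. replace (z - a)%C with ((z - b) + (b - a))%C by ring.
  apply Rle_lt_trans with (1 := Cmod_triangle _ _). lra.
Qed.

(** The tail is dominated by a geometric series of ratio at most one half, hence the factor 2. *)
Lemma pseries_tail (c : nat -> C) (rho M : R) (h l : C) (N : nat) :
  0 < rho -> (forall n, Cmod (c n) <= M / rho ^ n) -> Cmod h <= rho / 2 ->
  cseries (fun n => c n * h ^ n)%C l ->
  Cmod (l - csum (fun n => c n * h ^ n)%C N) <= 2 * M * (Cmod h / rho) ^ N.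
Proof.
  intros Hr Hc Hh H. set (x := Cmod h / rho).
  assert (Hx : 0 <= x <= / 2).
  { unfold x. split; [apply Rdiv_le_0_compat; [apply Cmod_ge_0 | assumption]|].
    apply Rmult_le_reg_r with rho; [assumption|]. unfold Rdiv. rewrite Rmult_assoc, Rinv_l; lra. }
  assert (PM : 0 <= M). { generalize (Hc O) (Cmod_ge_0 (c O)). simpl. lra. }
  assert (Hu : forall n, Cmod (c n * h ^ n)%C <= M * x ^ n).
  { intros n. rewrite Cmod_mult, Cmod_pow. unfold x, Rdiv. rewrite Rpow_mult_distr, pow_inv.
    assert (0 < rho ^ n) by (apply pow_lt; assumption). assert (0 <= Cmod h ^ n) by (apply pow_le, Cmod_ge_0).
    replace (M * (Cmod h ^ n * / rho ^ n)) with (M / rho ^ n * Cmod h ^ n) by (unfold Rdiv; ring).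
    apply Rmult_le_compat_r; [assumption | apply Hc]. }
  assert (Hs : ex_series (fun n => M * x ^ n)).
  { apply (ex_series_Rscal M), ex_series_geom. rewrite Rabs_pos_eq; lra. }
  apply Rle_trans with (1 := cseries_tail _ _ _ N Hu Hs H).
  rewrite (Series_ext _ (fun n => (M * x ^ N) * x ^ n)) by (intros n; rewrite pow_add; ring).
  rewrite Series_scal_l, Series_geom by (rewrite Rabs_pos_eq; lra).
  assert (P : 0 <= M * x ^ N) by (apply Rmult_le_pos; [assumption | apply pow_le; lra]).
  assert (Q : / (1 - x) <= 2). { rewrite <- (Rinv_inv 2). apply Rinv_le_contravar; lra. }
  nra.
Qed.

Lemma pseries_cder0 (c : nat -> C) (rho M : R) (f : C -> C) (a : C) :
  0 < rho -> (forall n, Cmod (c n) <= M / rho ^ n) ->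
  (forall z, Cmod (z - a) < rho -> cseries (fun n => c n * (z - a) ^ n)%C (f z)) ->
  f a = c O /\ cder f a (c 1%nat) /\
  forall h, Cmod h <= rho / 2 -> Cmod (f (a + h)%C - f a - c 1%nat * h) <= 2 * M * (Cmod h / rho) ^ 2.
Proof.
  intros Hr Hc H.
  assert (PM : 0 <= M). { generalize (Hc O) (Cmod_ge_0 (c O)). simpl. lra. }
  assert (A : f a = c O).
  { assert (Sz := H a (disc_center a rho Hr)). replace (a - a)%C with (RtoC 0) in Sz by ring.
    assert (T := pseries_tail c rho M 0 (f a) 1 Hr Hc ltac:(rewrite Cmod_0; lra) Sz).
    simpl in T. rewrite Cmod_0 in T.
    replace (2 * M * (0 / rho * 1)) with 0 in T by (field; lra).
    destruct (Ceq_dec (f a - (0 + c O * 1)) 0) as [E|E].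
    - replace (f a) with ((f a - (0 + c O * 1)) + c O)%C by ring. rewrite E. ring.
    - apply Cmod_gt_0 in E. lra. }
  assert (B : forall h, Cmod h <= rho / 2 -> Cmod (f (a + h)%C - f a - c 1%nat * h) <= 2 * M * (Cmod h / rho) ^ 2).
  { intros h Hh. assert (Sz := H (a + h)%C). replace (a + h - a)%C with h in Sz by ring.
    specialize (Sz ltac:(lra)).
    assert (T := pseries_tail c rho M h _ 2 Hr Hc Hh Sz). simpl csum in T.
    match type of T with Cmod ?u <= _ => replace (f (a + h)%C - f a - c 1%nat * h)%C with u; [exact T|] end.
    rewrite A. simpl. ring. }
  split; [exact A|]. split; [|exact B].
  intros eps Heps. exists (Rmin (rho / 2) (eps * rho ^ 2 / (2 * M + 1))).
  assert (Pr : 0 < rho ^ 2) by (apply pow_lt; assumption).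
  split. { apply Rmin_case; [lra|]. apply Rdiv_lt_0_compat; [apply Rmult_lt_0_compat|]; lra. }
  intros w Hw.
  assert (H1 := Rlt_le_trans _ _ _ Hw (Rmin_l _ _)). assert (H2 := Rlt_le_trans _ _ _ Hw (Rmin_r _ _)).
  specialize (B (w - a)%C (Rlt_le _ _ H1)). replace (a + (w - a))%C with w in B by ring.
  apply Rle_trans with (1 := B). set (x := Cmod (w - a)) in *. assert (Px : 0 <= x) by apply Cmod_ge_0.
  replace (2 * M * (x / rho) ^ 2) with (2 * M * x / rho ^ 2 * x) by (field; lra).
  apply Rmult_le_compat_r; [assumption|].
  apply Rmult_le_reg_r with (rho ^ 2); [assumption|].
  unfold Rdiv. rewrite Rmult_assoc, Rinv_l, Rmult_1_r by lra.
  apply Rle_trans with ((2 * M + 1) * (eps * rho ^ 2 / (2 * M + 1))); [|right; field; lra].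
  apply Rmult_le_compat; lra.
Qed.

(** The bound [M] is the maximum on the circle, attained because the parameter interval is
    compact. *)
Lemma taylor_disc (f : C -> C) (a : C) (r rho : R) :
  0 < rho < r -> holo_on (cdisc a r) f ->
  exists (c : nat -> C) (M : R), (forall n, Cmod (c n) <= M / rho ^ n) /\
    forall z, Cmod (z - a) < rho -> cseries (fun n => c n * (z - a) ^ n)%C (f z).
Proof.
  intros Hrho Hf. assert (Hpi := PI_RGT_0).
  set (g := fun t => (a + RtoC rho * Cexp (RtoC t * Ci))%C).
  assert (Mg : forall t, cdisc a r (g t)).
  { intros t. unfold g, cdisc. replace (a + RtoC rho * Cexp (RtoC t * Ci) - a)%C with (RtoC rho * Cexp (RtoC t * Ci))%C by ring.
    rewrite Cmod_mult, Cmod_R, Rabs_pos_eq, Cmod_Cexp by lra.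
    unfold Re; simpl. replace (t * 0 - 0 * 1) with 0 by ring. rewrite exp_0. lra. }
  destruct (continuity_ab_maj (fun t => Cmod (f (g t))) 0 (2 * PI)) as [tm [Htm _]].
  - lra.
  - intros t _ eps Heps.
    assert (Cc : rcont (fun t => f (g t)) t).
    { apply rcont_comp.
      - destruct (Hf _ (Mg t)) as [l Hl]. eapply cder_cont, Hl.
      - apply rcont_plus; [apply rcont_const|]. apply rcont_scal, rcont_Cexp_lin. }
    destruct (Cc eps Heps) as [d [Hd K]]. exists d. split; [assumption|]. intros u [_ Hu].
    simpl in *. unfold Rdist in *. specialize (K u Hu).
    apply Rle_lt_trans with (2 := K). apply Rabs_le. split.
    + generalize (Cmod_triangle_rev (f (g t)) (f (g u))). rewrite Cmod_minus_sym. lra.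
    + apply Cmod_triangle_rev.
  - destruct (taylor f a r rho (Cmod (f (g tm))) Hrho Hf) as [c [H1 H2]].
    + intros t Ht. apply (Htm t Ht).
    + exists c, (Cmod (f (g tm))). split; assumption.
Qed.

(** Both constants come from the Taylor bound on the circle of radius [r / 2]. The quadratic
    remainder, uniform in the function, is what allows derivatives to be summed in [weierstrass]. *)
Lemma cauchy_estimate (f : C -> C) (a : C) (r M : R) (l : C) :
  0 < r -> holo_on (cdisc a r) f -> (forall z, cdisc a r z -> Cmod (f z) <= M) -> cder f a l ->
  Cmod l <= 2 * M / r /\
  forall h, Cmod h <= r / 4 -> Cmod (f (a + h)%C - f a - l * h) <= 8 * M / r ^ 2 * Cmod h ^ 2.
Proof.
  intros Hr Hf HM Hl.
  destruct (taylor f a r (r / 2) M ltac:(lra) Hf) as [c [H1 H2]].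
  { intros t _. apply HM. unfold cdisc.
    replace (a + RtoC (r / 2) * Cexp (RtoC t * Ci) - a)%C with (RtoC (r / 2) * Cexp (RtoC t * Ci))%C by ring.
    rewrite Cmod_mult, Cmod_R, Rabs_pos_eq, Cmod_Cexp by lra.
    unfold Re; simpl. replace (t * 0 - 0 * 1) with 0 by ring. rewrite exp_0. lra. }
  destruct (pseries_cder0 c (r / 2) M f a ltac:(lra) H1 H2) as [_ [D B]].
  rewrite <- (cder_unique _ _ _ _ D Hl). split.
  - apply Rle_trans with (1 := H1 1%nat). right. simpl. field. lra.
  - intros h Hh. apply Rle_trans with (1 := B h ltac:(lra)). right. field. lra.
Qed.

(** Removal of a singularity: the quotient has the Taylor series without its constant term, shifted
    by one index, and takes the first coefficient as value at [a]. *)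
Lemma holo_quotient (f : C -> C) (a : C) (r : R) :
  0 < r -> holo_on (cdisc a r) f ->
  exists g, holo_on (cdisc a r) g /\ forall z, f z = (f a + (z - a) * g z)%C.
Proof.
  intros Hr Hf.
  destruct (taylor_disc f a r (r / 2) ltac:(lra) Hf) as [c [M [H1 H2]]].
  destruct (pseries_cder0 c (r / 2) M f a ltac:(lra) H1 H2) as [A _].
  set (g := fun z => if Ceq_dec z a then c 1%nat else ((f z - f a) / (z - a))%C).
  exists g. split.
  - intros z Hz. destruct (Ceq_dec z a) as [->|Hza].
    + assert (PM : 0 <= M). { generalize (H1 O) (Cmod_ge_0 (c O)). simpl. lra. }
      eexists. apply (pseries_cder0 (fun n => c (S n)) (r / 2) (M / (r / 2)) g a); [lra| |].
      * intros n. apply Rle_trans with (1 := H1 (S n)). right. simpl.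
        assert (0 < (r / 2) ^ n) by (apply pow_lt; lra). field. lra.
      * intros z Hz'. unfold g. destruct (Ceq_dec z a) as [->|Hza].
        -- replace (a - a)%C with (RtoC 0) by ring.
           replace (c 1%nat) with (c 1%nat * RtoC 0 ^ 0)%C by (simpl; ring).
           apply (cseries_single (fun n => c (S n) * RtoC 0 ^ n)%C). intros n. simpl. ring.
        -- assert (Hn : (z - a <> 0)%C) by (apply Cminus_eq_contra; assumption).
           assert (Sz := H2 z Hz').
           assert (Sz' : cseries (fun n => c (S n) * (z - a) ^ S n)%C (f z - f a)).
           { apply (cseries_shift (fun n => c n * (z - a) ^ n)%C).
             replace (c O * (z - a) ^ 0 + (f z - f a))%C with (f z) by (rewrite A; simpl; ring). exact Sz. }
           apply (cseries_scal (/ (z - a))) in Sz'.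
           replace ((f z - f a) / (z - a))%C with (/ (z - a) * (f z - f a))%C by (field; assumption).
           eapply cseries_ext; [|exact Sz']. intros n. simpl. field. assumption.
    + destruct (Hf z Hz) as [m Hm].
      assert (Hn : (z - a <> 0)%C) by (apply Cminus_eq_contra; assumption).
      eexists. apply (cder_ext_loc (fun u => (f u - f a) / (u - a))%C).
      * exists (Cmod (z - a)). split; [apply Cmod_gt_0; assumption|]. intros u Hu. unfold g.
        destruct (Ceq_dec u a) as [->|_]; [|reflexivity]. rewrite Cmod_minus_sym in Hu. lra.
      * cder_auto; eassumption.
  - intros z. unfold g. destruct (Ceq_dec z a) as [->|Hza]; [ring|].
    field. apply Cminus_eq_contra; assumption.
Qed.

(** The first-order remainder of [u n] is at most a fixed multiple of [M n * Cmod h ^ 2], so the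
    remainders can be summed. This identifies the derivative of the sum and not only its
    existence. *)
Lemma weierstrass (u : nat -> C -> C) (M : nat -> R) (l : nat -> C) (a : C) (r : R) :
  0 < r -> ex_series M -> (forall n, holo_on (cdisc a r) (u n)) ->
  (forall n z, cdisc a r z -> Cmod (u n z) <= M n) -> (forall n, cder (u n) a (l n)) ->
  cder (fun z => CSer (fun n => u n z)) a (CSer l).
Proof.
  intros Hr HM Hu Hb Hl.
  assert (PM : forall n, 0 <= M n).
  { intros n. apply Rle_trans with (2 := Hb n a (disc_center a r Hr)). apply Cmod_ge_0. }
  assert (E := fun n => cauchy_estimate (u n) a r (M n) (l n) Hr (Hu n) (Hb n) (Hl n)).
  assert (Sl : cseries l (CSer l)).
  { apply (cseries_abs l (fun n => 2 / r * M n)).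
    - intros n. apply Rle_trans with (1 := proj1 (E n)). right. field. lra.
    - apply (ex_series_Rscal (2 / r)), HM. }
  assert (Su : forall z, cdisc a r z -> cseries (fun n => u n z) (CSer (fun n => u n z))).
  { intros z Hz. apply (cseries_abs _ M); [intros n; apply Hb, Hz | exact HM]. }
  set (K := 8 / r ^ 2 * Series M).
  assert (Pr : 0 < r ^ 2) by (apply pow_lt; assumption).
  assert (PK : 0 <= K).
  { unfold K. apply Rmult_le_pos; [apply Rdiv_le_0_compat; lra|].
    apply Rle_trans with (rsum M 0); [simpl; lra|]. apply rsum_le_Series; assumption. }
  intros eps Heps. exists (Rmin (r / 4) (eps / (K + 1))).
  split. { apply Rmin_case; [lra|]. apply Rdiv_lt_0_compat; lra. }
  intros w Hw.
  assert (H1 := Rlt_le_trans _ _ _ Hw (Rmin_l _ _)). assert (H2 := Rlt_le_trans _ _ _ Hw (Rmin_r _ _)).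
  set (h := (w - a)%C) in *.
  assert (Sw := cseries_minus _ _ _ _ (cseries_minus _ _ _ _ (Su w ltac:(unfold cdisc; fold h; lra)) (Su a (disc_center a r Hr)))
     (cseries_scal h _ _ Sl)).
  replace (CSer l * h)%C with (h * CSer l)%C by ring.
  apply Rle_trans with (Series (fun n => 8 / r ^ 2 * Cmod h ^ 2 * M n)).
  - eapply cseries_bound; [| |exact Sw].
    + intros n. cbv beta. replace (u n w) with (u n (a + h)%C) by (f_equal; unfold h; ring).
      replace (h * l n)%C with (l n * h)%C by ring.
      apply Rle_trans with (1 := proj2 (E n) h ltac:(lra)). right. field. lra.
    + apply (ex_series_Rscal (8 / r ^ 2 * Cmod h ^ 2)), HM.
  - rewrite Series_scal_l.
    replace (8 / r ^ 2 * Cmod h ^ 2 * Series M) with (K * Cmod h * Cmod h) by (unfold K; field; lra).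
    assert (Ph := Cmod_ge_0 h). apply Rmult_le_compat_r; [assumption|].
    apply Rle_trans with ((K + 1) * (eps / (K + 1))); [apply Rmult_le_compat; lra | right; field; lra].
Qed.

Definition copen (U : C -> Prop) : Prop := forall a, U a -> exists r, 0 < r /\ forall z, cdisc a r z -> U z.

Lemma weierstrass_holo (U : C -> Prop) (u : nat -> C -> C) :
  (forall a, U a -> exists r M, 0 < r /\ (forall z, cdisc a r z -> U z) /\ ex_series M /\
     forall n z, cdisc a r z -> Cmod (u n z) <= M n) ->
  (forall n, holo_on U (u n)) -> holo_on U (fun z => CSer (fun n => u n z)).
Proof.
  intros HU Hu a Ha. destruct (HU a Ha) as [r [M [Hr [Hd [HM Hb]]]]].
  assert (L : forall n, exists l, cder (u n) a l) by (intros n; apply Hu, Ha).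
  exists (CSer (fun n => proj1_sig (constructive_indefinite_description _ (L n)))).
  apply (weierstrass u M _ a r); try assumption.
  - intros n z Hz. apply Hu, Hd, Hz.
  - intros n. apply (proj2_sig (constructive_indefinite_description _ (L n))).
Qed.

(** * The identity theorem *)

(** The series equals its constant term up to a multiple of [Cmod h], and [h] can be taken small. *)
Lemma pseries_coef0 (c : nat -> C) (rho M e : R) :
  0 < rho -> 0 < e <= rho / 2 -> (forall n, Cmod (c n) <= M / rho ^ n) ->
  (forall h, 0 < Cmod h < e -> cseries (fun n => c n * h ^ n)%C 0) -> c O = 0.
Proof.
  intros Hr He Hc H.
  assert (PM : 0 <= M). { generalize (Hc O) (Cmod_ge_0 (c O)). simpl. lra. }
  destruct (Ceq_dec (c O) 0) as [E|E]; [exact E|exfalso]. apply Cmod_gt_0 in E.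
  set (K := 2 * M / rho).
  assert (PK : 0 <= K) by (apply Rdiv_le_0_compat; lra).
  set (x := Rmin (e / 2) (Cmod (c O) / (2 * (K + 1)))).
  assert (Hx : 0 < x). { apply Rmin_case; [lra|]. apply Rdiv_lt_0_compat; lra. }
  assert (Hx1 : x <= e / 2) by apply Rmin_l.
  assert (Hx2 : x * (2 * (K + 1)) <= Cmod (c O)).
  { apply Rle_trans with (Cmod (c O) / (2 * (K + 1)) * (2 * (K + 1))); [|right; field; lra].
    apply Rmult_le_compat_r; [lra|apply Rmin_r]. }
  assert (Mx : Cmod (RtoC x) = x) by (rewrite Cmod_R; apply Rabs_pos_eq; lra).
  assert (T := pseries_tail c rho M (RtoC x) 0 1 Hr Hc ltac:(lra) (H (RtoC x) ltac:(lra))).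
  replace (RtoC 0 - csum (fun n => c n * RtoC x ^ n)%C 1)%C with (- c O)%C in T by (simpl; ring).
  rewrite Cmod_opp, Mx in T.
  replace (2 * M * (x / rho) ^ 1) with (K * x) in T by (unfold K; field; lra).
  nra.
Qed.

(** The Taylor coefficients at the centre vanish one after the other, each after a division by
    [h]. *)
Lemma identity_disc (f : C -> C) (a : C) (r d : R) :
  0 < d -> holo_on (cdisc a r) f -> (forall z, cdisc a d z -> f z = 0) -> forall z, cdisc a r z -> f z = 0.
Proof.
  intros Hd Hf H0 z Hz. unfold cdisc in Hz.
  set (rho := (Cmod (z - a) + r) / 2).
  assert (Hrho : 0 < rho < r) by (unfold rho; generalize (Cmod_ge_0 (z - a)); lra).
  destruct (taylor_disc f a r rho Hrho Hf) as [c [M [H1 H2]]].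
  assert (PM : 0 <= M). { generalize (H1 O) (Cmod_ge_0 (c O)). simpl. lra. }
  set (e := Rmin d (rho / 2)). assert (He : 0 < e) by (apply Rmin_case; lra).
  assert (Hed : e <= d) by apply Rmin_l. assert (Her : e <= rho / 2) by apply Rmin_r.
  assert (B : forall N, (forall h, 0 < Cmod h < e -> cseries (fun n => c (N + n)%nat * h ^ n)%C 0) -> c N = 0).
  { intros N HN. rewrite <- (Nat.add_0_r N).
    apply (pseries_coef0 (fun n => c (N + n)%nat) rho (M / rho ^ N) e); try lra; [|exact HN].
    intros n. apply Rle_trans with (1 := H1 (N + n)%nat). right. rewrite pow_add.
    assert (0 < rho ^ n) by (apply pow_lt; lra). assert (0 < rho ^ N) by (apply pow_lt; lra). field. lra. }
  assert (A : forall N h, 0 < Cmod h < e -> cseries (fun n => c (N + n)%nat * h ^ n)%C 0).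
  { induction N as [|N IH]; intros h Hh.
    - assert (Sz := H2 (a + h)%C). replace (a + h - a)%C with h in Sz by ring.
      specialize (Sz ltac:(lra)). rewrite H0 in Sz; [exact Sz|].
      unfold cdisc. replace (a + h - a)%C with h by ring. lra.
    - assert (Z : c N = 0) by (apply B, IH).
      assert (Hh0 : h <> 0) by (apply Cmod_gt_0; lra).
      assert (Sz' : cseries (fun n => c (N + S n)%nat * h ^ S n)%C 0).
      { apply (cseries_shift (fun n => c (N + n)%nat * h ^ n)%C). rewrite Nat.add_0_r, Z.
        replace (RtoC 0 * h ^ 0 + 0)%C with (RtoC 0) by (simpl; ring). apply IH, Hh. }
      apply (cseries_scal (/ h)) in Sz'. rewrite Cmult_0_r in Sz'.
      eapply cseries_ext; [|exact Sz']. intros n. cbv beta. rewrite Nat.add_succ_r. simpl. field. assumption. }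
  assert (Z : forall N, c N = 0) by (intros N; apply B, A).
  assert (Sz := H2 z ltac:(unfold rho; lra)).
  apply (cseries_unique _ _ _ Sz).
  intros eps Heps. exists O. intros n _.
  replace (csum (fun n => c n * (z - a) ^ n)%C n) with (RtoC 0).
  - replace (RtoC 0 - RtoC 0)%C with (RtoC 0) by ring. rewrite Cmod_0; assumption.
  - clear - Z. induction n as [|n IH]; [reflexivity|]. simpl. rewrite <- IH, Z. ring.
Qed.

Definition convex_set (U : C -> Prop) : Prop :=
  forall p q t, U p -> U q -> 0 <= t <= 1 -> U (p + RtoC t * (q - p))%C.

(** A supremum argument along the segment from [p] to [q], which convexity keeps inside [U]. *)
Lemma identity_convex (U : C -> Prop) (f : C -> C) (p : C) (d : R) :
  copen U -> convex_set U -> holo_on U f -> U p -> 0 < d ->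
  (forall z, cdisc p d z -> f z = 0) -> forall q, U q -> f q = 0.
Proof.
  intros HO HC Hf Hp Hd H0 q Hq.
  set (g := fun t => (p + RtoC t * (q - p))%C).
  set (P := fun t => exists e, 0 < e /\ forall z, cdisc (g t) e z -> f z = 0).
  assert (Gd : forall s t, Cmod (g s - g t) = Rabs (s - t) * Cmod (q - p)).
  { intros s t. unfold g. replace (p + RtoC s * (q - p) - (p + RtoC t * (q - p)))%C with (RtoC (s - t) * (q - p))%C
      by (rewrite RtoC_minus; ring). rewrite Cmod_mult, Cmod_R. reflexivity. }
  set (L := Cmod (q - p)) in *. assert (HL : 0 <= L) by apply Cmod_ge_0.
  (* Vanishing near one point of the segment spreads a fixed distance around each limit point. *)
  assert (Key : forall t, 0 <= t <= 1 -> exists m, 0 < m /\ forall s, Rabs (s - t) < m -> P s ->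
      forall s', Rabs (s' - t) < m -> P s').
  { intros t Ht. destruct (HO (g t) (HC p q t Hp Hq Ht)) as [r [Hr HrU]].
    exists (r / (4 * (L + 1))). split; [apply Rdiv_lt_0_compat; lra|].
    assert (Near : forall s, Rabs (s - t) < r / (4 * (L + 1)) -> Cmod (g s - g t) < r / 4).
    { intros s Hs. rewrite Gd. apply Rle_lt_trans with (Rabs (s - t) * (L + 1)).
      - apply Rmult_le_compat_l; [apply Rabs_pos|lra].
      - apply Rlt_le_trans with (r / (4 * (L + 1)) * (L + 1)); [apply Rmult_lt_compat_r; lra|]. right; field; lra. }
    intros s Hs [e [He Hz]] s' Hs'.
    assert (N1 := Near s Hs). assert (N2 := Near s' Hs').
    exists (r / 4). split; [lra|]. intros z Hzz.
    apply (identity_disc f (g s) (3 * r / 4) e He).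
    - intros w Hw. apply Hf, HrU. apply (disc_sub _ _ (g s) (3 * r / 4)); [lra|assumption].
    - exact Hz.
    - apply (disc_sub _ _ (g s') (r / 4)); [|assumption].
      replace (g s' - g s)%C with ((g s' - g t) - (g s - g t))%C by ring.
      apply Rle_trans with (Cmod (g s' - g t) + Cmod (g s - g t) + r / 4); [|lra].
      apply Rplus_le_compat_r. apply Cmod_triangle_minus. }
  (* The parameters up to which [f] vanishes near every point of the segment. *)
  set (E := fun t => 0 <= t <= 1 /\ forall s, 0 <= s <= t -> P s).
  assert (P0 : P 0).
  { exists d. split; [assumption|]. unfold g. replace (p + RtoC 0 * (q - p))%C with p by ring. exact H0. }
  assert (E0 : E 0). { split; [lra|]. intros s Hs. replace s with 0 by lra. exact P0. }
  destruct (completeness E) as [T [HT1 HT2]].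
  { exists 1. intros t [Ht _]. lra. } { exists 0. exact E0. }
  assert (HT : 0 <= T <= 1).
  { split; [apply HT1, E0|]. apply HT2. intros t [Ht _]; lra. }
  destruct (Key T HT) as [m [Hm K]].
  assert (Ex : exists t, E t /\ T - m < t).
  { destruct (excluded_middle_informative (exists t, E t /\ T - m < t)) as [Y|N]; [exact Y|exfalso].
    assert (T <= T - m); [|lra]. apply HT2. intros t Et. apply Rnot_lt_le. intros Ht. apply N. exists t. tauto. }
  destruct Ex as [t [[Ht Et] Htm]].
  assert (HtT : t <= T) by (apply HT1; split; assumption).
  assert (Pt : P t) by (apply Et; lra).
  assert (PN : forall s', Rabs (s' - T) < m -> P s').
  { apply (K t); [|exact Pt]. apply Rabs_def1; lra. }
  assert (E1 : E (Rmin 1 (T + m / 2))).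
  { split. { split; [apply Rmin_glb; lra | apply Rmin_l]. }
    intros s Hs. assert (s <= T + m / 2) by (apply Rle_trans with (1 := proj2 Hs), Rmin_r).
    destruct (Rle_dec s t) as [Hst|Hst]; [apply Et; lra|]. apply PN. apply Rabs_def1; lra. }
  assert (B := HT1 _ E1).
  assert (T1 : T = 1). { revert B. unfold Rmin. destruct Rle_dec; lra. }
  destruct (PN 1) as [e [He Hz]]. { rewrite T1, Rminus_diag, Rabs_R0. exact Hm. }
  apply Hz. replace q with (g 1) by (unfold g; ring). apply disc_center, He.
Qed.

Lemma identity_eq (U : C -> Prop) (f g : C -> C) (p : C) (d : R) :
  copen U -> convex_set U -> holo_on U f -> holo_on U g -> U p -> 0 < d ->
  (forall z, cdisc p d z -> f z = g z) -> forall q, U q -> f q = g q.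
Proof.
  intros HO HC Hf Hg Hp Hd H q Hq.
  assert (E : (f q - g q)%C = 0).
  { apply (identity_convex U (fun z => f z - g z)%C p d); try assumption.
    - intros z Hz. destruct (Hf z Hz) as [l Hl]. destruct (Hg z Hz) as [m Hm].
      eexists. cder_auto; eassumption.
    - intros z Hz. rewrite H by assumption. ring. }
  replace (f q) with ((f q - g q) + g q)%C by ring. rewrite E. ring.
Qed.

(** * Real powers and convergence tests *)

(** For [x <= 0] the convention [ln x = 0] makes the value 1; in the series below [pw 0] appears
    only with coefficient zero. *)
Definition pw (x : R) (s : C) : C := Cexp (s * RtoC (ln x)).

Lemma pw_add x s w : pw x (s + w) = (pw x s * pw x w)%C.
Proof. unfold pw. rewrite <- Cexp_add. f_equal. ring. Qed.

Lemma pw_mult x y s : 0 < x -> 0 < y -> pw (x * y) s = (pw x s * pw y s)%C.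
Proof. intros Hx Hy. unfold pw. rewrite <- Cexp_add, ln_mult, RtoC_plus by assumption. f_equal. ring. Qed.

Lemma pw_0 x : pw x 0 = 1.
Proof. unfold pw. rewrite Cmult_0_l. apply Cexp_0. Qed.

Lemma pw_1_l s : pw 1 s = 1.
Proof. unfold pw. rewrite ln_1, Cmult_0_r. apply Cexp_0. Qed.

Lemma pw_neq_0 x s : pw x s <> 0.
Proof. apply Cexp_neq_0. Qed.

Lemma pw_opp x s : pw x (- s) = (/ pw x s)%C.
Proof. unfold pw. rewrite <- Cexp_opp. f_equal. ring. Qed.

Lemma pw_1 x : 0 < x -> pw x 1 = RtoC x.
Proof. intros H. unfold pw. rewrite Cmult_1_l, Cexp_RtoC, exp_ln by assumption. reflexivity. Qed.

Lemma pw_nat x n : 0 < x -> pw x (RtoC (INR n)) = (RtoC x ^ n)%C.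
Proof. intros H. unfold pw. rewrite Cexp_mult_nat, Cexp_RtoC, exp_ln by assumption. reflexivity. Qed.

Lemma Cmod_pw x s : Cmod (pw x s) = exp (Re s * ln x).
Proof. unfold pw. rewrite Cmod_Cexp. f_equal. unfold Re; destruct s; simpl; ring. Qed.

Lemma pw_inv_l x s : 0 < x -> pw (/ x) s = pw x (- s).
Proof. intros H. unfold pw. rewrite ln_Rinv, RtoC_opp by assumption. f_equal. ring. Qed.

Lemma cder_pw x s : cder (pw x) s (RtoC (ln x) * pw x s).
Proof. unfold pw. eapply cder_eq; [cder_auto|]. ring. Qed.

Lemma INR_S_pos n : 0 < INR (S n).
Proof. apply lt_0_INR. lia. Qed.

Lemma ln_ge_0 x : 1 <= x -> 0 <= ln x.
Proof. intros [H| <-]; [left; rewrite <- ln_1; apply ln_increasing; lra | rewrite ln_1; lra]. Qed.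

Lemma ln_le_minus_1 x : 0 < x -> ln x <= x - 1.
Proof.
  intros H. apply Rle_trans with (ln (exp (x - 1))); [|rewrite ln_exp; lra].
  apply ln_le; [assumption|]. generalize (exp_ineq1_le (x - 1)); lra.
Qed.

Lemma ln_INR_S_ge_0 n : 0 <= ln (INR (S n)).
Proof. apply ln_ge_0. rewrite S_INR. generalize (pos_INR n); lra. Qed.

Lemma ex_series_bounded (a : nat -> R) (B : R) :
  (forall n, 0 <= a n) -> (forall n, rsum a n <= B) -> ex_series a.
Proof.
  intros Pa H. destruct (ex_finite_lim_seq_incr (sum_n a) B) as [l Hl].
  - intros n. rewrite sum_Sn. unfold plus; simpl. generalize (Pa (S n)); lra.
  - intros n. rewrite <- rsum_sum_n. apply H.
  - exists l. exact Hl.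
Qed.

Lemma ex_series_Rle (a b : nat -> R) : (forall n, 0 <= a n <= b n) -> ex_series b -> ex_series a.
Proof.
  intros H Hb. apply (ex_series_le (K := R_AbsRing) (V := R_CompleteNormedModule) a b); [|exact Hb].
  intros n. unfold norm; simpl. unfold abs; simpl. rewrite Rabs_pos_eq; apply H.
Qed.

Lemma ex_series_double (a : nat -> R) :
  (forall n, 0 <= a n) -> ex_series a -> ex_series (fun j => a (2 * j)%nat).
Proof.
  intros Pa Ha. apply (ex_series_bounded _ (Series a)); [intros; apply Pa|]. intros n.
  apply Rle_trans with (rsum a (2 * n)); [|apply rsum_le_Series; assumption].
  induction n as [|n IH]; [simpl; lra|].
  replace (2 * S n)%nat with (S (S (2 * n))) by lia. set (m := (2 * n)%nat) in *.
  cbn [rsum]. fold m. generalize (Pa (S m)). lra.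
Qed.

Definition rpow (n : nat) (t : R) : R := exp (t * ln (INR (S n))).

Lemma rpow_pos n t : 0 < rpow n t.
Proof. apply exp_pos. Qed.

Lemma rpow_plus n t u : rpow n (t + u) = rpow n t * rpow n u.
Proof. unfold rpow. rewrite <- exp_plus. f_equal. ring. Qed.

Lemma rpow_le n t u : t <= u -> rpow n t <= rpow n u.
Proof. intros H. apply exp_le. apply Rmult_le_compat_r; [apply ln_INR_S_ge_0 | exact H]. Qed.

Lemma rpow_m1 n : rpow n (-1) = / INR (S n).
Proof.
  unfold rpow. replace (-1 * ln (INR (S n))) with (- ln (INR (S n))) by ring.
  rewrite exp_Ropp, exp_ln by apply INR_S_pos. reflexivity.
Qed.

(** Integral comparison in discrete form: with [tau = sigma - 1], the term of index [S n] is at most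
    [(rpow n (- tau) - rpow (S n) (- tau)) / tau], and these differences telescope. *)
Lemma ex_series_rpow (sigma : R) : 1 < sigma -> ex_series (fun n => rpow n (- sigma)).
Proof.
  intros Hs. set (tau := sigma - 1). assert (Ht : 0 < tau) by (unfold tau; lra).
  apply (ex_series_bounded _ (1 + / tau)).
  - intros n. left; apply rpow_pos.
  - assert (K : forall n, rsum (fun n => rpow n (- sigma)) (S n) <= 1 + / tau * (1 - rpow n (- tau))).
    { induction n as [|n IH].
      - simpl. unfold rpow. simpl. rewrite ln_1, !Rmult_0_r, exp_0. lra.
      - cbn [rsum] in *. apply Rle_trans with (1 + / tau * (1 - rpow n (- tau)) + rpow (S n) (- sigma)); [lra|].
        assert (A : rpow (S n) (- sigma) <= / tau * (rpow n (- tau) - rpow (S n) (- tau))).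
        { replace (- sigma) with (- tau + -1) by (unfold tau; ring).
          rewrite rpow_plus, rpow_m1.
          assert (P := INR_S_pos n). assert (P' := INR_S_pos (S n)).
          assert (E : rpow n (- tau) = rpow (S n) (- tau) * exp (tau * ln (INR (S (S n)) / INR (S n)))).
          { unfold rpow. rewrite <- exp_plus. f_equal. rewrite ln_div by assumption. ring. }
          assert (L : / INR (S (S n)) <= ln (INR (S (S n)) / INR (S n))).
          { set (x := INR (S n)) in *. set (y := INR (S (S n))) in *.
            assert (Exy : y = x + 1) by (unfold x, y; rewrite (S_INR (S n)); reflexivity).
            replace (y / x) with (/ (x / y)) by (field; lra).
            rewrite ln_Rinv by (apply Rdiv_lt_0_compat; lra).
            assert (Q : ln (x / y) <= x / y - 1) by (apply ln_le_minus_1, Rdiv_lt_0_compat; lra).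
            replace (/ y) with (1 - x / y) by (rewrite Exy; field; lra). lra. }
          assert (X : 1 + tau * / INR (S (S n)) <= exp (tau * ln (INR (S (S n)) / INR (S n)))).
          { apply Rle_trans with (exp (tau * / INR (S (S n)))).
            - apply exp_ineq1_le.
            - apply exp_le. apply Rmult_le_compat_l; lra. }
          rewrite E. assert (Pr := rpow_pos (S n) (- tau)). set (p := rpow (S n) (- tau)) in *.
          apply Rmult_le_reg_l with tau; [assumption|].
          rewrite <- (Rmult_assoc tau (/ tau)), Rinv_r, Rmult_1_l by lra.
          nra. }
        lra. }
    intros [|n].
    + simpl. assert (0 < / tau) by (apply Rinv_0_lt_compat; assumption). lra.
    + apply Rle_trans with (1 := K n). assert (0 < / tau) by (apply Rinv_0_lt_compat; assumption).
      generalize (rpow_pos n (- tau)). nra.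
Qed.

(** * The binomial series *)

Fixpoint ff (z : C) (n : nat) : C :=
  match n with O => RtoC 1 | S k => (ff z k * (z - RtoC (INR k)))%C end.

(** The coefficient of [x ^ n] in [(1 - x) ^ (- K)], a majorant of all binomial coefficients whose
    upper argument has modulus at most [K]. *)
Fixpoint bb (K : R) (n : nat) : R :=
  match n with O => 1 | S k => bb K k * ((K + INR k) / INR (S k)) end.

Definition binc (z : C) (n : nat) : C := (ff z n * / RtoC (INR (fact n)))%C.

Lemma INR_fact_C_neq_0 n : RtoC (INR (fact n)) <> 0.
Proof. apply RtoC_neq_0, INR_fact_neq_0. Qed.

Lemma binc_S z n : (binc z (S n) * RtoC (INR (S n)) = binc z n * (z - RtoC (INR n)))%C.
Proof.
  unfold binc. simpl ff. rewrite fact_simpl, mult_INR, RtoC_mult. field. split.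
  - apply INR_fact_C_neq_0.
  - apply RtoC_neq_0, not_0_INR. lia.
Qed.

Lemma bb_pos K n : 0 < K -> 0 < bb K n.
Proof.
  intros HK. induction n as [|n IH]; [simpl; lra|]. cbn [bb].
  apply Rmult_lt_0_compat; [assumption|]. apply Rdiv_lt_0_compat; [generalize (pos_INR n); lra | apply INR_S_pos].
Qed.

Lemma Cmod_ff_le z K n : Cmod z <= K -> Cmod (ff z n) <= bb K n * INR (fact n).
Proof.
  intros HK. induction n as [|n IH]; [simpl; rewrite Cmod_1; lra|].
  cbn [ff bb]. rewrite Cmod_mult, fact_simpl, mult_INR.
  replace (bb K n * ((K + INR n) / INR (S n)) * (INR (S n) * INR (fact n)))
    with (bb K n * INR (fact n) * (K + INR n)) by (field; apply not_0_INR; lia).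
  apply Rmult_le_compat; [apply Cmod_ge_0 | apply Cmod_ge_0 | exact IH |].
  apply Rle_trans with (1 := Cmod_triangle_minus _ _). rewrite Cmod_R, Rabs_pos_eq by apply pos_INR. lra.
Qed.

Lemma Cmod_binc_le z K n : Cmod z <= K -> Cmod (binc z n) <= bb K n.
Proof.
  intros HK. unfold binc. rewrite Cmod_mult, Cmod_inv, Cmod_R by apply INR_fact_C_neq_0.
  assert (P : 0 < INR (fact n)) by (apply INR_fact_lt_0). rewrite Rabs_pos_eq by lra.
  apply Rmult_le_reg_r with (INR (fact n)); [assumption|]. rewrite Rmult_assoc, Rinv_l, Rmult_1_r by lra.
  apply Cmod_ff_le, HK.
Qed.

(** Absorbs into the parameter a factor linear in [n], such as the one that [s + sh j - 1] produces
    in [zPhi0_maj]. *)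
Lemma bb_raise K n : 0 < K -> bb K n * (K + INR n) = K * bb (K + 1) n.
Proof.
  intros HK. induction n as [|n IH]; [simpl; ring|]. cbn [bb]. rewrite S_INR.
  assert (Q := pos_INR n).
  replace (bb K n * ((K + INR n) / (INR n + 1)) * (K + (INR n + 1)))
    with (bb K n * (K + INR n) * ((K + 1 + INR n) / (INR n + 1))) by (field; lra).
  rewrite IH. ring.
Qed.

Lemma ex_series_bb K x : 0 < K -> 0 < x < 1 -> ex_series (fun n => bb K n * x ^ n).
Proof.
  intros HK Hx.
  assert (P : forall n, 0 < bb K n * x ^ n).
  { intros n. apply Rmult_lt_0_compat; [apply bb_pos, HK | apply pow_lt; lra]. }
  apply (ex_series_ext (fun n => Rabs (bb K n * x ^ n))).
  { intros n. apply Rabs_pos_eq. left; apply P. }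
  apply (ex_series_DAlembert _ x); [lra | intros n; apply Rgt_not_eq, P |].
  apply (is_lim_seq_ext (fun n => x * (1 + (K - 1) * / INR (S n)))).
  - intros n. assert (Hn := INR_S_pos n). assert (Q := pos_INR n).
    assert (B := bb_pos K n HK). assert (0 < x ^ n) by (apply pow_lt; lra).
    replace (bb K (S n) * x ^ S n / (bb K n * x ^ n)) with (x * ((K + INR n) / INR (S n))).
    + rewrite Rabs_pos_eq by (apply Rmult_le_pos; [lra | apply Rdiv_le_0_compat; lra]).
      rewrite S_INR in *. field. lra.
    + cbn [bb]. simpl pow. field. split; [lra|]. split; lra.
  - replace (Finite x) with (Finite (x * (1 + (K - 1) * 0))) by (f_equal; ring).
    apply (is_lim_seq_scal_l _ x (Finite (1 + (K - 1) * 0))).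
    apply is_lim_seq_plus'; [apply is_lim_seq_const|].
    apply (is_lim_seq_scal_l _ (K - 1) (Finite 0)).
    apply (is_lim_seq_incr_1 (fun n => / INR n)).
    apply (is_lim_seq_inv INR p_infty); [apply is_lim_seq_INR | discriminate].
Qed.

Lemma cder_pow (z : C) (n : nat) : cder (fun w => w ^ S n)%C z (RtoC (INR (S n)) * z ^ n).
Proof.
  induction n as [|n IH].
  - simpl. eapply cder_eq; [cder_auto|]. ring.
  - apply (cder_ext (fun w => w * w ^ S n)%C); [reflexivity|].
    eapply cder_eq; [apply cder_mult; [apply cder_id | exact IH]|].
    rewrite (S_INR (S n)), RtoC_plus. simpl. ring.
Qed.

Lemma pseries_cder (c : nat -> C) (a : nat -> R) (rho : R) :
  0 < rho -> (forall n, Cmod (c n) * rho ^ n <= a n) -> ex_series a ->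
  forall z, Cmod z < rho ->
  let dl := fun n => match n with O => RtoC 0 | S k => (c (S k) * (RtoC (INR (S k)) * z ^ k))%C end in
  cder (fun w => CSer (fun n => c n * w ^ n)%C) z (CSer dl) /\
  cseries (fun n => match n with O => RtoC 0 | S k => (c (S k) * (RtoC (INR (S k)) * z ^ k))%C end) (CSer dl).
Proof.
  intros Hr Hc Ha z Hz dl. assert (P := Cmod_ge_0 z).
  assert (Hd : forall n w, cder (fun w => c n * w ^ n)%C w
     (match n with O => RtoC 0 | S k => (c (S k) * (RtoC (INR (S k)) * w ^ k))%C end)).
  { intros [|n] w.
    - apply (cder_ext (fun _ => c O)); [intros; simpl; ring|]. apply cder_const.
    - eapply cder_eq; [apply (cder_mult (fun _ => c (S n))); [apply cder_const | apply cder_pow]|]. cbv beta. ring. }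
  assert (Maj : forall n w, cdisc z (rho - Cmod z) w -> Cmod (c n * w ^ n)%C <= a n).
  { intros n w Hw. apply Rle_trans with (2 := Hc n). rewrite Cmod_mult, Cmod_pow.
    apply Rmult_le_compat_l; [apply Cmod_ge_0|]. apply pow_incr. split; [apply Cmod_ge_0|].
    unfold cdisc in Hw. generalize (Cmod_triangle_rev w z). lra. }
  assert (Hh : forall n, holo_on (cdisc z (rho - Cmod z)) (fun w => c n * w ^ n)%C) by (intros n w _; eexists; apply Hd).
  split.
  - apply (weierstrass (fun n w => c n * w ^ n)%C a dl z (rho - Cmod z)); try assumption; [lra|].
    intros n. apply Hd.
  - apply (cseries_abs dl (fun n => 2 / (rho - Cmod z) * a n)); [|apply ex_series_Rscal, Ha].
    intros n. eapply Rle_trans.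
    + apply (cauchy_estimate (fun w => c n * w ^ n)%C z (rho - Cmod z) (a n) (dl n)); [lra | apply Hh | apply Maj | apply Hd].
    + right. field. lra.
Qed.

Lemma binomial_series (al : C) (x : R) :
  Rabs x < 1 -> cseries (fun n => binc al n * RtoC x ^ n)%C (pw (1 + x) al).
Proof.
  intros Hx. set (K := Cmod al + 1). assert (HK : 0 < K) by (unfold K; generalize (Cmod_ge_0 al); lra).
  assert (HKa : Cmod al <= K) by (unfold K; lra).
  set (Sf := fun z => CSer (fun n => binc al n * z ^ n)%C).
  assert (Maj : forall z r n, Cmod z <= r -> Cmod (binc al n * z ^ n)%C <= bb K n * r ^ n).
  { intros z r n Hz. rewrite Cmod_mult, Cmod_pow.
    apply Rmult_le_compat; [apply Cmod_ge_0 | apply pow_le, Cmod_ge_0 | apply Cmod_binc_le, HKa |].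
    apply pow_incr. split; [apply Cmod_ge_0 | exact Hz]. }
  assert (HS : forall z, Cmod z < 1 -> cseries (fun n => binc al n * z ^ n)%C (Sf z)).
  { intros z Hz. assert (P := Cmod_ge_0 z).
    apply (cseries_abs _ (fun n => bb K n * ((Cmod z + 1) / 2) ^ n)).
    - intros n. apply Maj. lra.
    - apply ex_series_bb; lra. }
  set (dl := fun z n => match n with O => RtoC 0 | S k => (binc al (S k) * (RtoC (INR (S k)) * z ^ k))%C end).
  assert (DS : forall z, Cmod z < 1 -> cder Sf z (CSer (dl z)) /\ cseries (dl z) (CSer (dl z))).
  { intros z Hz. assert (P := Cmod_ge_0 z). set (r := (Cmod z + 1) / 2).
    apply (pseries_cder (binc al) (fun n => bb K n * r ^ n) r).
    - unfold r; lra.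
    - intros n. apply Rmult_le_compat_r; [apply pow_le; unfold r; lra | apply Cmod_binc_le, HKa].
    - apply ex_series_bb; [assumption | unfold r; lra].
    - unfold r; lra. }
  (* The coefficient recursion [binc_S], read as a differential equation. *)
  assert (ODE : forall z, Cmod z < 1 -> ((1 + z) * CSer (dl z) = al * Sf z)%C).
  { intros z Hz. destruct (DS z Hz) as [_ S1].
    assert (S2 : cseries (fun k => binc al (S k) * (RtoC (INR (S k)) * z ^ k))%C (CSer (dl z))).
    { apply (cseries_shift (dl z)). unfold dl at 1. rewrite Cplus_0_l. exact S1. }
    assert (S3 := cseries_plus _ _ _ _ S2 (cseries_scal z _ _ S1)).
    assert (S4 := cseries_scal al _ _ (HS z Hz)).
    replace ((1 + z) * CSer (dl z))%C with (CSer (dl z) + z * CSer (dl z))%C by ring.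
    apply (cseries_unique _ _ _ S3). eapply cseries_ext; [|exact S4].
    intros [|n]; cbv beta; unfold dl.
    - assert (B := binc_S al 0). simpl in B. simpl. rewrite Cmult_1_r in *. rewrite B. ring.
    - assert (B := binc_S al (S n)).
      replace (binc al (S (S n)) * (RtoC (INR (S (S n))) * z ^ S n))%C
        with (binc al (S (S n)) * RtoC (INR (S (S n))) * z ^ S n)%C by ring.
      rewrite B. simpl. ring. }
  (* Both sides solve (1 + x) y' = al y, so their quotient is constant. *)
  assert (E : (Sf (RtoC x) * pw (1 + x) (- al) = 1)%C).
  { assert (Bt : forall t, Rmin 0 x <= t <= Rmax 0 x -> Rabs t < 1).
    { intros t Ht. apply Rabs_def2 in Hx. revert Ht. unfold Rmin, Rmax. destruct Rle_dec; intros; apply Rabs_def1; lra. }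
    assert (D : CInt (fun _ => RtoC 0) 0 x = (Sf (RtoC x) * pw (1 + x) (- al) - Sf (RtoC 0) * pw (1 + 0) (- al))%C).
    { apply (CInt_derive (fun t => Sf (RtoC t) * pw (1 + t) (- al))%C); [|intros t _; apply rcont_const].
      intros t Ht. specialize (Bt t Ht). apply Rabs_def2 in Bt.
      assert (R1 : rder RtoC t 1). { apply (rder_hor t 0). }
      assert (Ht1 : Cmod (RtoC t) < 1) by (rewrite Cmod_R; apply Rabs_def1; lra).
      assert (R2 : rder (fun u => Sf (RtoC u)) t (CSer (dl (RtoC t)) * 1)).
      { apply rder_comp; [apply DS, Ht1 | exact R1]. }
      assert (R3 : rder (fun u => RtoC (ln (1 + u))) t (RtoC (/ (1 + t)))).
      { apply is_derive_rder; unfold Re, Im; simpl.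
        - auto_derive; [lra|]. field. lra.
        - apply (is_derive_const (K := R_AbsRing) (V := R_NormedModule)). }
      assert (R4 : rder (fun u => pw (1 + u) (- al)) t (- al * pw (1 + t) (- al) * RtoC (/ (1 + t)))%C).
      { apply (rder_comp (fun w => Cexp (- al * w)) (fun u => RtoC (ln (1 + u)))); [|exact R3].
        eapply cder_eq; [cder_auto|]. unfold pw. ring. }
      assert (R5 : rder (fun u => Sf (RtoC u) * pw (1 + u) (- al))%C t
         (CSer (dl (RtoC t)) * 1 * pw (1 + t) (- al) + Sf (RtoC t) * (- al * pw (1 + t) (- al) * RtoC (/ (1 + t))))%C).
      { apply rder_mult; assumption. }
      replace (RtoC 0) with (CSer (dl (RtoC t)) * 1 * pw (1 + t) (- al) + Sf (RtoC t) * (- al * pw (1 + t) (- al) * RtoC (/ (1 + t))))%C; [exact R5|].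
      assert (O := ODE (RtoC t) Ht1).
      assert (N : (1 + RtoC t <> 0)%C). { rewrite <- RtoC_plus. apply RtoC_neq_0. lra. }
      rewrite RtoC_inv, RtoC_plus by lra.
      replace (CSer (dl (RtoC t))) with (/ (1 + RtoC t) * ((1 + RtoC t) * CSer (dl (RtoC t))))%C by (field; exact N).
      rewrite O. field. exact N. }
    rewrite CInt_const, Cmult_0_r, Rplus_0_r, pw_1_l in D.
    assert (S0 : Sf (RtoC 0) = 1).
    { apply CSer_unique. replace (RtoC 1) with (binc al 0 * RtoC 0 ^ 0)%C.
      - apply (cseries_single (fun n => binc al n * RtoC 0 ^ n)%C). intros n. simpl. ring.
      - unfold binc. simpl. field. }
    rewrite S0 in D.
    replace (Sf (RtoC x) * pw (1 + x) (- al))%C with ((Sf (RtoC x) * pw (1 + x) (- al) - 1 * 1) + 1)%C by ring.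
    rewrite <- D. ring. }
  assert (V : Sf (RtoC x) = pw (1 + x) al).
  { rewrite pw_opp in E. replace (Sf (RtoC x)) with (Sf (RtoC x) * / pw (1 + x) al * pw (1 + x) al)%C by (field; apply pw_neq_0).
    rewrite E. ring. }
  rewrite <- V. apply HS. rewrite Cmod_R. exact Hx.
Qed.

(** * Dirichlet series on half-planes *)

Definition hp (c : R) (s : C) : Prop := c < Re s.

Lemma Re_cdisc a r z : cdisc a r z -> Re a - r < Re z < Re a + r.
Proof.
  intros H. assert (K := re_le_Cmod (z - a)). change (Re (z - a)) with (Re z - Re a) in K.
  unfold cdisc in H. assert (Rabs (Re z - Re a) < r) by lra. apply Rabs_def2 in H0. lra.
Qed.

Lemma hp_disc c s z : hp c s -> cdisc s (Re s - c) z -> hp c z.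
Proof. intros H Hz. apply Re_cdisc in Hz. unfold hp in *. lra. Qed.

Lemma hp_open c : copen (hp c).
Proof. intros s Hs. exists (Re s - c). split; [unfold hp in Hs; lra|]. intros z. apply hp_disc, Hs. Qed.

Lemma hp_convex c : convex_set (hp c).
Proof.
  intros p q t Hp Hq Ht. unfold hp in *.
  replace (Re (p + RtoC t * (q - p))) with (Re p + t * (Re q - Re p)) by (unfold Re; simpl; ring).
  destruct (Rle_dec t (1 / 2)); nra.
Qed.

Lemma Re_plus z w : Re (z + w) = Re z + Re w.
Proof. reflexivity. Qed.

Lemma Re_opp z : Re (- z) = - Re z.
Proof. reflexivity. Qed.

Lemma Re_minus z w : Re (z - w) = Re z - Re w.
Proof. reflexivity. Qed.

Lemma Re_RtoC x : Re (RtoC x) = x.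
Proof. reflexivity. Qed.

Lemma Cmod_pw_S n s : Cmod (pw (INR (S n)) s) = rpow n (Re s).
Proof. apply Cmod_pw. Qed.

(** The coefficient [a n] belongs to the integer [n + 1]. *)
Definition dser (a : nat -> C) (s : C) : C := CSer (fun n => a n * pw (INR (S n)) (- s))%C.

Lemma dirichlet_term_le a n s sigma :
  sigma <= Re s -> Cmod (a n * pw (INR (S n)) (- s))%C <= Cmod (a n) * rpow n (- sigma).
Proof.
  intros H. rewrite Cmod_mult, Cmod_pw_S. apply Rmult_le_compat_l; [apply Cmod_ge_0|].
  apply rpow_le. rewrite Re_opp. lra.
Qed.

Lemma dirichlet_cv a c s :
  (forall sigma, c < sigma -> ex_series (fun n => Cmod (a n) * rpow n (- sigma))) ->
  hp c s -> cseries (fun n => a n * pw (INR (S n)) (- s))%C (dser a s).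
Proof.
  intros H Hs. apply (cseries_abs _ (fun n => Cmod (a n) * rpow n (- Re s))); [|apply H, Hs].
  intros n. apply dirichlet_term_le. lra.
Qed.

Lemma dirichlet_holo a c :
  (forall sigma, c < sigma -> ex_series (fun n => Cmod (a n) * rpow n (- sigma))) ->
  holo_on (hp c) (dser a).
Proof.
  intros H. apply (weierstrass_holo (hp c) (fun n s => a n * pw (INR (S n)) (- s))%C).
  - intros s Hs. unfold hp in Hs. set (r := (Re s - c) / 2).
    exists r, (fun n => Cmod (a n) * rpow n (- (c + r))). split; [unfold r; lra|]. split; [|split].
    + intros z Hz. apply Re_cdisc in Hz. unfold hp. unfold r in Hz. lra.
    + apply H. unfold r; lra.
    + intros n z Hz. apply dirichlet_term_le. apply Re_cdisc in Hz. unfold r in *. lra.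
  - intros n z _. eexists. apply (cder_mult (fun _ => a n)); [apply cder_const|].
    apply (cder_comp (pw (INR (S n))) Copp); [apply cder_pw|]. apply (cder_opp (fun w => w)), cder_id.
Qed.

Lemma dirichlet_bound a s sigma :
  ex_series (fun n => Cmod (a n) * rpow n (- sigma)) -> sigma <= Re s ->
  Cmod (dser a s) <= Series (fun n => Cmod (a n) * rpow n (- sigma)).
Proof.
  intros H Hs.
  apply (cseries_bound (fun n => a n * pw (INR (S n)) (- s))%C); [|exact H|].
  - intros n. apply dirichlet_term_le, Hs.
  - apply (cseries_abs _ (fun n => Cmod (a n) * rpow n (- sigma))); [|exact H]. intros n. apply dirichlet_term_le, Hs.
Qed.

Lemma cseries_odd (v : nat -> C) l :
  (forall i, v (2 * i)%nat = 0) -> cseries v l -> cseries (fun i => v (2 * i + 1)%nat) l.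
Proof.
  intros H0 H eps Heps. destruct (H eps Heps) as [N HN]. exists N. intros n Hn.
  replace (csum (fun i => v (2 * i + 1)%nat) n) with (csum v (2 * n)); [apply HN; lia|].
  clear - H0. induction n as [|n IH]; [reflexivity|]. replace (2 * S n)%nat with (S (S (2 * n))) by lia.
  cbn [csum]. rewrite IH, H0. replace (S (2 * n)) with (2 * n + 1)%nat by lia. ring.
Qed.

Lemma cseries_even (v : nat -> C) l :
  (forall i, v (2 * i + 1)%nat = 0) -> cseries v l -> cseries (fun i => v (2 * i)%nat) l.
Proof.
  intros H0 H eps Heps. destruct (H eps Heps) as [N HN]. exists N. intros n Hn.
  replace (csum (fun i => v (2 * i)%nat) n) with (csum v (2 * n)); [apply HN; lia|].
  clear - H0. induction n as [|n IH]; [reflexivity|]. replace (2 * S n)%nat with (S (S (2 * n))) by lia.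
  cbn [csum]. rewrite IH. replace (S (2 * n)) with (2 * n + 1)%nat by lia. rewrite H0. ring.
Qed.

(** * Continuation by a recursion with step two *)

Definition sh (j : nat) : C := RtoC (INR (2 * j + 2)).

Lemma Re_sh s j : Re (s + sh j) = Re s + 2 * INR j + 2.
Proof. rewrite Re_plus. unfold sh. rewrite Re_RtoC, plus_INR, mult_INR. simpl INR. ring. Qed.

Lemma CSer_ext u v : (forall n, u n = v n) -> CSer u = CSer v.
Proof. intros H. f_equal. apply functional_extensionality, H. Qed.

Lemma holo_csum (U : C -> Prop) (u : nat -> C -> C) n :
  (forall k, (k < n)%nat -> holo_on U (u k)) -> holo_on U (fun z => csum (fun k => u k z) n).
Proof.
  intros H. induction n as [|n IH]; intros z Hz; simpl.
  - eexists; apply cder_const.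
  - destruct (IH (fun k Hk => H k (Nat.lt_lt_succ_r _ _ Hk)) z Hz) as [l Hl].
    destruct (H n (Nat.lt_succ_diag_r n) z Hz) as [m Hm]. eexists. apply cder_plus; eassumption.
Qed.

Section Continuation.

Variables (c : R) (good : C -> Prop) (Phi0 A : C -> C) (q : nat -> C -> C).
Hypothesis good_shift : forall s j, good s -> good (s + sh j)%C.
Hypothesis A_holo : holo_on good A.
Hypothesis q_holo : forall j s, exists l, cder (q j) s l.
Hypothesis Phi0_holo : holo_on (hp c) Phi0.
Hypothesis Phi0_rec : forall s, hp c s -> cseries (fun j => q j s * Phi0 (s + sh j))%C (Phi0 s - A s).
Hypothesis Phi0_maj : forall K, exists J M, ex_series M /\ forall s j, Cmod s <= K -> (J <= j)%nat ->
  hp c (s + sh j) /\ Cmod (q j s * Phi0 (s + sh j))%C <= M j.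

(** Stage [N] carries the intended value for [Re s > c - 2 * INR N]: every shift is at least 2, so
    each use of the recursion gains a strip of width two. *)
Fixpoint PhiN (N : nat) : C -> C :=
  match N with
  | O => Phi0
  | S k => fun s => (A s + CSer (fun j => q j s * PhiN k (s + sh j)))%C
  end.

Lemma PhiN_step N s : hp (c - 2 * INR N) s -> PhiN (S N) s = PhiN N s.
Proof.
  revert s. induction N as [|N IH]; intros s Hs.
  - simpl in Hs. rewrite Rmult_0_r, Rminus_0_r in Hs. simpl. rewrite (CSer_unique _ _ (Phi0_rec s Hs)). ring.
  - cbn [PhiN]. f_equal. apply CSer_ext. intros j. f_equal. apply IH.
    unfold hp in *. rewrite Re_sh. rewrite S_INR in Hs. generalize (pos_INR j). lra.
Qed.

Lemma PhiN_le N k s : hp (c - 2 * INR N) s -> PhiN (N + k) s = PhiN N s.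
Proof.
  intros Hs. induction k as [|k IH]; [rewrite Nat.add_0_r; reflexivity|].
  rewrite Nat.add_succ_r, PhiN_step; [exact IH|]. unfold hp in *. rewrite plus_INR. generalize (pos_INR k). lra.
Qed.

Lemma PhiN_0 N s : hp c s -> PhiN N s = Phi0 s.
Proof. intros Hs. apply (PhiN_le 0 N). simpl. rewrite Rmult_0_r, Rminus_0_r. exact Hs. Qed.

(** On a bounded set all but finitely many shifted arguments lie in the original half-plane. The
    tail is therefore holomorphic outright, and singularities can come only from [A] and from
    finitely many first terms. *)
Lemma tail_holo K : exists J, (forall s, Cmod s <= K -> forall j, (J <= j)%nat -> hp c (s + sh j)) /\
  (forall s, Cmod s <= K -> cseries (fun j => q (J + j)%nat s * Phi0 (s + sh (J + j)))%C
                              (CSer (fun j => q (J + j)%nat s * Phi0 (s + sh (J + j)))%C)) /\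
  holo_on (fun s => Cmod s < K) (fun s => CSer (fun j => q (J + j)%nat s * Phi0 (s + sh (J + j)))%C).
Proof.
  destruct (Phi0_maj K) as [J [M [HM HJ]]]. exists J. split; [|split].
  - intros s Hs j Hj. apply (HJ s j Hs Hj).
  - intros s Hs. apply (cseries_abs _ (fun j => M (J + j)%nat)); [|apply ex_series_shift_n, HM].
    intros j. apply HJ; [exact Hs|lia].
  - apply (weierstrass_holo _ (fun j s => q (J + j)%nat s * Phi0 (s + sh (J + j)))%C).
    + intros s Hs. exists (K - Cmod s), (fun j => M (J + j)%nat).
      assert (In : forall z, cdisc s (K - Cmod s) z -> Cmod z < K).
      { intros z Hz. unfold cdisc in Hz. generalize (Cmod_triangle_rev z s). lra. }
      split; [lra|]. split; [exact In|]. split; [apply ex_series_shift_n, HM|].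
      intros j z Hz. apply HJ; [left; apply In, Hz | lia].
    + intros j s Hs. destruct (q_holo (J + j) s) as [l Hl].
      destruct (Phi0_holo (s + sh (J + j))%C) as [m Hm]; [apply HJ; [left; exact Hs|lia]|].
      eexists. apply cder_mult; [exact Hl|].
      apply (cder_comp Phi0 (fun w => w + sh (J + j))%C); [exact Hm|]. cder_auto.
Qed.

Lemma PhiN_cseries N s :
  cseries (fun j => q j s * PhiN N (s + sh j))%C (CSer (fun j => q j s * PhiN N (s + sh j))%C).
Proof.
  destruct (tail_holo (Cmod s)) as [J [HJ [HS _]]].
  eapply CSer_correct. eapply (cseries_shift_n _ _ J).
  eapply cseries_ext; [|apply (HS s (Rle_refl _))].
  intros j. cbv beta. rewrite PhiN_0; [reflexivity|]. apply HJ; [lra|lia].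
Qed.

Lemma PhiN_split N K J : (forall s, Cmod s <= K -> forall j, (J <= j)%nat -> hp c (s + sh j)) ->
  (forall s, Cmod s <= K -> cseries (fun j => q (J + j)%nat s * Phi0 (s + sh (J + j)))%C
                              (CSer (fun j => q (J + j)%nat s * Phi0 (s + sh (J + j)))%C)) ->
  forall s, Cmod s <= K -> CSer (fun j => q j s * PhiN N (s + sh j))%C =
    (csum (fun j => q j s * PhiN N (s + sh j))%C J + CSer (fun j => q (J + j)%nat s * Phi0 (s + sh (J + j)))%C)%C.
Proof.
  intros HJ HS s Hs. apply CSer_unique. apply cseries_shift_n.
  eapply cseries_ext; [|apply (HS s Hs)].
  intros j. cbv beta. rewrite PhiN_0; [reflexivity|]. apply HJ; [assumption|lia].
Qed.

Lemma PhiN_holo N : holo_on (fun s => good s /\ hp (c - 2 * INR N) s) (PhiN N).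
Proof.
  induction N as [|N IH]; intros s [Hg Hs].
  - apply Phi0_holo. simpl in Hs. rewrite Rmult_0_r, Rminus_0_r in Hs. exact Hs.
  - cbn [PhiN]. set (K := Cmod s + 1).
    destruct (tail_holo K) as [J [HJ [HS HH]]].
    destruct (A_holo s Hg) as [la Ha].
    destruct (HH s ltac:(unfold K; lra)) as [lt Ht].
    assert (Hf : exists lf, cder (fun z => csum (fun j => q j z * PhiN N (z + sh j))%C J) s lf).
    { apply (holo_csum (fun z => z = s) (fun j z => q j z * PhiN N (z + sh j))%C J); [|reflexivity].
      intros j _ z ->. destruct (q_holo j s) as [l Hl].
      destruct (IH (s + sh j)%C) as [m Hm].
      { split; [apply good_shift, Hg|]. unfold hp in *. rewrite Re_sh. rewrite S_INR in Hs. generalize (pos_INR j). lra. }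
      eexists. apply cder_mult; [exact Hl|].
      apply (cder_comp (PhiN N) (fun w => w + sh j)%C); [exact Hm|]. cder_auto. }
    destruct Hf as [lf Hf]. eexists.
    apply (cder_ext_loc (fun z => A z + (csum (fun j => q j z * PhiN N (z + sh j)) J
        + CSer (fun j => q (J + j)%nat z * Phi0 (z + sh (J + j)))))%C).
    + exists 1. split; [lra|]. intros w Hw. f_equal. symmetry. apply (PhiN_split N K J HJ HS).
      unfold K. generalize (Cmod_triangle_rev w s). lra.
    + apply cder_plus; [exact Ha|]. apply cder_plus; eassumption.
Qed.

Lemma continuation : exists Phi, (forall s, hp c s -> Phi s = Phi0 s) /\ holo_on good Phi /\
  forall s, cseries (fun j => q j s * Phi (s + sh j))%C (Phi s - A s).
Proof.
  assert (EN : forall s, exists N, hp (c - 2 * INR N) s).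
  { intros s. destruct (INR_unbounded ((c - Re s) / 2)) as [N HN]. exists N. unfold hp. lra. }
  (* The stage is chosen point by point; by [PhiN_le] the value does not depend on it, so near a
     given point a constant stage may be used. *)
  set (Nn := fun s => proj1_sig (constructive_indefinite_description _ (EN s))).
  assert (HN : forall s, hp (c - 2 * INR (Nn s)) s) by (intros s; exact (proj2_sig (constructive_indefinite_description _ (EN s)))).
  assert (Ind : forall s N, hp (c - 2 * INR N) s -> PhiN (Nn s) s = PhiN N s).
  { intros s N H. rewrite <- (PhiN_le N (Nn s) s H), Nat.add_comm. symmetry. apply PhiN_le, HN. }
  exists (fun s => PhiN (Nn s) s). split; [|split].
  - intros s Hs. apply PhiN_0, Hs.
  - intros s Hs. destruct (PhiN_holo (Nn s) s (conj Hs (HN s))) as [l Hl]. exists l.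
    apply (cder_ext_loc (PhiN (Nn s))); [|exact Hl].
    destruct (hp_open _ s (HN s)) as [r [Hr HrU]]. exists r. split; [assumption|].
    intros w Hw. symmetry. apply Ind. apply HrU, Hw.
  - intros s. set (N := Nn s).
    assert (H1 := PhiN_cseries N s).
    rewrite <- (PhiN_step N s (HN s)). cbn [PhiN].
    match goal with |- cseries _ ?l => replace l with (CSer (fun j => q j s * PhiN N (s + sh j))%C) by ring end.
    eapply cseries_ext; [|exact H1]. intros j. cbv beta. f_equal. symmetry. apply Ind.
    generalize (HN s). unfold hp. fold N. rewrite Re_sh. generalize (pos_INR j). lra.
Qed.

End Continuation.

(** * The Riemann zeta function *)

Definition zeta0 : C -> C := dser (fun _ => RtoC 1).

Lemma ex_series_one_rpow sigma : 1 < sigma -> ex_series (fun n => Cmod (RtoC 1) * rpow n (- sigma)).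
Proof. intros H. apply ex_series_Rscal, ex_series_rpow, H. Qed.

Lemma zeta0_cv s : hp 1 s -> cseries (fun n => pw (INR (S n)) (- s)) (zeta0 s).
Proof.
  intros H. eapply cseries_ext; [|apply (dirichlet_cv (fun _ => RtoC 1) 1 s ex_series_one_rpow H)].
  intros n. apply Cmult_1_l.
Qed.

Lemma zeta0_holo : holo_on (hp 1) zeta0.
Proof. apply dirichlet_holo, ex_series_one_rpow. Qed.

Lemma zeta0_bound s : 2 <= Re s -> Cmod (zeta0 s) <= Series (fun n => Cmod (RtoC 1) * rpow n (- (2))).
Proof. intros H. apply (dirichlet_bound _ s 2); [apply ex_series_one_rpow; lra | exact H]. Qed.

(** The last factor [1 - s - sh j] of the falling factorial of length [2 * j + 3] is minus the
    factor [s + sh j - 1] carried by [zPhi0 (s + sh j)]. Hence the length [2 * j + 2] beside the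
    factorial of [2 * j + 3]. *)
Definition zq (j : nat) (s : C) : C :=
  (- (ff (1 - s) (2 * j + 2) * RtoC (/ (2 ^ (2 * j + 2) * INR (fact (2 * j + 3))))))%C.

Definition zPhi0 (s : C) : C := ((s - 1) * zeta0 s)%C.

Lemma cder_ff (n : nat) (z : C) : exists l, cder (fun w => ff w n) z l.
Proof.
  induction n as [|n [l Hl]]; simpl; [eexists; apply cder_const|].
  eexists. apply cder_mult; [exact Hl|]. cder_auto.
Qed.

Lemma zq_holo j s : exists l, cder (zq j) s l.
Proof.
  destruct (cder_ff (2 * j + 2) (1 - s)) as [l Hl]. eexists. unfold zq.
  apply (cder_opp (fun s => ff (1 - s) (2 * j + 2) * _)%C).
  apply (cder_mult (fun s => ff (1 - s) (2 * j + 2))%C (fun _ => _)); [|apply cder_const].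
  apply (cder_comp (fun w => ff w (2 * j + 2)) (fun s => 1 - s)%C); [exact Hl|]. cder_auto.
Qed.

Lemma ex_series_bb_even K x : 0 < K -> 0 < x < 1 -> ex_series (fun j => bb K (2 * j + 2) * x ^ (2 * j + 2)).
Proof.
  intros HK Hx.
  assert (H : ex_series (fun j => (fun n => bb K n * x ^ n) (2 * (1 + j))%nat)).
  { apply (ex_series_shift_n (fun j => bb K (2 * j) * x ^ (2 * j)) 1).
    apply (ex_series_double (fun n => bb K n * x ^ n)); [|apply ex_series_bb; assumption].
    intros n. apply Rmult_le_pos; [left; apply bb_pos, HK | apply pow_le; lra]. }
  eapply ex_series_ext; [|exact H]. intros j. cbv beta. replace (2 * (1 + j))%nat with (2 * j + 2)%nat by lia. reflexivity.
Qed.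

Lemma zPhi0_maj K : exists J M, ex_series M /\ forall s j, Cmod s <= K -> (J <= j)%nat ->
  hp 1 (s + sh j) /\ Cmod (zq j s * zPhi0 (s + sh j))%C <= M j.
Proof.
  (* Beyond [J] the shifted argument has real part at least 2, where [zeta0] is bounded. *)
  destruct (INR_unbounded (Rabs K)) as [J HJ].
  set (K' := Rabs K + 1). assert (HK' : 0 < K') by (unfold K'; generalize (Rabs_pos K); lra).
  set (B := Series (fun n => Cmod (RtoC 1) * rpow n (- (2)))).
  exists J, (fun j => K' * B * (bb (K' + 1) (2 * j + 2) * (/ 2) ^ (2 * j + 2))). split.
  - apply (ex_series_Rscal (K' * B)), ex_series_bb_even; lra.
  - intros s j Hs Hj.
    assert (Hs' : Cmod s <= Rabs K) by (apply Rle_trans with (1 := Hs), Rle_abs).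
    assert (Hre : 2 <= Re (s + sh j)).
    { rewrite Re_sh. assert (INR J <= INR j) by (apply le_INR, Hj).
      generalize (re_le_Cmod s) (Rle_abs (- Re s)) (pos_INR j). rewrite Rabs_Ropp. lra. }
    split; [unfold hp; lra|].
    unfold zq, zPhi0. rewrite !Cmod_mult, Cmod_opp, Cmod_mult.
    assert (H1 : Cmod (1 - s) <= K').
    { apply Rle_trans with (1 := Cmod_triangle_minus _ _). rewrite Cmod_1. unfold K'; lra. }
    assert (H2 := Cmod_ff_le (1 - s) K' (2 * j + 2) H1).
    assert (H3 : Cmod (s + sh j - 1) <= K' + INR (2 * j + 2)).
    { replace (s + sh j - 1)%C with (sh j - (1 - s))%C by ring.
      apply Rle_trans with (1 := Cmod_triangle_minus _ _). unfold sh. rewrite Cmod_R, Rabs_pos_eq by apply pos_INR. lra. }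
    assert (H4 := zeta0_bound _ Hre). fold B in H4.
    assert (PB : 0 <= B) by (apply Rle_trans with (2 := H4), Cmod_ge_0).
    assert (F1 : 0 < INR (fact (2 * j + 2))) by apply INR_fact_lt_0.
    assert (F2 : INR (fact (2 * j + 2)) <= INR (fact (2 * j + 3))) by (apply le_INR, fact_le; lia).
    assert (P2 : 0 < 2 ^ (2 * j + 2)) by (apply pow_lt; lra).
    rewrite Cmod_R, Rabs_pos_eq by (left; apply Rinv_0_lt_compat, Rmult_lt_0_compat; lra).
    assert (PB' := bb_pos K' (2 * j + 2) HK').
    apply Rle_trans with (bb K' (2 * j + 2) * INR (fact (2 * j + 2)) * / (2 ^ (2 * j + 2) * INR (fact (2 * j + 2)))
       * ((K' + INR (2 * j + 2)) * B)).
    + apply Rmult_le_compat.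
      * apply Rmult_le_pos; [apply Cmod_ge_0 | left; apply Rinv_0_lt_compat, Rmult_lt_0_compat; lra].
      * apply Rmult_le_pos; apply Cmod_ge_0.
      * apply Rmult_le_compat; [apply Cmod_ge_0 | left; apply Rinv_0_lt_compat, Rmult_lt_0_compat; lra | exact H2 |].
        apply Rinv_le_contravar; [apply Rmult_lt_0_compat; lra|]. apply Rmult_le_compat_l; lra.
      * apply Rmult_le_compat; try apply Cmod_ge_0; assumption.
    + right.
      replace (K' * B * (bb (K' + 1) (2 * j + 2) * (/ 2) ^ (2 * j + 2)))
        with (K' * bb (K' + 1) (2 * j + 2) * B * (/ 2) ^ (2 * j + 2)) by ring.
      rewrite <- bb_raise by assumption. rewrite pow_inv. field. lra.
Qed.

Lemma cseries_telescope (g : nat -> C) (l : C) :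
  (forall eps, 0 < eps -> exists N, forall n, (N <= n)%nat -> Cmod (g n - l) < eps) ->
  cseries (fun n => g n - g (S n))%C (g O - l).
Proof.
  intros H eps Heps. destruct (H eps Heps) as [N HN]. exists N. intros n Hn.
  replace (csum (fun n => g n - g (S n))%C n) with (g O - g n)%C.
  - replace (g O - g n - (g O - l))%C with (- (g n - l))%C by ring. rewrite Cmod_opp. apply HN, Hn.
  - clear. induction n as [|n IH]; simpl; [ring|]. rewrite <- IH. ring.
Qed.

Lemma pw_tends_0 (a : R) (w : C) : 0 < a -> 0 < Re w ->
  forall eps, 0 < eps -> exists N, forall n, (N <= n)%nat -> Cmod (pw (INR n + a) (- w) - 0) < eps.
Proof.
  intros Ha Hw eps Heps.
  destruct (INR_unbounded (exp (- ln eps / Re w))) as [N HN]. exists N. intros n Hn.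
  replace (pw (INR n + a) (- w) - 0)%C with (pw (INR n + a) (- w)) by ring.
  rewrite Cmod_pw, Re_opp. rewrite <- (exp_ln eps) at 1 by assumption. apply exp_increasing.
  assert (INR N <= INR n) by (apply le_INR, Hn).
  assert (L : - ln eps / Re w < ln (INR n + a)).
  { rewrite <- (ln_exp (- ln eps / Re w)). apply ln_increasing; [apply exp_pos | lra]. }
  apply (Rmult_lt_compat_r (Re w)) in L; [|assumption].
  replace (- ln eps / Re w * Re w) with (- ln eps) in L by (field; lra). lra.
Qed.

Lemma ex_series_bb_odd K x : 0 < K -> 0 < x < 1 -> ex_series (fun j => bb K (2 * j + 1) * x ^ (2 * j + 1)).
Proof.
  intros HK Hx.
  assert (H : ex_series (fun j => (fun n => bb K (1 + n) * x ^ (1 + n)) (2 * j)%nat)).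
  { apply (ex_series_double (fun n => bb K (1 + n) * x ^ (1 + n))).
    - intros n. apply Rmult_le_pos; [left; apply bb_pos, HK | apply pow_le; lra].
    - apply (ex_series_shift_n (fun n => bb K n * x ^ n) 1), ex_series_bb; assumption. }
  eapply ex_series_ext; [|exact H]. intros j. cbv beta. replace (1 + 2 * j)%nat with (2 * j + 1)%nat by lia. reflexivity.
Qed.

Lemma Cpow_m1_even i : (RtoC (-1) ^ (2 * i) = 1)%C.
Proof. rewrite Cpow_mult_r. replace (RtoC (-1) ^ 2)%C with (RtoC 1) by (rewrite <- RtoC_pow; f_equal; ring). apply Cpow_1_l. Qed.

Lemma Cpow_m1_odd i : (RtoC (-1) ^ (2 * i + 1) = RtoC (-1))%C.
Proof. rewrite Cpow_add_r, Cpow_m1_even, Cpow_1_r, Cmult_1_l. reflexivity. Qed.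

Lemma RtoC_opp_pow x n : (RtoC (- x) ^ n = RtoC (-1) ^ n * RtoC x ^ n)%C.
Proof. rewrite <- Cpow_mult_l, <- RtoC_mult. f_equal. f_equal. ring. Qed.

Lemma odd_binomial (al : C) (x : R) : 0 < x < 1 ->
  cseries (fun i => - (2) * binc al (2 * i + 1) * RtoC x ^ (2 * i + 1))%C (pw (1 - x) al - pw (1 + x) al).
Proof.
  intros Hx.
  assert (S1 := binomial_series al (- x) ltac:(rewrite Rabs_Ropp, Rabs_pos_eq; lra)).
  assert (S2 := binomial_series al x ltac:(rewrite Rabs_pos_eq; lra)).
  assert (S3 := cseries_minus _ _ _ _ S1 S2). cbv beta in S3.
  apply (cseries_odd (fun n => binc al n * RtoC (- x) ^ n - binc al n * RtoC x ^ n)%C) in S3.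
  - replace (1 + - x) with (1 - x) in S3 by ring. eapply cseries_ext; [|exact S3].
    intros i. cbv beta. rewrite RtoC_opp_pow, Cpow_m1_odd.
    replace (RtoC (-1)) with (- (1))%C by (rewrite <- RtoC_opp; reflexivity). ring.
  - intros i. rewrite RtoC_opp_pow, Cpow_m1_even. ring.
Qed.

(** With [w = s - 1], the sum of [(n - 1/2)^(-w) - (n + 1/2)^(-w)] over [n >= 1] telescopes to
    [2^w]. Expanding each difference in powers of [1 / (2 n)] and summing over [n] first gives the
    recursion. The midpoints are symmetric about [n], so only odd powers survive and the shifts are
    even. *)
Lemma zPhi0_rec s : hp 1 s -> cseries (fun j => zq j s * zPhi0 (s + sh j))%C (zPhi0 s - pw 2 (s - 1)).
Proof.
  intros Hs. set (w := (s - 1)%C).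
  assert (Hw : 0 < Re w) by (unfold w; rewrite Re_minus, Re_RtoC; unfold hp in Hs; lra).
  set (K := Cmod w + 1). assert (HK : 0 < K) by (unfold K; generalize (Cmod_ge_0 w); lra).
  assert (HKw : Cmod (- w) <= K) by (rewrite Cmod_opp; unfold K; lra).
  set (u := fun n i => (- (2) * binc (- w) (2 * i + 1) * RtoC (/ (2 * INR (S n))) ^ (2 * i + 1) * pw (INR (S n)) (- w))%C).
  set (g := fun n => pw (INR n + / 2) (- w)).
  (* Column [i], summed over [n], is a multiple of zeta at [w + 2 i + 1]; column 0 is [zPhi0 s]
     itself. *)
  set (cc := fun i => (- (2) * binc (- w) (2 * i + 1) * RtoC ((/ 2) ^ (2 * i + 1)) * zeta0 (w + RtoC (INR (2 * i + 1))))%C).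
  assert (Hr : forall n, cseries (fun i => u n i) (g n - g (S n))%C).
  { intros n. assert (P := INR_S_pos n). assert (Q := pos_INR n).
    assert (Hx : 0 < / (2 * INR (S n)) < 1).
    { split; [apply Rinv_0_lt_compat; lra|]. rewrite <- Rinv_1. apply Rinv_lt_contravar; rewrite S_INR; lra. }
    assert (H := cseries_scal (pw (INR (S n)) (- w)) _ _ (odd_binomial (- w) _ Hx)).
    unfold g. replace (INR n + / 2) with (INR (S n) * (1 - / (2 * INR (S n)))) by (rewrite S_INR in *; field; lra).
    replace (INR (S n) + / 2) with (INR (S n) * (1 + / (2 * INR (S n)))) by (field; lra).
    rewrite !pw_mult by lra.
    match goal with |- cseries _ ?l => replace l with (pw (INR (S n)) (- w) * (pw (1 - / (2 * INR (S n))) (- w) - pw (1 + / (2 * INR (S n))) (- w)))%C by ring end.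
    eapply cseries_ext; [|exact H]. intros i. unfold u. cbv beta. ring. }
  assert (Eu : forall n i, u n i = (- (2) * binc (- w) (2 * i + 1) * RtoC ((/ 2) ^ (2 * i + 1)) * pw (INR (S n)) (- (w + RtoC (INR (2 * i + 1)))))%C).
  { intros n i. unfold u. assert (P := INR_S_pos n).
    replace (- (w + RtoC (INR (2 * i + 1))))%C with (- w + - RtoC (INR (2 * i + 1)))%C by ring.
    rewrite pw_add, (pw_opp _ (RtoC (INR (2 * i + 1)))), pw_nat by assumption. rewrite <- Cpow_inv by (apply RtoC_neq_0; lra).
    rewrite Rinv_mult, RtoC_mult, Cpow_mult_l, RtoC_pow, (RtoC_inv (INR (S n))) by lra. ring. }
  assert (Hc : forall i, cseries (fun n => u n i) (cc i)).
  { intros i. eapply cseries_ext; [intros n; symmetry; apply Eu|]. apply cseries_scal, zeta0_cv.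
    unfold hp. rewrite Re_plus, Re_RtoC, plus_INR, mult_INR. simpl INR. generalize (pos_INR i). lra. }
  set (a := fun n => rpow n (- (Re w + 1))).
  set (b := fun i => 2 * (bb K (2 * i + 1) * (/ 2) ^ (2 * i + 1))).
  assert (Ha : ex_series a) by (apply ex_series_rpow; lra).
  assert (Hb : ex_series b) by (apply (ex_series_Rscal 2), ex_series_bb_odd; lra).
  assert (Pa : forall n, 0 <= a n) by (intros; left; apply rpow_pos).
  assert (Pb : forall i, 0 <= b i).
  { intros i. unfold b. apply Rmult_le_pos; [lra|]. apply Rmult_le_pos; [left; apply bb_pos, HK | apply pow_le; lra]. }
  assert (C2 : Cmod (- (2)) = 2) by (rewrite Cmod_opp, Cmod_R, Rabs_pos_eq; lra).
  assert (Hub : forall n i, Cmod (u n i) <= a n * b i).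
  { intros n i. rewrite Eu. rewrite !Cmod_mult, C2, Cmod_pw_S, Cmod_R, Rabs_pos_eq by (apply pow_le; lra).
    replace (a n * b i) with (2 * bb K (2 * i + 1) * (/ 2) ^ (2 * i + 1) * a n) by (unfold b; ring).
    assert (0 < (/ 2) ^ (2 * i + 1)) by (apply pow_lt; lra).
    apply Rmult_le_compat.
    - repeat apply Rmult_le_pos; try lra. apply Cmod_ge_0.
    - left; apply rpow_pos.
    - apply Rmult_le_compat_r; [lra|]. apply Rmult_le_compat_l; [lra|]. apply Cmod_binc_le, HKw.
    - unfold a. apply rpow_le. rewrite Re_opp, Re_plus, Re_RtoC, plus_INR, mult_INR. simpl INR. generalize (pos_INR i). lra. }
  assert (Hcc : cseries cc (CSer cc)).
  { apply (cseries_abs cc (fun i => Series a * b i)); [|apply (ex_series_Rscal (Series a)), Hb].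
    intros i. rewrite <- Series_scal_r.
    apply (cseries_bound (fun n => u n i)); [intros n; apply Hub | apply (ex_series_scal_r (b i)), Ha | apply Hc]. }
  assert (Hsw := cseries_swap u a b _ cc _ Hub Ha Hb Pa Pb Hr Hc Hcc).
  assert (Tel := cseries_telescope g 0 (pw_tends_0 (/ 2) w ltac:(lra) Hw)).
  assert (E : CSer cc = pw 2 w).
  { rewrite (cseries_unique _ _ _ Hsw Tel). unfold g. simpl INR. rewrite Rplus_0_l, pw_inv_l by lra.
    replace (- - w)%C with w by ring. ring. }
  rewrite E in Hcc.
  assert (E0 : cc O = zPhi0 s).
  { unfold cc, zPhi0. simpl. unfold binc. simpl. fold w.
    replace (w + 1)%C with s by (unfold w; ring). rewrite Rmult_1_r, RtoC_inv by lra. field. }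
  assert (Hsh : cseries (fun j => cc (S j)) (pw 2 w - zPhi0 s)).
  { apply cseries_shift. rewrite E0. replace (zPhi0 s + (pw 2 w - zPhi0 s))%C with (pw 2 w) by ring. exact Hcc. }
  apply (cseries_scal (- (1))) in Hsh.
  replace (zPhi0 s - pw 2 w)%C with (- (1) * (pw 2 w - zPhi0 s))%C by ring.
  eapply cseries_ext; [|exact Hsh]. intros j. unfold cc, zq, zPhi0.
  replace (2 * S j + 1)%nat with (S (2 * j + 2)) by lia. replace (2 * j + 3)%nat with (S (2 * j + 2)) by lia.
  replace (w + RtoC (INR (S (2 * j + 2))))%C with (s + sh j)%C by (unfold w, sh; rewrite S_INR, RtoC_plus; ring).
  unfold binc. replace (- w)%C with (1 - s)%C by (unfold w; ring).
  change (ff (1 - s) (S (2 * j + 2))) with (ff (1 - s) (2 * j + 2) * (1 - s - sh j))%C.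
  set (F := ff (1 - s) (2 * j + 2)). set (N := INR (fact (S (2 * j + 2)))).
  assert (HN : N <> 0) by apply INR_fact_neq_0.
  assert (P2 : 2 ^ (2 * j + 2) <> 0) by (apply pow_nonzero; lra).
  rewrite Rinv_mult, pow_inv, RtoC_mult. simpl pow.
  rewrite Rinv_mult, RtoC_mult.
  rewrite (RtoC_inv N), (RtoC_inv 2) by (try assumption; lra).
  set (p := RtoC (/ 2 ^ (2 * j + 2))). field. apply RtoC_neq_0, HN.
Qed.

Lemma zeta_numerator : exists F : C -> C,
  (forall s, hp 1 s -> F s = ((s - 1) * zeta0 s)%C) /\ (forall s, exists l, cder F s l) /\
  forall s, cseries (fun j => zq j s * F (s + sh j))%C (F s - pw 2 (s - 1)).
Proof.
  destruct (continuation 1 (fun _ => True) zPhi0 (fun s => pw 2 (s - 1)) zq) as [F [H1 [H2 H3]]].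
  - tauto.
  - intros s _. eexists. apply (cder_comp (pw 2) (fun s => s - 1)%C); [apply cder_pw|]. cder_auto.
  - apply zq_holo.
  - intros s Hs. destruct (zeta0_holo s Hs) as [l Hl]. eexists. unfold zPhi0. apply cder_mult; [cder_auto | exact Hl].
  - apply zPhi0_rec.
  - apply zPhi0_maj.
  - exists F. split; [exact H1|]. split; [intros s; apply H2, I | exact H3].
Qed.

(* The entire function (s - 1) zeta(s). *)
Definition zF : C -> C := proj1_sig (constructive_indefinite_description _ zeta_numerator).

Lemma zF_zeta0 s : hp 1 s -> zF s = ((s - 1) * zeta0 s)%C.
Proof. apply (proj2_sig (constructive_indefinite_description _ zeta_numerator)). Qed.

Lemma zF_entire s : exists l, cder zF s l.
Proof. apply (proj2_sig (constructive_indefinite_description _ zeta_numerator)). Qed.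

Lemma zF_rec s : cseries (fun j => zq j s * zF (s + sh j))%C (zF s - pw 2 (s - 1)).
Proof. apply (proj2_sig (constructive_indefinite_description _ zeta_numerator)). Qed.

(** * Identification of [zeta] with the constructed continuation *)

Lemma holomorphic_at_iff f a :
  holomorphic_at f a <-> exists d, 0 < d /\ holo_on (cdisc a d) f.
Proof.
  unfold holomorphic_at. rewrite locally_Cmod. split; intros [d [Hd H]]; exists d; split; try assumption; intros w Hw.
  - destruct (H w Hw) as [l Hl]. exists l. apply cder_is_derive, Hl.
  - destruct (H w Hw) as [l Hl]. exists l. apply cder_is_derive, Hl.
Qed.

Lemma Cminus_neq_0 (x y : C) : x <> y -> (x - y)%C <> 0.
Proof. apply Cminus_eq_contra. Qed.

(** The choice operator only asks for a witness, here [zF s / (s - 1)]; that the chosen function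
    agrees with it away from 1 is the content of [zeta_zF]. *)
Lemma zeta_spec : is_riemann_zeta zeta.
Proof.
  unfold zeta. apply epsilon_spec. exists (fun s => zF s / (s - 1))%C. split.
  - intros s Hs. apply holomorphic_at_iff. apply Cminus_neq_0, Cmod_gt_0 in Hs.
    exists (Cmod (s - 1)). split; [assumption|]. intros w Hw.
    assert (Hw1 : (w - 1 <> 0)%C).
    { intros E. unfold cdisc in Hw. replace (w - s)%C with ((w - 1) - (s - 1))%C in Hw by ring.
      rewrite E in Hw. replace (0 - (s - 1))%C with (- (s - 1))%C in Hw by ring. rewrite Cmod_opp in Hw. lra. }
    destruct (zF_entire w) as [l Hl]. eexists. cder_auto; exact Hw1.
  - intros s Hs. apply cseries_is_series. rewrite zF_zeta0 by exact Hs.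
    replace ((s - 1) * zeta0 s / (s - 1))%C with (zeta0 s).
    + eapply cseries_ext; [|apply zeta0_cv, Hs]. intros n. rewrite Cmult_1_l. reflexivity.
    + field. apply Cminus_neq_0. intros ->. rewrite Re_RtoC in Hs. lra.
Qed.

Lemma zeta_zeta0 s : hp 1 s -> zeta s = zeta0 s.
Proof.
  intros Hs. apply (cseries_unique (fun n => pw (INR (S n)) (- s))).
  - assert (H := proj2 zeta_spec s Hs). apply cseries_is_series in H.
    eapply cseries_ext; [|exact H]. intros n. cbv beta. rewrite Cmult_1_l. reflexivity.
  - apply zeta0_cv, Hs.
Qed.

(** Open half-planes with 1 on the boundary: convex, free of the pole, and, for the directions used
    below, meeting the region of convergence. *)
Definition hplane (al be : R) (s : C) : Prop := 0 < al * (Re s - 1) + be * Im s.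

Lemma hplane_open al be : copen (hplane al be).
Proof.
  intros s Hs. unfold hplane in *. set (v := al * (Re s - 1) + be * Im s) in *.
  set (K := Rabs al + Rabs be + 1). assert (HK : 0 < K) by (unfold K; generalize (Rabs_pos al) (Rabs_pos be); lra).
  exists (v / K). split; [apply Rdiv_lt_0_compat; assumption|]. intros z Hz. unfold cdisc in Hz.
  assert (H1 := re_le_Cmod (z - s)). assert (H2 := im_le_Cmod (z - s)).
  change (Re (z - s)) with (Re z - Re s) in H1. change (Im (z - s)) with (Im z - Im s) in H2.
  assert (B : Rabs (al * (Re z - Re s) + be * (Im z - Im s)) < v).
  { apply Rle_lt_trans with (1 := Rabs_triang _ _). rewrite !Rabs_mult.
    apply Rle_lt_trans with (K * Cmod (z - s)).
    - generalize (Rabs_pos al) (Rabs_pos be) (Cmod_ge_0 (z - s)). unfold K. nra.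
    - apply Rlt_le_trans with (K * (v / K)); [apply Rmult_lt_compat_l; assumption | right; field; lra]. }
  apply Rabs_def2 in B. unfold v in *. lra.
Qed.

Lemma hplane_convex al be : convex_set (hplane al be).
Proof.
  intros p q t Hp Hq Ht. unfold hplane in *.
  replace (Re (p + RtoC t * (q - p))) with (Re p + t * (Re q - Re p)) by (unfold Re; simpl; ring).
  replace (Im (p + RtoC t * (q - p))) with (Im p + t * (Im q - Im p)) by (unfold Im; simpl; ring).
  destruct (Rle_dec t (1 / 2)); nra.
Qed.

Lemma zeta_on_hplane al be p : hplane al be p -> hp 1 p -> forall s, hplane al be s -> zeta s = (zF s / (s - 1))%C.
Proof.
  intros Hp Hp1.
  destruct (hp_open 1 p Hp1) as [d [Hd Hd2]].
  assert (N1 : forall s, hplane al be s -> s <> 1).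
  { intros s Hs ->. unfold hplane, Re, Im in Hs. simpl in Hs. lra. }
  apply (identity_eq (hplane al be) zeta (fun s => zF s / (s - 1))%C p d); try assumption.
  - apply hplane_open.
  - apply hplane_convex.
  - intros s Hs. assert (H := proj1 zeta_spec s (N1 s Hs)). apply holomorphic_at_iff in H.
    destruct H as [r [Hr H]]. apply H, disc_center, Hr.
  - intros s Hs. destruct (zF_entire s) as [l Hl]. eexists. cder_auto; apply Cminus_neq_0, N1, Hs.
  - intros z Hz. assert (H1 := Hd2 z Hz). rewrite zeta_zeta0, zF_zeta0 by assumption. field.
    apply Cminus_neq_0. intros ->. unfold hp in H1. rewrite Re_RtoC in H1. lra.
Qed.

Lemma zeta_zF (s : C) : s <> 1 -> zeta s = (zF s / (s - 1))%C.
Proof.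
  intros Hs. destruct (Rlt_dec 0 (Im s)) as [H1|H1]; [|destruct (Rlt_dec (Im s) 0) as [H2|H2]].
  - apply (zeta_on_hplane 0 1 (2, 1)); unfold hplane, hp, Re, Im in *; simpl; lra.
  - apply (zeta_on_hplane 0 (-1) (2, -1)); unfold hplane, hp, Re, Im in *; simpl; lra.
  - assert (Im s = 0) by lra. destruct (Rlt_dec 1 (Re s)) as [H3|H3].
    + rewrite zeta_zeta0, zF_zeta0 by exact H3. field. apply Cminus_neq_0, Hs.
    + assert (Re s <> 1).
      { intros E. apply Hs. apply injective_projections; simpl; assumption. }
      (* This slanted half-plane contains the real [s < 1] and still meets [Re s > 1]. *)
      apply (zeta_on_hplane (-1) 1 (2, 2)); unfold hplane, hp, Re, Im in *; simpl; lra.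
Qed.

Lemma ff_nat_zero m n : (m < n)%nat -> ff (RtoC (INR m)) n = 0.
Proof.
  induction n as [|n IH]; intros H; [lia|]. cbn [ff]. destruct (Nat.eq_dec m n) as [->|Hne].
  - replace (RtoC (INR n) - RtoC (INR n))%C with (RtoC 0) by ring. ring.
  - rewrite IH by lia. ring.
Qed.

Lemma cseries_zero : cseries (fun _ => RtoC 0) 0.
Proof. apply (cseries_single (fun _ => RtoC 0)). reflexivity. Qed.

Lemma Cminus_0_eq (x y : C) : (x - y)%C = 0 -> x = y.
Proof. intros H. replace x with ((x - y) + y)%C by ring. rewrite H. ring. Qed.

(** At [s = 1 - m] with [m] natural the recursion becomes a finite sum; the values at 1, 0 and -1
    are read off from this. *)
Lemma zq_nat_zero m j s : (1 - s = RtoC (INR m))%C -> (m < 2 * j + 2)%nat -> zq j s = 0.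
Proof. intros E H. unfold zq. rewrite E, ff_nat_zero by assumption. ring. Qed.

Lemma zF_1 : zF 1 = 1.
Proof.
  assert (H := zF_rec 1).
  assert (E : (zF 1 - pw 2 (1 - 1))%C = 0).
  { apply (cseries_unique _ _ _ H). eapply cseries_ext; [|apply cseries_zero]. intros j. cbv beta.
    rewrite (zq_nat_zero 0 j) by (try lia; simpl; ring). ring. }
  rewrite (Cminus_0_eq _ _ E). replace (1 - 1)%C with (RtoC 0) by ring. apply pw_0.
Qed.

Lemma zF_0 : zF 0 = RtoC (1 / 2).
Proof.
  assert (H := zF_rec 0).
  assert (E : (zF 0 - pw 2 (0 - 1))%C = 0).
  { apply (cseries_unique _ _ _ H). eapply cseries_ext; [|apply cseries_zero]. intros j. cbv beta.
    rewrite (zq_nat_zero 1 j) by (try lia; simpl; ring). ring. }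
  rewrite (Cminus_0_eq _ _ E). replace (0 - 1)%C with (- (1))%C by ring.
  rewrite pw_opp, pw_1, <- RtoC_inv by lra. f_equal. field.
Qed.

Lemma zF_m1 : zF (- (1)) = RtoC (1 / 6).
Proof.
  assert (H := zF_rec (- (1))).
  assert (E : (zF (- (1)) - pw 2 (- (1) - 1))%C = RtoC (- / 12)).
  { apply (cseries_unique _ _ _ H).
    assert (S1 : cseries (fun j => zq j (- (1)) * zF (- (1) + sh j))%C (zq 0 (- (1)) * zF (- (1) + sh 0))%C).
    { apply (cseries_single (fun j => zq j (- (1)) * zF (- (1) + sh j))%C). intros j.
      rewrite (zq_nat_zero 2 (S j)); [ring | | lia]. rewrite <- RtoC_opp, <- RtoC_minus. f_equal. simpl. ring. }
    replace (- (1) + sh 0)%C with (RtoC 1) in S1.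
    2: { unfold sh. rewrite <- RtoC_opp, <- RtoC_plus. f_equal. simpl. ring. }
    rewrite zF_1 in S1.
    replace (RtoC (- / 12)) with (zq 0 (- (1)) * 1)%C; [exact S1|].
    unfold zq. simpl. rewrite Cmult_1_r.
    replace (1 - - (1))%C with (RtoC 2) by (rewrite <- RtoC_opp, <- RtoC_minus; f_equal; ring).
    rewrite <- !RtoC_minus, <- !RtoC_mult, <- RtoC_opp. f_equal. field. }
  replace (zF (- (1))) with ((zF (- (1)) - pw 2 (- (1) - 1)) + pw 2 (- (1) - 1))%C by ring. rewrite E.
  replace (- (1) - 1)%C with (- RtoC (INR 2))%C by (rewrite <- RtoC_opp, <- RtoC_opp, <- RtoC_minus; f_equal; simpl; ring).
  rewrite pw_opp, pw_nat, <- RtoC_pow, <- RtoC_inv, <- RtoC_plus by lra. f_equal. field.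
Qed.

(** * Wallis' product and the derivative at 0 *)

Definition Wal (n : nat) : R := RInt (fun t => sin t ^ n) 0 (PI / 2).

Lemma Wal_ex n : ex_RInt (fun t => sin t ^ n) 0 (PI / 2).
Proof.
  apply (ex_RInt_continuous (V := R_CompleteNormedModule)). intros t _.
  apply (ex_derive_continuous (K := R_AbsRing) (V := R_NormedModule) (fun t => sin t ^ n)). auto_derive. exact I.
Qed.

(** Integrates the derivative of [- cos t * sin t ^ (n + 1)], which vanishes at both ends of the
    interval. *)
Lemma Wal_rec n : INR (n + 2) * Wal (n + 2) = INR (n + 1) * Wal n.
Proof.
  assert (D : forall t, is_derive (fun t => - cos t * sin t ^ (n + 1)) t
     (INR (n + 2) * sin t ^ (n + 2) - INR (n + 1) * sin t ^ n)).
  { intros t. auto_derive; [exact I|].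
    replace (n + 2)%nat with (S (S n)) by lia. replace (n + 1)%nat with (S n) by lia.
    rewrite (S_INR (S n)). simpl pred. simpl pow.
    assert (E := sin2_cos2 t). unfold Rsqr in E.
    replace (cos t * cos t) with (1 - sin t * sin t) by lra.
    transitivity (sin t * (sin t * sin t ^ n) - INR (S n) * (cos t * cos t) * sin t ^ n); [ring|].
    replace (cos t * cos t) with (1 - sin t * sin t) by lra. ring. }
  assert (H : is_RInt (fun t => INR (n + 2) * sin t ^ (n + 2) - INR (n + 1) * sin t ^ n) 0 (PI / 2)
     (minus (- cos (PI / 2) * sin (PI / 2) ^ (n + 1)) (- cos 0 * sin 0 ^ (n + 1)))).
  { apply (is_RInt_derive (V := R_CompleteNormedModule) (fun t => - cos t * sin t ^ (n + 1))).
    - intros t _. apply D.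
    - intros t _. apply (ex_derive_continuous (K := R_AbsRing) (V := R_NormedModule)). auto_derive. exact I. }
  assert (H2 : is_RInt (fun t => INR (n + 2) * sin t ^ (n + 2) - INR (n + 1) * sin t ^ n) 0 (PI / 2)
     (INR (n + 2) * Wal (n + 2) - INR (n + 1) * Wal n)).
  { apply (is_RInt_minus (V := R_NormedModule) (fun t => INR (n + 2) * sin t ^ (n + 2)) (fun t => INR (n + 1) * sin t ^ n));
    apply (is_RInt_scal (V := R_NormedModule)); apply (RInt_correct (V := R_CompleteNormedModule)), Wal_ex. }
  apply (is_RInt_unique (V := R_CompleteNormedModule)) in H. apply (is_RInt_unique (V := R_CompleteNormedModule)) in H2.
  rewrite H in H2. rewrite cos_PI2, sin_PI2, cos_0, sin_0 in H2. unfold minus, plus, opp in H2; simpl in H2.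
  replace (n + 1)%nat with (S n) in H2 at 2 by lia. simpl in H2. rewrite Rmult_0_l in H2. lra.
Qed.

Lemma Wal_decr n : Wal (S n) <= Wal n.
Proof.
  assert (Hpi := PI_RGT_0). apply RInt_le; [lra | apply Wal_ex | apply Wal_ex |].
  intros t Ht. assert (0 <= sin t) by (apply sin_ge_0; lra). assert (H1 := SIN_bound t).
  simpl. assert (0 <= sin t ^ n) by (apply pow_le; assumption). nra.
Qed.

Lemma Wal_0 : Wal 0 = PI / 2.
Proof.
  unfold Wal. simpl. rewrite (RInt_const (V := R_CompleteNormedModule)).
  unfold scal; simpl. unfold mult; simpl. field.
Qed.

Lemma Wal_1 : Wal 1 = 1.
Proof.
  unfold Wal. apply (is_RInt_unique (V := R_CompleteNormedModule)).
  replace 1 with (minus (- cos (PI / 2)) (- cos 0)).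
  - apply (is_RInt_derive (V := R_CompleteNormedModule) (fun t => - cos t)).
    + intros t _. auto_derive; [exact I|]. ring.
    + intros t _. apply (ex_derive_continuous (K := R_AbsRing) (V := R_NormedModule)). auto_derive. exact I.
  - rewrite cos_PI2, cos_0. unfold minus, plus, opp; simpl. ring.
Qed.

Lemma Wal_pos n : 0 < Wal n.
Proof.
  assert (K : forall n, 0 < Wal n /\ 0 < Wal (S n)).
  { clear n. induction n as [|n [IH1 IH2]].
    - rewrite Wal_0, Wal_1. generalize PI_RGT_0; lra.
    - split; [assumption|]. assert (H := Wal_rec n). replace (n + 2)%nat with (S (S n)) in H by lia.
      assert (P1 := INR_S_pos (S n)). assert (P2 : 0 < INR (n + 1)) by (apply lt_0_INR; lia).
      apply Rmult_lt_reg_l with (INR (S (S n))); [assumption|]. rewrite Rmult_0_r, H. apply Rmult_lt_0_compat; assumption. }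
  exact (proj1 (K n)).
Qed.

(** The logarithm of the Wallis factor [(2k+2)^2 / ((2k+1)(2k+3))], which is also the derivative at
    0 of [etaT k]. *)
Definition wlog (k : nat) : R := 2 * ln (INR (2 * k + 2)) - ln (INR (2 * k + 1)) - ln (INR (2 * k + 3)).

Lemma wlog_sum n : rsum wlog n = ln (PI / 2) + (ln (Wal (2 * n + 1)) - ln (Wal (2 * n))).
Proof.
  induction n as [|n IH].
  - simpl. rewrite Wal_0, Wal_1, ln_1. ring.
  - cbn [rsum]. rewrite IH. unfold wlog.
    assert (E1 := Wal_rec (2 * n)). assert (E2 := Wal_rec (2 * n + 1)).
    replace (2 * S n + 1)%nat with (2 * n + 1 + 2)%nat by lia. replace (2 * S n)%nat with (2 * n + 2)%nat by lia.
    replace (2 * n + 1 + 1)%nat with (2 * n + 2)%nat in E2 by lia.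
    apply (f_equal ln) in E1. apply (f_equal ln) in E2.
    rewrite !ln_mult in E1, E2 by (try apply Wal_pos; apply lt_0_INR; lia).
    replace (2 * n + 1 + 2)%nat with (2 * n + 3)%nat in * by lia. lra.
Qed.

Lemma wlog_lim : is_lim_seq (fun n => rsum wlog n) (ln (PI / 2)).
Proof.
  apply (is_lim_seq_ext (fun n => ln (PI / 2) + (ln (Wal (2 * n + 1)) - ln (Wal (2 * n))))).
  { intros n. symmetry. apply wlog_sum. }
  replace (Finite (ln (PI / 2))) with (Finite (ln (PI / 2) + 0)) by (f_equal; ring).
  apply is_lim_seq_plus'; [apply is_lim_seq_const|].
  apply (is_lim_seq_le_le (fun n => - / INR (S n)) _ (fun _ => 0)).
  - intros n.
    assert (P0 := Wal_pos (2 * n)). assert (P1 := Wal_pos (2 * n + 1)).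
    split.
    + assert (E := Wal_rec (2 * n)). assert (D := Wal_decr (2 * n + 1)). replace (S (2 * n + 1)) with (2 * n + 2)%nat in D by lia.
      assert (Q := INR_S_pos n). assert (Pn := pos_INR n).
      assert (I1 : INR (2 * n + 1) = 2 * INR n + 1) by (rewrite plus_INR, mult_INR; simpl; ring).
      assert (I2 : INR (2 * n + 2) = 2 * INR n + 2) by (rewrite plus_INR, mult_INR; simpl; ring).
      assert (L : ln (Wal (2 * n) / Wal (2 * n + 1)) <= Wal (2 * n) / Wal (2 * n + 1) - 1)
        by (apply ln_le_minus_1, Rdiv_lt_0_compat; assumption).
      rewrite ln_div in L by assumption.
      (* The recursion and [Wal (2 n + 2) <= Wal (2 n + 1)] bound the ratio by
         [(2 n + 2) / (2 n + 1)]. *)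
      assert (B : Wal (2 * n) / Wal (2 * n + 1) - 1 <= / INR (S n)).
      { apply Rmult_le_reg_r with (Wal (2 * n + 1)); [assumption|].
        replace ((Wal (2 * n) / Wal (2 * n + 1) - 1) * Wal (2 * n + 1)) with (Wal (2 * n) - Wal (2 * n + 1)) by (field; lra).
        rewrite I1, I2 in E. rewrite S_INR in *.
        apply Rmult_le_reg_l with (INR n + 1); [lra|].
        replace ((INR n + 1) * (/ (INR n + 1) * Wal (2 * n + 1))) with (Wal (2 * n + 1)) by (field; lra).
        assert (0 <= INR n * Wal (2 * n + 1)) by (apply Rmult_le_pos; lra).
        assert (0 <= INR n * (Wal (2 * n + 1) - Wal (2 * n + 2))) by (apply Rmult_le_pos; lra).
        assert (D0 := Wal_decr (2 * n)). replace (S (2 * n)) with (2 * n + 1)%nat in D0 by lia. nra. }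
      lra.
    + assert (D0 := Wal_decr (2 * n)). replace (S (2 * n)) with (2 * n + 1)%nat in D0 by lia.
      assert (ln (Wal (2 * n + 1)) <= ln (Wal (2 * n))) by (apply ln_le; assumption). lra.
  - replace (Finite 0) with (Finite (- 0)) by (f_equal; ring). apply (is_lim_seq_opp (fun n => / INR (S n)) (Finite 0)).
    apply (is_lim_seq_incr_1 (fun n => / INR n)).
    apply (is_lim_seq_inv INR p_infty); [apply is_lim_seq_INR | discriminate].
  - apply is_lim_seq_const.
Qed.

Lemma wlog_cseries : cseries (fun k => RtoC (wlog k)) (RtoC (ln (PI / 2))).
Proof.
  intros eps Heps.
  assert (E : forall n, csum (fun k => RtoC (wlog k)) n = RtoC (rsum wlog n)).
  { induction n as [|n IH]; [reflexivity|]. cbn [csum rsum]. rewrite IH, RtoC_plus. reflexivity. }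
  assert (H := wlog_lim). apply is_lim_seq_spec in H. destruct (H (mkposreal eps Heps)) as [N HN].
  exists N. intros n Hn. rewrite E, <- RtoC_minus, Cmod_R. apply HN, Hn.
Qed.

(** * Second differences of powers and the alternating zeta series *)

Lemma even_binomial (al : C) (x : R) : 0 < x < 1 ->
  cseries (fun i => 2 * binc al (2 * i + 2) * RtoC x ^ (2 * i + 2))%C (pw (1 - x) al + pw (1 + x) al - 2).
Proof.
  intros Hx.
  assert (S1 := binomial_series al (- x) ltac:(rewrite Rabs_Ropp, Rabs_pos_eq; lra)).
  assert (S2 := binomial_series al x ltac:(rewrite Rabs_pos_eq; lra)).
  assert (S3 := cseries_plus _ _ _ _ S1 S2). cbv beta in S3.
  apply (cseries_even (fun n => binc al n * RtoC (- x) ^ n + binc al n * RtoC x ^ n)%C) in S3.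
  - replace (1 + - x) with (1 - x) in S3 by ring.
    assert (S4 : cseries (fun i => 2 * binc al (2 * S i) * RtoC x ^ (2 * S i))%C (pw (1 - x) al + pw (1 + x) al - 2)).
    { apply (cseries_shift (fun i => 2 * binc al (2 * i) * RtoC x ^ (2 * i))%C).
      match goal with |- cseries _ ?l => replace l with (pw (1 - x) al + pw (1 + x) al)%C end.
      - eapply cseries_ext; [|exact S3]. intros i. cbv beta. rewrite RtoC_opp_pow, Cpow_m1_even. ring.
      - unfold binc. simpl. field. }
    eapply cseries_ext; [|exact S4]. intros i. cbv beta. replace (2 * S i)%nat with (2 * i + 2)%nat by lia. reflexivity.
  - intros i. rewrite RtoC_opp_pow, Cpow_m1_odd.
    replace (RtoC (-1)) with (- (1))%C by (rewrite <- RtoC_opp; reflexivity). ring.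
Qed.

Definition CK (K : R) : R := 8 * Series (fun i => bb K (2 * i + 2) * (/ 2) ^ (2 * i + 2)).

(** For [x <= 1/2] the power [x ^ (2 i + 2)] is at most [4 * x ^ 2 * (/ 2) ^ (2 i + 2)]; together
    with the coefficient 2 this explains the 8 in [CK]. *)
Lemma second_difference_bound (al : C) (K x : R) :
  0 < K -> Cmod al <= K -> 0 < x <= / 2 -> Cmod (pw (1 - x) al + pw (1 + x) al - 2) <= CK K * x ^ 2.
Proof.
  intros HK Hal Hx.
  assert (S1 := even_binomial al x ltac:(lra)).
  apply Rle_trans with (Series (fun i => 8 * x ^ 2 * (bb K (2 * i + 2) * (/ 2) ^ (2 * i + 2)))).
  - apply (cseries_bound _ _ _) with (2 := ex_series_Rscal (8 * x ^ 2) _ (ex_series_bb_even K (/ 2) HK ltac:(lra))) (3 := S1).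
    intros i. rewrite !Cmod_mult, Cmod_pow, !Cmod_R, (Rabs_pos_eq x), (Rabs_pos_eq 2) by lra.
    assert (B := Cmod_binc_le al K (2 * i + 2) Hal). assert (PB := bb_pos K (2 * i + 2) HK).
    replace (x ^ (2 * i + 2)) with ((2 * x) ^ (2 * i) * ((2 * x) ^ 2 * (/ 2) ^ (2 * i + 2))).
    2: { rewrite <- Rmult_assoc, <- pow_add, <- Rpow_mult_distr. f_equal. field. }
    assert (P1 : 0 <= (2 * x) ^ (2 * i) <= 1).
    { split; [apply pow_le; lra|]. rewrite <- (pow1 (2 * i)). apply pow_incr. lra. }
    assert (P2 : 0 < (/ 2) ^ (2 * i + 2)) by (apply pow_lt; lra).
    replace (8 * x ^ 2 * (bb K (2 * i + 2) * (/ 2) ^ (2 * i + 2)))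
      with (2 * bb K (2 * i + 2) * (1 * ((2 * x) ^ 2 * (/ 2) ^ (2 * i + 2)))) by ring.
    assert (P3 : 0 <= (2 * x) ^ 2 * (/ 2) ^ (2 * i + 2)) by (apply Rmult_le_pos; [apply pow2_ge_0 | lra]).
    apply Rmult_le_compat.
    + apply Rmult_le_pos; [lra | apply Cmod_ge_0].
    + apply Rmult_le_pos; lra.
    + lra.
    + apply Rmult_le_compat_r; lra.
  - rewrite Series_scal_l. unfold CK. right. ring.
Qed.

(** Grouping the alternating zeta series into second differences centred at the even integers gives
    twice its sum minus 1. The grouped terms decay two powers faster, so the series converges on
    [Re s > -1], around the point 0. *)
Definition etaT (k : nat) (s : C) : C :=
  (pw (INR (2 * k + 1)) (- s) - 2 * pw (INR (2 * k + 2)) (- s) + pw (INR (2 * k + 3)) (- s))%C.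

Definition eta (s : C) : C := CSer (fun k => etaT k s).

Lemma etaT_bound k s K sigma : 0 < K -> Cmod s <= K -> sigma <= Re s -> -1 < sigma ->
  Cmod (etaT k s) <= CK K * exp (- (sigma + 2) * ln 2) * rpow k (- (sigma + 2)).
Proof.
  intros HK Hs Hsig Hm1.
  set (X := INR (2 * k + 2)).
  assert (HX : X = 2 * INR (S k)) by (unfold X; rewrite S_INR, plus_INR, mult_INR; simpl; ring).
  assert (Pk := INR_S_pos k). assert (HX2 : 2 <= X) by (rewrite HX, S_INR; generalize (pos_INR k); lra).
  assert (E1 : INR (2 * k + 1) = X * (1 - / X)) by (unfold X in *; rewrite !plus_INR, !mult_INR in *; simpl in *; field; lra).
  assert (E3 : INR (2 * k + 3) = X * (1 + / X)) by (unfold X in *; rewrite !plus_INR, !mult_INR in *; simpl in *; field; lra).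
  assert (Hx : 0 < / X <= / 2) by (split; [apply Rinv_0_lt_compat; lra | apply Rinv_le_contravar; lra]).
  replace (etaT k s) with (pw X (- s) * (pw (1 - / X) (- s) + pw (1 + / X) (- s) - 2))%C.
  2: { unfold etaT. fold X. rewrite E1, E3, !pw_mult by lra. ring. }
  rewrite Cmod_mult, Cmod_pw, Re_opp.
  assert (B := second_difference_bound (- s) K (/ X) HK ltac:(rewrite Cmod_opp; exact Hs) Hx).
  assert (LX : 0 <= ln X) by (apply ln_ge_0; lra).
  apply Rle_trans with (exp (- sigma * ln X) * (CK K * (/ X) ^ 2)).
  - apply Rmult_le_compat; [left; apply exp_pos | apply Cmod_ge_0 | | exact B].
    apply exp_le. apply Rmult_le_compat_r; [exact LX|lra].
  - right. replace ((/ X) ^ 2) with (exp (- 2 * ln X)).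
    2: { replace (-2 * ln X) with (- ln X + - ln X) by ring. rewrite exp_plus, exp_Ropp, exp_ln by lra. ring. }
    unfold rpow. rewrite HX, ln_mult by lra.
    replace (exp (- sigma * (ln 2 + ln (INR (S k)))) * (CK K * exp (- 2 * (ln 2 + ln (INR (S k))))))
      with (CK K * (exp (- sigma * (ln 2 + ln (INR (S k)))) * exp (- 2 * (ln 2 + ln (INR (S k)))))) by ring.
    rewrite Rmult_assoc, <- !exp_plus. f_equal. f_equal. ring.
Qed.

Lemma cder_pw_opp x s : cder (fun w => pw x (- w)) s (- (RtoC (ln x) * pw x (- s))).
Proof.
  eapply cder_eq; [apply (cder_comp (pw x) Copp); [apply cder_pw | apply (cder_opp (fun w => w)), cder_id]|]. ring.
Qed.

Lemma etaT_cder k s : cder (etaT k) s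
  (- (RtoC (ln (INR (2 * k + 1))) * pw (INR (2 * k + 1)) (- s))
   - 2 * - (RtoC (ln (INR (2 * k + 2))) * pw (INR (2 * k + 2)) (- s))
   + - (RtoC (ln (INR (2 * k + 3))) * pw (INR (2 * k + 3)) (- s)))%C.
Proof.
  unfold etaT.
  apply (cder_plus (fun s => pw (INR (2 * k + 1)) (- s) - 2 * pw (INR (2 * k + 2)) (- s))%C (fun s => pw (INR (2 * k + 3)) (- s)));
    [|apply cder_pw_opp].
  apply (cder_minus (fun s => pw (INR (2 * k + 1)) (- s))); [apply cder_pw_opp|].
  eapply cder_eq; [apply (cder_mult (fun _ => RtoC 2)); [apply cder_const | apply cder_pw_opp]|]. cbv beta. ring.
Qed.

Lemma eta_local s : hp (-1) s -> exists r M, 0 < r /\ (forall z, cdisc s r z -> hp (-1) z) /\ ex_series M /\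
  forall n z, cdisc s r z -> Cmod (etaT n z) <= M n.
Proof.
  intros Hs. unfold hp in Hs. set (r := (Re s + 1) / 2). set (K := Cmod s + r).
  assert (Hr : 0 < r) by (unfold r; lra).
  assert (HK : 0 < K) by (unfold K; generalize (Cmod_ge_0 s); lra).
  exists r, (fun k => CK K * exp (- (Re s - r + 2) * ln 2) * rpow k (- (Re s - r + 2))).
  split; [exact Hr|]. split; [|split].
  - intros z Hz. apply Re_cdisc in Hz. unfold hp, r in *. lra.
  - apply (ex_series_Rscal (CK K * exp (- (Re s - r + 2) * ln 2))), ex_series_rpow. unfold r; lra.
  - intros k z Hz. apply etaT_bound; [exact HK | | | unfold r; lra].
    + unfold cdisc in Hz. unfold K. generalize (Cmod_triangle_rev z s). lra.
    + apply Re_cdisc in Hz. lra.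
Qed.

Lemma eta_holo : holo_on (hp (-1)) eta.
Proof.
  apply (weierstrass_holo (hp (-1)) etaT).
  - intros a Ha. apply eta_local, Ha.
  - intros n z _. eexists. apply etaT_cder.
Qed.

Lemma etaT_deriv_0 k : cder (etaT k) 0 (RtoC (wlog k)).
Proof.
  eapply cder_eq; [apply etaT_cder|]. unfold wlog.
  replace (- 0)%C with (RtoC 0) by ring. rewrite !pw_0, !Cmult_1_r, !RtoC_minus, RtoC_mult. ring.
Qed.

Lemma eta_cder_0 : cder eta 0 (RtoC (ln (PI / 2))).
Proof.
  destruct (eta_local 0) as [r [M [Hr [Hd [HM Hb]]]]]; [unfold hp; rewrite Re_RtoC; lra|].
  rewrite <- (CSer_unique _ _ wlog_cseries).
  apply (weierstrass etaT M _ 0 r Hr HM); [|exact Hb | apply etaT_deriv_0].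
  intros n z _. eexists. apply etaT_cder.
Qed.

Lemma eta_0 : eta 0 = 0.
Proof.
  apply CSer_unique. eapply cseries_ext; [|apply cseries_zero]. intros k. unfold etaT.
  replace (- 0)%C with (RtoC 0) by ring. rewrite !pw_0. ring.
Qed.

Lemma cseries_pairs (v : nat -> C) l : cseries v l -> cseries (fun k => v (2 * k)%nat + v (2 * k + 1)%nat)%C l.
Proof.
  intros H eps Heps. destruct (H eps Heps) as [N HN]. exists N. intros n Hn.
  replace (csum (fun i => v (2 * i)%nat + v (2 * i + 1)%nat)%C n) with (csum v (2 * n)); [apply HN; lia|].
  clear. induction n as [|n IH]; [reflexivity|]. replace (2 * S n)%nat with (S (S (2 * n))) by lia.
  cbn [csum]. rewrite IH. replace (S (2 * n)) with (2 * n + 1)%nat by lia. ring.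
Qed.

Lemma eta_zeta0 s : hp 1 s -> eta s = (2 * (1 - 2 * pw 2 (- s)) * zeta0 s - 1)%C.
Proof.
  intros Hs. apply CSer_unique.
  assert (H := zeta0_cv s Hs).
  assert (HB := cseries_scal (pw 2 (- s)) _ _ H).
  assert (HP := cseries_pairs _ _ H).
  assert (HA := cseries_minus _ _ _ _ HP HB). cbv beta in HA.
  assert (Ev : forall k, pw (INR (S (2 * k + 1))) (- s) = (pw 2 (- s) * pw (INR (S k)) (- s))%C).
  { intros k. rewrite <- pw_mult by (try apply INR_S_pos; lra). f_equal. rewrite !S_INR, plus_INR, mult_INR. simpl. ring. }
  assert (HA' : cseries (fun k => pw (INR (S (2 * k))) (- s)) (zeta0 s - pw 2 (- s) * zeta0 s)).
  { eapply cseries_ext; [|exact HA]. intros k. cbv beta. rewrite Ev. ring. }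
  assert (HA1 : cseries (fun k => pw (INR (S (2 * S k))) (- s)) (zeta0 s - pw 2 (- s) * zeta0 s - 1)).
  { apply (cseries_shift (fun k => pw (INR (S (2 * k))) (- s))).
    match goal with |- cseries _ ?l => replace l with (zeta0 s - pw 2 (- s) * zeta0 s)%C end; [exact HA'|].
    simpl. rewrite pw_1_l. ring. }
  assert (T := cseries_plus _ _ _ _ (cseries_minus _ _ _ _ HA' (cseries_scal 2 _ _ HB)) HA1). cbv beta in T.
  match type of T with cseries _ ?l => replace (2 * (1 - 2 * pw 2 (- s)) * zeta0 s - 1)%C with l by ring end.
  eapply cseries_ext; [|exact T]. intros k. cbv beta. unfold etaT. rewrite <- Ev.
  replace (S (2 * k + 1)) with (2 * k + 2)%nat by lia. replace (S (2 * k)) with (2 * k + 1)%nat by lia.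
  replace (S (2 * S k)) with (2 * k + 3)%nat by lia. reflexivity.
Qed.

(** The relation holds for [Re s > 1] and both sides are holomorphic on [Re s > -1], so it reaches
    0. *)
Lemma eta_zF s : hp (-1) s -> (2 * (1 - 2 * pw 2 (- s)) * zF s = (s - 1) * (1 + eta s))%C.
Proof.
  assert (P3 : hp 1 3) by (unfold hp; rewrite Re_RtoC; lra).
  destruct (hp_open 1 3 P3) as [d [Hd Hd2]].
  revert s. apply (identity_eq (hp (-1)) (fun s => 2 * (1 - 2 * pw 2 (- s)) * zF s)%C (fun s => (s - 1) * (1 + eta s))%C 3 d).
  - apply hp_open.
  - apply hp_convex.
  - intros s _. destruct (zF_entire s) as [l Hl]. assert (D := cder_pw_opp 2 s). eexists.
    apply (cder_mult (fun s => 2 * (1 - 2 * pw 2 (- s)))%C); [|exact Hl].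
    apply (cder_mult (fun _ => RtoC 2)); [apply cder_const|].
    apply (cder_minus (fun _ => RtoC 1)); [apply cder_const|].
    apply (cder_mult (fun _ => RtoC 2)); [apply cder_const|exact D].
  - intros s Hs. destruct (eta_holo s Hs) as [l Hl]. eexists. apply cder_mult; [cder_auto|]. cder_auto.
  - unfold hp; rewrite Re_RtoC; lra.
  - exact Hd.
  - intros z Hz. assert (H := Hd2 z Hz). rewrite zF_zeta0, eta_zeta0 by exact H. ring.
Qed.

(** Both sides of [eta_zF] are differentiated at 0, where [eta] vanishes and has derivative
    [ln (PI / 2)]. The value is equivalent to [zeta'(0) = - ln (2 PI) / 2]. *)
Lemma zF_cder_0 : cder zF 0 (RtoC ((ln (2 * PI) - 1) / 2)).
Proof.
  destruct (zF_entire 0) as [l Hl].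
  assert (D1 : cder (fun s => 2 * (1 - 2 * pw 2 (- s)) * zF s)%C 0
     ((0 * (1 - 2 * pw 2 (- 0)) + 2 * (0 - (0 * pw 2 (- 0) + 2 * - (RtoC (ln 2) * pw 2 (- 0))))) * zF 0 + 2 * (1 - 2 * pw 2 (- 0)) * l)%C).
  { apply (cder_mult (fun s => 2 * (1 - 2 * pw 2 (- s)))%C); [|exact Hl].
    apply (cder_mult (fun _ => RtoC 2) (fun s => 1 - 2 * pw 2 (- s))%C); [apply cder_const|].
    apply (cder_minus (fun _ => RtoC 1)); [apply cder_const|].
    apply (cder_mult (fun _ => RtoC 2) (fun s => pw 2 (- s))); [apply cder_const|apply cder_pw_opp]. }
  assert (D2 : cder (fun s => (s - 1) * (1 + eta s))%C 0 ((1 - 0) * (1 + eta 0) + (0 - 1) * (0 + RtoC (ln (PI / 2))))%C).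
  { apply (cder_mult (fun s => s - 1)%C (fun s => 1 + eta s)%C).
    - apply (cder_minus (fun s => s) (fun _ => RtoC 1)); [apply cder_id | apply cder_const].
    - apply (cder_plus (fun _ => RtoC 1)); [apply cder_const | apply eta_cder_0]. }
  assert (D3 := fun H => cder_ext_loc _ (fun s => (s - 1) * (1 + eta s))%C _ _ H D1).
  assert (E := fun H => cder_unique _ _ _ _ (D3 H) D2).
  assert (Loc : exists d, 0 < d /\ forall w, Cmod (w - 0) < d -> (2 * (1 - 2 * pw 2 (- w)) * zF w = (w - 1) * (1 + eta w))%C).
  { exists 1. split; [lra|]. intros w Hw. apply eta_zF. apply (Re_cdisc (RtoC 0)) in Hw. rewrite Re_RtoC in Hw. unfold hp. lra. }
  specialize (E Loc).
  rewrite zF_0, eta_0 in E. replace (- 0)%C with (RtoC 0) in E by ring. rewrite pw_0 in E.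
  replace (RtoC (1 / 2)) with (/ 2)%C in E by (rewrite <- RtoC_inv by lra; f_equal; field).
  assert (E2 : l = (RtoC (ln 2) - / 2 + / 2 * RtoC (ln (PI / 2)))%C).
  { replace l with (RtoC (ln 2) - / 2 * (2 * RtoC (ln 2) - 2 * l))%C by (field; apply RtoC_neq_0; lra).
    replace (2 * RtoC (ln 2) - 2 * l)%C with (1 - RtoC (ln (PI / 2)))%C.
    - ring.
    - transitivity ((1 - 0) * (1 + 0) + (0 - 1) * (0 + RtoC (ln (PI / 2))))%C; [ring|]. rewrite <- E.
      field; apply RtoC_neq_0; lra. }
  replace (RtoC ((ln (2 * PI) - 1) / 2)) with l; [exact Hl|]. rewrite E2.
  assert (Hpi := PI_RGT_0). rewrite ln_mult, ln_div by lra.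
  rewrite <- RtoC_inv by lra. rewrite <- RtoC_minus, <- RtoC_mult, <- RtoC_plus. f_equal. field.
Qed.

(** * Non-vanishing of zeta on the line Re s = 1 *)

Definition ind (P : Prop) : C := if excluded_middle_informative P then RtoC 1 else RtoC 0.

Lemma ind_true P : P -> ind P = 1.
Proof. intros H. unfold ind. destruct excluded_middle_informative; [reflexivity|contradiction]. Qed.

Lemma ind_false P : ~ P -> ind P = 0.
Proof. intros H. unfold ind. destruct excluded_middle_informative; [contradiction|reflexivity]. Qed.

Lemma ind_iff P Q : (P <-> Q) -> ind P = ind Q.
Proof. intros H. unfold ind. destruct excluded_middle_informative; destruct excluded_middle_informative; tauto. Qed.

Lemma Cmod_ind_le P : Cmod (ind P) <= 1.
Proof. unfold ind. destruct excluded_middle_informative; rewrite ?Cmod_1, ?Cmod_0; lra. Qed.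

(** The first [p * K] terms contain exactly the multiples [p, 2 p, ..., K p], so the new partial
    sums form a subsequence of the old ones. *)
Lemma cseries_multiples (f : nat -> C) (p : nat) (l : C) : (1 <= p)%nat ->
  cseries (fun n => ind (Nat.divide p (S n)) * f (S n))%C l -> cseries (fun m => f (p * S m)%nat) l.
Proof.
  intros Hp H eps Heps. destruct (H eps Heps) as [N HN]. exists N. intros K HK.
  set (u := fun n => (ind (Nat.divide p (S n)) * f (S n))%C) in *.
  assert (E : csum u (p * K) = csum (fun m => f (p * S m)%nat) K).
  { clear HN HK. induction K as [|K IH]; [rewrite Nat.mul_0_r; reflexivity|].
    assert (Z : forall i, (i < p)%nat -> csum u (p * K + i) = csum u (p * K)).
    { induction i as [|i IHi]; intros Hi; [rewrite Nat.add_0_r; reflexivity|].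
      rewrite Nat.add_succ_r. cbn [csum]. rewrite IHi by lia. unfold u at 2.
      rewrite ind_false; [ring|]. intros [k Hk].
      destruct (Nat.le_gt_cases k K).
      - assert (k * p <= K * p)%nat by (apply Nat.mul_le_mono_r; lia). lia.
      - assert (S K * p <= k * p)%nat by (apply Nat.mul_le_mono_r; lia). lia. }
    replace (p * S K)%nat with (S (p * K + (p - 1))) by nia. cbn [csum]. rewrite Z by lia. rewrite IH. f_equal.
    unfold u. replace (S (p * K + (p - 1))) with (p * S K)%nat by nia. rewrite ind_true; [ring|].
    exists (S K). lia. }
  rewrite <- E. apply HN. nia.
Qed.

(** For [N >= 1], [rough N (S N)] says that [S N] is prime. The series over rough integers is zeta
    with the Euler factors of the primes up to [N] removed, and [N] grows one integer at a time. *)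
Definition rough (N m : nat) : Prop := forall d, (2 <= d <= N)%nat -> ~ Nat.divide d m.

Definition roughser (N : nat) (s : C) : C := dser (fun n => ind (rough N (S n))) s.

Lemma ex_series_ind_rpow (P : nat -> Prop) sigma : 1 < sigma -> ex_series (fun n => Cmod (ind (P n)) * rpow n (- sigma)).
Proof.
  intros H. apply (ex_series_Rle _ (fun n => rpow n (- sigma))); [|apply ex_series_rpow, H].
  intros n. assert (A := Cmod_ge_0 (ind (P n))). assert (B := Cmod_ind_le (P n)). assert (D := rpow_pos n (- sigma)). nra.
Qed.

Lemma roughser_cv N s : hp 1 s -> cseries (fun n => ind (rough N (S n)) * pw (INR (S n)) (- s))%C (roughser N s).
Proof. intros H. apply (dirichlet_cv _ 1 s); [|exact H]. intros sigma Hs. apply (ex_series_ind_rpow (fun n => rough N (S n))), Hs. Qed.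

Lemma roughser_1 s : roughser 1 s = zeta0 s.
Proof. apply CSer_ext. intros n. rewrite ind_true; [reflexivity|]. intros d Hd. lia. Qed.

Lemma rough_S N m : rough (S N) m <-> rough N m /\ ((2 <= S N)%nat -> ~ Nat.divide (S N) m).
Proof.
  split.
  - intros H. split; [intros d Hd; apply H; lia | intros H2; apply H; lia].
  - intros [H1 H2] d Hd. destruct (Nat.eq_dec d (S N)) as [->|Hne]; [apply H2; lia | apply H1; lia].
Qed.

Lemma rough_composite N m : ~ rough N (S N) -> (rough (S N) m <-> rough N m).
Proof.
  intros H. rewrite rough_S. split; [tauto|]. intros H1. split; [exact H1|]. intros _ H2.
  apply H. intros d Hd Hdd. apply (H1 d Hd). eapply Nat.divide_trans; eassumption.
Qed.

(** A number [d] between 2 and [N] is coprime to the prime [S N], so Gauss's lemma applies. *)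
Lemma rough_prime_mult N k : (1 <= N)%nat -> rough N (S N) -> (rough N (S N * k) <-> rough N k).
Proof.
  intros HN H. split.
  - intros H1 d Hd Hk. apply (H1 d Hd). apply Nat.divide_mul_r, Hk.
  - intros H1 d Hd Hk. apply (H1 d Hd). apply (Nat.gauss d (S N) k); [exact Hk|].
    set (g := Nat.gcd d (S N)).
    assert (G1 : Nat.divide g d) by apply Nat.gcd_divide_l. assert (G2 : Nat.divide g (S N)) by apply Nat.gcd_divide_r.
    destruct (Nat.eq_dec g 1) as [E|E]; [exact E|exfalso].
    assert (g <> 0)%nat. { intros E0. rewrite E0 in G1. destruct G1 as [x Hx]. lia. }
    assert (g <= d)%nat by (apply Nat.divide_pos_le; [lia | exact G1]).
    apply (H g); [lia | exact G2].
Qed.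

Lemma roughser_composite N s : ~ rough N (S N) -> roughser (S N) s = roughser N s.
Proof.
  intros H. apply CSer_ext. intros n. f_equal.
  apply ind_iff, rough_composite, H.
Qed.

Lemma roughser_prime N s : (1 <= N)%nat -> rough N (S N) -> hp 1 s ->
  roughser (S N) s = ((1 - pw (INR (S N)) (- s)) * roughser N s)%C.
Proof.
  intros HN H Hs.
  assert (S1 := roughser_cv N s Hs). assert (S2 := roughser_cv (S N) s Hs).
  assert (S3 := cseries_minus _ _ _ _ S1 S2). cbv beta in S3.
  assert (S4 : cseries (fun n => ind (Nat.divide (S N) (S n)) * (ind (rough N (S n)) * pw (INR (S n)) (- s)))%C (roughser N s - roughser (S N) s)).
  { eapply cseries_ext; [|exact S3]. intros n. cbv beta.
    destruct (excluded_middle_informative (rough N (S n))) as [Y|Y].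
    - rewrite (ind_true _ Y). destruct (excluded_middle_informative (Nat.divide (S N) (S n))) as [D|D].
      + rewrite (ind_true _ D), ind_false; [ring|]. intros Z. apply rough_S in Z. destruct Z as [_ Z]. apply Z; [lia|exact D].
      + rewrite (ind_false _ D), ind_true; [ring|]. apply rough_S. tauto.
    - rewrite (ind_false _ Y), ind_false; [ring|]. intros Z. apply rough_S in Z. tauto. }
  apply (cseries_multiples (fun m => ind (rough N m) * pw (INR m) (- s))%C) in S4; [|lia].
  assert (S5 := cseries_scal (pw (INR (S N)) (- s)) _ _ S1).
  assert (E : (roughser N s - roughser (S N) s = pw (INR (S N)) (- s) * roughser N s)%C).
  { apply (cseries_unique _ _ _ S4). eapply cseries_ext; [|exact S5]. intros n. cbv beta.
    rewrite mult_INR, pw_mult by apply INR_S_pos.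
    replace (ind (rough N (S N * S n))) with (ind (rough N (S n))); [ring|].
    apply ind_iff. symmetry. apply rough_prime_mult; assumption. }
  replace ((1 - pw (INR (S N)) (- s)) * roughser N s)%C with (roughser N s - pw (INR (S N)) (- s) * roughser N s)%C by ring.
  rewrite <- E. ring.
Qed.

(** Among the first [N] integers only 1 is rough, so the series differs from 1 by at most the tail
    beyond [N]. This is the Euler product in limiting form. *)
Lemma roughser_lim s : hp 1 s -> is_lim_seq (fun N => Cmod (roughser N s)) 1.
Proof.
  intros Hs. apply is_lim_seq_spec. intros eps. simpl.
  assert (HM : ex_series (fun n => rpow n (- Re s))) by (apply ex_series_rpow, Hs).
  destruct (Series_tail_small _ HM eps (cond_pos eps)) as [N0 HN0].
  exists (S N0). intros N HN. specialize (HN0 N ltac:(lia)).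
  assert (S1 := roughser_cv N s Hs).
  assert (T := cseries_tail (fun n => ind (rough N (S n)) * pw (INR (S n)) (- s))%C
     (fun n => rpow n (- Re s)) (roughser N s) N).
  assert (Hb : forall k, Cmod (ind (rough N (S k)) * pw (INR (S k)) (- s))%C <= rpow k (- Re s)).
  { intros k. rewrite Cmod_mult, Cmod_pw_S, Re_opp. generalize (Cmod_ind_le (rough N (S k))) (Cmod_ge_0 (ind (rough N (S k)))) (rpow_pos k (- Re s)). nra. }
  specialize (T Hb HM S1).
  assert (E : csum (fun n => ind (rough N (S n)) * pw (INR (S n)) (- s))%C N = 1).
  { assert (K : forall k, (k < N)%nat -> csum (fun n => ind (rough N (S n)) * pw (INR (S n)) (- s))%C (S k) = 1).
    { induction k as [|k IH]; intros Hk.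
      - cbn [csum]. rewrite ind_true; [simpl INR; rewrite pw_1_l; ring|].
        intros d Hd Hdd. apply Nat.divide_1_r in Hdd. lia.
      - cbn [csum] in *. rewrite IH by lia. rewrite ind_false; [ring|]. intros Y. apply (Y (S (S k))); [lia|]. apply Nat.divide_refl. }
    destruct N as [|N]; [lia|]. apply K. lia. }
  rewrite E in T.
  assert (P : 0 <= Series (fun n => rpow (N + n) (- Re s))) by (apply Rle_trans with (2 := T), Cmod_ge_0).
  rewrite Rabs_pos_eq in HN0 by exact P.
  assert (A1 := Cmod_triangle_rev (roughser N s) 1). assert (A2 := Cmod_triangle_rev 1 (roughser N s)).
  rewrite (Cmod_minus_sym 1) in A2. rewrite Cmod_1 in *. apply Rabs_def1; lra.
Qed.

Lemma cseries_geom (q : C) : Cmod q < 1 -> cseries (fun n => q ^ n)%C (/ (1 - q)).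
Proof.
  intros Hq eps Heps.
  assert (Hd : (1 - q <> 0)%C).
  { apply Cmod_gt_0. generalize (Cmod_triangle_rev 1 q). rewrite Cmod_1. lra. }
  assert (Pd := proj1 (Cmod_gt_0 _) Hd).
  destruct (pow_lt_1_zero (Cmod q)) with (y := eps * Cmod (1 - q)) as [N HN].
  { rewrite Rabs_pos_eq; [exact Hq | apply Cmod_ge_0]. } { apply Rmult_lt_0_compat; assumption. }
  exists N. intros n Hn. specialize (HN n Hn).
  assert (E := csum_geom q n). set (sm := csum (fun k => q ^ k)%C n) in *.
  replace (sm - / (1 - q))%C with (- (q ^ n * / (1 - q)))%C.
  - rewrite Cmod_opp, Cmod_mult, Cmod_inv, Cmod_pow by exact Hd.
    rewrite Rabs_pos_eq in HN by (apply pow_le, Cmod_ge_0).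
    apply Rmult_lt_reg_r with (Cmod (1 - q)); [exact Pd|]. rewrite Rmult_assoc, Rinv_l, Rmult_1_r by lra. exact HN.
  - replace sm with (sm * (1 - q) * / (1 - q))%C by (field; exact Hd). rewrite E. field. exact Hd.
Qed.

Lemma Re_cseries_nonneg (u : nat -> C) l : (forall n, 0 <= Re (u n)) -> cseries u l -> 0 <= Re l.
Proof.
  intros Hu H. apply Rnot_lt_le. intros Hl.
  destruct (H (- Re l) ltac:(lra)) as [N HN]. specialize (HN N (le_n _)).
  assert (P : 0 <= Re (csum u N)).
  { clear HN. induction N as [|N IH]; [simpl; lra|]. cbn [csum]. rewrite Re_plus. generalize (Hu N); lra. }
  assert (A := re_le_Cmod (csum u N - l)). rewrite Re_minus, Rabs_pos_eq in A by lra. lra.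
Qed.

(** * The inequality with exponents 3, 4, 1 for one Euler factor *)

Section EulerFactor.

Variables a b : R.
Hypothesis unit : a * a + b * b = 1.

(** If [a] is the cosine of an angle, this is the cosine of the doubled angle. *)
Let a2 := 2 * (a * a) - 1.

Lemma euler_den_pos (x r : R) : -1 <= x <= 1 -> 0 <= r < 1 -> 0 < 1 - 2 * r * x + r ^ 2.
Proof. intros Hx Hr. assert (0 < (1 - r) ^ 2) by (apply pow_lt; lra). nra. Qed.

Lemma a_range : -1 <= a <= 1.
Proof. nra. Qed.

Lemma a2_range : -1 <= a2 <= 1.
Proof. unfold a2. nra. Qed.

(* The expansion in powers of r has coefficients 2 (1 + Re u^k)^2. *)
Lemma euler_log_derivative (r : R) : 0 <= r < 1 ->
  0 <= 3 / (1 - r) + 4 * ((a - r) / (1 - 2 * r * a + r ^ 2)) + (a2 - r) / (1 - 2 * r * a2 + r ^ 2).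
Proof.
  intros Hr. set (u := (a, b) : C).
  assert (Mu : Cmod u = 1). { unfold u, Cmod. simpl. replace (a * (a * 1) + b * (b * 1)) with 1 by lra. apply sqrt_1. }
  assert (Mq : forall v, Cmod v = 1 -> Cmod (RtoC r * v) < 1).
  { intros v Hv. rewrite Cmod_mult, Hv, Cmod_R, Rabs_pos_eq; lra. }
  assert (Muu : Cmod (u * u) = 1) by (rewrite Cmod_mult, Mu; ring).
  assert (S0 := cseries_scal 3 _ _ (cseries_geom (RtoC r * 1) (Mq 1 Cmod_1))).
  assert (S1 := cseries_scal (4 * u) _ _ (cseries_geom (RtoC r * u) (Mq u Mu))).
  assert (S2 := cseries_scal (u * u) _ _ (cseries_geom (RtoC r * (u * u)) (Mq _ Muu))).
  assert (S3 := cseries_plus _ _ _ _ (cseries_plus _ _ _ _ S0 S1) S2). cbv beta in S3.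
  assert (Pn : forall n, 0 <= Re (3 * (RtoC r * 1) ^ n + 4 * u * (RtoC r * u) ^ n + u * u * (RtoC r * (u * u)) ^ n)%C).
  { intros n. set (v := (u * u ^ n)%C).
    assert (Mv : Cmod v = 1) by (unfold v; rewrite Cmod_mult, Cmod_pow, Mu, pow1; ring).
    replace (3 * (RtoC r * 1) ^ n + 4 * u * (RtoC r * u) ^ n + u * u * (RtoC r * (u * u)) ^ n)%C
      with (RtoC (r ^ n) * (3 + 4 * v + v * v))%C.
    2: { rewrite !Cpow_mult_l, RtoC_pow, Cpow_1_l. unfold v. ring. }
    assert (Pr : 0 <= r ^ n) by (apply pow_le; lra).
    destruct v as [x y]. unfold Re. simpl.
    assert (Exy : x * x + y * y = 1).
    { apply (f_equal (fun z => z * z)) in Mv. unfold Cmod in Mv. rewrite sqrt_sqrt in Mv; simpl in Mv; nra. }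
    replace (r ^ n * (3 + (4 * x - 0 * y) + (x * x - y * y)) - 0 * (0 + (4 * y + 0 * x) + (x * y + y * x)))
      with (r ^ n * (2 * ((1 + x) * (1 + x)))) by (replace (y * y) with (1 - x * x) by lra; ring).
    apply Rmult_le_pos; [exact Pr|]. generalize (Rle_0_sqr (1 + x)). unfold Rsqr. lra. }
  assert (P := Re_cseries_nonneg _ _ Pn S3).
  assert (Pa := euler_den_pos a r a_range Hr). assert (Pa2 := euler_den_pos a2 r a2_range Hr).
  replace (3 / (1 - r) + 4 * ((a - r) / (1 - 2 * r * a + r ^ 2)) + (a2 - r) / (1 - 2 * r * a2 + r ^ 2))
    with (Re (3 * / (1 - RtoC r * 1) + 4 * u * / (1 - RtoC r * u) + u * u * / (1 - RtoC r * (u * u)))%C); [exact P|].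
  rewrite !Re_plus. f_equal; [f_equal|].
  - replace (3 * / (1 - RtoC r * 1))%C with (RtoC (3 / (1 - r))); [reflexivity|].
    unfold Rdiv. rewrite RtoC_mult, RtoC_inv, RtoC_minus by lra. f_equal. f_equal. ring.
  - unfold u, Re. simpl.
    replace ((1 + - (r * a - 0 * b)) * ((1 + - (r * a - 0 * b)) * 1) + (0 + - (r * b + 0 * a)) * ((0 + - (r * b + 0 * a)) * 1))
      with (1 - 2 * r * a + r * (r * 1)).
    2: { transitivity (1 - 2 * r * a + r * r * (a * a + b * b)); [rewrite unit; ring | ring]. }
    replace (a - r) with (a - r * (a * a + b * b)) by (rewrite unit; ring). simpl in Pa. field. lra.
  - unfold u, Re. simpl.
    set (p := a * a - b * b). set (q := a * b + b * a).
    assert (Ep : p = a2) by (unfold p, a2; lra).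
    assert (Epq : p * p + q * q = 1).
    { unfold p, q. transitivity ((a * a + b * b) * (a * a + b * b)); [ring | rewrite unit; ring]. }
    replace ((1 + - (r * p - 0 * q)) * ((1 + - (r * p - 0 * q)) * 1) + (0 + - (r * q + 0 * p)) * ((0 + - (r * q + 0 * p)) * 1))
      with (1 - 2 * r * p + r * (r * 1)).
    2: { transitivity (1 - 2 * r * p + r * r * (p * p + q * q)); [rewrite Epq; ring | ring]. }
    rewrite <- Ep in *. simpl in Pa2.
    replace (p - r) with (p - r * (p * p + q * q)) by (rewrite Epq; ring). field. lra.
Qed.

(** The square of the 3-4-1 inequality: the quadratic factors are squared moduli of [1 - r u] and
    [1 - r u^2] for [u = (a, b)], and [(1 - r) ^ 6] is a square already. The logarithm of the left
    side is 0 at [r = 0] and has derivative -2 times the non-negative quantity of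
    [euler_log_derivative]. *)
Lemma euler_factor (r : R) : 0 <= r < 1 ->
  (1 - r) ^ 6 * (1 - 2 * r * a + r ^ 2) ^ 4 * (1 - 2 * r * a2 + r ^ 2) <= 1.
Proof.
  intros Hr.
  set (f := fun r => 6 * ln (1 - r) + 4 * ln (1 - 2 * r * a + r ^ 2) + ln (1 - 2 * r * a2 + r ^ 2)).
  assert (D : forall x, 0 <= x <= r -> is_derive f x
     (-2 * (3 / (1 - x) + 4 * ((a - x) / (1 - 2 * x * a + x ^ 2)) + (a2 - x) / (1 - 2 * x * a2 + x ^ 2)))).
  { intros x Hx. assert (Pa := euler_den_pos a x a_range ltac:(lra)). assert (Pa2 := euler_den_pos a2 x a2_range ltac:(lra)).
    unfold f. auto_derive; [repeat split; lra|]. field. repeat split; lra. }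
  destruct (MVT_gen f 0 r (fun x => -2 * (3 / (1 - x) + 4 * ((a - x) / (1 - 2 * x * a + x ^ 2)) + (a2 - x) / (1 - 2 * x * a2 + x ^ 2)))) as [x [Hx E]].
  - rewrite Rmin_left, Rmax_right by lra. intros x Hx. apply D. lra.
  - rewrite Rmin_left, Rmax_right by lra. intros x Hx.
    apply continuity_pt_filterlim. apply (ex_derive_continuous (K := R_AbsRing) (V := R_NormedModule) f).
    eexists. apply D. lra.
  - rewrite Rmin_left, Rmax_right in Hx by lra.
    assert (L := euler_log_derivative x ltac:(lra)).
    assert (F0 : f 0 = 0).
    { unfold f. replace (1 - 0) with 1 by ring. replace (1 - 2 * 0 * a + 0 ^ 2) with 1 by ring.
      replace (1 - 2 * 0 * a2 + 0 ^ 2) with 1 by ring. rewrite ln_1. ring. }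
    assert (Fr : f r <= 0) by nra.
    assert (Pa := euler_den_pos a r a_range Hr). assert (Pa2 := euler_den_pos a2 r a2_range Hr).
    apply exp_le in Fr. rewrite exp_0 in Fr. unfold f in Fr. rewrite !exp_plus in Fr.
    replace (6 * ln (1 - r)) with (ln ((1 - r) ^ 6)) in Fr by (rewrite ln_pow by lra; simpl; ring).
    replace (4 * ln (1 - 2 * r * a + r ^ 2)) with (ln ((1 - 2 * r * a + r ^ 2) ^ 4)) in Fr by (rewrite ln_pow by lra; simpl; ring).
    rewrite !exp_ln in Fr by (try apply pow_lt; lra). exact Fr.
Qed.

End EulerFactor.

Lemma Cmod_euler_factor (x sigma t : R) :
  Cmod (1 - pw x (- (sigma, t)))%C ^ 2 =
  1 - 2 * exp (- sigma * ln x) * cos (t * ln x) + exp (- sigma * ln x) ^ 2.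
Proof.
  rewrite Cmod2_alt. unfold pw, Cexp, Re, Im. simpl.
  replace (- sigma * ln x - - t * 0) with (- sigma * ln x) by ring.
  replace (- sigma * 0 + - t * ln x) with (- (t * ln x)) by ring.
  rewrite cos_neg, sin_neg. set (r := exp (- sigma * ln x)). set (th := t * ln x).
  assert (E := sin2_cos2 th). unfold Rsqr in E.
  transitivity (1 - 2 * r * cos th + r * r * (sin th * sin th + cos th * cos th)); [ring | rewrite E; ring].
Qed.

Lemma euler_factor_le_1 (x sigma t : R) : 1 < x -> 0 < sigma ->
  Cmod (1 - pw x (- (sigma, 0)))%C ^ 3 * Cmod (1 - pw x (- (sigma, t)))%C ^ 4 * Cmod (1 - pw x (- (sigma, (2 * t)%R)))%C <= 1.
Proof.
  intros Hx Hs. set (r := exp (- sigma * ln x)).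
  assert (Hl : 0 < ln x) by (rewrite <- ln_1; apply ln_increasing; lra).
  assert (Hr : 0 <= r < 1).
  { split; [left; apply exp_pos|]. unfold r. rewrite <- exp_0. apply exp_increasing. nra. }
  assert (U : cos (t * ln x) * cos (t * ln x) + sin (t * ln x) * sin (t * ln x) = 1).
  { assert (E := sin2_cos2 (t * ln x)). unfold Rsqr in E. lra. }
  assert (F := euler_factor _ _ U r Hr).
  assert (E0 := Cmod_euler_factor x sigma 0). assert (E1 := Cmod_euler_factor x sigma t). assert (E2 := Cmod_euler_factor x sigma (2 * t)).
  fold r in E0, E1, E2. rewrite Rmult_0_l, cos_0 in E0.
  replace (2 * t * ln x) with (2 * (t * ln x)) in E2 by ring. rewrite cos_2a_cos in E2.
  set (c0 := Cmod (1 - pw x (- (sigma, 0)))%C) in *. set (c1 := Cmod (1 - pw x (- (sigma, t)))%C) in *.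
  set (c2 := Cmod (1 - pw x (- (sigma, (2 * t)%R)))%C) in *.
  assert (P0 : 0 <= c0) by apply Cmod_ge_0. assert (P1 : 0 <= c1) by apply Cmod_ge_0. assert (P2 : 0 <= c2) by apply Cmod_ge_0.
  replace (2 * cos (t * ln x) * cos (t * ln x) - 1) with (2 * (cos (t * ln x) * cos (t * ln x)) - 1) in E2 by ring.
  rewrite <- E1, <- E2 in F.
  replace ((1 - r) ^ 6) with ((c0 ^ 2) ^ 3) in F by (rewrite E0; ring).
  set (X := c0 ^ 3 * c1 ^ 4 * c2).
  assert (PX : 0 <= X) by (unfold X; apply Rmult_le_pos; [apply Rmult_le_pos; apply pow_le; assumption | assumption]).
  replace ((c0 ^ 2) ^ 3 * (c1 ^ 2) ^ 4 * c2 ^ 2) with (X * X) in F by (unfold X; ring). nra.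
Qed.

(** The product formed with [roughser N] decreases in [N], factor by factor, and tends to 1; at
    [N = 1] it is the product of zeta values. *)
Lemma three_four_one (sigma t : R) : 1 < sigma ->
  1 <= Cmod (zeta0 (sigma, 0)) ^ 3 * Cmod (zeta0 (sigma, t)) ^ 4 * Cmod (zeta0 (sigma, (2 * t)%R)).
Proof.
  intros Hs.
  set (Q := fun N => Cmod (roughser N (sigma, 0)) ^ 3 * Cmod (roughser N (sigma, t)) ^ 4 * Cmod (roughser N (sigma, (2 * t)%R))).
  assert (H0 : hp 1 (sigma, 0)) by exact Hs. assert (H1 : hp 1 (sigma, t)) by exact Hs. assert (H2 : hp 1 (sigma, (2 * t)%R)) by exact Hs.
  assert (St : forall N, (1 <= N)%nat -> Q (S N) <= Q N).
  { intros N HN. unfold Q. destruct (excluded_middle_informative (rough N (S N))) as [Y|Y].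
    - rewrite !roughser_prime by assumption. rewrite !Cmod_mult, !Rpow_mult_distr.
      assert (F := euler_factor_le_1 (INR (S N)) sigma t ltac:(apply (lt_INR 1); lia) ltac:(lra)).
      match goal with |- ?a * ?b * (?c * ?d) * (?e * ?f) <= _ =>
        replace (a * b * (c * d) * (e * f)) with (a * c * e * (b * d * f)) by ring end.
      rewrite <- (Rmult_1_l (Cmod (roughser N (sigma, 0)) ^ 3 * Cmod (roughser N (sigma, t)) ^ 4 * Cmod (roughser N (sigma, (2 * t)%R)))) at 2.
      apply Rmult_le_compat_r; [|exact F].
      apply Rmult_le_pos; [apply Rmult_le_pos; apply pow_le; apply Cmod_ge_0 | apply Cmod_ge_0].
    - rewrite !roughser_composite by assumption. lra. }
  assert (L : is_lim_seq Q (1 ^ 3 * 1 ^ 4 * 1)).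
  { assert (A := roughser_lim _ H0). assert (B := roughser_lim _ H1). assert (D := roughser_lim _ H2).
    assert (PW : forall (u : nat -> R) l n, is_lim_seq u (Finite l) -> is_lim_seq (fun k => u k ^ n) (Finite (l ^ n))).
    { intros u l n Hu. induction n as [|n IH]; simpl; [apply is_lim_seq_const|].
      apply is_lim_seq_mult'; assumption. }
    apply is_lim_seq_mult'; [apply is_lim_seq_mult'|]; [apply PW, A | apply PW, B | exact D]. }
  assert (B : forall n, Q (S n) <= Q 1%nat).
  { induction n as [|n IH]; [lra|]. apply Rle_trans with (2 := IH), St. lia. }
  apply is_lim_seq_incr_1 in L.
  assert (R := is_lim_seq_le _ _ _ _ B L (is_lim_seq_const _)). simpl in R.
  unfold Q in R. rewrite !roughser_1 in R.
  replace (1 * (1 * (1 * 1)) * (1 * (1 * (1 * (1 * 1)))) * 1) with 1 in R by ring. simpl. exact R.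
Qed.

Lemma cder_loc_bounded f z l : cder f z l -> exists d B, 0 < d /\ 0 < B /\ forall w, Cmod (w - z) < d -> Cmod (f w) <= B.
Proof.
  intros H. destruct (cder_cont _ _ _ H 1 Rlt_0_1) as [d [Hd K]]. exists d, (Cmod (f z) + 1).
  split; [exact Hd|]. split; [generalize (Cmod_ge_0 (f z)); lra|]. intros w Hw.
  specialize (K w Hw). generalize (Cmod_triangle_rev (f w) (f z)). lra.
Qed.

(** A zero at [1 + i t] would bound the 3-4-1 product at real part [1 + e] by [Z * e]: the fourth
    power of a zero outweighs the cube of a simple pole, and the factor at [2 t] stays bounded. *)
Lemma zF_line_1 (t : R) : t <> 0 -> zF (1, t) <> 0.
Proof.
  intros Ht E0.
  destruct (zF_entire (1, t)) as [l Hl]. destruct (zF_entire (1, 0)) as [l0 Hl0]. destruct (zF_entire (1, (2 * t)%R)) as [l2 Hl2].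
  destruct (cder_loc_bounded _ _ _ Hl0) as [d0 [B0 [Hd0 [PB0 K0]]]].
  destruct (cder_loc_bounded _ _ _ Hl2) as [d2 [B2 [Hd2 [PB2 K2]]]].
  destruct (Hl 1 Rlt_0_1) as [d1 [Hd1 K1]].
  set (L := 1 + Cmod l). assert (PL : 0 < L) by (unfold L; generalize (Cmod_ge_0 l); lra).
  set (T := Rabs t). assert (PT : 0 < T) by (apply Rabs_pos_lt, Ht).
  set (Z := B0 ^ 3 * (L / T) ^ 4 * (B2 / T)).
  assert (PZ : 0 < Z). { unfold Z. apply Rmult_lt_0_compat; [apply Rmult_lt_0_compat; apply pow_lt|]; try apply Rdiv_lt_0_compat; assumption. }
  (* The last constraint gives [Z * e < 1], against the lower bound 1. *)
  set (e := Rmin (Rmin d0 (Rmin d1 d2)) (/ Z) / 2).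
  assert (He : 0 < e). { unfold e. apply Rdiv_lt_0_compat; [|lra]. repeat apply Rmin_case; try assumption. apply Rinv_0_lt_compat, PZ. }
  assert (Pm : 0 < Rmin (Rmin d0 (Rmin d1 d2)) (/ Z)) by (unfold e in He; lra).
  assert (E1 : e < d0 /\ e < d1 /\ e < d2 /\ e < / Z).
  { assert (A1 := Rmin_l (Rmin d0 (Rmin d1 d2)) (/ Z)). assert (A2 := Rmin_r (Rmin d0 (Rmin d1 d2)) (/ Z)).
    assert (A3 := Rmin_l d0 (Rmin d1 d2)). assert (A4 := Rmin_r d0 (Rmin d1 d2)).
    assert (A5 := Rmin_l d1 d2). assert (A6 := Rmin_r d1 d2). unfold e. repeat split; lra. }
  destruct E1 as [E1 [E2 [E3 E4]]].
  assert (D : forall y, (((1 + e)%R, y) - (1, y) = RtoC e)%C) by (intros y; apply injective_projections; simpl; ring).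
  assert (Me : Cmod (RtoC e) = e) by (rewrite Cmod_R, Rabs_pos_eq; lra).
  assert (H := three_four_one (1 + e) t ltac:(lra)).
  assert (Zv : forall y, (Cmod (((1 + e)%R, y) - 1)%C * Cmod (zeta0 ((1 + e)%R, y)) = Cmod (zF ((1 + e)%R, y)))).
  { intros y. rewrite zF_zeta0, Cmod_mult by (unfold hp, Re; simpl; lra). reflexivity. }
  assert (Ge : forall y, e <= Cmod (((1 + e)%R, y) - 1)%C).
  { intros y. apply Rle_trans with (2 := re_le_Cmod _). unfold Re. simpl. replace (1 + e + - (1)) with e by ring. apply Rle_abs. }
  assert (Gy : forall y, Rabs y <= Cmod (((1 + e)%R, y) - 1)%C).
  { intros y. apply Rle_trans with (2 := im_le_Cmod _). unfold Im. simpl. replace (y + - 0) with y by ring. apply Rle_refl. }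
  assert (N0 : Cmod (zeta0 ((1 + e)%R, 0)) <= B0 / e).
  { apply Rmult_le_reg_l with e; [exact He|]. replace (e * (B0 / e)) with B0 by (field; lra).
    apply Rle_trans with (Cmod (zF ((1 + e)%R, 0))); [|apply K0; rewrite D, Me; exact E1].
    rewrite <- Zv. apply Rmult_le_compat_r; [apply Cmod_ge_0 | apply Ge]. }
  assert (N1 : Cmod (zeta0 ((1 + e)%R, t)) <= L / T * e).
  { apply Rmult_le_reg_l with T; [exact PT|]. replace (T * (L / T * e)) with (L * e) by (field; lra).
    apply Rle_trans with (Cmod (zF ((1 + e)%R, t))).
    - rewrite <- Zv. apply Rmult_le_compat_r; [apply Cmod_ge_0 | apply Gy].
    - specialize (K1 ((1 + e)%R, t)). rewrite D, Me, E0 in K1. specialize (K1 E2).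
      replace (zF ((1 + e)%R, t)) with ((zF ((1 + e)%R, t) - 0 - l * RtoC e) + l * RtoC e)%C by ring.
      apply Rle_trans with (1 := Cmod_triangle _ _). rewrite Cmod_mult, Me. unfold L. lra. }
  assert (N2 : Cmod (zeta0 ((1 + e)%R, (2 * t)%R)) <= B2 / T).
  { apply Rmult_le_reg_l with T; [exact PT|]. replace (T * (B2 / T)) with B2 by (field; lra).
    apply Rle_trans with (Cmod (zF ((1 + e)%R, (2 * t)%R))); [|apply K2; rewrite D, Me; exact E3].
    rewrite <- Zv. apply Rmult_le_compat_r; [apply Cmod_ge_0|]. apply Rle_trans with (2 := Gy _).
    rewrite Rabs_mult, (Rabs_pos_eq 2) by lra. fold T. lra. }
  assert (F : Cmod (zeta0 ((1 + e)%R, 0)) ^ 3 * Cmod (zeta0 ((1 + e)%R, t)) ^ 4 * Cmod (zeta0 ((1 + e)%R, (2 * t)%R)) <= (B0 / e) ^ 3 * (L / T * e) ^ 4 * (B2 / T)).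
  { apply Rmult_le_compat; [apply Rmult_le_pos; apply pow_le, Cmod_ge_0 | apply Cmod_ge_0 | | exact N2].
    apply Rmult_le_compat; try (apply pow_le, Cmod_ge_0); apply pow_incr; split; try apply Cmod_ge_0; assumption. }
  replace ((B0 / e) ^ 3 * (L / T * e) ^ 4 * (B2 / T)) with (Z * e) in F by (unfold Z; field; lra).
  assert (Z * e < 1); [|lra].
  apply Rlt_le_trans with (Z * / Z); [apply Rmult_lt_compat_l; assumption | right; field; lra].
Qed.

(** * The Fourier series of x - x^2 *)

Lemma is_derive_rsum (u du : nat -> R -> R) N x :
  (forall n, is_derive (u n) x (du n x)) -> is_derive (fun t => rsum (fun n => u n t) N) x (rsum (fun n => du n x) N).
Proof.
  intros H. induction N as [|N IH]; simpl.
  - apply (is_derive_const (K := R_AbsRing) (V := R_NormedModule)).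
  - apply (is_derive_plus (K := R_AbsRing) (V := R_NormedModule)); [exact IH | apply H].
Qed.

Lemma dirichlet_kernel N th : 2 * sin (th / 2) * rsum (fun n => cos (INR (S n) * th)) N = sin ((INR N + / 2) * th) - sin (th / 2).
Proof.
  induction N as [|N IH].
  - simpl. replace ((0 + / 2) * th) with (th / 2) by field. ring.
  - cbn [rsum]. rewrite Rmult_plus_distr_l, IH.
    assert (E : 2 * sin (th / 2) * cos (INR (S N) * th) = sin ((INR (S N) + / 2) * th) - sin ((INR N + / 2) * th)).
    { replace ((INR (S N) + / 2) * th) with (INR (S N) * th + th / 2) by field.
      replace ((INR N + / 2) * th) with (INR (S N) * th - th / 2) by (rewrite S_INR; field).
      rewrite sin_plus, sin_minus. ring. }
    lra.
Qed.

Definition fS (N : nat) (th : R) : R := rsum (fun n => (1 - cos (INR (S n) * th)) / INR (S n) ^ 2) N.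

Definition fS' (N : nat) (th : R) : R := rsum (fun n => sin (INR (S n) * th) / INR (S n)) N.

Lemma fS_derive N th : is_derive (fS N) th (fS' N th).
Proof.
  apply (is_derive_rsum (fun n t => (1 - cos (INR (S n) * t)) / INR (S n) ^ 2) (fun n t => sin (INR (S n) * t) / INR (S n))).
  intros n. assert (P := INR_S_pos n). set (k := INR (S n)) in *. auto_derive; [exact I|]. field. lra.
Qed.

Lemma fS'_derive N th : is_derive (fS' N) th (rsum (fun n => cos (INR (S n) * th)) N).
Proof.
  apply (is_derive_rsum (fun n t => sin (INR (S n) * t) / INR (S n)) (fun n t => cos (INR (S n) * t))).
  intros n. assert (P := INR_S_pos n). set (k := INR (S n)) in *. auto_derive; [exact I|]. field. lra.
Qed.

Lemma sin_nat_PI n : sin (INR n * PI) = 0.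
Proof.
  induction n as [|n IH]; [simpl; rewrite Rmult_0_l; apply sin_0|].
  rewrite S_INR, Rmult_plus_distr_r, Rmult_1_l, neg_sin, IH. ring.
Qed.

Lemma fS'_PI N : fS' N PI = 0.
Proof. unfold fS'. induction N as [|N IH]; [reflexivity|]. cbn [rsum]. rewrite IH, sin_nat_PI. field. apply not_0_INR. lia. Qed.

Lemma abs_MVT (f df : R -> R) (a b B : R) : a <= b -> (forall x, a <= x <= b -> is_derive f x (df x)) ->
  (forall x, a <= x <= b -> Rabs (df x) <= B) -> Rabs (f b - f a) <= B * (b - a).
Proof.
  intros Hab Hd HB. destruct (MVT_gen f a b df) as [x [Hx E]].
  - rewrite Rmin_left, Rmax_right by lra. intros x Hx. apply Hd. lra.
  - rewrite Rmin_left, Rmax_right by lra. intros x Hx. apply continuity_pt_filterlim.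
    apply (ex_derive_continuous (K := R_AbsRing) (V := R_NormedModule) f). eexists. apply Hd, Hx.
  - rewrite Rmin_left, Rmax_right in Hx by lra. rewrite E, Rabs_mult, (Rabs_pos_eq (b - a)) by lra.
    apply Rmult_le_compat_r; [lra | apply HB, Hx].
Qed.

(* Adding the boundary term of an integration by parts makes the derivative of size 1/N. *)
Lemma fS'_bound d N th : 0 < d -> d <= th <= PI ->
  Rabs (fS' N th - (PI / 2 - th / 2)) <= (PI / (4 * sin (d / 2) ^ 2) + / sin (d / 2)) / (INR N + / 2).
Proof.
  intros Hd Hth. assert (Hpi := PI_RGT_0). set (K := INR N + / 2).
  assert (HK : 0 < K) by (unfold K; generalize (pos_INR N); lra).
  assert (Sp : forall x, d <= x <= PI -> sin (d / 2) <= sin (x / 2)).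
  { intros x Hx. apply sin_incr_1; lra. }
  assert (Sd : 0 < sin (d / 2)) by (apply sin_gt_0; lra).
  set (psi := fun x => fS' N x - (PI / 2 - x / 2) + cos (K * x) * / (2 * sin (x / 2)) / K).
  assert (D : forall x, d <= x <= PI -> is_derive psi x (cos (K * x) * (- cos (x / 2) / (4 * sin (x / 2) ^ 2)) / K)).
  { intros x Hx. assert (S1 := Sp x Hx).
    assert (D1 := fS'_derive N x). assert (E := dirichlet_kernel N x). fold K in E.
    assert (D2 : is_derive (fun x => - (PI / 2 - x / 2) + cos (K * x) * / (2 * sin (x / 2)) / K) x
       (/ 2 + (- K * sin (K * x) * / (2 * sin (x / 2)) + cos (K * x) * (- cos (x / 2) / (4 * sin (x / 2) ^ 2))) / K)).
    { auto_derive; [lra|]. replace (x * / 2) with (x / 2) by reflexivity. field. lra. }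
    assert (D3 := is_derive_plus (K := R_AbsRing) (V := R_NormedModule) _ _ _ _ _ D1 D2).
    eapply is_derive_ext; [|replace (cos (K * x) * (- cos (x / 2) / (4 * sin (x / 2) ^ 2)) / K) with
      (plus (rsum (fun n => cos (INR (S n) * x)) N) (/ 2 + (- K * sin (K * x) * / (2 * sin (x / 2)) + cos (K * x) * (- cos (x / 2) / (4 * sin (x / 2) ^ 2))) / K)); [exact D3|]].
    - intros t. unfold psi, plus. simpl. ring.
    - match goal with |- plus ?p ?q = ?r => change (p + q = r) end.
      replace (rsum (fun n => cos (INR (S n) * x)) N) with ((sin (K * x) - sin (x / 2)) / (2 * sin (x / 2))).
      + field. lra.
      + rewrite <- E. field. lra. }
  assert (B := abs_MVT psi _ th PI (/ (4 * sin (d / 2) ^ 2) / K) (proj2 Hth) (fun x Hx => D x ltac:(lra))).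
  assert (Bb : forall x, th <= x <= PI -> Rabs (cos (K * x) * (- cos (x / 2) / (4 * sin (x / 2) ^ 2)) / K) <= / (4 * sin (d / 2) ^ 2) / K).
  { intros x Hx. assert (S1 := Sp x ltac:(lra)).
    assert (P1 : 0 < 4 * sin (d / 2) ^ 2) by (apply Rmult_lt_0_compat; [lra | apply pow_lt, Sd]).
    assert (P2 : 4 * sin (d / 2) ^ 2 <= 4 * sin (x / 2) ^ 2) by (apply Rmult_le_compat_l; [lra|]; apply pow_incr; lra).
    unfold Rdiv. rewrite !Rabs_mult, Rabs_Ropp, !Rabs_inv, (Rabs_pos_eq K), (Rabs_pos_eq (4 * _)) by lra.
    apply Rmult_le_compat_r; [left; apply Rinv_0_lt_compat, HK|].
    assert (C1 := COS_bound (K * x)). assert (C2 := COS_bound (x / 2)).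
    assert (A1 : Rabs (cos (K * x)) <= 1) by (apply Rabs_le; lra). assert (A2 : Rabs (cos (x / 2)) <= 1) by (apply Rabs_le; lra).
    assert (A3 : / (4 * sin (x / 2) ^ 2) <= / (4 * sin (d / 2) ^ 2)) by (apply Rinv_le_contravar; lra).
    assert (A4 : 0 < / (4 * sin (x / 2) ^ 2)) by (apply Rinv_0_lt_compat; lra).
    assert (A5 := Rabs_pos (cos (K * x))). assert (A6 := Rabs_pos (cos (x / 2))).
    apply Rle_trans with (1 * (1 * / (4 * sin (x / 2) ^ 2))); [|lra].
    apply Rmult_le_compat; [assumption | apply Rmult_le_pos; lra | assumption |]. apply Rmult_le_compat_r; lra. }
  specialize (B Bb).
  assert (Q0 : Rabs (psi PI) <= / (2 * sin (d / 2)) / K).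
  { unfold psi. rewrite fS'_PI. replace (0 - (PI / 2 - PI / 2)) with 0 by ring. rewrite Rplus_0_l.
    unfold Rdiv at 1. rewrite !Rabs_mult, !Rabs_inv, (Rabs_pos_eq K) by lra. apply Rmult_le_compat_r; [left; apply Rinv_0_lt_compat, HK|].
    assert (S1 := Sp PI ltac:(lra)). rewrite (Rabs_pos_eq (2 * _)) by lra.
    assert (C1 := COS_bound (K * PI)). assert (A1 : Rabs (cos (K * PI)) <= 1) by (apply Rabs_le; lra).
    assert (A3 : / (2 * sin (PI / 2)) <= / (2 * sin (d / 2))) by (apply Rinv_le_contravar; lra).
    assert (A4 : 0 < / (2 * sin (PI / 2))) by (apply Rinv_0_lt_compat; lra). assert (A5 := Rabs_pos (cos (K * PI))). nra. }
  assert (Qt : Rabs (cos (K * th) * / (2 * sin (th / 2)) / K) <= / (2 * sin (d / 2)) / K).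
  { unfold Rdiv at 1. rewrite !Rabs_mult, !Rabs_inv, (Rabs_pos_eq K) by lra. apply Rmult_le_compat_r; [left; apply Rinv_0_lt_compat, HK|].
    assert (S1 := Sp th ltac:(lra)). rewrite (Rabs_pos_eq (2 * _)) by lra.
    assert (C1 := COS_bound (K * th)). assert (A1 : Rabs (cos (K * th)) <= 1) by (apply Rabs_le; lra).
    assert (A3 : / (2 * sin (th / 2)) <= / (2 * sin (d / 2))) by (apply Rinv_le_contravar; lra).
    assert (A4 : 0 < / (2 * sin (th / 2))) by (apply Rinv_0_lt_compat; lra). assert (A5 := Rabs_pos (cos (K * th))). nra. }
  assert (B' : Rabs (psi PI - psi th) <= / (4 * sin (d / 2) ^ 2) / K * PI).
  { apply Rle_trans with (1 := B). apply Rmult_le_compat_l; [|lra].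
    left; apply Rdiv_lt_0_compat; [apply Rinv_0_lt_compat, Rmult_lt_0_compat; [lra|apply pow_lt, Sd] | exact HK]. }
  replace (fS' N th - (PI / 2 - th / 2)) with (psi PI - (psi PI - psi th) - cos (K * th) * / (2 * sin (th / 2)) / K) by (unfold psi; ring).
  replace ((PI / (4 * sin (d / 2) ^ 2) + / sin (d / 2)) / K)
    with (/ (2 * sin (d / 2)) / K + / (4 * sin (d / 2) ^ 2) / K * PI + / (2 * sin (d / 2)) / K) by (field; lra).
  eapply Rle_trans; [apply Rabs_triang|]. rewrite Rabs_Ropp. apply Rplus_le_compat; [|exact Qt].
  eapply Rle_trans; [apply Rabs_triang|]. rewrite Rabs_Ropp. apply Rplus_le_compat; assumption.
Qed.

Lemma one_minus_cos_bounds x : 0 <= 1 - cos x <= 2.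
Proof. generalize (COS_bound x); lra. Qed.

Lemma one_minus_cos_sq x : 1 - cos x <= x ^ 2 / 2.
Proof.
  replace x with (2 * (x / 2)) at 1 by field. rewrite cos_2a_sin.
  assert (H : Rabs (sin (x / 2)) <= Rabs (x / 2)).
  { destruct (Rle_dec 0 (x / 2)) as [Hp|Hp].
    - assert (A := abs_MVT sin cos 0 (x / 2) 1 Hp (fun t _ => is_derive_sin t) ).
      rewrite sin_0, !Rminus_0_r, Rmult_1_l in A. rewrite (Rabs_pos_eq (x / 2)) by lra. apply A.
      intros t _. apply Rabs_le. generalize (COS_bound t); lra.
    - assert (A := abs_MVT sin cos (x / 2) 0 1 ltac:(lra) (fun t _ => is_derive_sin t)).
      rewrite sin_0, !Rminus_0_l, Rmult_1_l, Rabs_Ropp in A. rewrite (Rabs_left (x / 2)) by lra. apply A.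
      intros t _. apply Rabs_le. generalize (COS_bound t); lra. }
  assert (H2 : sin (x / 2) ^ 2 <= (x / 2) ^ 2).
  { rewrite <- (pow2_abs (sin (x / 2))), <- (pow2_abs (x / 2)). apply pow_incr. split; [apply Rabs_pos | exact H]. }
  replace (x ^ 2 / 2) with (2 * (x / 2) ^ 2) by field. simpl in *. lra.
Qed.

(** A bound of exponent one half: it leaves the summable power [n ^ (- 3 / 2)] in the Fourier series
    and a factor [sqrt d] that tends to 0. *)
Lemma one_minus_cos_sqrt x : 0 <= x -> 1 - cos x <= 2 * sqrt x.
Proof.
  intros Hx. assert (P := sqrt_pos x). assert (E := sqrt_sqrt x Hx).
  destruct (Rle_dec x 1) as [H|H].
  - apply Rle_trans with (1 := one_minus_cos_sq x).
    assert (sqrt x <= 1) by (rewrite <- sqrt_1; apply sqrt_le_1_alt, H).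
    assert (x <= sqrt x) by nra. nra.
  - apply Rle_trans with 2; [apply one_minus_cos_bounds|].
    assert (1 <= sqrt x) by (rewrite <- sqrt_1; apply sqrt_le_1_alt; lra). lra.
Qed.

Definition fterm (th : R) (n : nat) : R := (1 - cos (INR (S n) * th)) / INR (S n) ^ 2.

Lemma rpow_m2 n : rpow n (- (2)) = / INR (S n) ^ 2.
Proof.
  replace (- (2)) with (-1 + -1) by ring. rewrite rpow_plus, rpow_m1. field. apply not_0_INR. lia.
Qed.

Lemma fterm_bounds th n : 0 <= fterm th n <= 2 * rpow n (- (2)).
Proof.
  unfold fterm. rewrite rpow_m2. assert (P := INR_S_pos n). assert (0 < / INR (S n) ^ 2) by (apply Rinv_0_lt_compat, pow_lt, P).
  assert (B := one_minus_cos_bounds (INR (S n) * th)). unfold Rdiv. nra.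
Qed.

Lemma fterm_ex th : ex_series (fterm th).
Proof. apply (ex_series_Rle _ (fun n => 2 * rpow n (- (2)))); [apply fterm_bounds|]. apply ex_series_Rscal, ex_series_rpow. lra. Qed.

Lemma fS_lim th : is_lim_seq (fun N => fS N th) (Series (fterm th)).
Proof.
  apply is_lim_seq_incr_1. apply (is_lim_seq_ext (sum_n (fterm th))).
  - intros n. rewrite <- rsum_sum_n. reflexivity.
  - apply Series_correct, fterm_ex.
Qed.

Lemma fterm_small d : 0 <= d -> Series (fterm d) <= 2 * sqrt d * Series (fun n => rpow n (- (3 / 2))).
Proof.
  intros Hd. rewrite <- Series_scal_l. apply Series_le; [|apply ex_series_Rscal, ex_series_rpow; lra].
  intros n. split; [apply fterm_bounds|].
  unfold fterm. assert (P := INR_S_pos n). assert (Pk : 0 < / INR (S n) ^ 2) by (apply Rinv_0_lt_compat, pow_lt, P).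
  assert (B := one_minus_cos_sqrt (INR (S n) * d) ltac:(apply Rmult_le_pos; lra)).
  rewrite sqrt_mult in B by lra.
  replace (rpow n (- (3 / 2))) with (sqrt (INR (S n)) * / INR (S n) ^ 2).
  - unfold Rdiv. apply Rle_trans with (2 * (sqrt (INR (S n)) * sqrt d) * / INR (S n) ^ 2); [apply Rmult_le_compat_r; lra|].
    right; ring.
  - rewrite <- rpow_m2. replace (- (3 / 2)) with (/ 2 + - (2)) by field. rewrite rpow_plus. f_equal.
    unfold rpow. rewrite <- (exp_ln (sqrt (INR (S n)))) by (apply sqrt_lt_R0, P). f_equal.
    assert (Ls : ln (INR (S n)) = 2 * ln (sqrt (INR (S n)))).
    { rewrite <- (sqrt_sqrt (INR (S n))) at 1 by lra. rewrite ln_mult by (apply sqrt_lt_R0, P). ring. }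
    rewrite Ls. field.
Qed.

(** The derivatives of the partial sums converge uniformly on [[d, PI]], so the difference of the
    two sides is constant on [(0, PI]]; letting the argument tend to 0 shows that the constant is
    0. *)
Lemma fourier_half th : 0 < th <= PI -> Series (fterm th) = PI * th / 2 - th ^ 2 / 4.
Proof.
  intros Hth. assert (Hpi := PI_RGT_0).
  set (F := fun x => PI * x / 2 - x ^ 2 / 4).
  assert (Const : forall d, 0 < d <= th -> Series (fterm th) - F th = Series (fterm d) - F d).
  { intros d Hd. set (Cd := (PI / (4 * sin (d / 2) ^ 2) + / sin (d / 2))).
    assert (L1 : is_lim_seq (fun N => (fS N th - F th) - (fS N d - F d)) ((Series (fterm th) - F th) - (Series (fterm d) - F d))).
    { apply is_lim_seq_minus'; (apply is_lim_seq_minus'; [apply fS_lim | apply is_lim_seq_const]). }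
    assert (L2 : is_lim_seq (fun N => (fS N th - F th) - (fS N d - F d)) 0).
    { apply is_lim_seq_abs_0.
      apply (is_lim_seq_le_le (fun _ => 0) _ (fun N => Cd * (th - d) * / (INR N + / 2))).
      - intros N. split; [apply Rabs_pos|].
        assert (B := abs_MVT (fun x => fS N x - F x) (fun x => fS' N x - (PI / 2 - x / 2)) d th (Cd / (INR N + / 2)) (proj2 Hd)).
        replace (Cd * (th - d) * / (INR N + / 2)) with (Cd / (INR N + / 2) * (th - d)) by (unfold Rdiv; ring). apply B.
        + intros x _. apply (is_derive_minus (K := R_AbsRing) (V := R_NormedModule) (fS N) F); [apply fS_derive|].
          unfold F. auto_derive; [exact I|]. field.
        + intros x Hx. apply fS'_bound; lra.
      - apply is_lim_seq_const.
      - replace (Finite 0) with (Rbar_mult (Finite (Cd * (th - d))) (Finite 0)) by (simpl; f_equal; ring).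
        apply is_lim_seq_scal_l.
        apply (is_lim_seq_inv (fun N => INR N + / 2) p_infty); [|discriminate].
        apply (is_lim_seq_plus _ _ p_infty (/ 2)); [apply is_lim_seq_INR | apply is_lim_seq_const | exact I || reflexivity]. }
    apply is_lim_seq_unique in L1. apply is_lim_seq_unique in L2. rewrite L1 in L2. injection L2. lra. }
  set (Q := Series (fun n => rpow n (- (3 / 2)))).
  assert (PQ : 0 <= Q).
  { apply Rle_trans with (rsum (fun n => rpow n (- (3 / 2))) 0); [simpl; lra|]. apply rsum_le_Series; [intros; left; apply rpow_pos|].
    apply ex_series_rpow; lra. }
  (* Both [Series (fterm d)] and [F d] are of order [sqrt d]. *)
  assert (Small : forall d, 0 < d <= th -> d <= 1 -> Rabs (Series (fterm th) - F th) <= (2 * Q + PI + 1) * sqrt d).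
  { intros d Hd Hd1. rewrite (Const d Hd).
    assert (P := sqrt_lt_R0 d (proj1 Hd)). assert (E := sqrt_sqrt d ltac:(lra)).
    assert (S1 : sqrt d <= 1) by (rewrite <- sqrt_1; apply sqrt_le_1_alt, Hd1).
    assert (B1 := fterm_small d ltac:(lra)). fold Q in B1.
    assert (B0 : 0 <= Series (fterm d)).
    { apply Rle_trans with (rsum (fterm d) 0); [simpl; lra|]. apply rsum_le_Series; [intros; apply fterm_bounds | apply fterm_ex]. }
    assert (Fd : 0 <= F d <= PI * sqrt d).
    { unfold F. assert (d <= sqrt d) by nra. split; nra. }
    apply Rabs_le. split; nra. }
  apply Rminus_diag_uniq. fold (F th).
  destruct (Req_dec (Series (fterm th) - F th) 0) as [E|E]; [exact E|exfalso].
  assert (P := Rabs_pos_lt _ E). set (v := Rabs (Series (fterm th) - F th)) in *.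
  set (W := 2 * Q + PI + 1) in *. assert (PW : 0 < W) by (unfold W; lra).
  set (d := Rmin (Rmin th 1) ((v / (2 * W)) ^ 2)).
  assert (Hd : 0 < d). { unfold d. repeat apply Rmin_case; try lra. apply pow_lt, Rdiv_lt_0_compat; lra. }
  assert (D1 : d <= th /\ d <= 1).
  { assert (A := Rmin_l (Rmin th 1) ((v / (2 * W)) ^ 2)). assert (B := Rmin_l th 1). assert (D := Rmin_r th 1). unfold d. lra. }
  assert (D2 : sqrt d <= v / (2 * W)).
  { rewrite <- (sqrt_pow2 (v / (2 * W))) by (apply Rdiv_le_0_compat; lra). apply sqrt_le_1_alt. apply Rmin_r. }
  assert (B := Small d ltac:(lra) ltac:(lra)).
  assert (W * sqrt d <= W * (v / (2 * W))) by (apply Rmult_le_compat_l; lra).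
  replace (W * (v / (2 * W))) with (v / 2) in H by (field; lra). lra.
Qed.

Lemma fterm_periodic th k n : fterm (th + 2 * INR k * PI) n = fterm th n.
Proof.
  unfold fterm. do 2 f_equal.
  replace (INR (S n) * (th + 2 * INR k * PI)) with (INR (S n) * th + 2 * INR (S n * k) * PI) by (rewrite mult_INR; ring).
  apply cos_period.
Qed.

Lemma fourier th : 0 <= th <= 2 * PI -> Series (fterm th) = PI * th / 2 - th ^ 2 / 4.
Proof.
  intros Hth. assert (Hpi := PI_RGT_0).
  destruct (Req_dec th 0) as [->|H0].
  - rewrite (Series_ext _ (fun n => 0 * rpow n (- (2)))).
    + rewrite Series_scal_l. field.
    + intros n. unfold fterm. rewrite Rmult_0_r, cos_0. unfold Rdiv. ring.
  - destruct (Rle_dec th PI) as [H|H]; [apply fourier_half; lra|].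
    destruct (Req_dec th (2 * PI)) as [->|H2].
    + rewrite (Series_ext _ (fun n => 0 * rpow n (- (2)))).
      * rewrite Series_scal_l. field.
      * intros n. replace (2 * PI) with (0 + 2 * INR 1 * PI) by (simpl; ring). rewrite fterm_periodic.
        unfold fterm. rewrite Rmult_0_r, cos_0. unfold Rdiv. ring.
    + rewrite (Series_ext _ (fterm (2 * PI - th))).
      * rewrite fourier_half by lra. field.
      * intros n. replace (2 * PI - th) with (- th + 2 * INR 1 * PI) by (simpl; ring). rewrite fterm_periodic.
        unfold fterm. do 2 f_equal. replace (INR (S n) * - th) with (- (INR (S n) * th)) by ring. rewrite cos_neg. reflexivity.
Qed.

(** * Euler-Maclaurin representation of zeta on Re s > -1 *)

Lemma rder_plus (f g : R -> C) t a b : rder f t a -> rder g t b -> rder (fun u => f u + g u)%C t (a + b).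
Proof.
  rewrite !rder_is_derive. intros H1 H2. exact (is_derive_plus (K := R_AbsRing) (V := C_R_NormedModule) _ _ _ _ _ H1 H2).
Qed.

Lemma rder_const c t : rder (fun _ => c) t 0.
Proof. apply rder_is_derive. apply (is_derive_const (K := R_AbsRing) (V := C_R_NormedModule)). Qed.

Lemma rder_eq g t v v' : rder g t v -> v = v' -> rder g t v'.
Proof. intros H <-; exact H. Qed.

Lemma rder_scal c g t v : rder g t v -> rder (fun u => c * g u)%C t (c * v).
Proof. intros H. eapply rder_eq; [apply rder_mult; [apply rder_const | exact H]|]. cbv beta. ring. Qed.

Lemma pw_minus_1 x w : 0 < x -> pw x (w - 1) = (pw x w * / RtoC x)%C.
Proof. intros Hx. unfold Cminus. rewrite pw_add, pw_opp, pw_1 by exact Hx. reflexivity. Qed.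

Lemma rder_pw x w : 0 < x -> rder (fun u => pw u w) x (w * pw x (w - 1)).
Proof.
  intros Hx.
  assert (R3 : rder (fun u => RtoC (ln u)) x (RtoC (/ x))).
  { apply is_derive_rder; unfold Re, Im; simpl.
    - auto_derive; [lra|]. field. lra.
    - apply (is_derive_const (K := R_AbsRing) (V := R_NormedModule)). }
  rewrite pw_minus_1 by exact Hx.
  eapply rder_eq; [apply (rder_comp (fun z => Cexp (w * z)) (fun u => RtoC (ln u))); [|exact R3]|].
  - cder_auto.
  - unfold pw. rewrite RtoC_inv by lra. ring.
Qed.

Lemma rcont_pw x w : 0 < x -> rcont (fun u => pw u w) x.
Proof. intros Hx. eapply rder_cont, rder_pw, Hx. Qed.

Lemma rcont_RtoC (f : R -> R) x : continuous f x -> rcont (fun u => RtoC (f u)) x.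
Proof. intros H. apply continuous_rcont; unfold Re, Im; simpl; [exact H | apply continuous_const]. Qed.

Lemma pw_shift x s : 0 < x ->
  pw x (- s - 1) = (RtoC x * pw x (- s - 2))%C /\ pw x (- s) = (RtoC x ^ 2 * pw x (- s - 2))%C /\
  pw x (1 - s) = (RtoC x ^ 3 * pw x (- s - 2))%C.
Proof.
  intros Hx. assert (N : RtoC x <> 0) by (apply RtoC_neq_0; lra).
  assert (A : pw x (- s - 2) = (pw x (- s - 1) * / RtoC x)%C).
  { rewrite <- pw_minus_1 by exact Hx. f_equal. replace (RtoC 2) with (1 + 1)%C by (rewrite <- RtoC_plus; f_equal; ring). ring. }
  assert (B : pw x (- s - 1) = (pw x (- s) * / RtoC x)%C) by (apply pw_minus_1, Hx).
  assert (D : pw x (- s) = (pw x (1 - s) * / RtoC x)%C).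
  { rewrite <- pw_minus_1 by exact Hx. f_equal. ring. }
  repeat split; rewrite A, ?B, ?D; field; exact N.
Qed.

(** [2 (s - 1)] times the error of the trapezoid rule for [x ^ (- s)] on the interval from [k + 1]
    to [k + 2]. *)
Definition zE (k : nat) (s : C) : C :=
  ((s - 1) * (pw (INR (S (S k))) (- s) + pw (INR (S k)) (- s)) + 2 * (pw (INR (S (S k))) (1 - s) - pw (INR (S k)) (1 - s)))%C.

Definition sawq (n x : R) : R := (x - n) * (n + 1 - x).

Lemma rcont_sawq_pw n x w : 0 < x -> rcont (fun u => RtoC (sawq n u) * pw u w)%C x.
Proof.
  intros Hx. apply rcont_mult; [|apply rcont_pw, Hx]. apply rcont_RtoC.
  apply (ex_derive_continuous (K := R_AbsRing) (V := R_NormedModule)). unfold sawq. auto_derive. exact I.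
Qed.

(** The antiderivative of [sawq n x * x ^ (- s - 2)], found by expanding the quadratic and cleared
    of the denominators [s - 1], [s] and [s + 1]. *)
Definition zM (n : R) (s : C) (x : R) : C :=
  (s * (s + 1) * pw x (1 - s) + (- (RtoC (2 * n + 1) * (s - 1) * (s + 1)) * pw x (- s)
   + RtoC (n * (n + 1)) * (s - 1) * s * pw x (- s - 1)))%C.

Lemma zM_rder n s x : 0 < x ->
  rder (zM n s) x ((s - 1) * s * (s + 1) * (RtoC (sawq n x) * pw x (- s - 2)))%C.
Proof.
  intros Hx. unfold zM.
  eapply rder_eq; [apply rder_plus; [|apply rder_plus]; apply rder_scal, rder_pw, Hx|].
  replace (1 - s - 1)%C with (- s)%C by ring.
  replace (- s - 1 - 1)%C with (- s - 2)%C by (replace (RtoC 2) with (1 + 1)%C by (rewrite <- RtoC_plus; f_equal; ring); ring).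
  destruct (pw_shift x s Hx) as [E1 [E2 _]]. rewrite E1, E2. unfold sawq.
  rewrite !RtoC_mult, !RtoC_minus, !RtoC_plus, !RtoC_mult. ring.
Qed.

Lemma saw_integral n s a b : 0 < a -> a <= b ->
  ((s - 1) * s * (s + 1) * CInt (fun x => RtoC (sawq n x) * pw x (- s - 2)) a b = zM n s b - zM n s a)%C.
Proof.
  intros Ha Hab.
  assert (Hc : rcont_on (fun x => RtoC (sawq n x) * pw x (- s - 2))%C a b).
  { apply rcont_on_le; [exact Hab|]. intros t Ht. apply rcont_sawq_pw. lra. }
  rewrite <- CInt_scal by exact Hc. apply (CInt_derive (zM n s)).
  - rewrite Rmin_left, Rmax_right by exact Hab. intros t Ht. apply zM_rder. lra.
  - intros t Ht. apply rcont_scal, Hc, Ht.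
Qed.

Lemma zM_diff k s : (zM (INR (S k)) s (INR (S (S k))) - zM (INR (S k)) s (INR (S k)) = zE k s)%C.
Proof.
  unfold zM, zE. rewrite (S_INR (S k)). assert (P := INR_S_pos k). set (n := INR (S k)) in *.
  destruct (pw_shift n s P) as [E1 [E2 E3]]. destruct (pw_shift (n + 1) s ltac:(lra)) as [F1 [F2 F3]].
  rewrite E1, E2, E3, F1, F2, F3. rewrite !RtoC_mult, !RtoC_plus, !RtoC_mult. ring.
Qed.

Lemma zE_integral k s :
  ((s - 1) * s * (s + 1) * CInt (fun x => RtoC (sawq (INR (S k)) x) * pw x (- s - 2)) (INR (S k)) (INR (S (S k))) = zE k s)%C.
Proof. rewrite saw_integral; [apply zM_diff | apply INR_S_pos | apply le_INR; lia]. Qed.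

(** The closed form of [zE] hides a cancellation; the integral form shows the decay
    [n ^ (- Re s - 2)], summable for [Re s > -1]. *)
Lemma zE_bound k s sigma : -1 < sigma <= Re s ->
  Cmod (zE k s) <= Cmod ((s - 1) * s * (s + 1)) * rpow k (- (sigma + 2)).
Proof.
  intros Hs. rewrite <- zE_integral, Cmod_mult. apply Rmult_le_compat_l; [apply Cmod_ge_0|].
  assert (P := INR_S_pos k). assert (P1 := pos_INR k). set (n := INR (S k)) in *. rewrite (S_INR (S k)). fold n.
  replace (rpow k (- (sigma + 2))) with (Rabs (n + 1 - n) * rpow k (- (sigma + 2))) by (replace (n + 1 - n) with 1 by ring; rewrite Rabs_R1; ring).
  assert (Hn1 : 1 <= n) by (unfold n; rewrite S_INR; lra).
  apply CInt_bound.
  - apply rcont_on_le; [lra|]. intros t Ht. apply rcont_sawq_pw. lra.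
  - rewrite Rmin_left, Rmax_right by lra. intros x Hx. rewrite Cmod_mult, Cmod_R, Cmod_pw.
    assert (A1 : Rabs (sawq n x) <= 1) by (unfold sawq; apply Rabs_le; nra).
    assert (A2 : exp (Re (- s - 2) * ln x) <= rpow k (- (sigma + 2))).
    { unfold rpow. fold n. apply exp_le. rewrite Re_minus, Re_opp, Re_RtoC.
      assert (L1 : 0 <= ln n) by (apply ln_ge_0, Hn1). assert (L2 : ln n <= ln x) by (apply ln_le; lra). nra. }
    assert (A3 := exp_pos (Re (- s - 2) * ln x)). assert (A4 := Rabs_pos (sawq n x)).
    rewrite <- (Rmult_1_l (rpow k (- (sigma + 2)))). apply Rmult_le_compat; lra.
Qed.

Lemma zE_cder k s : exists l, cder (zE k) s l.
Proof.
  eexists. unfold zE.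
  apply (cder_plus (fun s => (s - 1) * (pw (INR (S (S k))) (- s) + pw (INR (S k)) (- s)))%C).
  - apply (cder_mult (fun s => s - 1)%C); [cder_auto|].
    apply (cder_plus (fun s => pw (INR (S (S k))) (- s))); apply cder_pw_opp.
  - apply (cder_mult (fun _ => RtoC 2)); [apply cder_const|].
    apply (cder_minus (fun s => pw (INR (S (S k))) (1 - s)));
    (apply (cder_comp (pw _) (fun s => 1 - s)%C); [apply cder_pw | cder_auto]).
Qed.

Lemma zE_cv s : hp (-1) s -> cseries (fun k => zE k s) (CSer (fun k => zE k s)).
Proof.
  intros Hs. apply (cseries_abs _ (fun k => Cmod ((s - 1) * s * (s + 1)) * rpow k (- (Re s + 2)))).
  - intros k. apply zE_bound. unfold hp in Hs. lra.
  - apply (ex_series_Rscal (Cmod ((s - 1) * s * (s + 1)))), ex_series_rpow. unfold hp in Hs. lra.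
Qed.

Lemma zE_holo : holo_on (hp (-1)) (fun s => CSer (fun k => zE k s)).
Proof.
  apply (weierstrass_holo (hp (-1)) zE); [|intros n z _; apply zE_cder].
  intros s Hs. unfold hp in Hs. set (r := (Re s + 1) / 2).
  set (K := Cmod s + r + 1).
  exists r, (fun k => K * K * K * rpow k (- (Re s - r + 2))).
  assert (Hr : 0 < r) by (unfold r; lra). split; [exact Hr|]. split; [|split].
  - intros z Hz. apply Re_cdisc in Hz. unfold hp, r in *. lra.
  - apply (ex_series_Rscal (K * K * K)), ex_series_rpow. unfold r; lra.
  - intros k z Hz. assert (Hz' := Re_cdisc _ _ _ Hz).
    apply Rle_trans with (1 := zE_bound k z (Re s - r) ltac:(unfold r in *; lra)).
    apply Rmult_le_compat_r; [left; apply rpow_pos|].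
    assert (Mz : Cmod z <= Cmod s + r) by (unfold cdisc in Hz; generalize (Cmod_triangle_rev z s); lra).
    rewrite !Cmod_mult.
    assert (B1 : Cmod (z - 1) <= K) by (apply Rle_trans with (1 := Cmod_triangle_minus _ _); rewrite Cmod_1; unfold K; lra).
    assert (B2 : Cmod (z + 1) <= K) by (apply Rle_trans with (1 := Cmod_triangle _ _); rewrite Cmod_1; unfold K; lra).
    assert (B3 : Cmod z <= K) by (unfold K; lra).
    apply Rmult_le_compat; [apply Rmult_le_pos; apply Cmod_ge_0 | apply Cmod_ge_0 | | exact B2].
    apply Rmult_le_compat; try apply Cmod_ge_0; assumption.
Qed.

Lemma zE_zeta0 s : hp 1 s -> CSer (fun k => zE k s) = (2 * ((s - 1) * zeta0 s) - s - 1)%C.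
Proof.
  intros Hs. apply CSer_unique.
  assert (H := zeta0_cv s Hs).
  assert (H1 : cseries (fun k => pw (INR (S (S k))) (- s)) (zeta0 s - 1)).
  { apply (cseries_shift (fun k => pw (INR (S k)) (- s))).
    replace (pw (INR 1) (- s) + (zeta0 s - 1))%C with (zeta0 s); [exact H|]. simpl INR. rewrite pw_1_l. ring. }
  pose (w := (s - 1)%C). assert (Hw : 0 < Re w) by (unfold w; rewrite Re_minus, Re_RtoC; unfold hp in Hs; lra).
  assert (T := cseries_telescope (fun n => pw (INR n + 1) (- w)) 0 (pw_tends_0 1 w Rlt_0_1 Hw)). cbv beta in T.
  simpl (INR 0) in T. rewrite Rplus_0_l, pw_1_l in T.
  assert (R := cseries_minus _ _ _ _ (cseries_scal (s - 1) _ _ (cseries_plus _ _ _ _ H1 H)) (cseries_scal 2 _ _ T)). cbv beta in R.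
  match type of R with cseries _ ?l => replace (2 * ((s - 1) * zeta0 s) - s - 1)%C with l end.
  - eapply cseries_ext; [|exact R]. intros k. cbv beta. unfold zE.
    rewrite <- !S_INR. replace (- w)%C with (1 - s)%C by (unfold w; ring). ring.
  - replace (RtoC 2) with (1 + 1)%C by (rewrite <- RtoC_plus; f_equal; ring). ring.
Qed.

(** Summing trapezoid errors from 1 to infinity counts every integer twice except 1, whence the
    correction [- s - 1]; uniqueness of continuation extends this from [Re s > 1]. *)
Lemma zE_zF s : hp (-1) s -> CSer (fun k => zE k s) = (2 * zF s - s - 1)%C.
Proof.
  assert (P3 : hp 1 3) by (unfold hp; rewrite Re_RtoC; lra).
  destruct (hp_open 1 3 P3) as [d [Hd Hd2]].
  revert s. apply (identity_eq (hp (-1)) (fun s => CSer (fun k => zE k s)) (fun s => 2 * zF s - s - 1)%C 3 d).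
  - apply hp_open.
  - apply hp_convex.
  - apply zE_holo.
  - intros s _. destruct (zF_entire s) as [l Hl]. eexists. cder_auto.
  - unfold hp; rewrite Re_RtoC; lra.
  - exact Hd.
  - intros z Hz. assert (H := Hd2 z Hz). rewrite zF_zeta0, zE_zeta0 by exact H. reflexivity.
Qed.

(** * The Mellin transform of 1 - cos *)

Definition strip (a b : R) (s : C) : Prop := a < Re s < b.

Lemma strip_disc a b s z : strip a b s -> cdisc s (Rmin (Re s - a) (b - Re s)) z -> strip a b z.
Proof.
  intros H Hz. apply Re_cdisc in Hz. unfold strip in *.
  generalize (Rmin_l (Re s - a) (b - Re s)) (Rmin_r (Re s - a) (b - Re s)). lra.
Qed.

Lemma strip_open a b : copen (strip a b).
Proof.
  intros s Hs. exists (Rmin (Re s - a) (b - Re s)). split; [unfold strip in Hs; apply Rmin_case; lra|].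
  intros z. apply strip_disc, Hs.
Qed.

Lemma strip_convex a b : convex_set (strip a b).
Proof.
  intros p q t Hp Hq Ht. unfold strip in *.
  replace (Re (p + RtoC t * (q - p))) with (Re p + t * (Re q - Re p)) by (unfold Re; simpl; ring).
  destruct (Rle_dec t (1 / 2)); nra.
Qed.

Lemma ex_series_exp x : ex_series (fun n => x ^ n / INR (fact n)).
Proof.
  exists (exp x). apply (is_series_ext (fun n => scal (pow_n x n) (/ INR (fact n)))); [|apply is_exp_Reals].
  intros n. rewrite pow_n_pow. reflexivity.
Qed.

(** The coefficients of [(s - 1)] times the termwise antiderivative of [(1 - cos x) x ^ (- s - 2)].
    For [k = 1] the denominator [1 - s] cancels against [s - 1], leaving [- / 2]; this keeps
    everything holomorphic across [Re s = 1]. *)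
Definition hk (k : nat) (s : C) : C :=
  match k with
  | O => RtoC 0
  | S O => RtoC (- / 2)
  | _ => (- RtoC (cos_n k) * (s - 1) / (RtoC (2 * INR k - 1) - s))%C
  end.

Lemma hk_den k s : strip (-1) 2 s -> (2 <= k)%nat -> 1 <= Cmod (RtoC (2 * INR k - 1) - s).
Proof.
  intros Hs Hk. apply Rle_trans with (2 := re_le_Cmod _). rewrite Re_minus, Re_RtoC.
  apply le_INR in Hk. simpl in Hk. unfold strip in Hs. apply Rle_trans with (2 := Rle_abs _). lra.
Qed.

Lemma hk_den_neq k s : strip (-1) 2 s -> (2 <= k)%nat -> (RtoC (2 * INR k - 1) - s <> 0)%C.
Proof. intros Hs Hk. apply Cmod_gt_0. generalize (hk_den k s Hs Hk). lra. Qed.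

Lemma hk_eq k s : strip (-1) 2 s -> ((RtoC (2 * INR k - 1) - s) * hk k s = match k with O => 0 | S _ => - (s - 1) * RtoC (cos_n k) end)%C.
Proof.
  intros Hs. destruct k as [|[|k]].
  - simpl. ring.
  - simpl. unfold cos_n. simpl. replace (2 * 1 - 1) with 1 by ring. replace (-1 * 1 / (1 + 1)) with (- / 2) by field. ring.
  - unfold hk. field. apply hk_den_neq; [exact Hs | lia].
Qed.

Lemma Rabs_cos_n k : Rabs (cos_n k) <= / INR (fact k).
Proof.
  unfold cos_n, Rdiv. rewrite Rabs_mult, Rabs_inv, (Rabs_pos_eq (INR _)) by apply pos_INR.
  rewrite pow_1_abs, Rmult_1_l. apply Rinv_le_contravar; [apply INR_fact_lt_0|]. apply le_INR, fact_le. lia.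
Qed.

Lemma hk_bound k s K : strip (-1) 2 s -> Cmod s <= K -> Cmod (hk k s) <= (K + 2) * / INR (fact k).
Proof.
  intros Hs HK. assert (P := Cmod_ge_0 s). assert (F : 0 < / INR (fact k)) by (apply Rinv_0_lt_compat, INR_fact_lt_0).
  destruct k as [|[|k]].
  - simpl. rewrite Cmod_0. lra.
  - simpl. rewrite Cmod_R, Rabs_Ropp, Rabs_pos_eq by lra. lra.
  - assert (D := hk_den (S (S k)) s Hs ltac:(lia)). assert (N := hk_den_neq (S (S k)) s Hs ltac:(lia)).
    unfold hk. rewrite Cmod_div, Cmod_mult, Cmod_opp, Cmod_R by exact N.
    assert (B := Rabs_cos_n (S (S k))).
    assert (B1 : Cmod (s - 1) <= K + 2) by (apply Rle_trans with (1 := Cmod_triangle_minus _ _); rewrite Cmod_1; lra).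
    assert (A : 0 <= Rabs (cos_n (S (S k))) * Cmod (s - 1)) by (apply Rmult_le_pos; [apply Rabs_pos | apply Cmod_ge_0]).
    apply Rle_trans with (Rabs (cos_n (S (S k))) * Cmod (s - 1)).
    + apply Rmult_le_reg_r with (Cmod (RtoC (2 * INR (S (S k)) - 1) - s)); [lra|].
      unfold Rdiv. rewrite Rmult_assoc, Rinv_l by lra. nra.
    + rewrite Rmult_comm. apply Rmult_le_compat; try apply Cmod_ge_0; try apply Rabs_pos; assumption.
Qed.

Definition hQ (s y : C) : C := CSer (fun k => hk k s * y ^ k)%C.

Lemma hQ_cv s y : strip (-1) 2 s -> cseries (fun k => hk k s * y ^ k)%C (hQ s y).
Proof.
  intros Hs. apply (cseries_abs _ (fun k => (Cmod s + 2) * (Cmod y ^ k / INR (fact k)))).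
  - intros k. rewrite Cmod_mult, Cmod_pow.
    replace ((Cmod s + 2) * (Cmod y ^ k / INR (fact k))) with ((Cmod s + 2) * / INR (fact k) * Cmod y ^ k) by (unfold Rdiv; ring).
    apply Rmult_le_compat_r; [apply pow_le, Cmod_ge_0 | apply hk_bound; [exact Hs | lra]].
  - apply ex_series_Rscal, ex_series_exp.
Qed.

Lemma hQ_holo_s y : holo_on (strip (-1) 2) (fun s => hQ s y).
Proof.
  apply (weierstrass_holo (strip (-1) 2) (fun k s => hk k s * y ^ k)%C).
  - intros s Hs. set (r := Rmin (Re s - -1) (2 - Re s)). set (K := Cmod s + r).
    exists r, (fun k => (K + 2) * (Cmod y ^ k / INR (fact k))).
    split; [unfold r, strip in *; apply Rmin_case; lra|]. split; [intros z; apply strip_disc, Hs|]. split.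
    + apply ex_series_Rscal, ex_series_exp.
    + intros k z Hz. rewrite Cmod_mult, Cmod_pow.
      replace ((K + 2) * (Cmod y ^ k / INR (fact k))) with ((K + 2) * / INR (fact k) * Cmod y ^ k) by (unfold Rdiv; ring).
      apply Rmult_le_compat_r; [apply pow_le, Cmod_ge_0 | apply hk_bound].
      * apply (strip_disc _ _ s); assumption.
      * unfold cdisc in Hz. unfold K. generalize (Cmod_triangle_rev z s). lra.
  - intros k s Hs. destruct k as [|[|k]].
    + eexists. apply (cder_mult (fun _ => RtoC 0)); apply cder_const.
    + eexists. apply (cder_mult (fun _ => RtoC (- / 2))); apply cder_const.
    + eexists. apply (cder_mult (hk (S (S k))) (fun _ => y ^ S (S k))%C); [|apply cder_const].
      unfold hk. cder_auto. apply hk_den_neq; [exact Hs | lia].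
Qed.

Lemma cos_cseries x : cseries (fun k => RtoC (cos_n k * (x * x) ^ k)) (RtoC (cos x)).
Proof.
  assert (H : infinite_sum (fun i => cos_n i * (x * x) ^ i) (cos x)).
  { unfold cos. destruct (exist_cos (Rsqr x)) as [l Hl]. exact Hl. }
  intros eps Heps. destruct (H eps Heps) as [N HN]. exists (S N). intros n Hn. destruct n as [|n]; [lia|].
  assert (E : forall m, csum (fun k => RtoC (cos_n k * (x * x) ^ k)) (S m) = RtoC (sum_f_R0 (fun i => cos_n i * (x * x) ^ i) m)).
  { induction m as [|m IH]; [simpl csum; simpl sum_f_R0; ring|].
    set (u := fun i => cos_n i * (x * x) ^ i) in *.
    change (csum (fun k => RtoC (u k)) (S m) + RtoC (u (S m)) = RtoC (sum_f_R0 u (S m)))%C.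
    change (csum (fun k => RtoC (u k)) (S m) = RtoC (sum_f_R0 u m)) in IH.
    rewrite IH, tech5, RtoC_plus. reflexivity. }
  rewrite E, <- RtoC_minus, Cmod_R. apply HN. lia.
Qed.

(** An antiderivative in [x] of [(s - 1)(1 - cos x) x ^ (- s - 2)]; for [Re s < 1] it is the one
    that tends to 0 at 0. *)
Definition RH (x : R) (s : C) : C := (pw x (- s - 1) * hQ s (RtoC (x * x)))%C.

Lemma RH_rder x s : 0 < x -> strip (-1) 2 s ->
  rder (fun u => RH u s) x ((s - 1) * (RtoC (1 - cos x) * pw x (- s - 2)))%C.
Proof.
  intros Hx Hs. set (y := RtoC (x * x)). set (rho := x * x + 1).
  assert (Hy : Cmod y < rho) by (unfold y, rho; rewrite Cmod_R, Rabs_pos_eq; nra).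
  destruct (pseries_cder (fun k => hk k s) (fun k => (Cmod s + 2) * (rho ^ k / INR (fact k))) rho) with (z := y) as [D1 D2].
  { unfold rho; nra. }
  { intros k. replace ((Cmod s + 2) * (rho ^ k / INR (fact k))) with ((Cmod s + 2) * / INR (fact k) * rho ^ k) by (unfold Rdiv; ring).
    apply Rmult_le_compat_r; [apply pow_le; unfold rho; nra | apply hk_bound; [exact Hs|lra]]. }
  { apply ex_series_Rscal, ex_series_exp. }
  { exact Hy. }
  match type of D1 with cder _ _ ?l => set (dl := l) in * end.
  assert (R1 : rder (fun u => RtoC (u * u)) x (RtoC (2 * x))).
  { apply is_derive_rder; unfold Re, Im; simpl.
    - auto_derive; [exact I|]. ring.
    - apply (is_derive_const (K := R_AbsRing) (V := R_NormedModule)). }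
  assert (R2 : rder (fun u => hQ s (RtoC (u * u))) x (dl * RtoC (2 * x))).
  { apply (rder_comp (hQ s) (fun u => RtoC (u * u))); [exact D1 | exact R1]. }
  eapply rder_eq; [apply (rder_mult (fun u => pw u (- s - 1))); [apply rder_pw, Hx | exact R2]|].
  cbv beta. fold y.
  replace (- s - 1 - 1)%C with (- s - 2)%C by (replace (RtoC 2) with (1 + 1)%C by (rewrite <- RtoC_plus; f_equal; ring); ring).
  destruct (pw_shift x s Hx) as [E1 _]. rewrite E1.
  (* 2 y Q'(y) - (1 + s) Q(y) is the series of (s - 1)(1 - cos x). *)
  assert (Key : (2 * (y * dl) - (1 + s) * hQ s y = (s - 1) * RtoC (1 - cos x))%C).
  { assert (S1 := cseries_minus _ _ _ _ (cseries_scal 2 _ _ (cseries_scal y _ _ D2)) (cseries_scal (1 + s) _ _ (hQ_cv s y Hs))). cbv beta in S1.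
    apply (cseries_unique _ _ _ S1).
    assert (S2 := cos_cseries x). 
    assert (S3 : cseries (fun k => match k with O => RtoC 0 | S _ => RtoC (cos_n k * (x * x) ^ k) end) (RtoC (cos x) - 1)).
    { replace (RtoC (cos x) - 1)%C with (RtoC 0 + (RtoC (cos x) - 1))%C by ring.
      apply (cseries_shift (fun k => match k with O => RtoC 0 | S _ => RtoC (cos_n k * (x * x) ^ k) end)).
      apply (cseries_shift (fun k => RtoC (cos_n k * (x * x) ^ k))).
      replace (RtoC (cos_n 0 * (x * x) ^ 0) + (RtoC (cos x) - 1))%C with (RtoC (cos x)); [exact S2|].
      unfold cos_n. simpl. replace (1 / 1 * 1) with 1 by field. ring. }
    apply (cseries_scal (- (s - 1))) in S3.
    replace ((s - 1) * RtoC (1 - cos x))%C with (- (s - 1) * (RtoC (cos x) - 1))%C by (rewrite RtoC_minus; ring).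
    eapply cseries_ext; [|exact S3]. intros k. cbv beta.
    assert (H := hk_eq k s Hs). destruct k as [|k].
    - simpl. ring.
    - rewrite RtoC_mult, RtoC_pow. fold y.
      transitivity (- (s - 1) * RtoC (cos_n (S k)) * y ^ S k)%C; [ring|]. rewrite <- H.
      rewrite RtoC_minus, RtoC_mult. simpl Cpow. ring. }
  rewrite RtoC_mult. fold y.
  transitivity (pw x (- s - 2) * (2 * (RtoC x * RtoC x * dl) - (1 + s) * hQ s y))%C.
  - ring.
  - rewrite <- RtoC_mult. fold y. rewrite Key. ring.
Qed.

Lemma rcont_cosfun_pw x w : 0 < x -> rcont (fun u => RtoC (1 - cos u) * pw u w)%C x.
Proof.
  intros Hx. apply rcont_mult; [|apply rcont_pw, Hx]. apply rcont_RtoC.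
  apply (ex_derive_continuous (K := R_AbsRing) (V := R_NormedModule)). auto_derive. exact I.
Qed.

Lemma RH_integral a b s : 0 < a -> a <= b -> strip (-1) 2 s ->
  ((s - 1) * CInt (fun x => RtoC (1 - cos x) * pw x (- s - 2)) a b = RH b s - RH a s)%C.
Proof.
  intros Ha Hab Hs.
  assert (Hc : rcont_on (fun x => RtoC (1 - cos x) * pw x (- s - 2))%C a b).
  { apply rcont_on_le; [exact Hab|]. intros t Ht. apply rcont_cosfun_pw. lra. }
  rewrite <- CInt_scal by exact Hc. apply (CInt_derive (fun u => RH u s)).
  - rewrite Rmin_left, Rmax_right by exact Hab. intros t Ht. apply RH_rder; [lra | exact Hs].
  - intros t Ht. apply rcont_scal, Hc, Ht.
Qed.

Lemma RH_tail a b s : 0 < a -> a <= b -> strip (-1) 2 s ->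
  Cmod (RH b s - RH a s) <= Cmod (s - 1) * (2 / (Re s + 1) * exp (- (Re s + 1) * ln a)).
Proof.
  intros Ha Hab Hs. rewrite <- RH_integral, Cmod_mult by assumption. apply Rmult_le_compat_l; [apply Cmod_ge_0|].
  unfold strip in Hs. set (sg := Re s) in *.
  set (G := fun x => - (2 / (sg + 1)) * exp (- (sg + 1) * ln x)).
  assert (HI : is_RInt (fun x => 2 * exp (- (sg + 2) * ln x)) a b (minus (G b) (G a))).
  { apply (is_RInt_derive (V := R_CompleteNormedModule) G).
    - rewrite Rmin_left, Rmax_right by exact Hab. intros x Hx. unfold G. auto_derive; [lra|].
      replace (exp (- (sg + 2) * ln x)) with (exp (- (sg + 1) * ln x) * / x).
      + field. lra.
      + rewrite <- (exp_ln x) at 2 by lra. rewrite <- exp_Ropp, <- exp_plus. f_equal. ring.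
    - rewrite Rmin_left, Rmax_right by exact Hab. intros x Hx.
      apply (ex_derive_continuous (K := R_AbsRing) (V := R_NormedModule)). auto_derive. lra. }
  apply Rle_trans with (minus (G b) (G a)).
  - apply (CInt_bound_fct _ (fun x => 2 * exp (- (sg + 2) * ln x)) a b); [exact Hab | | | exact HI].
    + apply rcont_on_le; [exact Hab|]. intros t Ht. apply rcont_cosfun_pw. lra.
    + intros t Ht. rewrite Cmod_mult, Cmod_R, Cmod_pw, Re_minus, Re_opp, Re_RtoC. fold sg.
      replace (- sg - 2) with (- (sg + 2)) by ring. apply Rmult_le_compat_r; [left; apply exp_pos|].
      rewrite Rabs_pos_eq; apply one_minus_cos_bounds.
  - unfold minus, plus, opp; simpl. unfold G.
    assert (0 < 2 / (sg + 1) * exp (- (sg + 1) * ln b)) by (apply Rmult_lt_0_compat; [apply Rdiv_lt_0_compat; lra | apply exp_pos]).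
    lra.
Qed.

Lemma RH_step m s sigma : strip (-1) 2 s -> -1 < sigma <= Re s ->
  Cmod (RH (INR (S (S m))) s - RH (INR (S m)) s) <= Cmod (s - 1) * (2 * rpow m (- (sigma + 2))).
Proof.
  intros Hs Hsig. assert (P := INR_S_pos m). assert (Q := pos_INR m).
  rewrite <- RH_integral by (try assumption; apply le_INR; lia). rewrite Cmod_mult.
  apply Rmult_le_compat_l; [apply Cmod_ge_0|]. rewrite (S_INR (S m)). set (n := INR (S m)) in *.
  assert (Hn1 : 1 <= n) by (unfold n; rewrite S_INR; lra).
  replace (2 * rpow m (- (sigma + 2))) with (Rabs (n + 1 - n) * (2 * rpow m (- (sigma + 2)))) by (replace (n + 1 - n) with 1 by ring; rewrite Rabs_R1; ring).
  apply CInt_bound.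
  - apply rcont_on_le; [lra|]. intros t Ht. apply rcont_cosfun_pw. lra.
  - rewrite Rmin_left, Rmax_right by lra. intros x Hx. rewrite Cmod_mult, Cmod_R, Cmod_pw.
    apply Rmult_le_compat; [apply Rabs_pos | left; apply exp_pos | rewrite Rabs_pos_eq; apply one_minus_cos_bounds |].
    unfold rpow. fold n. apply exp_le. rewrite Re_minus, Re_opp, Re_RtoC.
    assert (L1 : 0 <= ln n) by (apply ln_ge_0, Hn1). assert (L2 : ln n <= ln x) by (apply ln_le; lra). nra.
Qed.

(** The limit of [RH x s] for [x] tending to infinity, written as a telescoping series so that
    holomorphy follows termwise. For [-1 < Re s < 1] it is [s - 1] times the Mellin integral of
    [1 - cos], and on the rest of the strip its continuation. *)
Definition RR (s : C) : C := (RH 1 s + CSer (fun m => RH (INR (S (S m))) s - RH (INR (S m)) s))%C.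

Lemma RH_holo x : holo_on (strip (-1) 2) (RH x).
Proof.
  intros s Hs. destruct (hQ_holo_s (RtoC (x * x)) s Hs) as [l Hl]. eexists. unfold RH.
  apply cder_mult; [|exact Hl]. apply (cder_comp (pw x) (fun s => - s - 1)%C); [apply cder_pw | cder_auto].
Qed.

Lemma RR_holo : holo_on (strip (-1) 2) RR.
Proof.
  assert (H : holo_on (strip (-1) 2) (fun s => CSer (fun m => RH (INR (S (S m))) s - RH (INR (S m)) s)%C)).
  { apply (weierstrass_holo (strip (-1) 2) (fun m s => RH (INR (S (S m))) s - RH (INR (S m)) s)%C).
    - intros s Hs. assert (Hs' := Hs). unfold strip in Hs'. set (r := Rmin (Re s - -1) (2 - Re s) / 2).
      assert (Hr : 0 < r). { unfold r. apply Rdiv_lt_0_compat; [apply Rmin_case; lra | lra]. }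
      assert (Hr1 : 2 * r <= Re s + 1) by (unfold r; generalize (Rmin_l (Re s - -1) (2 - Re s)); lra).
      exists r, (fun m => (Cmod s + r + 1) * (2 * rpow m (- (Re s - r + 2)))).
      assert (In : forall z, cdisc s r z -> strip (-1) 2 z).
      { intros z Hz. apply (strip_disc _ _ s); [exact Hs|]. unfold cdisc in *. unfold r in *. lra. }
      split; [exact Hr|]. split; [exact In|]. split.
      + apply (ex_series_Rscal (Cmod s + r + 1)), ex_series_Rscal, ex_series_rpow. lra.
      + intros m z Hz. assert (Hz' := Re_cdisc _ _ _ Hz).
        apply Rle_trans with (1 := RH_step m z (Re s - r) (In z Hz) ltac:(lra)).
        apply Rmult_le_compat_r; [generalize (rpow_pos m (- (Re s - r + 2))); lra|].
        apply Rle_trans with (1 := Cmod_triangle_minus _ _). rewrite Cmod_1.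
        unfold cdisc in Hz. generalize (Cmod_triangle_rev z s). lra.
    - intros m s Hs. destruct (RH_holo (INR (S (S m))) s Hs) as [l Hl]. destruct (RH_holo (INR (S m)) s Hs) as [l' Hl'].
      eexists. apply cder_minus; eassumption. }
  intros s Hs. destruct (RH_holo 1 s Hs) as [l Hl]. destruct (H s Hs) as [l' Hl']. eexists. apply cder_plus; eassumption.
Qed.

Lemma RR_tail a s : 0 < a -> strip (-1) 2 s ->
  Cmod (RR s - RH a s) <= Cmod (s - 1) * (2 / (Re s + 1) * exp (- (Re s + 1) * ln a)).
Proof.
  intros Ha Hs. set (B := Cmod (s - 1) * (2 / (Re s + 1) * exp (- (Re s + 1) * ln a))).
  apply Rnot_lt_le. intros Hlt.
  assert (S1 : cseries (fun m => RH (INR (S (S m))) s - RH (INR (S m)) s)%C (CSer (fun m => RH (INR (S (S m))) s - RH (INR (S m)) s)%C)).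
  { apply (cseries_abs _ (fun m => Cmod (s - 1) * (2 * rpow m (- (Re s + 2))))).
    - intros m. apply RH_step; [exact Hs | unfold strip in Hs; lra].
    - apply ex_series_Rscal, ex_series_Rscal, ex_series_rpow. unfold strip in Hs; lra. }
  assert (E : forall n, csum (fun m => RH (INR (S (S m))) s - RH (INR (S m)) s)%C n = (RH (INR (S n)) s - RH 1 s)%C).
  { induction n as [|n IH]; [simpl; ring|]. cbn [csum]. rewrite IH. ring. }
  destruct (S1 (Cmod (RR s - RH a s) - B) ltac:(lra)) as [N HN].
  destruct (INR_unbounded a) as [N' HN']. specialize (HN (max N N') ltac:(lia)).
  rewrite E in HN. set (n := S (max N N')) in *.
  assert (Hn : a <= INR n). { assert (INR N' <= INR n) by (apply le_INR; lia). lra. }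
  assert (T := RH_tail a (INR n) s Ha Hn Hs). fold B in T.
  replace (RH (INR n) s - RH 1 s - CSer (fun m => RH (INR (S (S m))) s - RH (INR (S m)) s))%C with (RH (INR n) s - RR s)%C in HN by (unfold RR; ring).
  assert (Tr := Cmod_triangle (RR s - RH (INR n) s) (RH (INR n) s - RH a s)).
  replace (RR s - RH (INR n) s + (RH (INR n) s - RH a s))%C with (RR s - RH a s)%C in Tr by ring.
  rewrite (Cmod_minus_sym (RR s) (RH (INR n) s)) in Tr. lra.
Qed.

Lemma RH_small d s : 0 < d <= 1 -> strip (-1) 2 s -> Cmod (RH d s) <= (Cmod s + 2) * exp 1 * exp ((1 - Re s) * ln d).
Proof.
  intros Hd Hs. unfold RH. rewrite Cmod_mult, Cmod_pw, Re_minus, Re_opp, Re_RtoC.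
  (* The constant coefficient is 0, so a factor [d * d] can be taken out of the series. *)
  assert (HQ : Cmod (hQ s (RtoC (d * d))) <= (Cmod s + 2) * exp 1 * (d * d)).
  { apply Rle_trans with (Series (fun k => (Cmod s + 2) * (d * d) * (1 ^ k / INR (fact k)))).
    - apply (cseries_bound (fun k => hk k s * RtoC (d * d) ^ k)%C); [| |apply hQ_cv, Hs].
      + intros k. rewrite Cmod_mult, Cmod_pow, Cmod_R, Rabs_pos_eq by nra.
        assert (B := hk_bound k s (Cmod s) Hs (Rle_refl _)). assert (P := Cmod_ge_0 s).
        assert (F : 0 < / INR (fact k)) by (apply Rinv_0_lt_compat, INR_fact_lt_0).
        replace ((Cmod s + 2) * (d * d) * (1 ^ k / INR (fact k))) with ((Cmod s + 2) * / INR (fact k) * (d * d)) by (rewrite pow1; field; apply INR_fact_neq_0).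
        destruct k as [|k].
        * simpl. rewrite Cmod_0, Rmult_0_l. apply Rmult_le_pos; [apply Rmult_le_pos; simpl in F; lra | nra].
        * apply Rmult_le_compat; [apply Cmod_ge_0 | apply pow_le; nra | exact B |].
          simpl pow. apply Rle_trans with (d * d * 1); [|lra]. apply Rmult_le_compat_l; [nra|].
          rewrite <- (pow1 k). apply pow_incr. nra.
      + apply ex_series_Rscal, ex_series_exp.
    - rewrite Series_scal_l.
      rewrite (Series_ext _ (fun n => 1 ^ n * / INR (fact n))) by reflexivity.
      assert (E : Series (fun n => 1 ^ n * / INR (fact n)) = exp 1).
      { apply is_series_unique. apply (is_series_ext (fun n => scal (pow_n 1 n) (/ INR (fact n)))); [|apply is_exp_Reals].
        intros n. rewrite pow_n_pow. reflexivity. }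
      rewrite E. right. ring. }
  apply Rle_trans with (exp ((- Re s - 1) * ln d) * ((Cmod s + 2) * exp 1 * (d * d))).
  - apply Rmult_le_compat_l; [left; apply exp_pos | exact HQ].
  - right. replace (d * d) with (exp (ln d + ln d)) by (rewrite exp_plus, exp_ln by lra; ring).
    replace (exp ((- Re s - 1) * ln d) * ((Cmod s + 2) * exp 1 * exp (ln d + ln d)))
      with ((Cmod s + 2) * exp 1 * (exp ((- Re s - 1) * ln d) * exp (ln d + ln d))) by ring.
    rewrite <- exp_plus. f_equal. f_equal. ring.
Qed.

(** * The functional equation and non-vanishing on Re s = 0 *)

Definition clim (x : nat -> C) (l : C) : Prop :=
  forall eps, 0 < eps -> exists N, forall n, (N <= n)%nat -> Cmod (x n - l) < eps.

Lemma clim_unique x l l' : clim x l -> clim x l' -> l = l'.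
Proof.
  intros H H'. apply Cminus_0_eq. destruct (Ceq_dec (l - l') 0) as [E|E]; [exact E|exfalso].
  apply Cmod_gt_0 in E.
  destruct (H (Cmod (l - l') / 2) ltac:(lra)) as [N HN]. destruct (H' (Cmod (l - l') / 2) ltac:(lra)) as [N' HN'].
  specialize (HN (max N N') ltac:(lia)). specialize (HN' (max N N') ltac:(lia)).
  assert (T := Cmod_triangle_minus (x (max N N') - l') (x (max N N') - l)).
  replace (x (max N N') - l' - (x (max N N') - l))%C with (l - l')%C in T by ring. lra.
Qed.

Lemma clim_ext x y l : (forall n, x n = y n) -> clim x l -> clim y l.
Proof. intros H K eps Heps. destruct (K eps Heps) as [N HN]. exists N. intros n Hn. rewrite <- H. apply HN, Hn. Qed.

Lemma clim_plus x y l m : clim x l -> clim y m -> clim (fun n => x n + y n)%C (l + m).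
Proof.
  intros H K eps Heps. destruct (H (eps / 2) ltac:(lra)) as [N HN]. destruct (K (eps / 2) ltac:(lra)) as [N' HN'].
  exists (max N N'). intros n Hn. specialize (HN n ltac:(lia)). specialize (HN' n ltac:(lia)).
  replace (x n + y n - (l + m))%C with ((x n - l) + (y n - m))%C by ring.
  apply Rle_lt_trans with (1 := Cmod_triangle _ _). lra.
Qed.

Lemma clim_const c : clim (fun _ => c) c.
Proof. intros eps Heps. exists O. intros n _. replace (c - c)%C with (RtoC 0) by ring. rewrite Cmod_0. exact Heps. Qed.

Lemma clim_scal c x l : clim x l -> clim (fun n => c * x n)%C (c * l).
Proof.
  intros H eps Heps. assert (P := Cmod_ge_0 c). destruct (H (eps / (Cmod c + 1)) ltac:(apply Rdiv_lt_0_compat; lra)) as [N HN].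
  exists N. intros n Hn. specialize (HN n Hn). replace (c * x n - c * l)%C with (c * (x n - l))%C by ring. rewrite Cmod_mult.
  apply Rle_lt_trans with (Cmod c * (eps / (Cmod c + 1))); [apply Rmult_le_compat_l; lra|].
  apply Rlt_le_trans with ((Cmod c + 1) * (eps / (Cmod c + 1))); [|right; field; lra].
  apply Rmult_lt_compat_r; [apply Rdiv_lt_0_compat; lra | lra].
Qed.

Lemma clim_bound x l (e : nat -> R) : (forall n, Cmod (x n - l) <= e n) -> is_lim_seq e 0 -> clim x l.
Proof.
  intros H K eps Heps. apply is_lim_seq_spec in K. destruct (K (mkposreal eps Heps)) as [N HN]. exists N. intros n Hn.
  specialize (HN n Hn). simpl in HN. rewrite Rminus_0_r in HN. apply Rle_lt_trans with (1 := H n).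
  apply Rle_lt_trans with (1 := Rle_abs _). exact HN.
Qed.

Lemma is_lim_seq_rpow a : 0 < a -> is_lim_seq (fun m => rpow m (- a)) 0.
Proof.
  intros Ha. apply is_lim_seq_spec. intros eps. destruct (pw_tends_0 1 (RtoC a) Rlt_0_1 Ha eps (cond_pos eps)) as [N HN].
  exists N. intros n Hn. specialize (HN n Hn). rewrite Rminus_0_r, Rabs_pos_eq by (left; apply rpow_pos).
  replace (pw (INR n + 1) (- RtoC a) - 0)%C with (pw (INR n + 1) (- RtoC a)) in HN by ring.
  rewrite <- S_INR, Cmod_pw_S, Re_opp, Re_RtoC in HN. exact HN.
Qed.

(** * Continuity and integration of uniformly convergent series *)

Lemma rcont_uniform (v : nat -> R -> C) (V : R -> C) (M : nat -> R) t :
  (forall n x, rcont (v n) x) -> (forall n x, Cmod (v n x) <= M n) -> ex_series M ->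
  (forall x, cseries (fun n => v n x) (V x)) -> rcont V t.
Proof.
  intros Hc HM Hs HV eps Heps. destruct (Series_tail_small M Hs (eps / 3) ltac:(lra)) as [N HN].
  specialize (HN N (le_n _)).
  assert (T : forall x, Cmod (V x - csum (fun n => v n x) N) < eps / 3).
  { intros x. apply Rle_lt_trans with (2 := HN). apply Rle_trans with (2 := Rle_abs _).
    apply (cseries_tail (fun n => v n x) M); [intros; apply HM | exact Hs | apply HV]. }
  assert (Cs : rcont (fun x => csum (fun n => v n x) N) t).
  { clear T HN. induction N as [|N IH]; simpl; [apply rcont_const|]. apply rcont_plus; [exact IH | apply Hc]. }
  destruct (Cs (eps / 3) ltac:(lra)) as [d [Hd K]]. exists d. split; [exact Hd|]. intros u Hu. specialize (K u Hu).
  assert (T1 := T u). assert (T2 := T t).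
  replace (V u - V t)%C with ((V u - csum (fun n => v n u) N) + (csum (fun n => v n u) N - csum (fun n => v n t) N) - (V t - csum (fun n => v n t) N))%C by ring.
  eapply Rle_lt_trans; [apply Cmod_triangle_minus|].
  eapply Rle_lt_trans; [apply Rplus_le_compat_r, Cmod_triangle|]. lra.
Qed.

Lemma CInt_cseries (u : nat -> R -> C) (U : R -> C) (M : nat -> R) a b :
  a <= b -> (forall n, rcont_on (u n) a b) -> rcont_on U a b ->
  (forall n t, a <= t <= b -> Cmod (u n t) <= M n) -> ex_series M ->
  (forall t, a <= t <= b -> cseries (fun n => u n t) (U t)) ->
  cseries (fun n => CInt (u n) a b) (CInt U a b).
Proof.
  intros Hab Hu HU HM Hs HV eps Heps.
  destruct (Series_tail_small M Hs (eps / (b - a + 1)) ltac:(apply Rdiv_lt_0_compat; lra)) as [N HN].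
  exists N. intros n Hn. specialize (HN n Hn).
  assert (Cs : rcont_on (fun x => csum (fun n => u n x) n) a b).
  { clear - Hu. intros t Ht. induction n as [|n IH]; simpl; [apply rcont_const|]. apply rcont_plus; [exact IH | apply Hu, Ht]. }
  rewrite <- CInt_csum by exact Hu. rewrite <- CInt_minus by assumption.
  apply Rle_lt_trans with (Rabs (b - a) * (eps / (b - a + 1))).
  - apply CInt_bound.
    + intros t Ht. apply rcont_minus; [apply Cs, Ht | apply HU, Ht].
    + rewrite Rmin_left, Rmax_right by exact Hab. intros t Ht. rewrite Cmod_minus_sym.
      left. apply Rle_lt_trans with (2 := HN). apply Rle_trans with (2 := Rle_abs _).
      apply (cseries_tail (fun n => u n t) M); [intros k; apply HM, Ht | exact Hs | apply HV, Ht].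
  - rewrite Rabs_pos_eq by lra. apply Rlt_le_trans with ((b - a + 1) * (eps / (b - a + 1))); [|right; field; lra].
    apply Rmult_lt_compat_r; [apply Rdiv_lt_0_compat; lra | lra].
Qed.

(** The one-periodic extension of [x (1 - x)], defined by its Fourier series; [beta_saw] recovers
    the parabola on each unit interval. *)
Definition beta (x : R) : R := Series (fterm (2 * PI * x)) / PI ^ 2.

Lemma beta_saw n x : INR n <= x <= INR n + 1 -> beta x = sawq (INR n) x.
Proof.
  intros Hx. assert (Hpi := PI_RGT_0). unfold beta.
  rewrite (Series_ext _ (fterm (2 * PI * (x - INR n)))).
  - rewrite fourier by nra. unfold sawq. field. lra.
  - intros k. rewrite <- (fterm_periodic (2 * PI * (x - INR n)) n k). f_equal. ring.
Qed.

Lemma beta_cseries x : cseries (fun n => RtoC (fterm (2 * PI * x) n / PI ^ 2)) (RtoC (beta x)).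
Proof.
  assert (Hpi := PI_RGT_0).
  assert (H : is_series (fun n => fterm (2 * PI * x) n / PI ^ 2) (beta x)).
  { apply (is_series_scal_r (/ PI ^ 2) (fterm (2 * PI * x))). apply Series_correct, fterm_ex. }
  intros eps Heps. destruct (H _ (ex_intro _ (mkposreal eps Heps) (fun y Hy => Hy))) as [N HN].
  exists (S N). intros n Hn. destruct n as [|n]; [lia|]. specialize (HN n ltac:(lia)).
  assert (E : forall m, csum (fun n => RtoC (fterm (2 * PI * x) n / PI ^ 2)) m = RtoC (rsum (fun n => fterm (2 * PI * x) n / PI ^ 2) m)).
  { induction m as [|m IH]; [reflexivity|]. cbn [csum rsum]. rewrite IH, RtoC_plus. reflexivity. }
  rewrite E, <- RtoC_minus, Cmod_R, rsum_sum_n. exact HN.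
Qed.

Definition ut (s : C) (n : nat) (x : R) : C := (RtoC (fterm (2 * PI * x) n / PI ^ 2) * pw x (- s - 2))%C.

Lemma rcont_fterm n x : rcont (fun x => RtoC (fterm (2 * PI * x) n / PI ^ 2)) x.
Proof.
  apply rcont_RtoC. apply (ex_derive_continuous (K := R_AbsRing) (V := R_NormedModule)).
  unfold fterm. set (k := INR (S n)). auto_derive. exact I.
Qed.

Lemma fterm_pi_bound n x : Cmod (RtoC (fterm (2 * PI * x) n / PI ^ 2)) <= 2 / PI ^ 2 * rpow n (- (2)).
Proof.
  assert (Hpi := PI_RGT_0). assert (P : 0 < PI ^ 2) by (apply pow_lt; lra). assert (B := fterm_bounds (2 * PI * x) n).
  assert (P' : 0 < / PI ^ 2) by (apply Rinv_0_lt_compat, P).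
  rewrite Cmod_R, Rabs_pos_eq by (apply Rmult_le_pos; lra).
  apply Rle_trans with (2 * rpow n (- (2)) * / PI ^ 2); [unfold Rdiv; apply Rmult_le_compat_r; lra | right; unfold Rdiv; ring].
Qed.

Lemma rcont_beta x : rcont (fun x => RtoC (beta x)) x.
Proof.
  apply (rcont_uniform (fun n x => RtoC (fterm (2 * PI * x) n / PI ^ 2)) _ (fun n => 2 / PI ^ 2 * rpow n (- (2)))).
  - intros n y. apply rcont_fterm.
  - intros n y. apply fterm_pi_bound.
  - apply ex_series_Rscal, ex_series_rpow. lra.
  - apply beta_cseries.
Qed.

Definition Ub (s : C) (x : R) : C := (RtoC (beta x) * pw x (- s - 2))%C.

Lemma rcont_Ub s x : 0 < x -> rcont (Ub s) x.
Proof. intros Hx. apply rcont_mult; [apply rcont_beta | apply rcont_pw, Hx]. Qed.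

Lemma Ub_cseries s a b : 0 < a -> a <= b -> cseries (fun n => CInt (ut s n) a b) (CInt (Ub s) a b).
Proof.
  intros Ha Hab.
  assert (Hb : exists K, 0 <= K /\ forall t, a <= t <= b -> Cmod (pw t (- s - 2)) <= K).
  { exists (exp (Rabs (Re (- s - 2)) * (Rabs (ln a) + Rabs (ln b)))). split; [left; apply exp_pos|]. intros t Ht. rewrite Cmod_pw. apply exp_le.
    apply Rle_trans with (1 := Rle_abs _). rewrite Rabs_mult. apply Rmult_le_compat_l; [apply Rabs_pos|].
    assert (L1 : ln a <= ln t) by (apply ln_le; lra). assert (L2 : ln t <= ln b) by (apply ln_le; lra).
    unfold Rabs; repeat destruct Rcase_abs; lra. }
  destruct Hb as [K [PK HK]].
  apply (CInt_cseries (ut s) (Ub s) (fun n => K * (2 / PI ^ 2 * rpow n (- (2))))); [exact Hab | | | | |].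
  - intros n. apply rcont_on_le; [exact Hab|]. intros t Ht. apply rcont_mult; [apply rcont_fterm | apply rcont_pw; lra].
  - apply rcont_on_le; [exact Hab|]. intros t Ht. apply rcont_Ub. lra.
  - intros n t Ht. unfold ut. rewrite Cmod_mult, Rmult_comm. apply Rmult_le_compat; try apply Cmod_ge_0; [apply HK, Ht | apply fterm_pi_bound].
  - apply (ex_series_Rscal K), ex_series_Rscal, ex_series_rpow. lra.
  - intros t Ht. assert (H := cseries_scal (pw t (- s - 2)) _ _ (beta_cseries t)).
    unfold Ub. rewrite Cmult_comm. eapply cseries_ext; [|exact H]. intros n. unfold ut. cbv beta. ring.
Qed.

Lemma rder_scale (f : R -> C) c x v : 0 < c -> rder f (c * x) v -> rder (fun u => f (c * u)) x (RtoC c * v).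
Proof.
  intros Hc H eps Heps. destruct (H (eps / c) ltac:(apply Rdiv_lt_0_compat; lra)) as [d [Hd K]].
  exists (d / c). split; [apply Rdiv_lt_0_compat; lra|]. intros u Hu.
  assert (E : c * u - c * x = c * (u - x)) by ring.
  specialize (K (c * u)). rewrite E, Rabs_mult, (Rabs_pos_eq c) in K by lra.
  assert (Hu' : c * Rabs (u - x) < d).
  { apply Rlt_le_trans with (c * (d / c)); [apply Rmult_lt_compat_l; lra | right; field; lra]. }
  specialize (K Hu'). rewrite RtoC_mult in K.
  replace (f (c * u)%R - f (c * x)%R - RtoC (u - x) * (RtoC c * v))%C with (f (c * u)%R - f (c * x)%R - RtoC c * RtoC (u - x) * v)%C by ring.
  apply Rle_trans with (1 := K). right. field. lra.
Qed.

(** The factor left in the [n]-th Fourier term by the substitution [u = 2 PI (n + 1) x]. *)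
Definition Tn (s : C) (n : nat) : C := (RtoC (/ (PI ^ 2 * INR (S n) ^ 2)) * pw (2 * PI * INR (S n)) (s + 1))%C.

Lemma ut_integral s n a b : 0 < a -> a <= b -> strip (-1) 2 s ->
  ((s - 1) * CInt (ut s n) a b = Tn s n * (RH (2 * PI * INR (S n) * b) s - RH (2 * PI * INR (S n) * a) s))%C.
Proof.
  intros Ha Hab Hs. assert (Hpi := PI_RGT_0). assert (P := INR_S_pos n). set (c := 2 * PI * INR (S n)).
  assert (Hc : 0 < c) by (unfold c; apply Rmult_lt_0_compat; lra).
  assert (Cu : rcont_on (ut s n) a b).
  { apply rcont_on_le; [exact Hab|]. intros t Ht. apply rcont_mult; [apply rcont_fterm | apply rcont_pw; lra]. }
  rewrite <- CInt_scal by exact Cu.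
  rewrite (CInt_derive (fun x => Tn s n * RH (c * x) s)%C).
  - ring.
  - rewrite Rmin_left, Rmax_right by exact Hab. intros t Ht.
    eapply rder_eq; [apply rder_scal, (rder_scale (fun x => RH x s)); [exact Hc | apply RH_rder; [nra | exact Hs]]|].
    unfold Tn, ut, fterm. fold c. replace (INR (S n) * (2 * PI * t)) with (c * t) by (unfold c; ring).
    rewrite pw_mult by lra.
    replace (s + 1)%C with (- (- s - 1))%C by ring. rewrite pw_opp.
    destruct (pw_shift c s Hc) as [E1 _]. rewrite E1.
    replace ((1 - cos (c * t)) / INR (S n) ^ 2 / PI ^ 2) with (/ (PI ^ 2 * INR (S n) ^ 2) * (1 - cos (c * t))).
    + rewrite !RtoC_mult. field. split; [apply pw_neq_0 | apply RtoC_neq_0; lra].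
    + field. split; lra.
  - intros t Ht. apply rcont_scal, Cu, Ht.
Qed.

(** The powers of [n + 1] combine to exponent [s - 1]; in this way zeta at [1 - s] enters. *)
Lemma Tn_pw s n : Tn s n = (RtoC (/ PI ^ 2) * pw (2 * PI) (s + 1) * pw (INR (S n)) (- (1 - s)))%C.
Proof.
  assert (Hpi := PI_RGT_0). assert (P := INR_S_pos n). unfold Tn. rewrite pw_mult by lra.
  replace (- (1 - s))%C with ((s + 1) - 1 - 1)%C by ring. rewrite !pw_minus_1 by exact P.
  rewrite Rinv_mult, RtoC_mult. replace (/ INR (S n) ^ 2) with (/ INR (S n) * / INR (S n)) by (field; lra).
  rewrite RtoC_mult, (RtoC_inv (INR (S n))) by lra. field. apply RtoC_neq_0; lra.
Qed.

Lemma Tn_cseries s : Re s < 0 -> cseries (Tn s) (RtoC (/ PI ^ 2) * pw (2 * PI) (s + 1) * zeta0 (1 - s))%C.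
Proof.
  intros Hs. eapply cseries_ext; [intros n; symmetry; apply Tn_pw|]. apply cseries_scal, zeta0_cv.
  unfold hp. rewrite Re_minus, Re_RtoC. lra.
Qed.

Lemma Cmod_Tn s n : Cmod (Tn s n) = / PI ^ 2 * rpow n (- (2)) * exp ((Re s + 1) * ln (2 * PI * INR (S n))).
Proof.
  assert (Hpi := PI_RGT_0). assert (P := INR_S_pos n). unfold Tn. rewrite Cmod_mult, Cmod_R, Cmod_pw, Re_plus, Re_RtoC, rpow_m2.
  assert (0 < PI ^ 2) by (apply pow_lt; lra). assert (0 < INR (S n) ^ 2) by (apply pow_lt; lra).
  rewrite Rabs_pos_eq by (left; apply Rinv_0_lt_compat, Rmult_lt_0_compat; lra). rewrite Rinv_mult. ring.
Qed.

(** The exponent [- Re s / 2] is a compromise: positive, so that the contribution of the lower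
    endpoint tends to 0, and small enough for the sum over the Fourier index to converge. *)
Lemma RH_bound_all s : strip (-1) 0 s -> exists B, 0 < B /\ forall d, 0 < d -> Cmod (RH d s) <= B * exp (- Re s / 2 * ln d).
Proof.
  intros Hs. assert (Hs2 : strip (-1) 2 s) by (unfold strip in *; lra). unfold strip in Hs.
  set (B1 := (Cmod s + 2) * exp 1). set (B2 := Cmod (RH 1 s) + Cmod (s - 1) * (2 / (Re s + 1))).
  assert (P1 : 0 < B1) by (unfold B1; apply Rmult_lt_0_compat; [generalize (Cmod_ge_0 s); lra | apply exp_pos]).
  assert (P2 : 0 <= B2).
  { unfold B2. apply Rplus_le_le_0_compat; [apply Cmod_ge_0|]. apply Rmult_le_pos; [apply Cmod_ge_0 | left; apply Rdiv_lt_0_compat; lra]. }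
  exists (B1 + B2). split; [lra|]. intros d Hd.
  assert (Pe := exp_pos (- Re s / 2 * ln d)).
  destruct (Rle_dec d 1) as [H|H].
  - apply Rle_trans with (1 := RH_small d s (conj Hd H) Hs2). fold B1.
    assert (L : ln d <= 0) by (rewrite <- ln_1; apply ln_le; lra).
    assert (E : exp ((1 - Re s) * ln d) <= exp (- Re s / 2 * ln d)) by (apply exp_le; nra). nra.
  - assert (T := RH_tail 1 d s Rlt_0_1 ltac:(lra) Hs2). rewrite ln_1, Rmult_0_r, exp_0, Rmult_1_r in T.
    assert (L : 0 <= ln d) by (apply ln_ge_0; lra).
    assert (E : 1 <= exp (- Re s / 2 * ln d)) by (rewrite <- exp_0; apply exp_le; nra).
    assert (Tr := Cmod_triangle_rev (RH d s) (RH 1 s)). unfold B2 in *. nra.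
Qed.

Lemma Ub_limit_right s : strip (-1) 0 s ->
  clim (fun m => (s - 1) * CInt (Ub s) (/ INR (S m)) (INR (S m)))%C
       (RtoC (/ PI ^ 2) * pw (2 * PI) (s + 1) * zeta0 (1 - s) * RR s).
Proof.
  intros Hs. assert (Hs2 : strip (-1) 2 s) by (unfold strip in *; lra). assert (Hpi := PI_RGT_0).
  destruct (RH_bound_all s Hs) as [B [PB HB]]. unfold strip in Hs.
  set (sg := Re s) in *. set (th := - sg / 2).
  set (c1 := Cmod (s - 1) * (2 / (sg + 1))).
  assert (P1 : 0 <= c1) by (unfold c1; apply Rmult_le_pos; [apply Cmod_ge_0 | left; apply Rdiv_lt_0_compat; lra]).
  (* With the powers of the cut-off [m] factored out, [M1] majorizes the error at the upper endpoint
     and [M2] the value at the lower one. *)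
  set (M1 := fun n => c1 * / PI ^ 2 * rpow n (- (2))).
  set (M2 := fun n => B * / PI ^ 2 * exp ((sg + 1 + th) * ln (2 * PI)) * rpow n (- (1 + th))).
  assert (E1 : ex_series M1) by (apply ex_series_Rscal, ex_series_rpow; lra).
  assert (E2 : ex_series M2) by (apply ex_series_Rscal, ex_series_rpow; unfold th; lra).
  assert (Ppi : 0 < / PI ^ 2) by (apply Rinv_0_lt_compat, pow_lt; lra).
  apply (clim_bound _ _ (fun m => Series M1 * rpow m (- (sg + 1)) + Series M2 * rpow m (- th))).
  - intros m. assert (Pm := INR_S_pos m). assert (Pm0 := pos_INR m).
    assert (Hm : / INR (S m) <= INR (S m)).
    { apply Rle_trans with 1; [rewrite <- Rinv_1; apply Rinv_le_contravar|]; rewrite ?S_INR; lra. }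
    assert (Hi : 0 < / INR (S m)) by (apply Rinv_0_lt_compat, Pm).
    assert (S1 := cseries_scal (s - 1) _ _ (Ub_cseries s _ _ Hi Hm)).
    assert (S2 := cseries_scal (RR s) _ _ (Tn_cseries s ltac:(fold sg; lra))).
    assert (S3 := cseries_minus _ _ _ _ S1 S2). cbv beta in S3.
    replace (RtoC (/ PI ^ 2) * pw (2 * PI) (s + 1) * zeta0 (1 - s) * RR s)%C with (RR s * (RtoC (/ PI ^ 2) * pw (2 * PI) (s + 1) * zeta0 (1 - s)))%C by ring.
    rewrite <- !Series_scal_r, <- Series_plus by (apply (ex_series_scal_r _ _); assumption).
    eapply cseries_bound; [| |exact S3].
    + intros n. cbv beta. rewrite ut_integral by assumption. assert (P := INR_S_pos n).
      set (c := 2 * PI * INR (S n)). assert (Hc : 0 < c) by (unfold c; apply Rmult_lt_0_compat; lra).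
      replace (Tn s n * (RH (c * INR (S m)) s - RH (c * / INR (S m)) s) - RR s * Tn s n)%C
        with (- (Tn s n * ((RR s - RH (c * INR (S m))%R s) + RH (c * / INR (S m))%R s)))%C by ring.
      rewrite Cmod_opp, Cmod_mult, Cmod_Tn. fold sg. fold c.
      assert (Q1 := RR_tail (c * INR (S m)) s ltac:(apply Rmult_lt_0_compat; assumption) Hs2).
      assert (Q2 := HB (c * / INR (S m)) ltac:(apply Rmult_lt_0_compat; assumption)).
      fold sg in Q1, Q2. rewrite ln_mult in Q1, Q2 by assumption. rewrite ln_Rinv in Q2 by exact Pm.
      assert (Q := Cmod_triangle (RR s - RH (c * INR (S m))%R s) (RH (c * / INR (S m))%R s)).
      set (T := / PI ^ 2 * rpow n (- (2)) * exp ((sg + 1) * ln c)).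
      assert (PT : 0 < T) by (unfold T; repeat apply Rmult_lt_0_compat; [exact Ppi | apply rpow_pos | apply exp_pos]).
      apply Rle_trans with (T * (Cmod (s - 1) * (2 / (sg + 1) * exp (- (sg + 1) * (ln c + ln (INR (S m)))))
         + B * exp (- sg / 2 * (ln c + - ln (INR (S m)))))).
      { apply Rmult_le_compat_l; [lra|]. apply Rle_trans with (1 := Q). apply Rplus_le_compat; assumption. }
      rewrite Rmult_plus_distr_l. apply Req_le. f_equal.
      * unfold T, M1, c1, rpow at 3. 
        replace (- (sg + 1) * (ln c + ln (INR (S m)))) with (- (sg + 1) * ln c + - (sg + 1) * ln (INR (S m))) by ring.
        rewrite exp_plus.
        transitivity (/ PI ^ 2 * rpow n (- (2)) * (exp ((sg + 1) * ln c) * exp (- (sg + 1) * ln c)) * (Cmod (s - 1) * (2 / (sg + 1))) * exp (- (sg + 1) * ln (INR (S m)))); [ring|].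
        rewrite <- exp_plus. replace ((sg + 1) * ln c + - (sg + 1) * ln c) with 0 by ring. rewrite exp_0. ring.
      * unfold T, M2. unfold rpow at 3.
        replace (- sg / 2 * (ln c + - ln (INR (S m)))) with (th * ln c + - th * ln (INR (S m))) by (unfold th; field).
        rewrite exp_plus.
        transitivity (B * / PI ^ 2 * (rpow n (- (2)) * (exp ((sg + 1) * ln c) * exp (th * ln c))) * exp (- th * ln (INR (S m)))); [ring|].
        rewrite <- exp_plus.
        replace (rpow n (- (2)) * exp ((sg + 1) * ln c + th * ln c)) with (exp ((sg + 1 + th) * ln (2 * PI)) * rpow n (- (1 + th))); [ring|].
        unfold rpow. rewrite <- !exp_plus. f_equal. unfold c. rewrite (ln_mult (2 * PI)) by lra. unfold th. field.
    + apply (ex_series_plus (K := R_AbsRing) (V := R_NormedModule)); apply (ex_series_scal_r _ _); assumption.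
  - replace (Finite 0) with (Finite (Series M1 * 0 + Series M2 * 0)) by (f_equal; ring).
    apply is_lim_seq_plus'; [apply (is_lim_seq_scal_l _ (Series M1) (Finite 0)) | apply (is_lim_seq_scal_l _ (Series M2) (Finite 0))];
    apply is_lim_seq_rpow; unfold th; lra.
Qed.

(** On [[a, 1]] the parabola is that of [n = 0]; each further unit interval adds one [zE]. *)
Lemma Ub_closed s a m : 0 < a <= 1 ->
  ((s - 1) * s * (s + 1) * CInt (Ub s) a (INR (S m)) = zM 0 s 1 - zM 0 s a + csum (fun k => zE k s) m)%C.
Proof.
  intros Ha. induction m as [|m IH].
  - simpl INR. simpl csum. rewrite Cplus_0_r, <- saw_integral by lra. f_equal.
    apply CInt_ext. rewrite Rmin_left, Rmax_right by lra. intros t Ht. unfold Ub.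
    rewrite (beta_saw 0) by (simpl; lra). reflexivity.
  - assert (P := INR_S_pos m). assert (P0 := pos_INR m). assert (E := S_INR (S m)). assert (E' := S_INR m).
    rewrite (CInt_Chasles _ a (INR (S m))), Cmult_plus_distr_l, IH.
    + cbn [csum]. rewrite <- (zE_integral m s).
      replace (CInt (fun x => RtoC (sawq (INR (S m)) x) * pw x (- s - 2))%C (INR (S m)) (INR (S (S m)))) with (CInt (Ub s) (INR (S m)) (INR (S (S m)))); [ring|].
      apply CInt_ext. rewrite Rmin_left, Rmax_right by lra. intros t Ht. unfold Ub. rewrite (beta_saw (S m)) by lra. reflexivity.
    + apply rcont_on_le; [lra|]. intros t Ht. apply rcont_Ub. lra.
    + apply rcont_on_le; [lra|]. intros t Ht. apply rcont_Ub. lra.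
Qed.

(** The integral of [beta x * x ^ (- s - 2)] over the half-line, convergent for [-1 < Re s < 0], is
    computed twice. Unit intervals and trapezoid errors give [zF s]; the Fourier terms give the
    Mellin transform of [1 - cos] times [zF (1 - s)]. *)
Lemma functional_equation_strip s : strip (-1) 0 s ->
  (2 * zF s = - (s + 1) * RtoC (/ PI ^ 2) * pw (2 * PI) (s + 1) * RR s * zF (1 - s))%C.
Proof.
  intros Hs. assert (L1 := clim_scal (s * (s + 1)) _ _ (Ub_limit_right s Hs)). unfold strip in Hs.
  assert (L2 : clim (fun m => s * (s + 1) * ((s - 1) * CInt (Ub s) (/ INR (S m)) (INR (S m))))%C (2 * zF s)).
  { assert (Z1 : clim (fun m => pw (/ INR (S m)) (- s)) 0).
    { apply (clim_bound _ _ (fun m => rpow m (- (- Re s)))); [|apply is_lim_seq_rpow; lra].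
      intros m. replace (pw (/ INR (S m)) (- s) - 0)%C with (pw (/ INR (S m)) (- s)) by ring.
      rewrite pw_inv_l, Cmod_pw_S, !Re_opp by apply INR_S_pos. lra. }
    assert (Z2 : clim (fun m => pw (/ INR (S m)) (1 - s)) 0).
    { apply (clim_bound _ _ (fun m => rpow m (- (1 - Re s)))); [|apply is_lim_seq_rpow; lra].
      intros m. replace (pw (/ INR (S m)) (1 - s) - 0)%C with (pw (/ INR (S m)) (1 - s)) by ring.
      rewrite pw_inv_l, Cmod_pw_S, Re_opp, Re_minus, Re_RtoC by apply INR_S_pos. lra. }
    assert (Z3 : clim (fun m => csum (fun k => zE k s) m) (2 * zF s - s - 1)).
    { rewrite <- zE_zF by (unfold hp; lra). apply zE_cv. unfold hp; lra. }
    (* The value [zM 0 s 1] is [s + 1], which cancels the [- s - 1] of [zE_zF]; the powers of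
       [/ INR (S m)] vanish in the limit. *)
    assert (Z := clim_plus _ _ _ _ (clim_plus _ _ _ _ (clim_const (s + 1))
       (clim_plus _ _ _ _ (clim_scal (- (s * (s + 1))) _ _ Z2) (clim_scal ((s - 1) * (s + 1)) _ _ Z1))) Z3). cbv beta in Z.
    match type of Z with clim _ ?l => replace (2 * zF s)%C with l by ring end.
    eapply clim_ext; [|exact Z]. intros m. cbv beta.
    assert (Pm := INR_S_pos m). assert (Pm0 := pos_INR m).
    assert (Hi : 0 < / INR (S m) <= 1).
    { split; [apply Rinv_0_lt_compat, Pm|]. rewrite <- Rinv_1. apply Rinv_le_contravar; rewrite ?S_INR; lra. }
    replace (s * (s + 1) * ((s - 1) * CInt (Ub s) (/ INR (S m)) (INR (S m))))%C
      with ((s - 1) * s * (s + 1) * CInt (Ub s) (/ INR (S m)) (INR (S m)))%C by ring.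
    rewrite Ub_closed by exact Hi. unfold zM. rewrite !pw_1_l, Rmult_0_l, Rmult_0_r, Rplus_0_l. ring. }
  rewrite <- (clim_unique _ _ _ L1 L2).
  rewrite (zF_zeta0 (1 - s)) by (unfold hp; rewrite Re_minus, Re_RtoC; lra). ring.
Qed.

(** Continued so as to include the line [Re s = 1], where the equation is applied. *)
Lemma functional_equation s : strip (-1) 2 s ->
  (2 * zF s = - (s + 1) * RtoC (/ PI ^ 2) * pw (2 * PI) (s + 1) * RR s * zF (1 - s))%C.
Proof.
  revert s. apply (identity_eq (strip (-1) 2) (fun s => 2 * zF s)%C
    (fun s => - (s + 1) * RtoC (/ PI ^ 2) * pw (2 * PI) (s + 1) * RR s * zF (1 - s))%C (RtoC (- / 2)) (/ 2)).
  - apply strip_open.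
  - apply strip_convex.
  - intros s _. destruct (zF_entire s) as [l Hl]. eexists. cder_auto.
  - intros s Hs. destruct (zF_entire (1 - s)) as [l Hl]. destruct (RR_holo s Hs) as [l' Hl']. eexists.
    apply (cder_mult (fun s => - (s + 1) * RtoC (/ PI ^ 2) * pw (2 * PI) (s + 1) * RR s)%C (fun s => zF (1 - s))).
    + apply cder_mult; [|exact Hl']. apply (cder_mult (fun s => - (s + 1) * RtoC (/ PI ^ 2))%C (fun s => pw (2 * PI) (s + 1))).
      * cder_auto.
      * apply (cder_comp (pw (2 * PI)) (fun s => s + 1)%C); [apply cder_pw | cder_auto].
    + apply (cder_comp zF (fun s => 1 - s)%C); [exact Hl | cder_auto].
  - unfold strip. rewrite Re_RtoC. lra.
  - lra.
  - intros z Hz. apply functional_equation_strip. apply Re_cdisc in Hz. rewrite Re_RtoC in Hz. unfold strip. lra.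
Qed.

(** At [1 - i t] the right-hand side of the functional equation has the factor [zF (i t)], so a zero
    on the imaginary axis would be carried to the line [Re s = 1]. *)
Lemma zeta_line_0 (t : R) : t <> 0 -> zeta (0, t) <> 0.
Proof.
  intros Ht E.
  assert (N1 : ((0, t) : C) <> RtoC 1) by (intros F; apply (f_equal fst) in F; simpl in F; lra).
  rewrite zeta_zF in E by exact N1.
  assert (E0 : zF (0, t) = 0).
  { replace (zF (0, t)) with (zF (0, t) / ((0, t) - 1) * ((0, t) - 1))%C by (field; apply Cminus_neq_0, N1). rewrite E. ring. }
  assert (F := functional_equation (1, - t)%R).
  replace (1 - (1, (- t)%R))%C with ((0, t) : C) in F by (apply injective_projections; simpl; ring).
  rewrite E0, Cmult_0_r in F.
  apply (zF_line_1 (- t)); [lra|].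
  replace (zF (1, (- t)%R)) with (/ 2 * (2 * zF (1, (- t)%R)))%C by field.
  rewrite F; [ring|]. unfold strip, Re. simpl. lra.
Qed.

(** * Bernoulli numbers *)

(** The point 0 is excluded because [x / (exp x - 1)] takes the default value 0 there instead of its
    limit 1. *)
Definition psum (a : nat -> R) (f : R -> R) (r : R) : Prop :=
  forall x, 0 < Rabs x < r -> is_pseries a x (f x).

Lemma psum_radius a f r x : psum a f r -> Rabs x < r -> Rbar_lt (Rabs x) (CV_radius a).
Proof.
  intros H Hx. assert (P := Rabs_pos x). set (y := (Rabs x + r) / 2).
  assert (Hy : Rabs y = y) by (apply Rabs_pos_eq; unfold y; lra).
  assert (K : is_pseries a y (f y)) by (apply H; rewrite Hy; unfold y; lra).
  destruct (Rbar_lt_le_dec (CV_radius a) y) as [L|L].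
  - exfalso. rewrite <- Hy in L. apply (CV_disk_outside _ _ L).
    apply is_pseries_R in K. apply ex_series_lim_0. exists (f y). exact K.
  - apply Rbar_lt_le_trans with (2 := L). simpl. unfold y. lra.
Qed.

(** Equality is known only off 0; continuity of the power series supplies the value at 0. *)
Lemma psum_zero a r n : 0 < r -> psum a (fun _ => 0) r -> a n = 0.
Proof.
  intros Hr H. assert (P : Rbar_lt 0 (CV_radius a)) by (rewrite <- Rabs_R0; apply (psum_radius a _ r _ H); rewrite Rabs_R0; exact Hr).
  assert (A0 : PSeries a 0 = 0).
  { destruct (Req_dec (PSeries a 0) 0) as [E|E]; [exact E|exfalso].
    assert (Cn := PSeries_continuity a 0 ltac:(rewrite Rabs_R0; exact P)).
    destruct (Cn (Rabs (PSeries a 0)) (Rabs_pos_lt _ E)) as [d [Hd K]].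
    set (x := Rmin (d / 2) (r / 2)). assert (Hx : 0 < x < d /\ x < r).
    { unfold x, Rmin. destruct Rle_dec; lra. }
    specialize (K x). simpl in K. unfold R_dist, D_x, no_cond in K.
    assert (Ea : PSeries a x = 0) by (apply is_pseries_unique, H; rewrite Rabs_pos_eq; lra).
    rewrite Ea in K. unfold Rminus in K. rewrite Rplus_0_l, Rabs_Ropp, Ropp_0, Rplus_0_r in K.
    assert (Rabs (PSeries a 0) < Rabs (PSeries a 0)); [|lra].
    apply K. split; [split; [exact I | lra]|]. rewrite Rabs_pos_eq; lra. }
  apply (PSeries_ext_recip a (fun _ => 0) n P).
  - rewrite CV_radius_const_0. exact I.
  - exists (mkposreal r Hr). intros x Hx. rewrite PSeries_const_0.
    destruct (Req_dec x 0) as [E|E]; [rewrite E; exact A0|].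
    apply is_pseries_unique, H. split; [apply Rabs_pos_lt, E|].
    change (Rabs (x - 0) < r) in Hx. rewrite Rminus_0_r in Hx. exact Hx.
Qed.

Lemma psum_zero_ext a f r n : 0 < r -> psum a f r -> (forall x, 0 < Rabs x < r -> f x = 0) -> a n = 0.
Proof. intros Hr H K. apply (psum_zero a r n Hr). intros x Hx. rewrite <- (K x Hx). apply H, Hx. Qed.

Lemma psum_plus a b f g r : psum a f r -> psum b g r -> psum (fun n => a n + b n) (fun x => f x + g x) r.
Proof. intros H K x Hx. apply (is_pseries_plus a b x (f x) (g x)); [apply H | apply K]; exact Hx. Qed.

Lemma psum_scal c a f r : psum a f r -> psum (fun n => c * a n) (fun x => c * f x) r.
Proof.
  intros H x Hx. apply (is_pseries_scal c a x (f x)); [apply Rmult_comm | apply H, Hx].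
Qed.

Lemma psum_mult a b f g r : psum a f r -> psum b g r -> psum (PS_mult a b) (fun x => f x * g x) r.
Proof.
  intros H K x Hx. apply is_pseries_mult; [apply H, Hx | apply K, Hx | |]; eapply psum_radius; try eassumption; apply Hx.
Qed.

(** Multiplication by [x] keeps the index unchanged, so differential equations become recursions
    without shifts. *)
Lemma psum_xderive a f f' r : psum a f r -> (forall x, 0 < Rabs x < r -> is_derive f x (f' x)) ->
  psum (fun n => INR n * a n) (fun x => x * f' x) r.
Proof.
  intros H K x Hx. assert (D := is_derive_PSeries a x (psum_radius a f r x H (proj2 Hx))).
  assert (E : f' x = PSeries (PS_derive a) x).
  { apply is_derive_unique in D. rewrite <- D. symmetry. apply is_derive_unique. apply (is_derive_ext_loc f); [|apply K, Hx].
    assert (Hd : 0 < Rmin (Rabs x) (r - Rabs x)) by (apply Rmin_glb_lt; lra).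
    exists (mkposreal _ Hd). intros y Hy. change (Rabs (y - x) < Rmin (Rabs x) (r - Rabs x)) in Hy.
    symmetry. apply is_pseries_unique, H.
    assert (M1 := Rmin_l (Rabs x) (r - Rabs x)). assert (M2 := Rmin_r (Rabs x) (r - Rabs x)).
    unfold Rabs in *; repeat destruct Rcase_abs; lra. }
  rewrite E. eapply is_pseries_ext; [|apply (is_pseries_incr_1 (K := R_AbsRing) (V := R_NormedModule) (PS_derive a) x (PSeries (PS_derive a) x)), PSeries_correct, ex_pseries_derive].
  - intros [|n]; [exact (eq_sym (Rmult_0_l _))|reflexivity].
  - apply (psum_radius a f r x H (proj2 Hx)).
Qed.

Lemma psum_exp r : psum (fun n => / INR (fact n)) exp r.
Proof. intros x _. apply is_exp_Reals. Qed.

Lemma psum_exp_opp r : psum (fun n => (-1) ^ n * / INR (fact n)) (fun x => exp (- x)) r.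
Proof.
  intros x _. assert (H := is_exp_Reals (- x)). apply is_pseries_R in H. apply is_pseries_R.
  eapply is_series_ext; [|exact H]. intros n. simpl. replace (- x) with (-1 * x) by ring. rewrite Rpow_mult_distr. ring.
Qed.

Lemma psum_monom c N r : psum (fun n => if Nat.eq_dec n N then c else 0) (fun x => c * x ^ N) r.
Proof.
  intros x _. apply is_pseries_R.
  assert (H : is_series (fun n => if Nat.eq_dec n N then c * x ^ N else 0) (c * x ^ N)).
  { change (is_lim_seq (sum_n (fun n => if Nat.eq_dec n N then c * x ^ N else 0)) (c * x ^ N)).
    apply is_lim_seq_ext_loc with (u := fun _ => c * x ^ N); [|apply is_lim_seq_const].
    exists N. intros n Hn. induction n as [|n IH].
    - assert (N = 0)%nat as -> by lia. rewrite sum_O. destruct Nat.eq_dec; [reflexivity|lia].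
    - rewrite sum_Sn. destruct (Nat.eq_dec (S n) N) as [E|E].
      + rewrite (sum_n_ext_loc _ (fun _ => 0)).
        * rewrite sum_n_const. unfold plus; simpl. ring.
        * intros k Hk. destruct Nat.eq_dec; [lia|reflexivity].
      + rewrite <- IH by lia. unfold plus; simpl. ring. }
  eapply is_series_ext; [|exact H]. intros n. simpl. destruct Nat.eq_dec as [->|]; ring.
Qed.

(** * The generating function of the Bernoulli numbers *)

Lemma exp_minus_1_neq_0 x : 0 < Rabs x -> exp x - 1 <> 0.
Proof.
  intros H E. assert (x = 0); [|subst; rewrite Rabs_R0 in H; lra].
  apply exp_inv. rewrite exp_0. lra.
Qed.

(* Near 0 the function [Cexp z = 1 + z g z] has [g 0 = 1], so [1 / g] is holomorphic there; the Bernoulli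
   numbers are read off its Taylor coefficients. *)
Lemma bernoulli_exists : exists B, is_bernoulli B.
Proof.
  destruct (holo_quotient Cexp 0 1 Rlt_0_1) as [g [Hg Eg]]; [intros z _; eexists; apply cder_Cexp|].
  assert (E0 : forall z, Cexp z = (1 + z * g z)%C) by (intros z; rewrite (Eg z), Cexp_0; ring).
  assert (g0 : g 0 = 1).
  { eapply (cder_unique Cexp 0); [|rewrite <- Cexp_0; apply cder_Cexp].
    destruct (Hg 0 ltac:(apply disc_center; lra)) as [l Hl].
    apply (cder_ext (fun z => 1 + z * g z)%C); [intros; symmetry; apply E0|].
    eapply cder_eq; [cder_auto|]. cbv beta. ring. }
  destruct (Hg 0 ltac:(apply disc_center; lra)) as [l Hl].
  destruct (cder_cont _ _ _ Hl (/ 2) ltac:(lra)) as [d [Hd Kd]].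
  set (r := Rmin d 1). assert (Hr : 0 < r <= d /\ r <= 1) by (unfold r, Rmin; destruct Rle_dec; lra).
  assert (gn : forall z, cdisc 0 r z -> g z <> 0).
  { intros z Hz E. unfold cdisc in Hz. specialize (Kd z ltac:(lra)). rewrite E, g0 in Kd.
    replace (0 - 1)%C with (RtoC (-1)) in Kd by (rewrite <- RtoC_minus; f_equal; ring). rewrite Cmod_R, Rabs_left in Kd; lra. }
  destruct (taylor_disc (fun z => / g z)%C 0 r (r / 2) ltac:(lra)) as [c [M [Hc HT]]].
  { intros z Hz. destruct (Hg z) as [l' Hl']; [unfold cdisc in *; lra|]. eexists. cder_auto. apply gn, Hz. }
  exists (fun n => INR (fact n) * Re (c n)). exists (r / 2). split; [lra|]. intros x Hx.
  assert (Q := HT (RtoC x)). replace (RtoC x - 0)%C with (RtoC x) in Q by ring. rewrite Cmod_R in Q. specialize (Q (proj2 Hx)).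
  assert (gx : g (RtoC x) = RtoC ((exp x - 1) / x)).
  { assert (E := E0 (RtoC x)). rewrite Cexp_RtoC in E. assert (Nx : x <> 0) by (intros ->; rewrite Rabs_R0 in Hx; lra).
    unfold Rdiv. rewrite RtoC_mult, RtoC_inv, RtoC_minus, E by exact Nx. field. intros F. apply Nx, RtoC_inj, F. }
  rewrite gx in Q. assert (Nx : x <> 0) by (intros ->; rewrite Rabs_R0 in Hx; lra).
  assert (Ne := exp_minus_1_neq_0 x (proj1 Hx)).
  rewrite <- RtoC_inv in Q by (unfold Rdiv; apply Rmult_integral_contrapositive_currified; [exact Ne | apply Rinv_neq_0_compat, Nx]).
  replace (/ ((exp x - 1) / x)) with (x / (exp x - 1)) in Q by (field; split; assumption).
  apply is_pseries_R. apply (is_series_ext (fun n => Re (c n) * x ^ n)).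
  { intros n. simpl. field. apply INR_fact_neq_0. }
  apply (is_lim_seq_spec _ (Finite _)). intros eps. destruct (Q eps (cond_pos eps)) as [N HN]. exists N. intros n Hn.
  specialize (HN (S n) ltac:(lia)). rewrite <- rsum_sum_n.
  assert (Es : Re (csum (fun n => c n * RtoC x ^ n)%C (S n) - RtoC (x / (exp x - 1))) = rsum (fun n => Re (c n) * x ^ n) (S n) - x / (exp x - 1)).
  { rewrite Re_minus, Re_RtoC. f_equal. generalize (S n) as m. induction m as [|m IH]; [reflexivity|]. cbn [csum rsum].
    rewrite Re_plus, IH, <- RtoC_pow. f_equal. unfold Re, Cmult, RtoC. simpl. ring. }
  rewrite <- Es. apply Rle_lt_trans with (2 := HN). apply re_le_Cmod.
Qed.

Definition bcoef (n : nat) : R := bernoulli n / INR (fact n).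

Lemma bernoulli_psum : exists r, 0 < r /\ psum bcoef (fun x => x / (exp x - 1)) r.
Proof.
  destruct (epsilon_spec (inhabits (fun _ : nat => 0)) is_bernoulli bernoulli_exists) as [r [Hr H]].
  exists r. split; [exact Hr|]. exact H.
Qed.

Lemma exp_quotient_derive x : 0 < Rabs x ->
  is_derive (fun x => x / (exp x - 1)) x (1 / (exp x - 1) - x * exp x / (exp x - 1) ^ 2).
Proof. intros H. assert (N := exp_minus_1_neq_0 x H). auto_derive; [exact N|]. field. exact N. Qed.

Lemma bcoef_0 : bcoef 0 = 1.
Proof.
  destruct bernoulli_psum as [r [Hr H]].
  (* The coefficient of [x] in [y (exp x - 1) - x = 0], where [y = x / (exp x - 1)]. *)
  assert (Q := psum_plus _ _ _ _ _ (psum_mult _ _ _ _ _ H (psum_plus _ _ _ _ _ (psum_exp r) (psum_monom (-1) 0 r))) (psum_monom (-1) 1 r)).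
  assert (Z := psum_zero_ext _ _ r 1 Hr Q). cbv beta in Z.
  lapply Z; clear Z; [intros Z | intros x Hx; assert (N := exp_minus_1_neq_0 x (proj1 Hx)); rewrite ?exp_Ropp; assert (P := exp_pos x); field; repeat split; lra].
  unfold PS_mult in Z. simpl in Z. field_simplify in Z. lra.
Qed.

(** The correction removes the linear coefficient and leaves those of the even function
    [(x / 2) coth (x / 2)]. *)
Definition ccoef (n : nat) : R := bcoef n + (if Nat.eq_dec n 1 then / 2 else 0).

(* Comparing coefficients in [x c' = c - c^2 + x^2 / 4] for [c = x / (exp x - 1) + x / 2]. *)
Lemma ccoef_rec n : INR n * ccoef n = ccoef n - PS_mult ccoef ccoef n + (if Nat.eq_dec n 2 then / 4 else 0).
Proof.
  destruct bernoulli_psum as [r [Hr H]].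
  assert (Hc : psum ccoef (fun x => x / (exp x - 1) + / 2 * x ^ 1) r) by (apply psum_plus; [exact H | apply psum_monom]).
  assert (Hd := psum_xderive _ _ (fun x => 1 / (exp x - 1) - x * exp x / (exp x - 1) ^ 2 + / 2) r Hc
    ltac:(intros x Hx; assert (N := exp_minus_1_neq_0 x (proj1 Hx)); auto_derive; [exact N | field; exact N])).
  assert (Q := psum_plus _ _ _ _ _ Hd (psum_plus _ _ _ _ _ (psum_scal (-1) _ _ _ Hc) (psum_plus _ _ _ _ _ (psum_mult _ _ _ _ _ Hc Hc) (psum_monom (- / 4) 2 r)))).
  assert (Z := psum_zero_ext _ _ r n Hr Q). cbv beta in Z.
  lapply Z; clear Z; [intros Z | intros x Hx; assert (N := exp_minus_1_neq_0 x (proj1 Hx)); rewrite ?exp_Ropp; assert (P := exp_pos x); field; repeat split; lra].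
  cbv beta in Z. destruct Nat.eq_dec; lra.
Qed.

Lemma sum_f_R0_ends f n : (1 <= n)%nat -> sum_f_R0 f (S n) = f 0%nat + sum_f_R0 (fun i => f (S i)) (pred n) + f (S n).
Proof.
  intros H. rewrite tech5. f_equal. destruct n as [|n]; [lia|]. rewrite decomp_sum by lia. reflexivity.
Qed.

(** For [n > 2] the recursion says that [(n + 1) c_n] is minus the sum of [c_i c_(n - i)] over
    [0 < i < n]. By strong induction products with an odd index vanish, and for [n = 2 m] the others
    all have the sign [(-1) ^ m], so that nothing cancels. *)
Lemma ccoef_signs n : (1 <= n)%nat ->
  (Nat.Odd n -> ccoef n = 0) /\ (forall m, n = (2 * m)%nat -> 0 < (-1) ^ (S m) * ccoef n).
Proof.
  assert (c0 : ccoef 0 = 1) by (unfold ccoef; rewrite bcoef_0; simpl; ring).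
  induction n as [n IH] using lt_wf_ind. intros Hn.
  assert (R := ccoef_rec n). unfold PS_mult in R.
  destruct n as [|[|n]]; [lia| |].
  - simpl in R. rewrite c0 in R. split; [intros _; lra | intros m Hm; lia].
  - rewrite sum_f_R0_ends in R by lia. rewrite Nat.sub_diag, Nat.sub_0_r, c0 in R.
    set (T := sum_f_R0 _ _) in R.
    assert (R' : (INR (S (S n)) + 1) * ccoef (S (S n)) = - T + (if Nat.eq_dec (S (S n)) 2 then / 4 else 0)) by lra. clear R.
    assert (P : 0 < INR (S (S n)) + 1) by (assert (Q := pos_INR (S (S n))); lra).
    split.
    + intros [p Hp]. assert (Z : T = 0).
      { unfold T. rewrite <- (sum_eq (fun _ => 0)); [apply sum_eq_R0; intros; reflexivity|]. intros i Hi. simpl in Hi.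
        destruct (Nat.Even_or_Odd (S i)) as [[q Hq]|Ho].
        - rewrite (proj1 (IH (S (S n) - S i)%nat ltac:(lia) ltac:(lia))) by (exists (p - q)%nat; lia). ring.
        - rewrite (proj1 (IH (S i) ltac:(lia) ltac:(lia)) Ho). ring. }
      rewrite Z in R'. destruct Nat.eq_dec as [E|E]; [lia|].
      apply (Rmult_eq_reg_l (INR (S (S n)) + 1)); lra.
    + intros m Hm. apply (Rmult_lt_reg_l (INR (S (S n)) + 1)); [exact P|]. rewrite Rmult_0_r.
      replace ((INR (S (S n)) + 1) * ((-1) ^ S m * ccoef (S (S n)))) with ((-1) ^ S m * ((INR (S (S n)) + 1) * ccoef (S (S n)))) by ring.
      rewrite R'. destruct Nat.eq_dec as [E|E].
      * assert (n = 0)%nat as -> by lia. assert (m = 1)%nat as -> by lia. unfold T. simpl.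
        assert (c1 : ccoef 1 = 0) by (apply (IH 1%nat); [lia | lia | exists 0%nat; lia]). rewrite c1. lra.
      * rewrite Rplus_0_r. replace ((-1) ^ S m * - T) with ((-1) ^ m * T) by (simpl; ring).
        unfold T. rewrite scal_sum.
        assert (term : forall i, (i <= n)%nat ->
           (exists p q, S i = (2 * p)%nat /\ S (S n) - S i = 2 * q /\ p + q = m)%nat /\ 0 < ccoef (S i) * ccoef (S (S n) - S i) * (-1) ^ m
           \/ ccoef (S i) * ccoef (S (S n) - S i) * (-1) ^ m = 0).
        { intros i Hi. destruct (Nat.Even_or_Odd (S i)) as [[p Hp]|Ho].
          - left. assert (Hq : (S (S n) - S i = 2 * (m - p))%nat) by lia. split; [exists p, (m - p)%nat; lia|].
            assert (A := proj2 (IH (S i) ltac:(lia) ltac:(lia)) p Hp).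
            assert (B := proj2 (IH (S (S n) - S i)%nat ltac:(lia) ltac:(lia)) _ Hq).
            replace (ccoef (S i) * ccoef (S (S n) - S i) * (-1) ^ m) with (((-1) ^ S p * ccoef (S i)) * ((-1) ^ S (m - p) * ccoef (S (S n) - S i))).
            + apply Rmult_lt_0_compat; assumption.
            + replace ((-1) ^ m) with ((-1) ^ p * (-1) ^ (m - p)) by (rewrite <- pow_add; f_equal; lia). simpl. ring.
          - right. rewrite (proj1 (IH (S i) ltac:(lia) ltac:(lia)) Ho). ring. }
        assert (Pos : forall N, (1 <= N <= n)%nat -> 0 < sum_f_R0 (fun i => ccoef (S i) * ccoef (S (S n) - S i) * (-1) ^ m) N).
        { induction N as [|N IHN]; intros HN; [lia|]. rewrite tech5. destruct N as [|N].
          (* Index 0 contributes a multiple of [ccoef 1 = 0]; strict positivity comes from index 1,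
             which is the reason for [1 <= N]. *)
          - cbn [sum_f_R0]. destruct (term 0%nat ltac:(lia)) as [[[p [q [K _]]] _]|E0]; [lia|]. rewrite E0.
            destruct (term 1%nat ltac:(lia)) as [[_ K]|E1]; [simpl in *; lra|].
            exfalso. assert (A := proj2 (IH 2%nat ltac:(lia) ltac:(lia)) 1%nat eq_refl).
            assert (B := proj2 (IH (S (S n) - 2)%nat ltac:(lia) ltac:(lia)) (m - 1)%nat ltac:(lia)).
            assert (NZ : (-1) ^ m <> 0) by (apply pow_nonzero; lra).
            apply Rmult_integral in E1. destruct E1 as [E1|E1]; [|exact (NZ E1)].
            apply Rmult_integral in E1. destruct E1 as [E1|E1]; [rewrite E1 in A | rewrite E1 in B]; lra.
          - assert (Q := IHN ltac:(lia)). destruct (term (S (S N)) ltac:(lia)) as [[_ K]|K]; lra. }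
        simpl pred. apply Pos. lia.
Qed.

Lemma bernoulli_even_neq_0 k : (2 <= k)%nat -> Nat.Even k -> bernoulli k <> 0.
Proof.
  intros Hk [m Hm] E. assert (H := proj2 (ccoef_signs k ltac:(lia)) m Hm).
  unfold ccoef, bcoef in H. destruct Nat.eq_dec as [F|F]; [lia|]. rewrite E in H. unfold Rdiv in H. lra.
Qed.

(** * The convolution identity behind the residues *)

Lemma sum_even f N : (forall i, Nat.Odd i -> f i = 0) -> sum_f_R0 f (2 * N) = sum_f_R0 (fun i => f (2 * i)%nat) N.
Proof.
  intros H. induction N as [|N IH]; [reflexivity|].
  replace (2 * S N)%nat with (S (S (2 * N))) by lia. rewrite !tech5, IH.
  rewrite (H (S (2 * N))) by (exists N; lia). replace (2 * S N)%nat with (S (S (2 * N))) by lia. ring.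
Qed.

Definition acoef (k : nat) : R := (1 - INR (2 * k)) * bcoef (2 * k).

(* Comparing coefficients in [(2 cosh x - 2) (y - x y') = x^2] for [y = x / (exp x - 1)]. *)
Lemma acoef_convolution K : sum_f_R0 (fun j => 2 / INR (fact (2 * j + 2)) * acoef (K - j)) K = if Nat.eq_dec K 0 then 1 else 0.
Proof.
  destruct bernoulli_psum as [r [Hr H]].
  assert (Hd := psum_xderive _ _ _ r H (fun x Hx => exp_quotient_derive x (proj1 Hx))).
  assert (Ha := psum_plus _ _ _ _ _ H (psum_scal (-1) _ _ _ Hd)).
  assert (Hh := psum_plus _ _ _ _ _ (psum_exp r) (psum_plus _ _ _ _ _ (psum_exp_opp r) (psum_monom (-2) 0 r))).
  assert (Q := psum_plus _ _ _ _ _ (psum_mult _ _ _ _ _ Hh Ha) (psum_monom (-1) 2 r)).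
  (* Since [2 cosh x - 2] starts with [x ^ 2], the identity for [K] is found at the coefficient
     [2 K + 2]. *)
  assert (Z := psum_zero_ext _ _ r (2 * (S K)) Hr Q). cbv beta in Z.
  lapply Z; clear Z; [intros Z | intros x Hx; assert (N := exp_minus_1_neq_0 x (proj1 Hx)); rewrite ?exp_Ropp; assert (P := exp_pos x); field; repeat split; lra].
  cbv beta in Z. unfold PS_mult in Z. rewrite sum_even in Z.
  - rewrite decomp_sum in Z by lia. simpl pred in Z.
    assert (E0 : / INR (fact (2 * 0)) + ((-1) ^ (2 * 0) * / INR (fact (2 * 0)) + (if Nat.eq_dec (2 * 0) 0 then -2 else 0)) = 0) by (simpl; field).
    rewrite E0, Rmult_0_l, Rplus_0_l in Z.
    rewrite (sum_eq _ (fun j => 2 / INR (fact (2 * j + 2)) * acoef (K - j))) in Z.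
    + destruct (Nat.eq_dec (2 * S K) 2), (Nat.eq_dec K 0); try lia; lra.
    + intros j Hj. replace (2 * S K - 2 * S j)%nat with (2 * (K - j))%nat by lia. replace (2 * S j)%nat with (2 * j + 2)%nat by lia.
      unfold acoef. destruct (Nat.eq_dec (2 * j + 2) 0) as [F|F]; [lia|]. rewrite Nat.add_comm, pow_add, pow_1_even. simpl ((-1) ^ 2).
      rewrite (Nat.add_comm 2). field. apply INR_fact_neq_0.
  - intros i [p ->]. destruct (Nat.eq_dec (2 * p + 1) 0) as [F|F]; [lia|]. rewrite Nat.add_1_r, pow_1_odd. ring.
Qed.

(** * Digit sums and their Dirichlet series *)

Section Digits.

Variable b : nat.
Hypothesis hb : (2 <= b)%nat.

Lemma digit_high i n : (n < i)%nat -> digit b i n = 0%nat.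
Proof.
  intros H. unfold digit. rewrite Nat.div_small; [apply Nat.Div0.mod_0_l|].
  apply Nat.lt_le_trans with i; [exact H|]. apply Nat.lt_le_incl, Nat.pow_gt_lin_r. lia.
Qed.

Lemma digit_sum_long N n : (n < N)%nat -> list_sum (map (fun i => digit b i n) (seq 0 N)) = digit_sum b n.
Proof.
  intros H. induction N as [|N IH]; [lia|]. destruct (Nat.eq_dec n N) as [->|E]; [reflexivity|].
  rewrite seq_S, map_app, list_sum_app, IH by lia. simpl. rewrite digit_high by lia. lia.
Qed.

Lemma digit_sum_step n r : (r < b)%nat -> digit_sum b (b * n + r) = (digit_sum b n + r)%nat.
Proof.
  intros H. rewrite <- (digit_sum_long (S (S (b * n + r))) (b * n + r)) by lia.
  rewrite <- (digit_sum_long (S (b * n + r)) n) by nia.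
  rewrite <- cons_seq, <- seq_shift. cbn [map]. rewrite map_map.
  change (list_sum (?a :: ?l)) with (a + list_sum l)%nat. rewrite Nat.add_comm. f_equal.
  - f_equal. apply map_ext. intros i. unfold digit. rewrite Nat.pow_succ_r', <- Nat.Div0.div_div.
    do 2 f_equal. rewrite Nat.mul_comm, Nat.div_add_l, Nat.div_small by lia. lia.
  - unfold digit. rewrite Nat.pow_0_r, Nat.div_1_r, Nat.add_comm, Nat.mul_comm, Nat.Div0.mod_add. apply Nat.mod_small, H.
Qed.

Lemma digit_sum_0 : digit_sum b 0 = 0%nat.
Proof. unfold digit_sum, digit. simpl. rewrite Nat.Div0.mod_0_l. reflexivity. Qed.

Lemma cumul_digit_sum_S n : cumul_digit_sum b (S n) = (cumul_digit_sum b n + digit_sum b n)%nat.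
Proof.
  unfold cumul_digit_sum. destruct n as [|n]; [rewrite digit_sum_0; reflexivity|].
  replace (S (S n) - 1)%nat with (S n) by lia. replace (S n - 1)%nat with n by lia.
  rewrite seq_S, map_app, list_sum_app. simpl. lia.
Qed.

Definition dS (n : nat) : R := INR (cumul_digit_sum b n).
(** The jump of the digit sum at the integer [n + 1], which is also the second difference of [dS]
    centred there. *)
Definition dc (n : nat) : R := INR (digit_sum b (S n)) - INR (digit_sum b n).

Lemma dS_diff n : dc n = dS (S (S n)) - 2 * dS (S n) + dS n.
Proof. unfold dc, dS. rewrite (cumul_digit_sum_S (S n)), (cumul_digit_sum_S n), !plus_INR. ring. Qed.

Lemma dS_0 : dS 0 = 0.
Proof. reflexivity. Qed.

Lemma dS_1 : dS 1 = 0.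
Proof. reflexivity. Qed.

Lemma dS_pos n : 0 <= dS n.
Proof. apply pos_INR. Qed.

Lemma dc_nondiv n : ~ Nat.divide b (S n) -> dc n = 1.
Proof.
  intros H. unfold dc. assert (E := Nat.div_mod_eq (S n) b). assert (L := Nat.mod_upper_bound (S n) b ltac:(lia)).
  set (q := (S n / b)%nat) in *. set (r := (S n mod b)%nat) in *. destruct r as [|r].
  - exfalso. apply H. exists q. lia.
  - replace n with (b * q + r)%nat by lia. replace (S (b * q + r)) with (b * q + S r)%nat by lia.
    rewrite !digit_sum_step by lia. rewrite !plus_INR, S_INR. ring.
Qed.

(** Appending the digit 0 does not change the digit sum, while the predecessor of a multiple of [b]
    ends in the digit [b - 1]. *)
Lemma dc_mult n : dc (b * S n - 1) = dc n - (INR b - 1).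
Proof.
  unfold dc. replace (S (b * S n - 1)) with (b * S n + 0)%nat by lia.
  replace (b * S n - 1)%nat with (b * n + (b - 1))%nat by lia. rewrite !digit_sum_step by lia.
  rewrite !plus_INR, minus_INR by lia. simpl INR. ring.
Qed.

Lemma ln_b_pos : 0 < ln (INR b).
Proof. rewrite <- ln_1. apply ln_increasing; [lra|]. apply (lt_INR 1 b). lia. Qed.

Lemma digit_sum_log n : INR (digit_sum b (S n)) <= INR b * (1 + ln (INR (S n)) / ln (INR b)).
Proof.
  assert (Lb := ln_b_pos). assert (Hb : 2 <= INR b) by (apply (le_INR 2), hb).
  induction n as [n IH] using lt_wf_ind.
  assert (E := Nat.div_mod_eq (S n) b). assert (L := Nat.mod_upper_bound (S n) b ltac:(lia)).
  set (q := (S n / b)%nat) in *. set (r := (S n mod b)%nat) in *.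
  assert (Hr : INR r <= INR b) by (apply le_INR; lia).
  assert (Ln := ln_INR_S_ge_0 n).
  rewrite E at 1. rewrite digit_sum_step, plus_INR by exact L. destruct q as [|q].
  - rewrite digit_sum_0. simpl (INR 0).
    assert (0 <= ln (INR (S n)) / ln (INR b)) by (apply Rmult_le_pos; [exact Ln | left; apply Rinv_0_lt_compat, Lb]). nra.
  - assert (Q := IH q ltac:(nia)).
    assert (Ll : ln (INR b) + ln (INR (S q)) <= ln (INR (S n))).
    { rewrite <- ln_mult by (try apply INR_S_pos; lra). apply ln_le.
      - apply Rmult_lt_0_compat; [lra | apply INR_S_pos].
      - rewrite <- mult_INR. apply le_INR. lia. }
    assert (Ld : 1 + ln (INR (S q)) / ln (INR b) <= ln (INR (S n)) / ln (INR b)).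
    { replace (1 + ln (INR (S q)) / ln (INR b)) with ((ln (INR b) + ln (INR (S q))) / ln (INR b)) by (field; lra).
      apply Rmult_le_compat_r; [left; apply Rinv_0_lt_compat, Lb | exact Ll]. }
    nra.
Qed.

(** Logarithmic growth is traded for an arbitrarily small power, enough for absolute convergence on
    all of [Re s > 2] for the sums and [Re w > 1] for the jumps. *)
Lemma digit_sum_rpow e : 0 < e -> exists K, 0 < K /\ forall n, INR (digit_sum b (S n)) <= K * rpow n e.
Proof.
  intros He. assert (Lb := ln_b_pos). assert (Hb : 2 <= INR b) by (apply (le_INR 2), hb).
  assert (P : 0 < / (e * ln (INR b))) by (apply Rinv_0_lt_compat, Rmult_lt_0_compat; lra).
  exists (INR b * (1 + / (e * ln (INR b)))). split; [nra|]. intros n.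
  apply Rle_trans with (1 := digit_sum_log n). rewrite Rmult_assoc. apply Rmult_le_compat_l; [lra|].
  assert (Ln := ln_INR_S_ge_0 n).
  assert (L : e * ln (INR (S n)) <= rpow n e) by (unfold rpow; generalize (exp_ineq1_le (e * ln (INR (S n)))); lra).
  assert (1 <= rpow n e) by (unfold rpow; rewrite <- exp_0; apply exp_le; nra).
  replace (ln (INR (S n)) / ln (INR b)) with (/ (e * ln (INR b)) * (e * ln (INR (S n)))) by (field; split; lra). nra.
Qed.

Lemma dc_rpow e : 0 < e -> exists K, 0 < K /\ forall n, Rabs (dc n) <= K * rpow n e.
Proof.
  intros He. destruct (digit_sum_rpow e He) as [K [HK H]]. exists (2 * K). split; [lra|]. intros n.
  assert (A := H n). assert (A0 := pos_INR (digit_sum b (S n))). assert (B0 := pos_INR (digit_sum b n)).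
  assert (B : INR (digit_sum b n) <= K * rpow n e).
  { destruct n as [|n].
    - rewrite digit_sum_0. simpl (INR 0). assert (Q := rpow_pos 0 e). nra.
    - apply Rle_trans with (1 := H n). apply Rmult_le_compat_l; [lra|]. apply exp_le. apply Rmult_le_compat_l; [lra|].
      apply ln_le; [apply INR_S_pos | apply le_INR; lia]. }
  unfold dc. apply Rabs_le. lra.
Qed.

Lemma dS_rpow e : 0 < e -> exists K, 0 < K /\ forall n, dS (S n) <= K * rpow n (1 + e).
Proof.
  intros He. destruct (digit_sum_rpow e He) as [K [HK H]]. exists K. split; [exact HK|]. intros n.
  assert (M : forall i, (i <= n)%nat -> dS (S i) <= INR i * (K * rpow n e)).
  { induction i as [|i IH]; intros Hi; [rewrite dS_1; simpl; lra|].
    unfold dS in *. rewrite cumul_digit_sum_S, plus_INR, S_INR. assert (Q := H i).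
    assert (rpow i e <= rpow n e).
    { apply exp_le. apply Rmult_le_compat_l; [lra|]. apply ln_le; [apply INR_S_pos | apply le_INR; lia]. }
    specialize (IH ltac:(lia)). nra. }
  apply Rle_trans with (1 := M n (le_n _)). rewrite rpow_plus.
  assert (E1 : rpow n 1 = INR (S n)) by (unfold rpow; rewrite Rmult_1_l; apply exp_ln, INR_S_pos).
  rewrite E1, S_INR. assert (Q := rpow_pos n e). assert (Q' := pos_INR n). nra.
Qed.

Lemma ex_series_dS sigma : 2 < sigma -> ex_series (fun n => Cmod (RtoC (dS (S n))) * rpow n (- sigma)).
Proof.
  intros Hs. set (e := (sigma - 2) / 2). destruct (dS_rpow e ltac:(unfold e; lra)) as [K [HK H]].
  apply (ex_series_Rle _ (fun n => K * rpow n (- (1 + e)))); [|apply ex_series_Rscal, ex_series_rpow; unfold e; lra].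
  intros n. assert (Q := rpow_pos n (- sigma)). rewrite Cmod_R, Rabs_pos_eq by apply dS_pos. split; [apply Rmult_le_pos; [apply dS_pos | lra]|].
  replace (- (1 + e)) with ((1 + e) + - sigma) by (unfold e; field). rewrite rpow_plus, <- Rmult_assoc.
  apply Rmult_le_compat_r; [lra | apply H].
Qed.

Lemma ex_series_dc sigma : 1 < sigma -> ex_series (fun n => Cmod (RtoC (dc n)) * rpow n (- sigma)).
Proof.
  intros Hs. set (e := (sigma - 1) / 2). destruct (dc_rpow e ltac:(unfold e; lra)) as [K [HK H]].
  apply (ex_series_Rle _ (fun n => K * rpow n (- (1 + e)))); [|apply ex_series_Rscal, ex_series_rpow; unfold e; lra].
  intros n. assert (Q := rpow_pos n (- sigma)). rewrite Cmod_R. split; [apply Rmult_le_pos; [apply Rabs_pos | lra]|].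
  replace (- (1 + e)) with (e + - sigma) by (unfold e; field). rewrite rpow_plus, <- Rmult_assoc.
  apply Rmult_le_compat_r; [lra | apply H].
Qed.

Definition dG : C -> C := dser (fun n => RtoC (dS (S n))).
Definition dZ : C -> C := dser (fun n => RtoC (dc n)).

Lemma dG_cv s : 2 < Re s -> cseries (fun n => RtoC (dS (S n)) * pw (INR (S n)) (- s))%C (dG s).
Proof. intros H. apply (dirichlet_cv _ 2); [intros; apply ex_series_dS; assumption | exact H]. Qed.

Lemma dZ_cv w : 1 < Re w -> cseries (fun n => RtoC (dc n) * pw (INR (S n)) (- w))%C (dZ w).
Proof. intros H. apply (dirichlet_cv _ 1); [intros; apply ex_series_dc; assumption | exact H]. Qed.

Lemma dG_holo : holo_on (hp 2) dG.
Proof. apply dirichlet_holo. intros; apply ex_series_dS; assumption. Qed.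

Lemma INR_b_pos : 0 < INR b.
Proof. apply (lt_INR 0). lia. Qed.

(** The difference [dZ - zeta0] lives on the multiples of [b], where its coefficient at [b m] is the
    jump at [m] minus [b]. Hence [dZ - zeta0 = b^(-w) (dZ - b zeta0)], a linear equation for
    [dZ]. *)
Lemma dZ_zeta0 w : 1 < Re w -> (dZ w * (pw (INR b) w - 1) = zeta0 w * (pw (INR b) w - RtoC (INR b)))%C.
Proof.
  intros Hw. assert (Pb := INR_b_pos).
  assert (HZ := dZ_cv w Hw). assert (Hz := zeta0_cv w Hw).
  set (f := fun l => ((RtoC (dc (l - 1)) - 1) * pw (INR l) (- w))%C).
  assert (Hd := cseries_minus _ _ _ _ HZ Hz). cbv beta in Hd.
  assert (Hi : cseries (fun n => ind (Nat.divide b (S n)) * f (S n))%C (dZ w - zeta0 w)).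
  { eapply cseries_ext; [|exact Hd]. intros n. cbv beta. unfold f. replace (S n - 1)%nat with n by lia.
    destruct (excluded_middle_informative (Nat.divide b (S n))) as [D|D].
    - rewrite ind_true by exact D. ring.
    - rewrite ind_false, (dc_nondiv n D) by exact D. ring. }
  apply cseries_multiples in Hi; [|lia].
  assert (Hr := cseries_scal (pw (INR b) (- w)) _ _ (cseries_minus _ _ _ _ HZ (cseries_scal (RtoC (INR b)) _ _ Hz))). cbv beta in Hr.
  assert (E : (dZ w - zeta0 w = pw (INR b) (- w) * (dZ w - RtoC (INR b) * zeta0 w))%C).
  { eapply cseries_unique; [exact Hi|]. eapply cseries_ext; [|exact Hr]. intros m. cbv beta. unfold f.
    rewrite dc_mult, mult_INR, pw_mult by (try exact Pb; apply INR_S_pos). rewrite !RtoC_minus. ring. }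
  rewrite pw_opp in E. assert (N := pw_neq_0 (INR b) w). set (p := pw (INR b) w) in *.
  assert (E2 : ((dZ w - zeta0 w) * p = dZ w - RtoC (INR b) * zeta0 w)%C) by (rewrite E; field; exact N).
  replace (dZ w * (p - 1))%C with ((dZ w - zeta0 w) * p - dZ w + zeta0 w * p)%C by ring. rewrite E2. ring.
Qed.

(** Summation by parts, moving the second difference from [dS] to the powers; the boundary terms
    vanish because [dS 0 = dS 1 = 0]. *)
Lemma second_difference_sum w : 2 < Re w ->
  cseries (fun n => RtoC (dS (S n)) * (pw (INR n) (- w) - 2 * pw (INR (S n)) (- w) + pw (INR (S (S n))) (- w)))%C (dZ w).
Proof.
  intros Hw. set (sg := Re w) in *.
  assert (X := ex_series_dS sg Hw).
  set (e1 := fun n => (RtoC (dS (S n)) * pw (INR n) (- w))%C).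
  set (e3 := fun n => (RtoC (dS (S n)) * pw (INR (S (S n))) (- w))%C).
  assert (H2 := dG_cv w Hw).
  assert (H1 : cseries e1 (CSer e1)).
  { apply (cseries_abs e1 (fun n => exp (sg * ln 2) * (Cmod (RtoC (dS (S n))) * rpow n (- sg)))); [|apply ex_series_Rscal, X].
    (* Index 0 would involve [pw 0]; it is killed by [dS 1 = 0]. *)
    intros [|n]; unfold e1.
    - rewrite dS_1, Cmod_mult, Cmod_0, !Rmult_0_l, Rmult_0_r. lra.
    - rewrite Cmod_mult, Cmod_pw_S, Re_opp. fold sg.
      replace (exp (sg * ln 2) * (Cmod (RtoC (dS (S (S n)))) * rpow (S n) (- sg))) with (Cmod (RtoC (dS (S (S n)))) * (exp (sg * ln 2) * rpow (S n) (- sg))) by ring.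
      apply Rmult_le_compat_l; [apply Cmod_ge_0|]. unfold rpow. rewrite <- exp_plus. apply exp_le.
      assert (L : ln (INR (S (S n))) <= ln 2 + ln (INR (S n))).
      { rewrite <- ln_mult by (try apply INR_S_pos; lra). apply ln_le; [apply INR_S_pos|]. rewrite !S_INR. generalize (pos_INR n). lra. }
      nra. }
  assert (H3 : cseries e3 (CSer e3)).
  { apply (cseries_abs e3 (fun n => Cmod (RtoC (dS (S n))) * rpow n (- sg))); [|exact X].
    intros n. unfold e3. rewrite Cmod_mult. apply Rmult_le_compat_l; [apply Cmod_ge_0|].
    rewrite Cmod_pw_S, Re_opp. fold sg. apply exp_le.
    assert (L : ln (INR (S n)) <= ln (INR (S (S n)))) by (apply ln_le; [apply INR_S_pos | apply le_INR; lia]). nra. }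
  assert (K1 : cseries (fun n => RtoC (dS (S (S n))) * pw (INR (S n)) (- w))%C (CSer e1)).
  { apply (cseries_shift e1). replace (e1 O) with (RtoC 0) by (unfold e1; rewrite dS_1; ring). rewrite Cplus_0_l. exact H1. }
  assert (K3 : cseries (fun n => RtoC (dS n) * pw (INR (S n)) (- w))%C (CSer e3)).
  { assert (Q := proj1 (cseries_shift (fun n => RtoC (dS n) * pw (INR (S n)) (- w))%C (CSer e3)) H3). cbv beta in Q.
    rewrite dS_0, Cmult_0_l, Cplus_0_l in Q. exact Q. }
  assert (Q1 := cseries_plus _ _ _ _ (cseries_minus _ _ _ _ K1 (cseries_scal 2 _ _ H2)) K3). cbv beta in Q1.
  assert (Q2 := cseries_plus _ _ _ _ (cseries_minus _ _ _ _ H1 (cseries_scal 2 _ _ H2)) H3). cbv beta in Q2.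
  assert (E : dZ w = (CSer e1 - 2 * dG w + CSer e3)%C).
  { eapply cseries_unique; [apply dZ_cv; fold sg; lra|]. eapply cseries_ext; [|exact Q1]. intros n. cbv beta.
    rewrite dS_diff, RtoC_plus, RtoC_minus, RtoC_mult. ring. }
  rewrite E. eapply cseries_ext; [|exact Q2]. intros n. unfold e1, e3. cbv beta. ring.
Qed.

(** The second difference at [n] is expanded by the even binomial series at [x = 1 / n], and the sum
    over [n] is taken first. At [n = 1] the series would be on the boundary of its disc, but
    [dS 1 = 0]. *)
Lemma dG_relation w : 2 < Re w ->
  cseries (fun i => 2 * binc (- w) (2 * i + 2) * dG (w + sh i))%C (dZ w).
Proof.
  intros Hw. set (K := Cmod w + 1). assert (HK : 0 < K) by (unfold K; generalize (Cmod_ge_0 w); lra).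
  assert (HKw : Cmod (- w) <= K) by (rewrite Cmod_opp; unfold K; lra).
  set (u := fun n i => (2 * binc (- w) (2 * i + 2) * (RtoC (dS (S n)) * pw (INR (S n)) (- (w + sh i))))%C).
  set (cc := fun i => (2 * binc (- w) (2 * i + 2) * dG (w + sh i))%C).
  assert (Hc : forall i, cseries (fun n => u n i) (cc i)).
  { intros i. apply cseries_scal, dG_cv. rewrite Re_sh. generalize (pos_INR i). lra. }
  assert (Es : forall n i, pw (INR (S n)) (- (w + sh i)) = (RtoC (/ INR (S n)) ^ (2 * i + 2) * pw (INR (S n)) (- w))%C).
  { intros n i. assert (P := INR_S_pos n). replace (- (w + sh i))%C with (- w + - sh i)%C by ring.
    unfold sh. rewrite pw_add, (pw_opp _ (RtoC (INR (2 * i + 2)))), pw_nat by assumption.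
    rewrite <- Cpow_inv, <- RtoC_inv by (try apply RtoC_neq_0; lra). ring. }
  assert (Hr : forall n, cseries (fun i => u n i) (RtoC (dS (S n)) * (pw (INR n) (- w) - 2 * pw (INR (S n)) (- w) + pw (INR (S (S n))) (- w)))%C).
  { intros [|n].
    - rewrite dS_1, Cmult_0_l. apply (cseries_ext (fun _ => RtoC 0)); [|apply cseries_zero]. intros i. unfold u. rewrite dS_1. ring.
    - assert (P := INR_S_pos n). assert (P' := INR_S_pos (S n)). assert (Q := pos_INR n). assert (E := S_INR (S n)). assert (E' := S_INR n).
      assert (Hx : 0 < / INR (S (S n)) < 1).
      { split; [apply Rinv_0_lt_compat; lra|]. rewrite <- Rinv_1. apply Rinv_lt_contravar; lra. }
      assert (H := cseries_scal (RtoC (dS (S (S n))) * pw (INR (S (S n))) (- w)) _ _ (even_binomial (- w) _ Hx)). cbv beta in H.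
      replace (INR (S n)) with (INR (S (S n)) * (1 - / INR (S (S n)))) by (field_simplify; lra).
      replace (INR (S (S (S n)))) with (INR (S (S n)) * (1 + / INR (S (S n)))) by (rewrite (S_INR (S (S n))); field; lra).
      rewrite !pw_mult by lra.
      match type of H with cseries _ ?l => match goal with |- cseries _ ?l' => replace l' with l by ring end end.
      eapply cseries_ext; [|exact H]. intros i. unfold u. cbv beta. rewrite Es. ring. }
  set (a := fun n => Cmod (RtoC (dS (S n))) * rpow n (- (Re w + 2))).
  set (bo := fun i => 8 * (bb K (2 * i + 2) * (/ 2) ^ (2 * i + 2))).
  assert (Ha : ex_series a) by (apply ex_series_dS; lra).
  assert (Hb : ex_series bo) by (apply (ex_series_Rscal 8), ex_series_bb_even; lra).
  assert (Pa : forall n, 0 <= a n) by (intros n; apply Rmult_le_pos; [apply Cmod_ge_0 | left; apply rpow_pos]).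
  assert (Pb : forall i, 0 <= bo i).
  { intros i. unfold bo. apply Rmult_le_pos; [lra|]. apply Rmult_le_pos; [left; apply bb_pos, HK | apply pow_le; lra]. }
  assert (Hub : forall n i, Cmod (u n i) <= a n * bo i).
  { intros n i. unfold u. destruct n as [|n].
    { rewrite dS_1, Cmult_0_l, Cmult_0_r, Cmod_0. apply Rmult_le_pos; [apply Pa | apply Pb]. }
    rewrite !Cmod_mult, Cmod_pw_S, Cmod_R, Rabs_pos_eq by lra.
    (* Integers from 2 on satisfy [n ^ (- 2 i) <= 2 ^ (- 2 i)], which supplies the part of the
       product majorant depending on [i]. *)
    assert (E : rpow (S n) (Re (- (w + sh i))) <= rpow (S n) (- (Re w + 2)) * (4 * (/ 2) ^ (2 * i + 2))).
    { replace (4 * (/ 2) ^ (2 * i + 2)) with (exp (- (2 * INR i) * ln 2)).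
      - unfold rpow. rewrite <- exp_plus. apply exp_le. rewrite Re_opp, Re_sh.
        assert (L : ln 2 <= ln (INR (S (S n)))) by (apply ln_le; [lra|]; rewrite !S_INR; generalize (pos_INR n); lra).
        assert (Q := pos_INR i). nra.
      - replace (- (2 * INR i) * ln 2) with (INR (2 * i) * (- ln 2)) by (rewrite mult_INR; simpl INR; ring).
        rewrite <- ln_Rinv by lra. fold (Rpower (/ 2) (INR (2 * i))). rewrite Rpower_pow, pow_add by lra. field. }
    replace (a (S n) * bo i) with (2 * bb K (2 * i + 2) * (Cmod (RtoC (dS (S (S n)))) * (rpow (S n) (- (Re w + 2)) * (4 * (/ 2) ^ (2 * i + 2))))) by (unfold a, bo; ring).
    apply Rmult_le_compat.
    - apply Rmult_le_pos; [lra | apply Cmod_ge_0].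
    - apply Rmult_le_pos; [apply Cmod_ge_0 | left; apply rpow_pos].
    - apply Rmult_le_compat_l; [lra|]. apply Cmod_binc_le, HKw.
    - apply Rmult_le_compat_l; [apply Cmod_ge_0 | exact E]. }
  assert (Hcc : cseries cc (CSer cc)).
  { apply (cseries_abs cc (fun i => Series a * bo i)); [|apply (ex_series_Rscal (Series a)), Hb].
    intros i. rewrite <- Series_scal_r.
    apply (cseries_bound (fun n => u n i)); [intros n; apply Hub | apply (ex_series_scal_r (bo i)), Ha | apply Hc]. }
  assert (Hsw := cseries_swap u a bo _ cc _ Hub Ha Hb Pa Pb Hr Hc Hcc).
  rewrite (cseries_unique _ _ _ (second_difference_sum w Hw) Hsw). exact Hcc.
Qed.

End Digits.

(** * Continuation of the digit series *)

Lemma holo_div (U : C -> Prop) (f : C -> C) (a : C) : copen U -> U a -> holo_on U f ->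
  exists g, holo_on U g /\ forall z, f z = (f a + (z - a) * g z)%C.
Proof.
  intros HU Ha Hf. destruct (HU a Ha) as [r [Hr HrU]].
  destruct (holo_quotient f a r Hr) as [g [Hg E]]; [intros z Hz; apply Hf, HrU, Hz|].
  exists g. split; [|exact E]. intros z Hz. destruct (Ceq_dec z a) as [->|N]; [apply Hg, disc_center, Hr|].
  destruct (Hf z Hz) as [l Hl]. assert (P : 0 < Cmod (z - a)) by (apply Cmod_gt_0, Cminus_neq_0, N).
  eexists. apply (cder_ext_loc (fun w => (f w - f a) * / (w - a))%C).
  - exists (Cmod (z - a)). split; [exact P|]. intros w Hw. rewrite (E w). field.
    intros F. apply Cminus_0_eq in F. subst w. rewrite Cmod_minus_sym in Hw. lra.
  - cder_auto. apply Cminus_neq_0, N.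
Qed.

Lemma copen_all : copen (fun _ => True).
Proof. intros z _. exists 1. split; [lra | tauto]. Qed.

Lemma Cexp_eq_1 z : Cexp z = 1 -> exists m : Z, z = (2 * RtoC PI * Ci * RtoC (IZR m))%C.
Proof.
  intros E. assert (Hre : Re z = 0).
  { assert (M := Cmod_Cexp z). rewrite E, Cmod_1 in M. apply exp_inv. rewrite exp_0. lra. }
  assert (E1 := f_equal fst E). assert (E2 := f_equal snd E). unfold Cexp in E1, E2. simpl in E1, E2.
  rewrite Hre, exp_0, Rmult_1_l in E1, E2. destruct (sin_eq_0_0 _ E2) as [k Hk].
  destruct (Z.Even_or_Odd k) as [[m Hm]|[m Hm]].
  - exists m. rewrite (surjective_pairing z). change (fst z) with (Re z). change (snd z) with (Im z). rewrite Hre, Hk, Hm, mult_IZR.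
    apply injective_projections; simpl; ring.
  - exfalso. rewrite Hk, Hm, plus_IZR, mult_IZR in E1.
    replace ((2 * IZR m + 1) * PI) with (2 * IZR m * PI + PI) in E1 by ring. rewrite neg_cos in E1.
    assert (S0 : sin (IZR m * PI) = 0) by (apply sin_eq_0_1; exists m; reflexivity).
    replace (2 * IZR m * PI) with (2 * (IZR m * PI)) in E1 by ring. rewrite cos_2a_sin, S0 in E1. lra.
Qed.

Lemma Cexp_2PI_Z (m : Z) : Cexp (2 * RtoC PI * Ci * RtoC (IZR m)) = 1.
Proof.
  replace (2 * RtoC PI * Ci * RtoC (IZR m))%C with ((0, 2 * (IZR m * PI)) : C) by (apply injective_projections; simpl; ring).
  unfold Cexp. simpl. assert (S0 : sin (IZR m * PI) = 0) by (apply sin_eq_0_1; exists m; reflexivity).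
  rewrite exp_0, cos_2a_sin, sin_2a, S0. apply injective_projections; simpl; ring.
Qed.

Section HSeries.

Variable b : nat.
Hypothesis hb : (2 <= b)%nat.

Notation L := (RtoC (ln (INR b))).
Notation v := (vshift b).

Lemma L_neq_0 : L <> 0.
Proof. apply RtoC_neq_0. generalize (ln_b_pos b hb). lra. Qed.

Lemma v_im m : v m = (0, 2 * PI * IZR m / ln (INR b)).
Proof.
  assert (P := ln_b_pos b hb). unfold vshift. rewrite <- (Cmult_1_l (0, _)). unfold Cdiv. rewrite <- RtoC_inv by lra.
  apply injective_projections; simpl; field; lra.
Qed.

Lemma Re_v m : Re (v m) = 0.
Proof. rewrite v_im. reflexivity. Qed.

Lemma v_0 : v 0 = 0.
Proof. unfold vshift. field. apply L_neq_0. Qed.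

Lemma pw_b_eq_1 w : pw (INR b) w = 1 <-> exists m, w = v m.
Proof.
  unfold pw. split.
  - intros E. destruct (Cexp_eq_1 _ E) as [m Hm]. exists m. unfold vshift. rewrite <- Hm. field. apply L_neq_0.
  - intros [m ->]. unfold vshift. replace (2 * RtoC PI * Ci * RtoC (IZR m) / L * L)%C with (2 * RtoC PI * Ci * RtoC (IZR m))%C by (field; apply L_neq_0).
    apply Cexp_2PI_Z.
Qed.

(** The numerator [b ^ w - b] vanishes at 1 and thereby cancels the pole of zeta. *)
Lemma b_quotient : exists Q, holo_on (fun _ => True) Q /\ forall w, pw (INR b) w = (RtoC (INR b) + (w - 1) * Q w)%C.
Proof.
  destruct (holo_div (fun _ => True) (pw (INR b)) 1 copen_all I) as [Q [H E]]; [intros z _; eexists; apply cder_pw|].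
  exists Q. split; [exact H|]. intros w. rewrite (E w), pw_1 by apply (INR_b_pos b hb). reflexivity.
Qed.

Definition bQ : C -> C := proj1_sig (constructive_indefinite_description _ b_quotient).

Lemma bQ_holo w : exists l, cder bQ w l.
Proof. exact (proj1 (proj2_sig (constructive_indefinite_description _ b_quotient)) w I). Qed.

Lemma bQ_eq w : pw (INR b) w = (RtoC (INR b) + (w - 1) * bQ w)%C.
Proof. exact (proj2 (proj2_sig (constructive_indefinite_description _ b_quotient)) w). Qed.

(** The continuation of [dZ]: the entire numerator [zF w * bQ w] stands for [zeta(w) (b^w - b)], so
    the only possible poles are the zeros of [b^w - 1]. *)
Definition Zc (w : C) : C := (zF w * bQ w * / (pw (INR b) w - 1))%C.

Lemma Zc_dZ w : 1 < Re w -> Zc w = dZ b w.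
Proof.
  intros Hw. unfold Zc. assert (H := dZ_zeta0 b hb w Hw).
  assert (N : (pw (INR b) w - 1)%C <> 0).
  { apply Cminus_neq_0. intros E. apply pw_b_eq_1 in E. destruct E as [m ->]. rewrite Re_v in Hw. lra. }
  rewrite (zF_zeta0 w Hw). replace (dZ b w) with (dZ b w * (pw (INR b) w - 1) * / (pw (INR b) w - 1))%C by (field; exact N).
  rewrite H. replace (pw (INR b) w - RtoC (INR b))%C with ((w - 1) * bQ w)%C by (rewrite bQ_eq; ring). ring.
Qed.

Lemma Zc_holo w : (forall m, w <> v m) -> exists l, cder Zc w l.
Proof.
  intros H. destruct (bQ_holo w) as [l1 H1]. destruct (zF_entire w) as [l2 H2]. assert (H3 := cder_pw (INR b) w). eexists. unfold Zc. cder_auto.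
  apply Cminus_neq_0. intros E. apply pw_b_eq_1 in E. destruct E as [m E]. exact (H m E).
Qed.

Definition pt (k : nat) (m : Z) : C := (2 - RtoC (INR (2 * k)) + v m)%C.
Definition good (s : C) : Prop := forall k m, s <> pt k m.
(** The last two factors of the falling factorial of length [2 * j + 4] are absorbed by
    [dH (s + sh j)]; hence the length [2 * j + 2] beside the factorial of [2 * j + 4]. *)
Definition hq (j : nat) (s : C) : C := (- (2) * ff (2 - s) (2 * j + 2) * / RtoC (INR (fact (2 * j + 4))))%C.
Definition dH (s : C) : C := ((s - 1) * (s - 2) * dG b s)%C.

Lemma Re_pt k m : Re (pt k m) = 2 - 2 * INR k.
Proof. unfold pt. rewrite Re_plus, Re_minus, !Re_RtoC, Re_v, mult_INR. simpl INR. ring. Qed.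

Lemma good_hp s : 2 < Re s -> good s.
Proof. intros H k m ->. rewrite Re_pt in H. generalize (pos_INR k). lra. Qed.

Lemma good_shift s j : good s -> good (s + sh j)%C.
Proof.
  intros H k m E. apply (H (k + j + 1)%nat m). unfold pt in *.
  replace (2 * (k + j + 1))%nat with (2 * k + (2 * j + 2))%nat by lia. rewrite plus_INR, RtoC_plus. fold (sh j).
  replace s with (s + sh j - sh j)%C by ring. rewrite E. ring.
Qed.

Lemma hq_holo j s : exists l, cder (hq j) s l.
Proof.
  destruct (cder_ff (2 * j + 2) (2 - s)) as [l Hl]. eexists. unfold hq.
  apply (cder_mult (fun s => - (2) * ff (2 - s) (2 * j + 2))%C (fun _ => / RtoC (INR (fact (2 * j + 4))))%C); [|cder_auto].
  apply (cder_mult (fun _ => - (2))%C (fun s => ff (2 - s) (2 * j + 2))); [cder_auto|].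
  apply (cder_comp (fun z => ff z (2 * j + 2)) (fun s => 2 - s)%C); [exact Hl | cder_auto].
Qed.

(** [dG_relation] at [w = s - 2], whose index 0 term is [dH s]; the condition [2 < Re w] explains
    the half-plane. *)
Lemma dH_rec s : hp 4 s -> cseries (fun j => hq j s * dH (s + sh j))%C (dH s - Zc (s - 2)).
Proof.
  intros Hs. unfold hp in Hs. assert (Hw : 2 < Re (s - 2)) by (rewrite Re_minus, Re_RtoC; lra).
  assert (R := dG_relation b hb (s - 2) Hw). rewrite <- Zc_dZ in R by lra.
  set (cc := fun i => (2 * binc (- (s - 2)) (2 * i + 2) * dG b (s - 2 + sh i))%C) in R.
  assert (E0 : cc O = dH s).
  { unfold cc, dH, sh, binc. simpl. replace (s - 2 + RtoC (1 + 1))%C with s by (rewrite RtoC_plus; ring).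
    replace (RtoC (1 + 1)) with (RtoC 2) by (f_equal; ring). field. }
  assert (Hsh : cseries (fun j => cc (S j)) (Zc (s - 2) - dH s)).
  { apply cseries_shift. rewrite E0. replace (dH s + (Zc (s - 2) - dH s))%C with (Zc (s - 2)) by ring. exact R. }
  apply (cseries_scal (- (1))) in Hsh.
  replace (dH s - Zc (s - 2))%C with (- (1) * (Zc (s - 2) - dH s))%C by ring.
  eapply cseries_ext; [|exact Hsh]. intros j. unfold cc, hq, dH, binc.
  replace (2 * S j + 2)%nat with (S (S (2 * j + 2))) by lia. replace (2 * j + 4)%nat with (S (S (2 * j + 2))) by lia.
  replace (s - 2 + sh (S j))%C with (s + sh j)%C
    by (unfold sh; replace (2 * S j + 2)%nat with (2 + (2 * j + 2))%nat by lia; rewrite (plus_INR 2 (2 * j + 2)), RtoC_plus; change (INR 2) with (1 + 1); replace (1 + 1) with 2 by ring; ring).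
  replace (- (s - 2))%C with (2 - s)%C by ring. cbn [ff]. rewrite (S_INR (2 * j + 2)), RtoC_plus. fold (sh j). ring.
Qed.

(** As [dS 1 = 0], the series starts at the integer 2 and decays like [2 ^ (- Re s)]. The
    coefficients [hq] contain no geometric factor, so convergence of the recursion relies on this
    decay. *)
Lemma dG_decay s : 3 <= Re s -> Cmod (dG b s) <= exp (- (Re s - 3) * ln 2) * Series (fun n => Cmod (RtoC (dS b (S n))) * rpow n (- (3))).
Proof.
  intros Hs. assert (X := ex_series_dS b hb 3 ltac:(lra)). rewrite <- Series_scal_l.
  eapply cseries_bound; [|apply (ex_series_Rscal (exp (- (Re s - 3) * ln 2))), X | apply (dG_cv b hb); lra].
  intros [|n]; cbv beta.
  - rewrite dS_1, Cmult_0_l, Cmod_0, Rmult_0_l, Rmult_0_r. lra.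
  - rewrite Cmod_mult, Cmod_pw_S, Re_opp.
    replace (exp (- (Re s - 3) * ln 2) * (Cmod (RtoC (dS b (S (S n)))) * rpow (S n) (- (3)))) with (Cmod (RtoC (dS b (S (S n)))) * (exp (- (Re s - 3) * ln 2) * rpow (S n) (- (3)))) by ring.
    apply Rmult_le_compat_l; [apply Cmod_ge_0|]. unfold rpow. rewrite <- exp_plus. apply exp_le.
    assert (Q : ln 2 <= ln (INR (S (S n)))) by (apply ln_le; [lra|]; rewrite !S_INR; generalize (pos_INR n); lra). nra.
Qed.

Lemma dH_maj K : exists J M, ex_series M /\ forall s j, Cmod s <= K -> (J <= j)%nat ->
  hp 4 (s + sh j) /\ Cmod (hq j s * dH (s + sh j))%C <= M j.
Proof.
  set (B := Series (fun n => Cmod (RtoC (dS b (S n))) * rpow n (- (3)))).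
  assert (PK := Rabs_pos K). set (K' := Rabs K + 4). assert (HK' : 4 <= K') by (unfold K'; generalize (Rabs_pos K); lra).
  destruct (INR_unbounded K') as [J HJ].
  assert (PB : 0 <= B).
  { assert (G := dG_decay (RtoC 3) ltac:(rewrite Re_RtoC; lra)). fold B in G. rewrite Re_RtoC in G.
    replace (- (3 - 3) * ln 2) with 0 in G by ring. rewrite exp_0 in G. generalize (Cmod_ge_0 (dG b (RtoC 3))). lra. }
  exists J, (fun j => 2 * K' * K' * exp ((K' + 1) * ln 2) * B * (bb K' (2 * j + 2) * (/ 2) ^ (2 * j + 2))). split.
  { apply ex_series_Rscal, ex_series_bb_even; lra. }
  intros s j Hs Hj. assert (Hj' : INR J <= INR j) by (apply le_INR, Hj).
  assert (Hre : Rabs (Re s) <= Rabs K) by (apply Rle_trans with (1 := re_le_Cmod s); apply Rle_trans with (1 := Hs); apply Rle_abs).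
  assert (Hre' : - Rabs K <= Re s) by (unfold Rabs in *; repeat destruct Rcase_abs; lra).
  assert (HR := Re_sh s j).
  split; [unfold hp; rewrite HR; unfold K' in HJ; lra|].
  assert (HKK : Cmod s <= Rabs K) by (apply Rle_trans with (1 := Hs), Rle_abs).
  assert (C2 : Cmod (RtoC 2) = 2) by (rewrite Cmod_R, Rabs_pos_eq; lra).
  assert (F := Cmod_ff_le (2 - s) K' (2 * j + 2) ltac:(apply Rle_trans with (1 := Cmod_triangle_minus _ _); rewrite C2; unfold K'; lra)).
  assert (Gd := dG_decay (s + sh j) ltac:(rewrite HR; unfold K' in HJ; lra)). fold B in Gd.
  set (N := INR (2 * j + 2)) in *. assert (PN : 2 <= N) by (unfold N; apply (le_INR 2); lia).
  assert (Ns : Cmod (sh j) = N) by (unfold sh; rewrite Cmod_R, Rabs_pos_eq; [reflexivity | fold N; lra]).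
  assert (M1 : Cmod (s + sh j - 1) <= K' * (N + 1)).
  { apply Rle_trans with (1 := Cmod_triangle_minus _ _). rewrite Cmod_1. assert (T := Cmod_triangle s (sh j)). unfold K'. nra. }
  assert (M2 : Cmod (s + sh j - 2) <= K' * (N + 2)).
  { apply Rle_trans with (1 := Cmod_triangle_minus _ _). rewrite C2. assert (T := Cmod_triangle s (sh j)). unfold K'. nra. }
  unfold hq, dH. rewrite !Cmod_mult, Cmod_opp, C2, Cmod_inv, Cmod_R by apply INR_fact_C_neq_0.
  rewrite (Rabs_pos_eq (INR (fact (2 * j + 4)))) by apply pos_INR.
  replace (2 * j + 4)%nat with (S (S (2 * j + 2))) by lia. rewrite !fact_simpl, !mult_INR, !S_INR. fold N.
  assert (Pf := INR_fact_lt_0 (2 * j + 2)). set (f := INR (fact (2 * j + 2))) in *.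
  assert (E : exp (- (Re (s + sh j) - 3) * ln 2) <= exp ((K' + 1) * ln 2) * (/ 2) ^ (2 * j + 2)).
  { replace ((/ 2) ^ (2 * j + 2)) with (exp (- N * ln 2)).
    - rewrite <- exp_plus. apply exp_le. rewrite HR. assert (N = 2 * INR j + 2) as -> by (unfold N; rewrite plus_INR, mult_INR; simpl INR; ring).
      assert (P2 : 0 < ln 2) by (rewrite <- ln_1; apply ln_increasing; lra). unfold K'. nra.
    - replace (- N * ln 2) with (N * (- ln 2)) by ring. rewrite <- ln_Rinv by lra. unfold N. fold (Rpower (/ 2) (INR (2 * j + 2))). apply Rpower_pow. lra. }
  assert (PE := exp_pos (- (Re (s + sh j) - 3) * ln 2)).
  assert (Pbb := bb_pos K' (2 * j + 2) ltac:(lra)). set (bbv := bb K' (2 * j + 2)) in *. set (h := (/ 2) ^ (2 * j + 2)) in *.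
  assert (Pd : 0 < / ((N + 1 + 1) * ((N + 1) * f))) by (apply Rinv_0_lt_compat; repeat apply Rmult_lt_0_compat; lra).
  apply Rle_trans with (2 * (bbv * f) * / ((N + 1 + 1) * ((N + 1) * f)) * (K' * (N + 1) * (K' * (N + 2)) * (exp ((K' + 1) * ln 2) * h * B))).
  - apply Rmult_le_compat.
    + apply Rmult_le_pos; [|lra]. apply Rmult_le_pos; [lra | apply Cmod_ge_0].
    + apply Rmult_le_pos; [apply Rmult_le_pos|]; apply Cmod_ge_0.
    + apply Rmult_le_compat_r; [lra|]. apply Rmult_le_compat_l; [lra | exact F].
    + apply Rmult_le_compat; [apply Rmult_le_pos; apply Cmod_ge_0 | apply Cmod_ge_0 | apply Rmult_le_compat; try apply Cmod_ge_0; assumption|].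
      apply Rle_trans with (1 := Gd). apply Rmult_le_compat_r; assumption.
  - right. field. lra.
Qed.

(** The last clause isolates the terms with shifted argument in [Re s > 4]: in a bounded region they
    sum to a holomorphic function, so the analysis of a pole involves a finite sum. *)
Lemma H_exists : exists H : C -> C,
  (forall s, 2 < Re s -> H s = dH s) /\ holo_on good H /\
  (forall s, cseries (fun j => hq j s * H (s + sh j))%C (H s - Zc (s - 2))) /\
  (forall K, exists J, (forall s, Cmod s <= K -> forall j, (J <= j)%nat -> hp 4 (s + sh j)) /\
     exists T, holo_on (fun s => Cmod s < K) T /\
       forall s, Cmod s < K -> cseries (fun j => hq (J + j)%nat s * H (s + sh (J + j)))%C (T s)).
Proof.
  assert (HA : holo_on good (fun s => Zc (s - 2))).
  { intros s Hs. destruct (Zc_holo (s - 2)) as [l Hl].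
    - intros m E. apply (Hs 0%nat m). unfold pt. simpl. rewrite <- E. ring.
    - eexists. apply (cder_comp Zc (fun s => s - 2)%C); [exact Hl | cder_auto]. }
  assert (HH0 : holo_on (hp 2) dH).
  { intros s Hs. destruct (dG_holo b hb s Hs) as [l Hl]. eexists. unfold dH. cder_auto. }
  assert (HH4 : holo_on (hp 4) dH) by (intros s Hs; apply HH0; unfold hp in *; lra).
  destruct (continuation 4 good dH (fun s => Zc (s - 2)) hq good_shift HA hq_holo HH4 dH_rec dH_maj) as [H [E [Hh Hr]]].
  exists H. split; [|split; [exact Hh | split; [exact Hr|]]].
  (* The construction gives agreement on [Re s > 4]; both functions are holomorphic for
     [Re s > 2]. *)
  - apply (identity_eq (hp 2) H dH 6 1); [apply hp_open | apply hp_convex | | exact HH0 | | lra |].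
    + intros s Hs. apply Hh, good_hp, Hs.
    + unfold hp. rewrite Re_RtoC. lra.
    + intros z Hz. apply E. apply Re_cdisc in Hz. rewrite Re_RtoC in Hz. unfold hp. lra.
  - intros K. destruct (tail_holo 4 dH hq hq_holo HH4 dH_maj K) as [J [HJ [HS HT]]]. exists J. split; [exact HJ|].
    eexists. split; [exact HT|]. intros s Hs. eapply cseries_ext; [|apply HS; lra]. intros j. cbv beta.
    rewrite E; [reflexivity|]. apply HJ; [lra|lia].
Qed.

End HSeries.

(** * Poles *)

Definition lhol (f : C -> C) (a : C) : Prop := exists d, 0 < d /\ holo_on (cdisc a d) f.

(* At most a simple pole, with residue [r]. *)
Definition spole (f : C -> C) (a r : C) : Prop :=
  exists d T, 0 < d /\ holo_on (cdisc a d) T /\ T a = r /\ forall s, cdisc a d s -> s <> a -> f s = (T s * / (s - a))%C.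

Lemma cdisc_min a d d' z : cdisc a (Rmin d d') z -> cdisc a d z /\ cdisc a d' z.
Proof. unfold cdisc. intros H. generalize (Rmin_l d d') (Rmin_r d d'). lra. Qed.

Lemma Rmin_pos d d' : 0 < d -> 0 < d' -> 0 < Rmin d d'.
Proof. apply Rmin_glb_lt. Qed.

Lemma lhol_entire f a : (forall z, exists l, cder f z l) -> lhol f a.
Proof. intros H. exists 1. split; [lra|]. intros z _. apply H. Qed.

Lemma lhol_plus f g a : lhol f a -> lhol g a -> lhol (fun s => f s + g s)%C a.
Proof.
  intros [d [Hd H]] [d' [Hd' H']]. exists (Rmin d d'). split; [apply Rmin_pos; assumption|]. intros z Hz. apply cdisc_min in Hz.
  destruct (H z (proj1 Hz)) as [l Hl]. destruct (H' z (proj2 Hz)) as [l' Hl']. eexists. apply cder_plus; eassumption.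
Qed.

Lemma lhol_mult f g a : lhol f a -> lhol g a -> lhol (fun s => f s * g s)%C a.
Proof.
  intros [d [Hd H]] [d' [Hd' H']]. exists (Rmin d d'). split; [apply Rmin_pos; assumption|]. intros z Hz. apply cdisc_min in Hz.
  destruct (H z (proj1 Hz)) as [l Hl]. destruct (H' z (proj2 Hz)) as [l' Hl']. eexists. apply cder_mult; eassumption.
Qed.

Lemma lhol_inv f a : lhol f a -> f a <> 0 -> lhol (fun s => / f s)%C a.
Proof.
  intros [d [Hd H]] N. destruct (H a (disc_center a d Hd)) as [l Hl].
  destruct (cder_cont _ _ _ Hl (Cmod (f a)) (proj1 (Cmod_gt_0 _) N)) as [e [He K]].
  exists (Rmin d e). split; [apply Rmin_pos; assumption|]. intros z Hz. apply cdisc_min in Hz.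
  destruct (H z (proj1 Hz)) as [l' Hl']. eexists. apply cder_inv; [|exact Hl']. intros E.
  specialize (K z (proj2 Hz)). rewrite E in K. replace (0 - f a)%C with (- f a)%C in K by ring. rewrite Cmod_opp in K. lra.
Qed.

Lemma lhol_shift f a c : lhol f (a + c) -> lhol (fun s => f (s + c)%C) a.
Proof.
  intros [d [Hd H]]. exists d. split; [exact Hd|]. intros z Hz. destruct (H (z + c)%C) as [l Hl].
  - unfold cdisc in *. replace (z + c - (a + c))%C with (z - a)%C by ring. exact Hz.
  - eexists. apply (cder_comp f (fun s => s + c)%C); [exact Hl | cder_auto].
Qed.

Lemma lhol_csum (u : nat -> C -> C) a n : (forall j, lhol (u j) a) -> lhol (fun s => csum (fun j => u j s) n) a.
Proof.
  intros H. induction n as [|n IH]; [apply lhol_entire; intros z; eexists; apply (cder_const (RtoC 0))|]. apply lhol_plus; [exact IH | apply H].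
Qed.

Lemma spole_ext f g a r : (exists d, 0 < d /\ forall s, cdisc a d s -> s <> a -> f s = g s) -> spole f a r -> spole g a r.
Proof.
  intros [d [Hd E]] [d' [T [Hd' [HT [Ta HE]]]]]. exists (Rmin d d'), T. split; [apply Rmin_pos; assumption|].
  split; [intros z Hz; apply HT; apply cdisc_min in Hz; apply Hz|]. split; [exact Ta|].
  intros s Hs N. apply cdisc_min in Hs. rewrite <- E by tauto. apply HE; tauto.
Qed.

Lemma spole_plus f g a r r' : spole f a r -> spole g a r' -> spole (fun s => f s + g s)%C a (r + r').
Proof.
  intros [d [T [Hd [HT [Ta HE]]]]] [d' [T' [Hd' [HT' [Ta' HE']]]]].
  destruct (lhol_plus T T' a (ex_intro _ d (conj Hd HT)) (ex_intro _ d' (conj Hd' HT'))) as [e [He H]].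
  exists (Rmin e (Rmin d d')), (fun s => T s + T' s)%C. split; [repeat apply Rmin_pos; assumption|].
  split; [intros z Hz; apply H; apply cdisc_min in Hz; apply Hz|]. split; [rewrite Ta, Ta'; reflexivity|].
  intros s Hs N. apply cdisc_min in Hs. destruct Hs as [_ Hs]. apply cdisc_min in Hs. rewrite HE, HE' by tauto. ring.
Qed.

Lemma spole_mult g f a r : lhol g a -> spole f a r -> spole (fun s => g s * f s)%C a (g a * r).
Proof.
  intros Hg [d [T [Hd [HT [Ta HE]]]]]. destruct (lhol_mult g T a Hg (ex_intro _ d (conj Hd HT))) as [e [He H]].
  exists (Rmin e d), (fun s => g s * T s)%C. split; [apply Rmin_pos; assumption|].
  split; [intros z Hz; apply H; apply cdisc_min in Hz; apply Hz|]. split; [rewrite Ta; reflexivity|].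
  intros s Hs N. apply cdisc_min in Hs. rewrite HE by tauto. ring.
Qed.

Lemma spole_holo f a : lhol f a -> spole f a 0.
Proof.
  intros [d [Hd H]]. exists d, (fun s => (s - a) * f s)%C. split; [exact Hd|]. split; [|split; [ring|]].
  - intros z Hz. destruct (H z Hz) as [l Hl]. eexists. cder_auto.
  - intros s _ N. field. apply Cminus_neq_0, N.
Qed.

Lemma spole_shift f a c r : spole f (a + c) r -> spole (fun s => f (s + c)%C) a r.
Proof.
  intros [d [T [Hd [HT [Ta HE]]]]].
  assert (Hs : forall z, cdisc a d z -> cdisc (a + c) d (z + c)%C).
  { intros z Hz. unfold cdisc in *. replace (z + c - (a + c))%C with (z - a)%C by ring. exact Hz. }
  exists d, (fun s => T (s + c)%C). split; [exact Hd|]. split; [|split; [exact Ta|]].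
  - intros z Hz. destruct (HT _ (Hs z Hz)) as [l Hl]. eexists. apply (cder_comp T (fun s => s + c)%C); [exact Hl | cder_auto].
  - intros s Hz N. rewrite HE.
    + replace (s + c - (a + c))%C with (s - a)%C by ring. reflexivity.
    + apply Hs, Hz.
    + intros E. apply N. replace s with (s + c - c)%C by ring. rewrite E. ring.
Qed.

Lemma spole_csum (u : nat -> C -> C) (e : nat -> C) a n :
  (forall j, spole (u j) a (e j)) -> spole (fun s => csum (fun j => u j s) n) a (csum e n).
Proof.
  intros H. induction n as [|n IH]; [apply spole_holo, lhol_entire; intros z; eexists; apply (cder_const (RtoC 0))|].
  apply spole_plus; [exact IH | apply H].
Qed.

Lemma spole_inv f a l : lhol f a -> f a = 0 -> cder f a l -> l <> 0 -> spole (fun s => / f s)%C a (/ l).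
Proof.
  intros [d [Hd H]] Fa Hl Nl. destruct (holo_quotient f a d Hd H) as [g [Hg E]].
  assert (ga : g a = l).
  { destruct (Hg a (disc_center a d Hd)) as [l' Hl']. eapply (cder_unique f a); [|exact Hl].
    apply (cder_ext (fun z => f a + (z - a) * g z)%C); [intros; symmetry; apply E|]. eapply cder_eq; [cder_auto|]. cbv beta. ring. }
  destruct (lhol_inv g a) as [e [He Hi]]; [exists d; split; assumption | rewrite ga; exact Nl|].
  exists e, (fun s => / g s)%C. split; [exact He|]. split; [exact Hi|]. split; [rewrite ga; reflexivity|].
  intros s Hs N. rewrite (E s), Fa, Cplus_0_l, (Cmult_comm (s - a)).
  (* The identity is claimed also where [g s = 0]; there both sides are 0 because the inverse of 0
     is 0. *)
  destruct (Ceq_dec (g s) 0) as [G0|G0].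
  - rewrite G0, Cmult_0_l. unfold Cinv. simpl. apply injective_projections; simpl; unfold Rdiv; ring.
  - field. split; [apply Cminus_neq_0, N | exact G0].
Qed.

Lemma spole_principal f a r : spole f a r -> is_principal_part f a 1 (fun _ => r).
Proof.
  intros [d [T [Hd [HT [Ta HE]]]]]. destruct (holo_quotient T a d Hd HT) as [g [Hg E]]. exists g. split.
  - apply holomorphic_at_iff. exists d. split; assumption.
  - apply locally'_Cmod. exists d. split; [exact Hd|]. intros s Hs N. rewrite sum_n_n, HE, (E s), Ta by assumption.
    simpl. unfold Cdiv. rewrite Cmult_1_r. field. apply Cminus_neq_0, N.
Qed.

Lemma cont_punctured_eq f g a d l l' : 0 < d -> (forall s, cdisc a d s -> s <> a -> f s = g s) -> cder f a l -> cder g a l' -> f a = g a.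
Proof.
  intros Hd E Hf Hg. apply Cminus_0_eq. destruct (Ceq_dec (f a - g a) 0) as [F|F]; [exact F|exfalso].
  apply Cmod_gt_0 in F. set (e := Cmod (f a - g a)) in *.
  destruct (cder_cont _ _ _ Hf (e / 2) ltac:(lra)) as [d1 [Hd1 K1]]. destruct (cder_cont _ _ _ Hg (e / 2) ltac:(lra)) as [d2 [Hd2 K2]].
  set (x := Rmin d (Rmin d1 d2) / 2).
  assert (Px : 0 < Rmin d (Rmin d1 d2)) by (repeat apply Rmin_pos; assumption).
  assert (Ex : Cmod (a + RtoC x - a) = x).
  { replace (a + RtoC x - a)%C with (RtoC x) by ring. rewrite Cmod_R. apply Rabs_pos_eq. unfold x. lra. }
  assert (Hx : cdisc a (Rmin d (Rmin d1 d2)) (a + RtoC x)) by (unfold cdisc; rewrite Ex; unfold x; lra).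
  apply cdisc_min in Hx. destruct Hx as [X X']. apply cdisc_min in X'. destruct X' as [X1 X2].
  specialize (K1 _ X1). specialize (K2 _ X2). rewrite E in K1.
  - assert (T := Cmod_triangle_minus (g (a + RtoC x)%C - g a) (g (a + RtoC x)%C - f a)).
    replace (g (a + RtoC x)%C - g a - (g (a + RtoC x)%C - f a))%C with (f a - g a)%C in T by ring. fold e in T. lra.
  - exact X.
  - intros F'. rewrite F' in Ex. replace (a - a)%C with (RtoC 0) in Ex by ring. rewrite Cmod_0 in Ex. unfold x in Ex. lra.
Qed.

Lemma sum_n_m_csum (f : nat -> C) n : sum_n_m f 1 n = csum (fun i => f (S i)) n.
Proof.
  induction n as [|n IH]; [rewrite sum_n_m_zero by lia; reflexivity|].
  rewrite sum_n_Sm by lia. rewrite IH. reflexivity.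
Qed.

(** After multiplication by [(s - a) ^ n] the function has value 0 at [a], while the principal part
    gives the leading coefficient [c n]. *)
Lemma holomorphic_not_pole f a : holomorphic_at f a -> ~ is_pole f a.
Proof.
  intros Hf [n [Hn [c [[h [Hh E]] Nc]]]]. apply holomorphic_at_iff in Hf. destruct Hf as [d [Hd Hf]].
  apply holomorphic_at_iff in Hh. destruct Hh as [d' [Hd' Hh]]. apply locally'_Cmod in E. destruct E as [d'' [Hd'' E]].
  destruct (Hf a (disc_center a d Hd)) as [l Hl]. destruct (Hh a (disc_center a d' Hd')) as [l' Hl'].
  set (P := fun s => (csum (fun i => c (S i) * (s - a) ^ (n - S i)) n + (s - a) ^ n * h s)%C).
  assert (Dp : forall k z, exists l, cder (fun s => (s - a) ^ k)%C z l).
  { intros [|k] z; eexists; [apply (cder_const (RtoC 1))|]. apply (cder_comp (fun x => x ^ S k)%C (fun s => s - a)%C); [apply cder_pow | cder_auto]. }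
  assert (DP : exists l, cder P a l).
  { assert (Q : holo_on (fun _ => True) (fun s => csum (fun i => c (S i) * (s - a) ^ (n - S i))%C n)).
    { apply (holo_csum _ (fun i s => c (S i) * (s - a) ^ (n - S i))%C). intros k _ z _. destruct (Dp (n - S k)%nat z) as [lk Hk].
      eexists. apply (cder_mult (fun _ => c (S k))); [apply cder_const | exact Hk]. }
    destruct (Q a I) as [l1 H1]. destruct (Dp n a) as [l2 H2]. eexists. apply cder_plus; [exact H1|]. apply cder_mult; eassumption. }
  destruct DP as [lP HP]. destruct (Dp n a) as [ln Hln].
  assert (Z : ((fun s => (s - a) ^ n * f s) a = P a)%C).
  { eapply (cont_punctured_eq (fun s => (s - a) ^ n * f s)%C P a d''); [exact Hd'' | | apply cder_mult; eassumption | exact HP].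
    intros s Hs N. cbv beta. rewrite (E s Hs N), sum_n_m_csum. unfold P. rewrite Cmult_plus_distr_l. f_equal.
    assert (Ns := Cminus_neq_0 s a N).
    rewrite <- csum_scal. assert (G : forall m, (m <= n)%nat -> csum (fun k => (s - a) ^ n * (c (S k) / (s - a) ^ S k))%C m = csum (fun i => c (S i) * (s - a) ^ (n - S i))%C m).
    { induction m as [|m IH]; intros Hm; [reflexivity|]. cbn [csum]. rewrite IH by lia. f_equal.
      replace n with ((n - S m) + S m)%nat at 1 by lia. rewrite Cpow_add_r. field. apply Cpow_nz, Ns. }
    apply G. lia. }
  cbv beta in Z. replace (a - a)%C with (RtoC 0) in Z by ring. unfold P in Z. replace (a - a)%C with (RtoC 0) in Z by ring.
  destruct n as [|n]; [lia|]. assert (P0 : forall k, (RtoC 0 ^ S k = 0)%C) by (intros k; simpl; ring).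
  rewrite P0, !Cmult_0_l, Cplus_0_r in Z. cbn [csum] in Z. rewrite Nat.sub_diag in Z.
  assert (G : forall m, (m <= n)%nat -> csum (fun i => c (S i) * RtoC 0 ^ (S n - S i))%C m = 0).
  { induction m as [|m IH]; intros Hm; [reflexivity|]. cbn [csum]. rewrite IH by lia.
    replace (S n - S m)%nat with (S (n - S m)) by lia. rewrite P0. ring. }
  rewrite G in Z by lia. apply Nc. rewrite Cplus_0_l in Z. simpl in Z. rewrite Z. ring.
Qed.

Lemma ff_split z m n : ff z (m + n) = (ff z m * ff (z - RtoC (INR m)) n)%C.
Proof.
  induction n as [|n IH]; [rewrite Nat.add_0_r; simpl; ring|].
  rewrite Nat.add_succ_r. cbn [ff]. rewrite IH, plus_INR, RtoC_plus. ring.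
Qed.

Lemma csum_sum_f_R0 g n : csum (fun j => RtoC (g j)) (S n) = RtoC (sum_f_R0 g n).
Proof.
  induction n as [|n IH]; [simpl; ring|]. rewrite tech5, RtoC_plus, <- IH. reflexivity.
Qed.

(** * Residues of [H] *)

Section HPoles.

Variable b : nat.
Hypothesis hb : (2 <= b)%nat.
Variable H : C -> C.
Hypothesis H_holo : holo_on (good b) H.
Hypothesis H_rec : forall s, cseries (fun j => hq j s * H (s + sh j))%C (H s - Zc b hb (s - 2)).
Hypothesis H_tail : forall K, exists J, (forall s, Cmod s <= K -> forall j, (J <= j)%nat -> hp 4 (s + sh j)) /\
     exists T, holo_on (fun s => Cmod s < K) T /\
       forall s, Cmod s < K -> cseries (fun j => hq (J + j)%nat s * H (s + sh (J + j)))%C (T s).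

Notation L := (RtoC (ln (INR b))).
Notation v := (vshift b).
Notation pb := (pt b).

(** Real parts differ by multiples of 2 and imaginary parts by multiples of [2 PI / ln b]. *)
Lemma pt_separated k m k' m' : Cmod (pb k m - pb k' m') < Rmin 2 (2 * PI / ln (INR b)) -> pb k m = pb k' m'.
Proof.
  intros Hc. assert (Lb := ln_b_pos b hb). assert (Hpi := PI_RGT_0).
  assert (M1 := Rmin_l 2 (2 * PI / ln (INR b))). assert (M2 := Rmin_r 2 (2 * PI / ln (INR b))).
  assert (A := re_le_Cmod (pb k m - pb k' m')). assert (B := im_le_Cmod (pb k m - pb k' m')).
  rewrite Re_minus, !Re_pt in A by exact hb.
  assert (Ek : k = k').
  { assert (A' : Rabs (2 * (INR k' - INR k)) < 2) by (replace (2 * (INR k' - INR k)) with (2 - 2 * INR k - (2 - 2 * INR k')) by ring; lra).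
    apply Rabs_def2 in A'. destruct (Nat.lt_trichotomy k k') as [Q|[Q|Q]]; [|exact Q|].
    - apply (le_INR (S k)) in Q. rewrite S_INR in Q. lra.
    - apply (le_INR (S k')) in Q. rewrite S_INR in Q. lra. }
  assert (Em : m = m').
  { assert (EI : Im (pb k m - pb k' m') = 2 * PI / ln (INR b) * (IZR m - IZR m')).
    { unfold pt. rewrite !v_im by exact hb. simpl. field. lra. }
    rewrite EI, Rabs_mult, (Rabs_pos_eq (2 * PI / ln (INR b))) in B by (left; apply Rdiv_lt_0_compat; lra).
    assert (P : 0 < 2 * PI / ln (INR b)) by (apply Rdiv_lt_0_compat; lra).
    assert (B' : Rabs (IZR (m - m')) < 1) by (rewrite minus_IZR; nra).
    rewrite <- abs_IZR in B'. apply lt_IZR in B'. lia. }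
  rewrite Ek, Em. reflexivity.
Qed.

Lemma good_isolated s : exists d, 0 < d /\ forall z, cdisc s d z -> z <> s -> good b z.
Proof.
  assert (Lb := ln_b_pos b hb). assert (Hpi := PI_RGT_0).
  set (e := Rmin 2 (2 * PI / ln (INR b))). assert (He : 0 < e) by (apply Rmin_pos; [lra | apply Rdiv_lt_0_compat; lra]).
  destruct (excluded_middle_informative (exists k m, pb k m <> s /\ cdisc s (e / 2) (pb k m))) as [[k [m [N D]]]|N].
  - assert (P : 0 < Cmod (pb k m - s)) by (apply Cmod_gt_0, Cminus_neq_0, N).
    exists (Rmin (e / 2) (Cmod (pb k m - s))). split; [apply Rmin_pos; lra|]. intros z Hz Nz k' m' E.
    apply cdisc_min in Hz. destruct Hz as [Z1 Z2]. unfold cdisc in *.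
    assert (Q : pb k' m' = pb k m).
    { apply pt_separated. fold e. rewrite <- E. assert (T := Cmod_triangle_minus (z - s) (pb k m - s)).
      replace (z - s - (pb k m - s))%C with (z - pb k m)%C in T by ring. lra. }
    rewrite E, Q in Z2. lra.
  - exists (e / 2). split; [lra|]. intros z Hz Nz k' m' E. apply N. exists k', m'. rewrite <- E. split; assumption.
Qed.

Lemma H_lhol s : good b s -> lhol H s.
Proof.
  intros Hs. destruct (good_isolated s) as [d [Hd K]]. exists d. split; [exact Hd|]. intros z Hz. apply H_holo.
  destruct (Ceq_dec z s) as [->|N]; [exact Hs | apply K; assumption].
Qed.

(** Near [p] everything but [Zc] and [J] explicit terms is collected in the holomorphic [D]. The
    bound on [k] guarantees that all shifts of [p] onto another lattice point are among the explicit
    terms; the last clause serves the point 2, where every [hq j] vanishes. *)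
Lemma H_split p : exists J D, lhol D p /\ (forall k m, p = pb k m -> (k <= J)%nat) /\
  (forall k m j, p = pb k m -> (k <= j)%nat -> good b (p + sh j)%C) /\
  (exists d, 0 < d /\ forall s, cdisc p d s -> H s = (Zc b hb (s - 2) + csum (fun j => hq j s * H (s + sh j)) J + D s)%C) /\
  ((forall j, hq j p = 0) -> D p = 0).
Proof.
  destruct (H_tail (Cmod p + 1)) as [J [HJ [T [HT HE]]]]. exists J, T.
  assert (In : forall z, cdisc p 1 z -> Cmod z < Cmod p + 1).
  { intros z Hz. unfold cdisc in Hz. generalize (Cmod_triangle_rev z p). lra. }
  split; [exists 1; split; [lra|]; intros z Hz; apply HT, In, Hz|]. split; [|split; [|split]].
  - intros k m E. apply Nat.nlt_ge. intros Q. assert (A := HJ p ltac:(lra) J (le_n _)). unfold hp in A.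
    rewrite Re_sh, E, Re_pt in A by exact hb. apply (le_INR (S J)) in Q. rewrite S_INR in Q. lra.
  - intros k m j E Hj. apply (good_hp b hb). rewrite Re_sh, E, Re_pt by exact hb. apply le_INR in Hj. lra.
  - exists 1. split; [lra|]. intros s Hs.
    assert (R := proj1 (cseries_shift_n (fun j => hq j s * H (s + sh j))%C (T s) J) (HE s (In s Hs))).
    assert (U := cseries_unique _ _ _ (H_rec s) R).
    replace (H s) with (Zc b hb (s - 2) + (H s - Zc b hb (s - 2)))%C by ring. rewrite U. ring.
  - intros Z. eapply cseries_unique; [apply HE; lra|]. apply (cseries_ext (fun _ => RtoC 0)); [|apply cseries_zero].
    intros j. rewrite Z. ring.
Qed.

Lemma hq_lhol j p : lhol (hq j) p.
Proof. apply lhol_entire. intros z. apply hq_holo. Qed.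

(** The residue of [Zc] at [v m]: there [b ^ w = 1] turns [b ^ w - b] into [1 - b], and [b ^ w - 1]
    has derivative [ln b]. *)
Definition rho (m : Z) : C := (zeta (v m) * (1 - RtoC (INR b)) / L)%C.

Lemma v_neq_1 m : v m <> 1.
Proof. intros E. assert (Q := Re_v b hb m). rewrite E, Re_RtoC in Q. lra. Qed.

Lemma Zc_spole m : spole (Zc b hb) (v m) (rho m).
Proof.
  assert (Pv : pw (INR b) (v m) = 1) by (apply pw_b_eq_1; [exact hb | exists m; reflexivity]).
  assert (I1 : spole (fun s => / (pw (INR b) s - 1))%C (v m) (/ L)).
  { apply (spole_inv (fun s => pw (INR b) s - 1)%C).
    - apply lhol_entire. intros z. assert (Hz := cder_pw (INR b) z). eexists. cder_auto.
    - rewrite Pv. ring.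
    - assert (Hz := cder_pw (INR b) (v m)). eapply cder_eq; [cder_auto|]. cbv beta. rewrite Pv. ring.
    - apply (L_neq_0 b hb). }
  assert (I2 : lhol (fun s => zF s * bQ b hb s)%C (v m)).
  { apply lhol_entire. intros z. destruct (bQ_holo b hb z) as [l1 H1]. destruct (zF_entire z) as [l2 H2]. eexists. cder_auto. }
  assert (R := spole_mult _ _ _ _ I2 I1). cbv beta in R.
  replace (rho m) with (zF (v m) * bQ b hb (v m) * / L)%C; [exact R|].
  unfold rho. rewrite (zeta_zF _ (v_neq_1 m)).
  assert (E := bQ_eq b hb (v m)). rewrite Pv in E.
  assert (E2 : ((v m - 1) * bQ b hb (v m) = 1 - RtoC (INR b))%C).
  { replace ((v m - 1) * bQ b hb (v m))%C with (RtoC (INR b) + (v m - 1) * bQ b hb (v m) - RtoC (INR b))%C by ring. rewrite <- E. ring. }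
  rewrite <- E2.
  field. split; [apply Cminus_neq_0, v_neq_1 | apply (L_neq_0 b hb)].
Qed.

Lemma Zc_lhol w : Re w < 0 -> lhol (Zc b hb) w.
Proof.
  intros Hw. exists (- Re w). split; [lra|]. intros z Hz. apply Zc_holo. intros m E.
  apply Re_cdisc in Hz. rewrite E, Re_v in Hz by exact hb. lra.
Qed.

(** With [V = 2 k - v m], every step of the recursion contributes a falling factorial of [V]. By
    [ff_split] these combine into the common factor [ff V (2 k)], and the numbers left over form the
    convolution that [acoef] solves. *)
Definition Hres (k : nat) (m : Z) : C := (rho m * RtoC (acoef k) * ff (RtoC (INR (2 * k)) - v m) (2 * k))%C.

Lemma pt_shift k m j : (j < k)%nat -> (pb k m + sh j)%C = pb (k - 1 - j) m.
Proof.
  intros Hj. unfold pt, sh. replace (2 * k)%nat with (2 * (k - 1 - j) + (2 * j + 2))%nat by lia. rewrite (plus_INR (2 * (k - 1 - j))), RtoC_plus. ring.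
Qed.

Lemma Hres_rec k m :
  Hres k m = ((if Nat.eq_dec k 0 then rho m else 0) + csum (fun j => hq j (pb k m) * Hres (k - 1 - j) m) k)%C.
Proof.
  assert (Cv := acoef_convolution k). destruct k as [|k].
  - simpl in Cv. unfold Hres. simpl. replace (acoef 0) with 1 by lra. ring.
  (* The summand [j = 0] of the convolution is [acoef (S k)] itself, as [2 / 2! = 1]; the other
     summands form the recursion. *)
  - rewrite decomp_sum in Cv by lia. simpl pred in Cv. destruct (Nat.eq_dec (S k) 0) as [F|_]; [lia|].
    replace (2 / INR (fact (2 * 0 + 2)) * acoef (S k - 0)) with (acoef (S k)) in Cv by (rewrite Nat.sub_0_r; simpl; field).
    set (V := (RtoC (INR (2 * S k)) - v m)%C).
    rewrite (csum_ext _ (fun j => (- (rho m * ff V (2 * S k))) * RtoC (2 / INR (fact (2 * S j + 2)) * acoef (S k - S j)))%C).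
    + rewrite csum_scal, csum_sum_f_R0. unfold Hres. fold V.
      replace (sum_f_R0 (fun j => 2 / INR (fact (2 * S j + 2)) * acoef (S k - S j)) k) with (- acoef (S k)) by lra.
      rewrite RtoC_opp. ring.
    + intros j Hj. unfold hq, Hres. replace (2 - pb (S k) m)%C with V by (unfold V, pt; ring).
      replace (ff V (2 * S k)) with (ff V ((2 * j + 2) + 2 * (S k - 1 - j))) by (f_equal; lia). rewrite (ff_split V (2 * j + 2) (2 * (S k - 1 - j))).
      replace (V - RtoC (INR (2 * j + 2)))%C with (RtoC (INR (2 * (S k - 1 - j))) - v m)%C.
      * replace (2 * S j + 2)%nat with (2 * j + 4)%nat by lia. replace (S k - S j)%nat with (S k - 1 - j)%nat by lia.
        unfold Rdiv. rewrite !RtoC_mult, RtoC_inv by apply INR_fact_neq_0. ring.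
      * unfold V. replace (2 * S k)%nat with (2 * (S k - 1 - j) + (2 * j + 2))%nat by lia. rewrite (plus_INR (2 * (S k - 1 - j))), RtoC_plus. ring.
Qed.

Lemma csum_stop (e : nat -> C) k J : (k <= J)%nat -> (forall j, (k <= j)%nat -> e j = 0) -> csum e J = csum e k.
Proof.
  intros HJ He. induction J as [|J IH]; [replace k with O by lia; reflexivity|].
  destruct (Nat.eq_dec k (S J)) as [->|N]; [reflexivity|]. cbn [csum]. rewrite IH, He by lia. ring.
Qed.

(** Induction on [k]: the first [k] shifts of [pt k m] land on the points [pt (k - 1 - j) m] treated
    before, all later ones on regular points, and [Zc (s - 2)] is singular only for [k = 0]. *)
Lemma H_spole k m : spole H (pb k m) (Hres k m).
Proof.
  induction k as [k IH] using lt_wf_ind.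
  destruct (H_split (pb k m)) as [J [D [HD [Hk [Hg [[d [Hd E]] _]]]]]]. specialize (Hk k m eq_refl).
  set (e := fun j => if lt_dec j k then (hq j (pb k m) * Hres (k - 1 - j) m)%C else RtoC 0).
  apply (spole_ext (fun s => Zc b hb (s - 2) + csum (fun j => hq j s * H (s + sh j)) J + D s)%C);
    [exists d; split; [exact Hd|]; intros s Hs _; symmetry; apply E, Hs|].
  replace (Hres k m) with ((if Nat.eq_dec k 0 then rho m else 0) + csum e J + 0)%C.
  - apply spole_plus; [apply spole_plus|apply spole_holo, HD].
    + destruct (Nat.eq_dec k 0) as [->|N].
      * apply (spole_shift (Zc b hb) (pb 0 m) (- (2))). replace (pb 0 m + - (2))%C with (v m) by (unfold pt; simpl; ring). apply Zc_spole.
      * apply spole_holo, (lhol_shift (Zc b hb) (pb k m) (- (2))), Zc_lhol. rewrite Re_plus, Re_pt, Re_opp, Re_RtoC by exact hb.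
        assert (Q : (1 <= k)%nat) by lia. apply (le_INR 1) in Q. simpl in Q. lra.
    + apply (spole_csum (fun j s => hq j s * H (s + sh j))%C e). intros j. unfold e. destruct lt_dec as [Hj|Hj].
      * apply (spole_mult (hq j) (fun s => H (s + sh j)%C)); [apply hq_lhol|]. apply spole_shift. rewrite pt_shift by exact Hj. apply IH. lia.
      * apply spole_holo, lhol_mult; [apply hq_lhol|]. apply lhol_shift, H_lhol, (Hg k m); [reflexivity | lia].
  - rewrite Hres_rec, Cplus_0_r. f_equal. rewrite (csum_stop e k J Hk).
    + apply csum_ext. intros j Hj. unfold e. destruct lt_dec; [reflexivity | lia].
    + intros j Hj. unfold e. destruct lt_dec; [lia | reflexivity].
Qed.

End HPoles.

(** * The Laurent expansions of the digit series *)

Lemma quotient_value f g a l l' : (forall z, f z = f a + (z - a) * g z)%C -> cder f a l -> cder g a l' -> g a = l.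
Proof.
  intros E Hf Hg. eapply (cder_unique f a); [|exact Hf].
  apply (cder_ext (fun z => f a + (z - a) * g z)%C); [intros; symmetry; apply E|]. eapply cder_eq; [cder_auto|]. cbv beta. ring.
Qed.

Lemma taylor_order_2 T a l : lhol T a -> cder T a l ->
  exists h, lhol h a /\ forall z, T z = (T a + (z - a) * (l + (z - a) * h z))%C.
Proof.
  intros [d [Hd HT]] Hl. destruct (holo_quotient T a d Hd HT) as [g [Hg E]].
  destruct (Hg a (disc_center a d Hd)) as [l' Hl']. assert (ga := quotient_value T g a l l' E Hl Hl').
  destruct (holo_quotient g a d Hd Hg) as [h [Hh E']]. exists h. split; [exists d; split; assumption|].
  intros z. rewrite (E z), (E' z), ga. reflexivity.
Qed.

Lemma spole_pole f a r : spole f a r -> r <> 0 -> pole_of_order f a 1.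
Proof. intros H N. split; [lia|]. exists (fun _ => r). split; [apply spole_principal, H | exact N]. Qed.

Lemma spole_residue f a r : spole f a r -> is_residue f a r.
Proof. intros H. exists 1%nat, (fun _ => r). split; [lia|]. split; [apply spole_principal, H | reflexivity]. Qed.

Lemma Cprod1_S f n : Cprod1 f (S n) = (Cprod1 f n * f (S n))%C.
Proof.
  unfold Cprod1. rewrite seq_S, fold_right_app. simpl fold_right at 2.
  generalize (seq 1 n) as l. change (1 + n)%nat with (S n). induction l as [|x l IH]; simpl; [ring|]. simpl in IH. rewrite IH. ring.
Qed.

(** The same factors in reverse order and with opposite signs. *)
Lemma ff_Cprod1 w n : ff (RtoC (INR n) - w) n = (RtoC ((-1) ^ n) * Cprod1 (fun j => w - RtoC (INR j)) n)%C.
Proof.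
  induction n as [|n IH]; [unfold Cprod1; simpl; ring|].
  rewrite Cprod1_S. set (z := (RtoC (INR (S n)) - w)%C).
  assert (E : (z - RtoC (INR 1))%C = (RtoC (INR n) - w)%C) by (unfold z; rewrite S_INR, RtoC_plus; simpl (INR 1); ring).
  change (ff z (S n)) with (ff z (1 + n)). rewrite (ff_split z 1 n), E, IH, <- tech_pow_Rmult, RtoC_mult. cbn [ff]. unfold z. simpl (INR 0).
  replace (RtoC (-1)) with (- (1))%C by (rewrite <- RtoC_opp; reflexivity). ring.
Qed.

(** * Poles and principal parts of [G] *)

Section GPoles.

Variable b : nat.
Hypothesis hb : (2 <= b)%nat.
Variable H : C -> C.
Hypothesis H_holo : holo_on (good b) H.
Hypothesis H_rec : forall s, cseries (fun j => hq j s * H (s + sh j))%C (H s - Zc b hb (s - 2)).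
Hypothesis H_tail : forall K, exists J, (forall s, Cmod s <= K -> forall j, (J <= j)%nat -> hp 4 (s + sh j)) /\
     exists T, holo_on (fun s => Cmod s < K) T /\
       forall s, Cmod s < K -> cseries (fun j => hq (J + j)%nat s * H (s + sh (J + j)))%C (T s).

Notation L := (RtoC (ln (INR b))).
Notation B := (RtoC (INR b)).
Notation v := (vshift b).

Definition Gc (s : C) : C := (/ ((s - 1) * (s - 2)) * H s)%C.

Lemma inv_factor_lhol (p : C) : p <> 1 -> p <> 2 -> lhol (fun s => / ((s - 1) * (s - 2)))%C p.
Proof.
  intros N1 N2. apply (lhol_inv (fun s => (s - 1) * (s - 2))%C).
  - apply lhol_entire. intros z. eexists. cder_auto.
  - apply Cmult_neq_0; apply Cminus_neq_0; assumption.
Qed.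

Lemma Gc_lhol (s : C) : good b s -> s <> 1 -> s <> 2 -> lhol Gc s.
Proof. intros Hg N1 N2. apply lhol_mult; [apply inv_factor_lhol; assumption | apply (H_lhol b hb H H_holo), Hg]. Qed.

Lemma Gc_spole k m : pt b k m <> 1 -> pt b k m <> 2 ->
  spole Gc (pt b k m) (/ ((pt b k m - 1) * (pt b k m - 2)) * Hres b k m).
Proof.
  intros N1 N2. apply (spole_mult (fun s => / ((s - 1) * (s - 2)))%C H); [apply inv_factor_lhol; assumption|].
  apply (H_spole b hb H H_holo H_rec H_tail).
Qed.

Lemma pt_neq_1 k m : pt b k m <> 1.
Proof.
  intros E. assert (Q := Re_pt b hb k m). rewrite E, Re_RtoC in Q.
  assert (Q' : INR (2 * k) = INR 1) by (rewrite mult_INR; simpl INR; lra). apply INR_eq in Q'. lia.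
Qed.

Lemma good_1 : good b 1.
Proof. intros k m E. symmetry in E. exact (pt_neq_1 k m E). Qed.

(** Every [hq j] vanishes at 1 because [ff 1 n = 0] for [n >= 2], so [H 1] is [Zc] at -1, computed
    from [zF (-1) = 1 / 6]. *)
Lemma H_at_1 : H 1 = RtoC (- (INR b + 1) / 12).
Proof.
  assert (Pb := INR_b_pos b hb). assert (b2 : 2 <= INR b) by (apply (le_INR 2), hb).
  assert (E : (H 1 - Zc b hb (1 - 2))%C = 0).
  { eapply cseries_unique; [apply H_rec|]. apply (cseries_ext (fun _ => RtoC 0)); [|apply cseries_zero]. intros j. unfold hq.
    replace (2 - 1)%C with (RtoC (INR 1)) by (simpl; ring). rewrite ff_nat_zero by lia. ring. }
  replace (H 1) with (H 1 - Zc b hb (1 - 2) + Zc b hb (1 - 2))%C by ring. rewrite E.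
  replace (1 - 2)%C with (- (1))%C by ring. unfold Zc. rewrite zF_m1.
  assert (Q := bQ_eq b hb (- (1))). rewrite pw_opp, pw_1 in Q by exact Pb. rewrite pw_opp, pw_1 by exact Pb.
  assert (Q' : bQ b hb (- (1)) = RtoC ((INR b - / INR b) / 2)).
  { replace (bQ b hb (- (1))) with ((B - (B + (- (1) - 1) * bQ b hb (- (1)))) * / 2)%C by field.
    rewrite <- Q. unfold Rdiv. rewrite RtoC_mult, RtoC_minus, !RtoC_inv by lra. reflexivity. }
  rewrite Q'. rewrite <- RtoC_inv, <- RtoC_minus, <- RtoC_inv, <- !RtoC_mult, Cplus_0_l.
  - f_equal. field. split; [lra|]. intros F. lra.
  - intros F. assert (G := Rinv_l (INR b) ltac:(lra)). assert (G' : / INR b = 1) by lra. rewrite G' in G. lra.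
  - lra.
Qed.

Lemma Gc_spole_1 : spole Gc 1 (RtoC ((INR b + 1) / 12)).
Proof.
  assert (S1 : spole (fun s => / (s - 1))%C 1 (/ 1)).
  { apply (spole_inv (fun s => s - 1)%C).
    - apply lhol_entire. intros z. eexists. cder_auto.
    - ring.
    - eapply cder_eq; [cder_auto|]. cbv beta. ring.
    - apply C1_nz. }
  assert (S2 : lhol (fun s => / (s - 2) * H s)%C 1).
  { apply lhol_mult; [|apply (H_lhol b hb H H_holo), good_1]. apply (lhol_inv (fun s => s - 2)%C).
    - apply lhol_entire. intros z. eexists. cder_auto.
    - apply Cminus_neq_0. intros F. apply RtoC_inj in F. lra. }
  assert (R := spole_mult _ _ _ _ S2 S1). cbv beta in R. rewrite H_at_1 in R.
  replace (RtoC ((INR b + 1) / 12)) with (/ (1 - 2) * RtoC (- (INR b + 1) / 12) * / 1)%C.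
  - eapply spole_ext; [|exact R]. exists 1. split; [lra|]. intros s Hs N. unfold Gc. cbv beta.
    assert (N2 : s <> 2).
    { intros ->. unfold cdisc in Hs. rewrite <- RtoC_minus, Cmod_R, Rabs_pos_eq in Hs; lra. }
    field. split; apply Cminus_neq_0; assumption.
  - replace (1 - 2)%C with (RtoC (-1)) by (rewrite <- RtoC_minus; f_equal; ring).
    rewrite <- !RtoC_inv, <- !RtoC_mult by lra. f_equal. field.
Qed.

(** The derivative [L * L / 2] is the second Taylor coefficient of [b ^ w]. It follows from
    [b ^ w * b ^ (- w) = 1], which ties the even part of the second quotient [k] to
    [g w * g (- w)]. *)
Lemma pw_quotient_0 : exists g, (forall z, exists l, cder g z l) /\ (forall w, pw (INR b) w = (1 + w * g w)%C) /\
  g 0 = L /\ cder g 0 (L * L / 2).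
Proof.
  destruct (holo_div (fun _ => True) (pw (INR b)) 0 copen_all I) as [g [Hg E]]; [intros z _; eexists; apply cder_pw|].
  assert (Eg : forall w, pw (INR b) w = (1 + w * g w)%C) by (intros w; rewrite (E w), pw_0; ring).
  destruct (Hg 0 I) as [l Hl].
  assert (g0 : g 0 = L) by (eapply quotient_value; [exact E | eapply cder_eq; [apply cder_pw|]; rewrite pw_0; ring | exact Hl]).
  destruct (holo_div (fun _ => True) g 0 copen_all I Hg) as [k [Hk Ek]].
  destruct (Hk 0 I) as [lk Hlk].
  assert (k0 : k 0 = l) by (eapply quotient_value; eassumption).
  exists g. split; [intros z; apply Hg, I|]. split; [exact Eg|]. split; [exact g0|].
  eapply cder_eq; [exact Hl|].
  assert (Hlk' : cder k (- 0) lk) by (replace (- 0)%C with (RtoC 0) by ring; exact Hlk).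
  assert (Hl' : cder g (- 0) l) by (replace (- 0)%C with (RtoC 0) by ring; exact Hl).
  assert (K1 : cder (fun w => k (- w)%C) 0 (- (1) * lk)) by (apply (cder_comp k (fun w => - w)%C); [exact Hlk' | cder_auto]).
  assert (K2 : cder (fun w => g (- w)%C) 0 (- (1) * l)) by (apply (cder_comp g (fun w => - w)%C); [exact Hl' | cder_auto]).
  assert (Z : ((fun w => k w + k (- w)) 0 = (fun w => g w * g (- w)) 0)%C).
  { eapply (cont_punctured_eq (fun w => k w + k (- w))%C (fun w => g w * g (- w))%C 0 1); [lra | | cder_auto | cder_auto].
    (* expanding [b ^ w * b ^ (- w) = 1] *)
    intros w _ N. assert (P : (pw (INR b) w * pw (INR b) (- w) = 1)%C) by (rewrite pw_opp; field; apply pw_neq_0).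
    rewrite (Eg w), (Eg (- w)%C) in P.
    assert (P' : (w * (g w - g (- w)%C) = w * w * (g w * g (- w)%C))%C).
    { replace (w * (g w - g (- w)%C))%C with ((1 + w * g w) * (1 + - w * g (- w)%C) - 1 + w * w * (g w * g (- w)%C))%C by ring. rewrite P. ring. }
    assert (P2 : (w * w * (k w + k (- w)%C) = w * w * (g w * g (- w)%C))%C).
    { rewrite <- P'. replace (g w - g (- w)%C)%C with (w * (k w + k (- w)%C))%C by (rewrite (Ek w), (Ek (- w)%C); ring). ring. }
    replace (k w + k (- w)%C)%C with (/ (w * w) * (w * w * (k w + k (- w)%C)))%C by (field; exact N).
    rewrite P2. field. exact N. }
  cbv beta in Z. replace (- 0)%C with (RtoC 0) in Z by ring. rewrite k0, g0 in Z.
  replace l with ((l + l) / 2)%C by field. rewrite Z. reflexivity.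
Qed.

(** Near 2, [Gc s] is [T s / (s - 2) ^ 2] with [T] holomorphic, so the principal part consists of
    the value and the derivative of [T] at 2. *)
Lemma Gc_at_2 : exists h, lhol h 2 /\ exists d, 0 < d /\ forall s, cdisc 2 d s -> s <> 2 ->
  Gc s = (RtoC ((INR b - 1) / (2 * ln (INR b))) / (s - 2) ^ 2 +
           RtoC ((INR b - 1) / (2 * ln (INR b)) * (ln (2 * PI) - 1) - (INR b + 1) / 4) / (s - 2) + h s)%C.
Proof.
  assert (Lb := ln_b_pos b hb). assert (NL := L_neq_0 b hb).
  destruct pw_quotient_0 as [g [Hg [Eg [g0 g1]]]].
  destruct (bQ_holo b hb 0) as [q1 Hq1].
  assert (Q0 : bQ b hb 0 = (B - 1)%C).
  { assert (Q := bQ_eq b hb 0). rewrite pw_0 in Q. replace (bQ b hb 0) with (B - (B + (0 - 1) * bQ b hb 0))%C by ring. rewrite <- Q. reflexivity. }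
  assert (Q1 : q1 = (B - 1 - L)%C).
  { assert (D : cder (fun w => B + (w - 1) * bQ b hb w)%C 0 L).
    { apply (cder_ext (pw (INR b))); [apply bQ_eq|]. eapply cder_eq; [apply cder_pw|]. rewrite pw_0. ring. }
    assert (D' : cder (fun w => B + (w - 1) * bQ b hb w)%C 0 (B - 1 - q1)).
    { eapply cder_eq; [cder_auto|]. cbv beta. rewrite Q0. ring. }
    assert (U := cder_unique _ _ _ _ D D'). rewrite U. ring. }
  assert (F1 := zF_cder_0).
  (* [M w] is [w * Zc w] with the zero of [b ^ w - 1] divided out; [m0] and [m1] are its value and
     derivative at 0. *)
  set (M := fun w => (zF w * bQ b hb w * / g w)%C).
  set (m0 := ((B - 1) / (2 * L))%C).
  set (m1 := ((RtoC ((ln (2 * PI) - 1) / 2) * (B - 1) + (B - 1 - L) / 2) / L - (B - 1) / 4)%C).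
  assert (M0 : M 0 = m0) by (unfold M, m0; rewrite Q0, zF_0, g0; replace (RtoC (1 / 2)) with (/ 2)%C by (rewrite <- RtoC_inv by lra; f_equal; field); field; exact NL).
  assert (M1 : cder M 0 m1).
  { unfold M. eapply cder_eq; [apply (cder_mult (fun w => zF w * bQ b hb w)%C (fun w => / g w)%C);
      [apply cder_mult; [exact F1 | exact Hq1] | apply cder_inv; [rewrite g0; exact NL | exact g1]]|].
    cbv beta. rewrite Q0, Q1, zF_0, g0. replace (RtoC (1 / 2)) with (/ 2)%C by (rewrite <- RtoC_inv by lra; f_equal; field).
    unfold m1. field. exact NL. }
  destruct (H_split b hb H H_rec H_tail 2) as [J [D0 [HD0 [_ [_ [[d [Hd E]] Z0]]]]]].
  assert (hq2 : forall j, hq j 2 = 0).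
  { intros j. unfold hq. replace (2 - 2)%C with (RtoC (INR 0)) by (simpl; ring). rewrite ff_nat_zero by lia. ring. }
  specialize (Z0 hq2).
  set (D := fun s => (csum (fun j => hq j s * H (s + sh j)%C) J + D0 s)%C).
  assert (HD : lhol D 2).
  { apply lhol_plus; [|exact HD0]. apply (lhol_csum (fun j s => hq j s * H (s + sh j))%C). intros j.
    apply lhol_mult; [apply hq_lhol|]. apply lhol_shift, (H_lhol b hb H H_holo), (good_hp b hb).
    rewrite Re_sh, Re_RtoC. generalize (pos_INR j). lra. }
  (* Therefore [(s - 2) * D s] vanishes to second order and contributes no polar term. *)
  assert (D2 : D 2 = 0).
  { unfold D. rewrite Z0, (csum_ext _ (fun _ => RtoC 0)); [|intros j _; rewrite hq2; ring].
    clear. induction J as [|J IH]; [simpl; ring|]. cbn [csum]. rewrite Cplus_0_r in *. rewrite IH. ring. }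
  set (T := fun s => (/ (s - 1) * (M (s - 2) + (s - 2) * D s))%C).
  assert (N21 : (2 - 1)%C <> 0) by (apply Cminus_neq_0; intros F; apply RtoC_inj in F; lra).
  assert (HM : lhol M 0).
  { apply lhol_mult; [|apply lhol_inv; [apply lhol_entire, Hg | rewrite g0; exact NL]].
    apply lhol_mult; apply lhol_entire; [apply zF_entire | apply bQ_holo]. }
  assert (HT : lhol T 2).
  { apply lhol_mult.
    - apply (lhol_inv (fun s => s - 1)%C); [apply lhol_entire; intros z; eexists; cder_auto | exact N21].
    - apply lhol_plus.
      + apply (lhol_shift M 2 (- (2))). replace (2 + - (2))%C with (RtoC 0) by ring. exact HM.
      + apply lhol_mult; [apply lhol_entire; intros z; eexists; cder_auto | exact HD]. }
  assert (T2 : T 2 = m0) by (unfold T; rewrite D2; replace (2 - 2)%C with (RtoC 0) by ring; rewrite M0; field; exact N21).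
  (* The term [- m0] comes from the derivative of [1 / (s - 1)] at 2. *)
  assert (T2' : cder T 2 (m1 - m0)).
  { destruct HD as [e [He HD']]. destruct (HD' 2 (disc_center _ _ He)) as [ld Hld].
    assert (HMs : cder (fun s => M (s - 2)%C) 2 ((1 - 0) * m1)).
    { apply (cder_comp M (fun s => s - 2)%C); [replace (2 - 2)%C with (RtoC 0) by ring; exact M1 | cder_auto]. }
    unfold T. eapply cder_eq; [apply (cder_mult (fun s => / (s - 1))%C (fun s => M (s - 2) + (s - 2) * D s)%C);
      [cder_auto; exact N21 | cder_auto]|]. cbv beta. rewrite D2. replace (2 - 2)%C with (RtoC 0) by ring. rewrite M0. field. }
  destruct (taylor_order_2 T 2 _ HT T2') as [h [Hh Eh]]. exists h. split; [exact Hh|].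
  assert (Hg' : exists e, 0 < e /\ forall w, cdisc 0 e w -> g w <> 0).
  { destruct (cder_cont _ _ _ g1 (Cmod L) (proj1 (Cmod_gt_0 _) NL)) as [e [He K]]. exists e. split; [exact He|]. intros w Hw F.
    specialize (K w Hw). rewrite F, g0 in K. replace (0 - L)%C with (- L)%C in K by ring. rewrite Cmod_opp in K. lra. }
  destruct Hg' as [e [He Hge]].
  exists (Rmin d (Rmin e 1)). split; [repeat apply Rmin_pos; lra|]. intros s Hs N. apply cdisc_min in Hs. destruct Hs as [Hs1 Hs]. apply cdisc_min in Hs. destruct Hs as [Hs2 Hs3].
  assert (Ns := Cminus_neq_0 s 2 N).
  assert (N1 : (s - 1)%C <> 0).
  { apply Cminus_neq_0. intros ->. unfold cdisc in Hs3. rewrite <- RtoC_minus, Cmod_R, Rabs_left in Hs3; lra. }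
  assert (Gs : g (s - 2)%C <> 0) by (apply Hge; unfold cdisc in *; replace (s - 2 - 0)%C with (s - 2)%C by ring; exact Hs2).
  assert (EG : Gc s = (T s / (s - 2) ^ 2)%C).
  { unfold Gc. rewrite (E s Hs1). unfold T, D, M, Zc. rewrite (Eg (s - 2)%C).
    replace (1 + (s - 2) * g (s - 2)%C - 1)%C with ((s - 2) * g (s - 2)%C)%C by ring. field. repeat split; assumption. }
  rewrite EG, (Eh s), T2.
  replace (RtoC ((INR b - 1) / (2 * ln (INR b)))) with m0.
  2:{ unfold m0, Rdiv, Cdiv. rewrite RtoC_mult, RtoC_inv, RtoC_mult, RtoC_minus by lra. reflexivity. }
  replace (RtoC ((INR b - 1) / (2 * ln (INR b)) * (ln (2 * PI) - 1) - (INR b + 1) / 4)) with (m1 - m0)%C.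
  2:{ unfold m1, m0. replace ((INR b - 1) / (2 * ln (INR b)) * (ln (2 * PI) - 1) - (INR b + 1) / 4)
       with (((ln (2 * PI) - 1) / 2 * (INR b - 1) + (INR b - 1 - ln (INR b)) / 2) / ln (INR b) - (INR b - 1) / 4 - (INR b - 1) / (2 * ln (INR b))) by (field; lra).
      unfold Rdiv, Cdiv. rewrite !RtoC_minus, !RtoC_mult, !RtoC_plus, !RtoC_mult, !RtoC_inv, !RtoC_minus, !RtoC_mult by lra. reflexivity. }
  field. exact Ns.
Qed.

Lemma v_neq_0 m : m <> 0%Z -> v m <> 0.
Proof.
  intros Hm E. rewrite v_im in E by exact hb. apply (f_equal snd) in E. simpl in E. assert (Lb := ln_b_pos b hb). assert (Hpi := PI_RGT_0).
  apply Hm, eq_IZR. apply (Rmult_eq_reg_l (2 * PI / ln (INR b))); [|apply Rgt_not_eq, Rdiv_lt_0_compat; lra]. unfold Rdiv in *. lra.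
Qed.

(** For [m = 0] the value is [zeta 0 = - 1 / 2]; otherwise [v m] is a non-zero point of the
    imaginary axis. *)
Lemma zeta_v_neq_0 m : zeta (v m) <> 0.
Proof.
  destruct (Z.eq_dec m 0) as [->|N].
  - rewrite v_0 by exact hb. rewrite zeta_zF by (intros F; apply RtoC_inj in F; lra). rewrite zF_0. intros F.
    assert (Q : RtoC (1 / 2) = 0) by (replace (RtoC (1 / 2)) with (RtoC (1 / 2) / (0 - 1) * - (1))%C by field; rewrite F; ring).
    apply RtoC_inj in Q. lra.
  - intros F. rewrite v_im in F by exact hb. revert F. apply zeta_line_0.
    intros F. apply (v_neq_0 m N). rewrite v_im, F by exact hb. reflexivity.
Qed.

Lemma one_plus_v_neq_0 m : (1 + v m)%C <> 0.
Proof. intros E. assert (Q : Re (1 + v m) = 0) by (rewrite E; reflexivity). rewrite Re_plus, Re_v, Re_RtoC in Q by exact hb. lra. Qed.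

Lemma Gc_spole_line m : m <> 0%Z -> spole Gc (2 + v m)
  (- (RtoC (INR b - 1) / (2 * RtoC PI * Ci * RtoC (IZR m))) * / (1 + v m) * zeta (v m)).
Proof.
  intros Hm. assert (Nv := v_neq_0 m Hm). assert (N1 := one_plus_v_neq_0 m). assert (NL := L_neq_0 b hb).
  assert (Ep : pt b 0 m = (2 + v m)%C) by (unfold pt; simpl; ring).
  assert (Sp := Gc_spole 0 m (pt_neq_1 0 m)). rewrite Ep in Sp.
  replace (2 * RtoC PI * Ci * RtoC (IZR m))%C with (v m * L)%C by (unfold vshift; field; exact NL).
  replace (- (RtoC (INR b - 1) / (v m * L)) * / (1 + v m) * zeta (v m))%C
    with (/ ((2 + v m - 1) * (2 + v m - 2)) * Hres b 0 m)%C.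
  - apply Sp. intros F. apply Nv. replace (v m) with (2 + v m - 2)%C by ring. rewrite F. ring.
  - unfold Hres, rho, acoef. simpl (2 * 0)%nat. rewrite bcoef_0. simpl ff. simpl (INR 0).
    replace ((1 - 0) * 1) with 1 by ring. rewrite RtoC_minus.
    replace (2 + v m - 1)%C with (1 + v m)%C by ring. replace (2 + v m - 2)%C with (v m) by ring. field. repeat split; assumption.
Qed.

Lemma v_minus_nat_neq_0 m j : (1 <= j)%nat -> (v m - RtoC (INR j))%C <> 0.
Proof.
  intros Hj E. assert (Q : Re (v m - RtoC (INR j)) = 0) by (rewrite E; reflexivity). rewrite Re_minus, Re_v, Re_RtoC in Q by exact hb.
  apply (le_INR 1) in Hj. simpl in Hj. lra.
Qed.

Lemma Gc_spole_even k m : (2 <= k)%nat -> Nat.Even k -> spole Gc (2 - RtoC (INR k) + v m)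
  (RtoC ((INR b - 1) / ln (INR b)) * zeta (v m) * RtoC (bernoulli k / (INR k * INR (fact (k - 2)))) *
   Cprod1 (fun j => v m - RtoC (INR j))%C (k - 2)).
Proof.
  intros Hk [q Hq]. assert (Lb := ln_b_pos b hb). assert (NL := L_neq_0 b hb).
  assert (Ep : pt b q m = (2 - RtoC (INR k) + v m)%C) by (unfold pt; rewrite Hq; reflexivity).
  assert (N1 := v_minus_nat_neq_0 m (k - 1) ltac:(lia)). assert (N2 := v_minus_nat_neq_0 m k ltac:(lia)).
  assert (E1 : (2 - RtoC (INR k) + v m - 1)%C = (v m - RtoC (INR (k - 1)))%C) by (rewrite minus_INR, RtoC_minus by lia; simpl (INR 1); ring).
  assert (E2 : (2 - RtoC (INR k) + v m - 2)%C = (v m - RtoC (INR k))%C) by ring.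
  assert (Sp := Gc_spole q m (pt_neq_1 q m)). rewrite Ep, E1, E2 in Sp.
  match goal with |- spole _ _ ?r => replace r with (/ ((v m - RtoC (INR (k - 1))) * (v m - RtoC (INR k))) * Hres b q m)%C end.
  - apply Sp. intros F. apply N2. rewrite <- E2, F. ring.
  - unfold Hres, acoef, bcoef, rho. rewrite <- Hq, ff_Cprod1.
    replace ((-1) ^ k) with 1 by (rewrite Hq, pow_1_even; reflexivity).
    (* The denominators [s - 1] and [s - 2] at the pole are the last two factors of the product,
       which therefore stops at [k - 2]. *)
    set (P := Cprod1 (fun j => v m - RtoC (INR j))%C). replace (P k) with (P (k - 2)%nat * (v m - RtoC (INR (k - 1))) * (v m - RtoC (INR k)))%C.
    2:{ unfold P. replace k with (S (S (k - 2))) at 4 by lia. rewrite !Cprod1_S. replace (S (S (k - 2))) with k by lia. replace (S (k - 2)) with (k - 1)%nat by lia. reflexivity. }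
    (* The factor [1 - k] cancels [k - 1] in [k!]; the remaining sign turns the [1 - b] of [rho]
       into [b - 1]. *)
    assert (EF : (1 - INR k) * (bernoulli k / INR (fact k)) = - (bernoulli k / (INR k * INR (fact (k - 2))))).
    { replace (fact k) with (k * ((k - 1) * fact (k - 2)))%nat.
      - rewrite !mult_INR, minus_INR by lia. simpl (INR 1). apply (le_INR 2) in Hk. simpl in Hk. assert (Fp := INR_fact_lt_0 (k - 2)). field. repeat split; lra.
      - destruct k as [|[|k]]; try lia. replace (S (S k) - 2)%nat with k by lia. replace (S (S k) - 1)%nat with (S k) by lia. reflexivity. }
    rewrite EF. rewrite RtoC_opp. unfold Rdiv at 2. rewrite (RtoC_mult (INR b - 1)), RtoC_inv, RtoC_minus by lra. field. repeat split; assumption.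
Qed.

Lemma RtoC_bernoulli_neq_0 k : (2 <= k)%nat -> Nat.Even k -> RtoC (bernoulli k / (INR k * INR (fact (k - 2)))) <> 0.
Proof.
  intros Hk He. apply RtoC_neq_0. unfold Rdiv. apply Rmult_integral_contrapositive_currified; [apply bernoulli_even_neq_0; assumption|].
  apply Rinv_neq_0_compat, Rmult_integral_contrapositive_currified; [apply not_0_INR; lia | apply INR_fact_neq_0].
Qed.

Lemma Cprod1_v_neq_0 m n : Cprod1 (fun j => v m - RtoC (INR j))%C n <> 0.
Proof.
  induction n as [|n IH]; [apply C1_nz|]. rewrite Cprod1_S. apply Cmult_neq_0; [exact IH | apply v_minus_nat_neq_0; lia].
Qed.

Lemma Gc_pole_2 : pole_of_order Gc 2 2.
Proof.
  destruct Gc_at_2 as [h [Hh [d [Hd E]]]]. assert (Lb := ln_b_pos b hb). assert (b2 : 2 <= INR b) by (apply (le_INR 2), hb).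
  set (c1 := RtoC ((INR b - 1) / (2 * ln (INR b)) * (ln (2 * PI) - 1) - (INR b + 1) / 4)) in E.
  set (c2 := RtoC ((INR b - 1) / (2 * ln (INR b)))) in E.
  (* Only the indices 1 and 2 of the coefficient sequence are read. *)
  split; [lia|]. exists (fun j => if Nat.eq_dec j 2 then c2 else c1). split.
  - exists h. split; [apply holomorphic_at_iff, Hh|]. apply locally'_Cmod. exists d. split; [exact Hd|]. intros s Hs N.
    rewrite (E s Hs N), sum_n_m_csum. simpl. assert (Ns := Cminus_neq_0 s 2 N). field. exact Ns.
  - simpl. apply RtoC_neq_0, Rgt_not_eq, Rdiv_lt_0_compat; lra.
Qed.

Lemma Gc_laurent_2 : exists M : R, locally' (T := C_UniformSpace) (RtoC 2) (fun s : C =>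
  Cmod (Gc s - (RtoC ((INR b - 1) / (2 * ln (INR b))) / (s - 2) ^ 2 +
    RtoC ((INR b - 1) / (2 * ln (INR b)) * (ln (2 * PI) - 1) - (INR b + 1) / 4) / (s - 2))) <= M).
Proof.
  destruct Gc_at_2 as [h [[e [He Hh]] [d [Hd E]]]]. destruct (Hh 2 (disc_center _ _ He)) as [l Hl].
  destruct (cder_cont _ _ _ Hl 1 Rlt_0_1) as [d' [Hd' K]]. exists (Cmod (h 2) + 1).
  apply locally'_Cmod. exists (Rmin d d'). split; [apply Rmin_pos; assumption|]. intros s Hs N.
  apply cdisc_min in Hs. rewrite (E s (proj1 Hs) N). specialize (K s (proj2 Hs)).
  match goal with |- Cmod ?x <= _ => replace x with (h s) by ring end.
  generalize (Cmod_triangle_rev (h s) (h 2)). lra.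
Qed.

Lemma Gc_pole_1 : pole_of_order Gc 1 1.
Proof.
  assert (b2 : 2 <= INR b) by (apply (le_INR 2), hb). apply (spole_pole _ _ _ Gc_spole_1). apply RtoC_neq_0. lra.
Qed.

Lemma Gc_pole_line m : m <> 0%Z -> pole_of_order Gc (2 + v m) 1.
Proof.
  intros Hm. assert (b2 : 2 <= INR b) by (apply (le_INR 2), hb). apply (spole_pole _ _ _ (Gc_spole_line m Hm)).
  replace (2 * RtoC PI * Ci * RtoC (IZR m))%C with (v m * L)%C by (unfold vshift; field; apply (L_neq_0 b hb)).
  assert (N1 : RtoC (INR b - 1) <> 0) by (apply RtoC_neq_0; lra).
  assert (Nv := v_neq_0 m Hm). assert (NL := L_neq_0 b hb). assert (Ni := one_plus_v_neq_0 m). assert (Nz := zeta_v_neq_0 m).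
  intros F. assert (Q : (RtoC (INR b - 1) * zeta (v m))%C = 0); [|revert Q; apply Cmult_neq_0; assumption].
  replace (RtoC (INR b - 1) * zeta (v m))%C with (- (- (RtoC (INR b - 1) / (v m * L)) * / (1 + v m) * zeta (v m)) * (v m * L) * (1 + v m))%C
    by (field; repeat split; assumption).
  rewrite F. ring.
Qed.

Lemma Gc_pole_even k m : (2 <= k)%nat -> Nat.Even k -> pole_of_order Gc (2 - RtoC (INR k) + v m) 1.
Proof.
  intros Hk He. assert (b2 : 2 <= INR b) by (apply (le_INR 2), hb). assert (Lb := ln_b_pos b hb).
  apply (spole_pole _ _ _ (Gc_spole_even k m Hk He)).
  apply Cmult_neq_0; [|apply Cprod1_v_neq_0]. apply Cmult_neq_0; [|apply RtoC_bernoulli_neq_0; assumption].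
  apply Cmult_neq_0; [|apply zeta_v_neq_0]. apply RtoC_neq_0, Rgt_not_eq, Rdiv_lt_0_compat; lra.
Qed.

Definition Gc_pole_set (s : C) : Prop :=
  s = 2 \/ s = 1 \/ (exists m : Z, m <> 0%Z /\ s = (2 + v m)%C) \/
  (exists (k : nat) (m : Z), (2 <= k)%nat /\ Nat.Even k /\ s = (2 - RtoC (INR k) + v m)%C).

Lemma Gc_pole_set_pole s : Gc_pole_set s -> is_pole Gc s.
Proof.
  intros [->|[->|[[m [Hm ->]]|[k [m [Hk [He ->]]]]]]]; eexists;
    [apply Gc_pole_2 | apply Gc_pole_1 | apply Gc_pole_line, Hm | apply Gc_pole_even; assumption].
Qed.

Lemma Gc_holomorphic s : ~ Gc_pole_set s -> holomorphic_at Gc s.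
Proof.
  intros N. apply holomorphic_at_iff, Gc_lhol.
  - intros k m ->. apply N. unfold Gc_pole_set. destruct k as [|k].
    + destruct (Z.eq_dec m 0) as [->|Hm].
      * left. unfold pt. rewrite v_0 by exact hb. simpl. ring.
      * right; right; left. exists m. split; [exact Hm|]. unfold pt. simpl. ring.
    + right; right; right. exists (2 * S k)%nat, m. split; [lia|]. split; [exists (S k); reflexivity | reflexivity].
  - intros E. apply N. right; left. exact E.
  - intros E. apply N. left. exact E.
Qed.

Lemma Gc_is_pole s : is_pole Gc s <-> Gc_pole_set s.
Proof.
  split; [|apply Gc_pole_set_pole]. intros Hp. destruct (excluded_middle_informative (Gc_pole_set s)) as [Q|Q]; [exact Q|exfalso].
  exact (holomorphic_not_pole _ _ (Gc_holomorphic s Q) Hp).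
Qed.

Lemma Gc_meromorphic : meromorphic Gc.
Proof.
  intros s. destruct (excluded_middle_informative (Gc_pole_set s)) as [Q|Q]; [right; apply Gc_pole_set_pole, Q | left; apply Gc_holomorphic, Q].
Qed.

End GPoles.

Lemma Gc_dirichlet b H s : (2 <= b)%nat -> 2 < Re s -> H s = dH b s ->
  is_dirichlet_series (fun n => RtoC (INR (cumul_digit_sum b n))) s (Gc H s).
Proof.
  intros hb Hs E. unfold Gc. rewrite E. unfold dH.
  assert (N1 : (s - 1)%C <> 0) by (apply Cminus_neq_0; intros ->; rewrite Re_RtoC in Hs; lra).
  assert (N2 : (s - 2)%C <> 0) by (apply Cminus_neq_0; intros ->; rewrite Re_RtoC in Hs; lra).
  replace (/ ((s - 1) * (s - 2)) * ((s - 1) * (s - 2) * dG b s))%C with (dG b s) by (field; split; assumption).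
  apply cseries_is_series, (dG_cv b hb s Hs).
Qed.

Open Scope C_scope.

Theorem theorem1p2 (b : nat) (hb : (2 <= b)%nat) :
  exists G : C -> C,
    (forall s : C, (2 < Re s)%R ->
       is_dirichlet_series (fun n => RtoC (INR (cumul_digit_sum b n))) s (G s)) /\
    meromorphic G /\
    (forall s : C, is_pole G s <->
       s = 2 \/
       s = 1 \/
       (exists m : Z, m <> 0%Z /\ s = 2 + vshift b m) \/
       (exists (k : nat) (m : Z), (2 <= k)%nat /\ Nat.Even k /\
          s = 2 - RtoC (INR k) + vshift b m)) /\
    (* (i) *)
    (pole_of_order G 2 2 /\
     exists M : R, locally' (RtoC 2) (fun s : C =>
       (Cmod (G s -
          (RtoC ((INR b - 1) / (2 * ln (INR b))) / (s - 2) ^ 2 +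
           RtoC ((INR b - 1) / (2 * ln (INR b)) * (ln (2 * PI) - 1)
                 - (INR b + 1) / 4) / (s - 2))) <= M)%R)) /\
    (* (ii) *)
    (pole_of_order G 1 1 /\ is_residue G 1 (RtoC ((INR b + 1) / 12))) /\
    (* (iii) *)
    (forall m : Z, m <> 0%Z ->
       pole_of_order G (2 + vshift b m) 1 /\
       is_residue G (2 + vshift b m)
         (- (RtoC (INR b - 1) / (2 * RtoC PI * Ci * RtoC (IZR m))) *
          / (1 + vshift b m) * zeta (vshift b m))) /\
    (* (iv) *)
    (forall (k : nat) (m : Z), (2 <= k)%nat -> Nat.Even k ->
       pole_of_order G (2 - RtoC (INR k) + vshift b m) 1 /\
       is_residue G (2 - RtoC (INR k) + vshift b m)
         (RtoC ((INR b - 1) / ln (INR b)) * zeta (vshift b m) *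
          RtoC (bernoulli k / (INR k * INR (fact (k - 2)))) *
          Cprod1 (fun j => vshift b m - RtoC (INR j)) (k - 2))).
Proof.
  destruct (H_exists b hb) as [H [HE [Hh [Hr Ht]]]]. exists (Gc H).
  split; [intros s Hs; apply Gc_dirichlet; [exact hb | exact Hs | apply HE, Hs]|].
  split; [exact (Gc_meromorphic b hb H Hh Hr Ht)|].
  split; [exact (Gc_is_pole b hb H Hh Hr Ht)|].
  split; [exact (conj (Gc_pole_2 b hb H Hh Hr Ht) (Gc_laurent_2 b hb H Hh Hr Ht))|].
  split; [exact (conj (Gc_pole_1 b hb H Hh Hr) (spole_residue _ _ _ (Gc_spole_1 b hb H Hh Hr)))|].
  split.
  - intros m Hm. split; [apply (Gc_pole_line b hb H Hh Hr Ht m Hm)|].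
    exact (spole_residue _ _ _ (Gc_spole_line b hb H Hh Hr Ht m Hm)).
  - intros k m Hk He. split; [apply (Gc_pole_even b hb H Hh Hr Ht k m Hk He)|].
    exact (spole_residue _ _ _ (Gc_spole_even b hb H Hh Hr Ht k m Hk He)).
Qed.
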